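(* Let $k$ be an algebraically closed field of characteristic $p>0$, and set $A_0=\mathbb{A}_k^N$. Let \[ A_n \xrightarrow{\varphi_n} A_{n-1} \xrightarrow{\varphi_{n-1}} \cdots \xrightarrow{\varphi_2} A_1 \xrightarrow{\varphi_1} A_0 \] be a sequence in which each $\varphi_i$ is the blow-up of $A_{i-1}$ at a closed point $P_i\in A_{i-1}$ dominating (i.e. mapping to) the origin $0\in A_0$. Then there exists a sequence of varieties over $\mathbb{C}$, \[ \widetilde A_n \xrightarrow{\widetilde\varphi_n} \widetilde A_{n-1} \xrightarrow{\widetilde\varphi_{n-1}} \cdots \xrightarrow{\widetilde\varphi_2} \widetilde A_1 \xrightarrow{\widetilde\varphi_1} \widetilde A_0:=\mathbb{A}^N_{\mathbb{C}}, \] such that: (i) $\widetilde A_i \pmod p = A_i$ for all $0\le i\le n$; (ii) for each $1\le i\le n$, the morphism $\widetilde\varphi_i:\widetilde A_i\to \widetilde A_{i-1}$ is the blow-up at a closed point $\widetilde P_i\in \widetilde A_{i-1}$ dominating the origin of $\widetilde A_0$; (iii) if $E_i\subset A_i$ and $\widetilde E_i\subset \widetilde A_i$ denote the exceptional divisors of $\varphi_i$ and $\widetilde\varphi_i$, respectively, then $k_{\widetilde E_i}=k_{E_i}$ for all $1\le i\le n$; (iv) when $N=2$, for every $f\in k[x_1,x_2]$ there exists a lifting $\widetilde f\in \mathbb{C}[x_1,x_2]$ of $f$ such that $v_{E_i}(f)=v_{\widetilde E_i}(\widetilde f)$ for every $i$.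
   Context: Skeletons. Let $F$ be a field of characteristic $q\ge 0$ and $R$ an integral domain that is a finitely generated $F$-algebra. A subring $S\subset R$ is a skeleton of $R$ if $S$ is a finitely generated $\mathbb{Z}/(q)$-subalgebra of $R$ (so a finitely generated $\mathbb{Z}$-subalgebra if $q=0$) with $F[S]=R$. Compatible skeletons. Let $k$ be a field of characteristic $p>0$, $K$ a field of characteristic $0$, $R$ a finitely generated $k$-algebra and $\widetilde R$ a finitely generated $K$-algebra. Skeletons $S\subset R$ and $\widetilde S\subset\widetilde R$ are compatible if $\widetilde S$ is $\mathbb{Z}$-flat at $p$ (automatic if $\widetilde R$ is a domain) and $S\simeq \widetilde S\otimes_{\mathbb{Z}}\mathbb{Z}/(p)$; the canonical surjection is denoted $\Phi_p:\widetilde S\to S$. In this case one writes $\widetilde R\pmod p=R$. If schemes $\widetilde A$ and $A$ are defined by $\widetilde R$ and $R$ (e.g. as Spec, or as Proj of graded rings with graded compatible skeletons), one writes $\widetilde A\pmod p=A$. Liftings of elements. If $\widetilde f\in\widetilde S$ and $f\in S$ satisfy $\Phi_p(\widetilde f)=f$, then $\widetilde f$ is called a lifting of $f$. Within one discussion a common pair of compatible skeletons is used. For polynomial rings, one uses compatible skeletons $\Sigma\subset k$ and $\widetilde\Sigma\subset\mathbb{C}$ and the induced compatible skeletons $\Sigma[x_1,\dots,x_N]\subset k[x_1,\dots,x_N]$, $\widetilde\Sigma[x_1,\dots,x_N]\subset\mathbb{C}[x_1,\dots,x_N]$ (with $\Phi_p$ acting on coefficients); skeletons may be enlarged so as to contain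 any given finite set of elements. Valuations. For a prime divisor $E$ on a normal variety $A'$ with a proper birational morphism $A'\to A$ to a smooth variety $A$, $v_E$ is the associated divisorial valuation and $k_E$ is the coefficient of the relative canonical divisor $K_{A'/A}$ at $E$. Here $k_{E_i}$, $v_{E_i}$ are taken over $A_0$, and $k_{\widetilde E_i}$, $v_{\widetilde E_i}$ over $\widetilde A_0$. *)

(* Defs.v *)
(* Schemes are not available, but every scheme in sight is integral, separated
   and birational to affine N-space.  Such a scheme over F is encoded, as in
   Zariski-Samuel, by the set of its local rings inside its function field
   F(x_1, ..., x_N) (a "model").  A point is its local ring O: it specializes to
   Q iff Q `<=` O, and a birational morphism sends O to the local ring that O
   dominates. *)
From HB Require Import structures.
From mathcomp Require Import all_boot all_order all_algebra.
From mathcomp Require Import boolp classical_sets mpoly.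
Set Implicit Arguments.
Unset Strict Implicit.
Unset Printing Implicit Defensive.
Import Order.TTheory GRing.Theory Num.Theory.
Local Open Scope classical_set_scope.
Local Open Scope ring_scope.

(** * Subrings and skeletons *)

Definition is_subring (A : comNzRingType) (S : set A) : Prop :=
  [/\ S 1, (forall a b, S a -> S b -> S (a - b))
         & (forall a b, S a -> S b -> S (a * b))].

Definition subring_gen (A : comNzRingType) (G : set A) : set A :=
  smallest (@is_subring A) G.

Definition fg_subring (A : comNzRingType) (S : set A) : Prop :=
  exists s : seq A, S = subring_gen [set a | a \in s].

(* A is an ambient domain that is an F-algebra through iota, and R a subset of
   A; the last equation says F[S] = R, so that R is in particular a finitely
   generated F-algebra.  If F has characteristic q, every subring of A is a
   Z/(q)-subalgebra, whence fg_subring. *)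
Definition is_skeleton (F : fieldType) (A : idomainType) (iota : F -> A)
    (R S : set A) : Prop :=
  fg_subring S /\ subring_gen (range iota `|` S) = R.

(* Phi induces an isomorphism St (x) Z/(p) = St / p St -> S; it is irrelevant
   outside St.  Flatness of St at p needs no mention: in every use At is a domain
   of characteristic 0, so that St is torsion-free. *)
Definition compatible (p : nat) (At A : idomainType) (Phi : At -> A)
    (St : set At) (S : set A) : Prop :=
  [/\ Phi 1 = 1,
      (forall a b, St a -> St b -> Phi (a - b) = Phi a - Phi b),
      (forall a b, St a -> St b -> Phi (a * b) = Phi a * Phi b),
      Phi @` St = S
    & (forall a, St a -> (Phi a = 0 <-> exists2 b, St b & a = b *+ p))].

(* Compatible skeletons Sigmat of Ft and Sigma of F. *)
Definition compatible_base (p : nat) (Ft F : fieldType) (phi : Ft -> F)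
    (Sigmat : set Ft) (Sigma : set F) : Prop :=
  [/\ is_skeleton idfun [set: Ft] Sigmat, is_skeleton idfun [set: F] Sigma
    & compatible p phi Sigmat Sigma].

Definition is_lifting (Ft F : fieldType) (N : nat) (phi : Ft -> F)
    (Sigmat : set Ft) (ft : {mpoly Ft[N]}) (f : {mpoly F[N]}) : Prop :=
  forall m : 'X_{1..N}, Sigmat ft@_m /\ phi ft@_m = f@_m.

(** * Models *)

Notation funfield F N := {fraction {mpoly F[N]}}.

Definition polyF (F : fieldType) (N : nat) (f : {mpoly F[N]}) : funfield F N :=
  tofrac f.

Definition constF (F : fieldType) (N : nat) (c : F) : funfield F N :=
  polyF c%:MP.

Definition prime_ideal (A : comNzRingType) (B P : set A) : Prop :=
  [/\ P `<=` B,
      P 0 /\ (forall a b, P a -> P b -> P (a + b)),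
      (forall a b, B a -> P b -> P (a * b)), ~ P 1
    & (forall a b, B a -> B b -> P (a * b) -> P a \/ P b)].

Definition localization (K : fieldType) (B P : set K) : set K :=
  [set x | exists a b, [/\ B a, B b, ~ P b & x = a / b]].

Definition Spec_model (K : fieldType) (B : set K) : set (set K) :=
  [set O | exists2 P, prime_ideal B P & O = localization B P].

Definition is_graded (K : fieldType) (S : set {poly K}) : Prop :=
  forall f d, S f -> S (f`_d *: 'X^d).

(* For a graded subring R of K[T] and h = a T^d in R, this is R_(h), the degree
   zero part of R[1/h]. *)
Definition homog_localization (K : fieldType) (R : set {poly K}) (a : K)
    (d : nat) : set K :=
  [set x | exists b e, R (b *: 'X^(d * e)) /\ x = b / a ^+ e].

Definition Proj_model (K : fieldType) (R : set {poly K}) : set (set K) :=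
  [set O | exists a d, [/\ (0 < d)%N, a != 0, R (a *: 'X^d)
                         & Spec_model (homog_localization R a d) O]].

Definition max_ideal (K : fieldType) (O : set K) : set K :=
  [set x | O x /\ ~ exists2 y, O y & x * y = 1].

Definition dominates (K : fieldType) (Q O : set K) : Prop :=
  O `<=` Q /\ max_ideal O `<=` max_ideal Q.

Definition closed_point (K : fieldType) (M : set (set K)) (P : set K) : Prop :=
  M P /\ forall Q, M Q -> Q `<=` P -> Q = P.

Definition affine_space (F : fieldType) (N : nat) : set (set (funfield F N)) :=
  Spec_model (range (@polyF F N)).

Definition origin (F : fieldType) (N : nat) : set (funfield F N) :=
  localization (range (@polyF F N))
    (@polyF F N @` [set f | f.@[fun=> 0] = 0]).

(** * Blow-ups at closed points *)

(* The sum of the m^d T^d, m the maximal ideal of the local ring O. *)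
Definition rees (K : fieldType) (O : set K) : set {poly K} :=
  subring_gen ([set c%:P | c in O] `|` [set c *: 'X | c in max_ideal O]).

(* The exceptional fibre: points over P of Proj (rees P), the blow-up of
   Spec P at its closed point. *)
Definition exc_divisor (K : fieldType) (P : set K) : set (set K) :=
  [set Q | Proj_model (rees P) Q /\ dominates Q P].

Definition blowup (K : fieldType) (M : set (set K)) (P : set K) :
    set (set K) :=
  [set Q | (M Q /\ Q <> P) \/ exc_divisor P Q].

(* A i is obtained by blowing up A (i-1) at P i, for 1 <= i <= n; the values
   P 0 and those of A, P beyond n play no role. *)
Definition blowup_sequence (F : fieldType) (N n : nat)
    (A : nat -> set (set (funfield F N))) (P : nat -> set (funfield F N)) :
    Prop :=
  A 0%N = @affine_space F N /\
  forall i, (i < n)%N ->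
    [/\ closed_point (A i) (P i.+1), dominates (P i.+1) (@origin F N)
      & A i.+1 = blowup (A i) (P i.+1)].

(** * Divisorial valuations and discrepancies *)

(* v is the normalized discrete valuation with valuation ring O.  Only values
   at nonzero elements are meaningful: v 0 stands for +oo. *)
Definition valuation_of (K : fieldType) (O : set K) (v : K -> int) : Prop :=
  [/\ (forall x y, x != 0 -> y != 0 -> v (x * y) = v x + v y),
      (forall x y, x != 0 -> y != 0 -> x + y != 0 ->
         Num.min (v x) (v y) <= v (x + y)),
      (exists2 x, x != 0 & v x = 1)
    & O = [set x | x = 0 \/ 0 <= v x]].

Definition same_value (K Kt : fieldType) (v : K -> int) (x : K)
    (vt : Kt -> int) (xt : Kt) : Prop :=
  (x = 0 <-> xt = 0) /\ (x != 0 -> v x = vt xt).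

Definition generic_point (K : fieldType) (E : set (set K)) (O : set K) : Prop :=
  E O /\ forall Q, E Q -> Q `<=` O.

(* O is the local ring at the generic point of the exceptional divisor E of the
   blow-up at P, and v = v_E. *)
Definition exc_valuation (K : fieldType) (P : set K) (O : set K)
    (v : K -> int) : Prop :=
  generic_point (exc_divisor P) O /\ valuation_of O v.

(* The partial derivative of F(x_1, ..., x_N) with respect to x_j. *)
Definition pderiv (F : fieldType) (N : nat) (j : 'I_N) (u : funfield F N) :
    funfield F N :=
  let a := \n_(repr u) in let b := \d_(repr u) in
  polyF (mderiv j a * b - a * mderiv j b) / polyF b ^+ 2.

(* du_1 ^ ... ^ du_N = jacobian u * dx_1 ^ ... ^ dx_N. *)
Definition jacobian (F : fieldType) (N : nat) (u : 'I_N -> funfield F N) :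
    funfield F N :=
  \det (\matrix_(i, j) pderiv j (u i)).

(* kappa is the coefficient of E in K_{A'/A_0}, the divisor of
   dx_1 ^ ... ^ dx_N as a rational section of the canonical sheaf of A'.  With O
   and v the local ring and valuation of E, the stalk of that sheaf at the
   generic point of E is the O-module generated by the forms
   du_1 ^ ... ^ du_N, u_i in O; it equals O omega with
   v (omega / dx_1 ^ ... ^ dx_N) = - kappa. *)
Definition rel_canonical_coef (F : fieldType) (N : nat)
    (O : set (funfield F N)) (v : funfield F N -> int) (kappa : int) : Prop :=
  (exists u : 'I_N -> funfield F N,
     [/\ forall i, O (u i), jacobian u != 0 & v (jacobian u) = - kappa]) /\
  (forall u : 'I_N -> funfield F N, (forall i, O (u i)) ->
     jacobian u != 0 -> - kappa <= v (jacobian u)).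

(** * Reduction modulo p of models *)

(* Phi is the identity on the variables and phi on the coefficients. *)
Definition extends_base (Ft F : fieldType) (N : nat) (At A : idomainType)
    (iotat : {mpoly Ft[N]} -> At) (iota : {mpoly F[N]} -> A)
    (phi : Ft -> F) (Sigmat : set Ft) (Phi : At -> A) (St : set At) : Prop :=
  forall ft f, is_lifting phi Sigmat ft f ->
    St (iotat ft) /\ Phi (iotat ft) = iota f.

Definition Spec_reduction (p : nat) (Ft F : fieldType) (N : nat)
    (phi : Ft -> F) (Sigmat : set Ft)
    (Mt : set (set (funfield Ft N))) (M : set (set (funfield F N))) : Prop :=
  exists (Rt St : set (funfield Ft N)) (R S : set (funfield F N))
         (Phi : funfield Ft N -> funfield F N),
    [/\ is_skeleton (@constF Ft N) Rt St, is_skeleton (@constF F N) R S,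
        compatible p Phi St S,
        extends_base (@polyF Ft N) (@polyF F N) phi Sigmat Phi St
      & Mt = Spec_model Rt /\ M = Spec_model R].

(* Graded rings are taken inside K[T], K the function field: this is no loss,
   for a graded domain whose degree zero field of fractions is K. *)
Definition Proj_reduction (p : nat) (Ft F : fieldType) (N : nat)
    (phi : Ft -> F) (Sigmat : set Ft)
    (Mt : set (set (funfield Ft N))) (M : set (set (funfield F N))) : Prop :=
  exists (Rt St : set {poly funfield Ft N}) (R S : set {poly funfield F N})
         (Phi : {poly funfield Ft N} -> {poly funfield F N}),
    [/\ is_skeleton (fun c => (constF N c)%:P) Rt St /\
        is_skeleton (fun c => (constF N c)%:P) R S,
        [/\ is_graded Rt, is_graded St, is_graded R & is_graded S],
        compatible p Phi St S /\
        (forall b d, St (b *: 'X^d) ->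
           exists c, Phi (b *: 'X^d) = c *: 'X^d),
        extends_base (fun f => (polyF f)%:P) (fun f => (polyF f)%:P)
          phi Sigmat Phi St
      & Mt = Proj_model Rt /\ M = Proj_model R].

(* Mt (mod p) = M, relative to compatible skeletons of the ground fields with
   reduction map phi defined on Sigmat. *)
Definition reduces_to (p : nat) (Ft F : fieldType) (N : nat)
    (phi : Ft -> F) (Sigmat : set Ft)
    (Mt : set (set (funfield Ft N))) (M : set (set (funfield F N))) : Prop :=
  Spec_reduction p phi Sigmat Mt M \/ Proj_reduction p phi Sigmat Mt M.

(* Main.v *)
(* A point infinitely near to the origin is named by a word of chart substitutions
   x_j -> x_j, x_l -> x_j (x_l + a_l); composing them gives an automorphism theta
   of the function field, and the local ring of the point is the preimage under
   theta of that of the origin.  The i-th blow-up is the Proj of the Rees algebra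
   of an ideal G_i of F[x_1, ..., x_N], and blowing up the point w replaces G_i by
   G_i J, with J the elements of G_i vanishing at w.  By the Nullstellensatz every
   centre P_i is named by a word over k.

   Adjoin to Z, step by step, lifts in C of the finitely many coordinates in these
   words (transcendentals lift transcendentals, as C is uncountable; algebraic
   elements are lifted by roots of lifted monic equations), and let B be the
   localization at the kernel of the reduction r.  The words and the ideals lift to
   B, and the same polynomial identities certify the centres over k and over C.
   That the centre is a B-point shows by induction that the Rees algebra of G_i has
   eventually no p-torsion modulo B[x], so that after a Veronese twist and inverting
   one element the two Rees algebras are compatible skeletons.

   The exceptional valuation at w is the order at the origin composed with theta,
   and its discrepancy is N - 1 plus the order of the Jacobian of theta, a monomial
   times a unit over B, which has the same order over k and over C.

   For N = 2, polynomials are lifted by induction on the length of the words.  If f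
   has multiplicity m, its transforms at the points s of the exceptional line meet
   that line with multiplicities of sum at most m.  Lifts g_s of these transforms
   with the right orders are available by induction, and are glued into a lift of f
   modulo (g_s) and a high power of the maximal ideal, degree by degree, by the
   Chinese remainder theorem for binary forms of degree at least m. *)
Require Import Defs.
From HB Require Import structures.
From mathcomp Require Import all_boot all_order all_algebra.
From mathcomp Require Import fingroup perm.
From mathcomp Require Import boolp classical_sets reals complex mpoly.
From mathcomp Require Import ring lra zify.
Set Implicit Arguments.
Unset Strict Implicit.
Unset Printing Implicit Defensive.
Import Order.TTheory GRing.Theory Num.Theory.
Local Open Scope classical_set_scope.
Local Open Scope ring_scope.

(** * Subrings and Rees algebras *)

(** The certificates ([fval], [Bpt], [Jspec], [chain]) are polynomial identities over an arbitrary
    domain together with the invertibility of some of its elements. They pass along ring morphisms,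
    provided the chart element h does not become 0, so that one chain over B yields both sequences:
    over k through r, over C through the inclusion. The main obstacle is that Rees algebras do not
    commute with reduction: an element of G_i^d may be divisible by p in B[x] while the quotient
    lies outside G_i^d. Such quotients return to the Rees algebra only in high degrees, which is
    enough because Proj ignores low degrees; hence the Veronese twist. The bases inside C are
    required to be p-adically separated. This replaces a discrete valuation: a nonzero polynomial
    can be divided by p until its reduction is nonzero. For N = 2 the coefficients of f need a base
    that depends on f. The base is then enlarged while words and ideals are merely transported, so
    the varieties over C stay the same. *)

Section Subrings.
Variable A : comNzRingType.
Implicit Types (S G : set A).

Lemma subring0 S : is_subring S -> S 0.
Proof. by case=> h1 hB _; rewrite -(subrr 1); apply: hB. Qed.

Lemma subringN S a : is_subring S -> S a -> S (- a).
Proof.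
by move=> hS ha; rewrite -sub0r; case: (hS) => _ hB _; apply: hB => //; apply: subring0.
Qed.

Lemma subringD S a b : is_subring S -> S a -> S b -> S (a + b).
Proof.
move=> hS ha hb; rewrite -[b]opprK; case: (hS) => _ hB _; apply: hB => //.
exact: subringN.
Qed.

Lemma subringX S a n : is_subring S -> S a -> S (a ^+ n).
Proof.
move=> hS ha; case: (hS) => h1 _ hM; elim: n => [|n IH]; first by rewrite expr0.
by rewrite exprS; apply: hM.
Qed.

Lemma subringMn S a n : is_subring S -> S a -> S (a *+ n).
Proof.
move=> hS ha; elim: n => [|n IH]; first by rewrite mulr0n; apply: subring0.
by rewrite mulrS; apply: subringD.
Qed.

Lemma subring_sum S (I : Type) (r : seq I) (Q : pred I) (F : I -> A) :
  is_subring S -> (forall i, Q i -> S (F i)) -> S (\sum_(i <- r | Q i) F i).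
Proof.
move=> hS h; elim/big_ind: _ => //; first exact: subring0.
by move=> *; apply: subringD.
Qed.

Lemma subring_prod S (I : Type) (r : seq I) (Q : pred I) (F : I -> A) :
  is_subring S -> (forall i, Q i -> S (F i)) -> S (\prod_(i <- r | Q i) F i).
Proof. by case=> h1 hB hM h; elim/big_ind: _. Qed.

Lemma subring_genP G : is_subring (subring_gen G).
Proof.
split=> [C [[h1 _ _] _]//|a b ha hb C hC|a b ha hb C hC].
  by case: (hC) => -[h1 hB hM] hG; apply: hB; [apply: ha|apply: hb].
by case: (hC) => -[h1 hB hM] hG; apply: hM; [apply: ha|apply: hb].
Qed.

Lemma sub_subring_gen G : G `<=` subring_gen G.
Proof. by move=> a ha C [_ hG]; apply: hG. Qed.

Lemma subring_gen_min G S : is_subring S -> G `<=` S -> subring_gen G `<=` S.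
Proof. by move=> hS hG a; apply. Qed.

Lemma subring_gen_mono G G' : G `<=` subring_gen G' ->
  subring_gen G `<=` subring_gen G'.
Proof. by move=> h; apply: subring_gen_min => //; apply: subring_genP. Qed.

Lemma subring_genU G G' : subring_gen (G `|` subring_gen G') =
  subring_gen (G `|` G').
Proof.
apply/seteqP; split; apply: subring_gen_mono.
  move=> a [ha|]; first by apply: sub_subring_gen; left.
  by apply: subring_gen_mono => b hb; apply: sub_subring_gen; right.
move=> a [ha|ha]; apply: sub_subring_gen; first by left.
by right; apply: sub_subring_gen.
Qed.

(* [pw S G d] is the component of degree [d] of the Rees algebra [S[G T]]. *)
Inductive pw S G : nat -> A -> Prop :=
| pw_base b : S b -> pw S G 0 b
| pw_mulg d a g : pw S G d a -> G g -> pw S G d.+1 (a * g)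
| pw_zero d : pw S G d 0
| pw_sub d a b : pw S G d a -> pw S G d b -> pw S G d (a - b).

Lemma pwN S G d a : pw S G d a -> pw S G d (- a).
Proof. by rewrite -sub0r => h; apply: pw_sub => //; apply: pw_zero. Qed.

Lemma pwD S G d a b : pw S G d a -> pw S G d b -> pw S G d (a + b).
Proof. by move=> ha hb; rewrite -[b]opprK; apply/pw_sub/pwN. Qed.

Lemma pw_sum S G d (I : Type) (r : seq I) (Q : pred I) (F : I -> A) :
  (forall i, Q i -> pw S G d (F i)) -> pw S G d (\sum_(i <- r | Q i) F i).
Proof.
move=> h; elim/big_ind: _ => //; first exact: pw_zero.
by move=> *; apply: pwD.
Qed.

Lemma pw0P S G a : is_subring S -> pw S G 0 a -> S a.
Proof.
move=> hS h; remember 0%N as d; elim: h Heqd => //.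
  by move=> *; apply: subring0.
by move=> d' b c _ IHb _ IHc e; case: (hS) => _ hB _; apply: hB; [apply: IHb|apply: IHc].
Qed.

Lemma pw_mono S S' G G' d : S `<=` S' -> G `<=` G' ->
  pw S G d `<=` pw S' G' d.
Proof.
move=> hS hG a; elim=> [b /hS|e b g _ IH /hG|e|e b c _ IHb _ IHc].
- exact: pw_base.
- exact: pw_mulg.
- exact: pw_zero.
- exact: pw_sub.
Qed.

Lemma pw_scale S G d s a : is_subring S -> S s -> pw S G d a -> pw S G d (s * a).
Proof.
move=> hS hs; elim=> [b hb|e b g _ IH hg|e|e b c _ IHb _ IHc].
- by apply: pw_base; case: hS => _ _; apply.
- by rewrite mulrA; apply: pw_mulg.
- by rewrite mulr0; apply: pw_zero.
- by rewrite mulrBr; apply: pw_sub.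
Qed.

Lemma pwM S G d e a b : is_subring S -> pw S G d a -> pw S G e b ->
  pw S G (d + e) (a * b).
Proof.
move=> hS ha; elim=> [s hs|e' c g _ IH hg|e'|e' c c' _ IHb _ IHc].
- by rewrite addn0 mulrC; apply: pw_scale.
- by rewrite addnS mulrA; apply: pw_mulg.
- by rewrite mulr0; apply: pw_zero.
- by rewrite mulrBr; apply: pw_sub.
Qed.

Lemma pw_gen S G g : is_subring S -> G g -> pw S G 1 g.
Proof.
move=> hS hg; rewrite -[g]mul1r; apply: pw_mulg => //; apply: pw_base.
by case: hS.
Qed.

Lemma pwX S G d a n : is_subring S -> pw S G d a -> pw S G (n * d) (a ^+ n).
Proof.
move=> hS ha; elim: n => [|n IH]; last by rewrite exprS mulSn; apply: pwM.
by rewrite expr0 mul0n; apply: pw_base; case: hS.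
Qed.

Lemma pw_genX S G g n : is_subring S -> G g -> pw S G n (g ^+ n).
Proof. by move=> hS hg; rewrite -[n in pw _ _ n]muln1; apply/pwX/pw_gen. Qed.

Lemma pw_trans S G G' d e : is_subring S -> (forall g, G' g -> pw S G e g) ->
  forall a, pw S G' d a -> pw S G (d * e) a.
Proof.
move=> hS h a; elim=> [b hb|d' b g _ IH hg|d'|d' b c _ IHb _ IHc].
- by rewrite mul0n; apply: pw_base.
- by rewrite mulSn addnC; apply: pwM => //; apply: h.
- exact: pw_zero.
- exact: pw_sub.
Qed.

(** The single products whose sums make up [pw]. They matter in local rings: when a sum is a unit,
    one of its terms is, and that term can be factored. *)
Inductive mono S G : nat -> A -> Prop :=
| mono_base b : S b -> mono S G 0 b
| mono_mulg d a g : mono S G d a -> G g -> mono S G d.+1 (a * g).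

Lemma mono_pw S G d : mono S G d `<=` pw S G d.
Proof. by move=> a; elim=> [b hb|e b g _ IH hg]; [apply: pw_base|apply: pw_mulg]. Qed.

Lemma mono_inv S G d x : mono S G d.+1 x ->
  exists y g, [/\ mono S G d y, G g & x = y * g].
Proof.
move=> h; remember d.+1 as e; case: h Heqe => // d' a g ha hg [<-].
by exists a, g.
Qed.

Lemma monoN S G d a : is_subring S -> mono S G d a -> mono S G d (- a).
Proof.
move=> hS; elim=> [b hb|e b g _ IH hg].
  by apply: mono_base; apply: subringN.
by rewrite -mulNr; apply: mono_mulg.
Qed.

Lemma pw_monos S G d a : is_subring S -> pw S G d a ->
  exists s : seq A, (forall x, x \in s -> mono S G d x) /\ a = \sum_(x <- s) x.
Proof.
move=> hS; elim=> [b hb|e b g _ [s [hs ->]] hg|e|e b c _ [s [hs ->]] _ [t [ht ->]]].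
- exists [:: b]; rewrite big_seq1; split=> // x; rewrite inE => /eqP->.
  exact: mono_base.
- exists [seq x * g | x <- s]; rewrite big_map mulr_suml; split=> // x.
  by case/mapP=> y /hs hy ->; apply: mono_mulg.
- by exists [::]; rewrite big_nil.
exists (s ++ [seq - x | x <- t]); rewrite big_cat big_map sumrN; split=> // x.
by rewrite mem_cat => /orP[/hs//|/mapP[y /ht hy ->]]; apply: monoN.
Qed.

Definition mulset G J : set A := [set x | exists g t, [/\ G g, J t & x = g * t]].

End Subrings.

Lemma rees_coef (A : comNzRingType) (S G : set A) (f : {poly A}) : is_subring S ->
  subring_gen ([set c%:P | c in S] `|` [set c *: 'X | c in G]) f <->
  forall d, pw S G d f`_d.
Proof.
move=> hS; case: (hS) => h1 hB hM; split.
  suff H : subring_gen ([set c%:P | c in S] `|` [set c *: 'X | c in G]) `<=`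
    [set f | forall d, pw S G d f`_d] by move=> hf; exact: (H f hf).
  apply: subring_gen_min.
    split.
    - by move=> d; rewrite coef1; case: d => [|d]; [apply: pw_base|apply: pw_zero].
    - by move=> a b ha hb d; rewrite coefB; apply: pw_sub.
    - move=> a b ha hb d; rewrite coefM; apply: pw_sum => i _.
      by have := pwM hS (ha i) (hb (d - i)%N); rewrite subnKC // -ltnS.
  move=> q [] [c hc <-] d.
    by rewrite coefC; case: d => [|d]; [apply: pw_base|apply: pw_zero].
  rewrite coefZ coefX; case: d => [|[|d]]; rewrite ?mulr0 ?mulr1;
    [exact: pw_zero|exact: pw_gen|exact: pw_zero].
move=> h; set R := subring_gen _.
have hR : is_subring R by apply: subring_genP.
suff hX d a : pw S G d a -> R (a *: 'X^d).
  by rewrite -[f]coefK poly_def; apply: subring_sum => // i _; apply: hX.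
elim=> [b hb|e b g _ IH hg|e|e b c _ IHb _ IHc].
- rewrite expr0 alg_polyC; apply: sub_subring_gen; left; by exists b.
- have -> : (b * g) *: 'X^(e.+1) = (b *: 'X^e) * (g *: 'X) :> {poly A}.
    by rewrite -scalerAl -scalerAr scalerA exprSr.
  case: hR => _ _; apply=> //.
  by apply: sub_subring_gen; right; exists g.
- by rewrite scale0r; apply: subring0.
- by rewrite scalerBl; case: hR => _ hRB _; apply: hRB.
Qed.

Lemma pw_image (A A' : comNzRingType) (f : {rmorphism A -> A'}) (S G : set A) d :
  pw (f @` S) (f @` G) d = f @` (pw S G d).
Proof.
apply/seteqP; split=> x.
  elim=> [_ [b hb <-]|e _ _ _ [b hb <-] [g hg <-]|e|e _ _ _ [b hb <-] _ [c hc <-]].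
  - by exists b => //; apply: pw_base.
  - by exists (b * g); [apply: pw_mulg|rewrite rmorphM].
  - by exists 0; [apply: pw_zero|rewrite rmorph0].
  - by exists (b - c); [apply: pw_sub|rewrite rmorphB].
case=> a ha <-; elim: ha => [b hb|e b g _ IH hg|e|e b c _ IHb _ IHc].
- by apply: pw_base; exists b.
- by rewrite rmorphM; apply: pw_mulg => //; exists g.
- by rewrite rmorph0; apply: pw_zero.
- by rewrite rmorphB; apply: pw_sub.
Qed.

Lemma mulset_image (A A' : comNzRingType) (f : {rmorphism A -> A'}) (G J : set A) :
  f @` mulset G J = mulset (f @` G) (f @` J).
Proof.
apply/seteqP; split=> [_ [_ [g [t [hg ht ->]]] <-]|_ [_ [_ [[g hg <-] [t ht <-] ->]]]].
  by exists (f g), (f t); split; [exists g|exists t|rewrite rmorphM].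
by exists (g * t); [exists g, t|rewrite rmorphM].
Qed.

Lemma subring_image (A A' : comNzRingType) (f : {rmorphism A -> A'}) (S : set A) :
  is_subring S -> is_subring (f @` S).
Proof.
case=> h1 hB hM; split; first by exists 1; rewrite ?rmorph1.
  by move=> _ _ [a ha <-] [b hb <-]; exists (a - b); rewrite ?rmorphB //; apply: hB.
by move=> _ _ [a ha <-] [b hb <-]; exists (a * b); rewrite ?rmorphM //; apply: hM.
Qed.

Lemma subring_preimage (A A' : comNzRingType) (f : {rmorphism A -> A'})
  (S : set A') : is_subring S -> is_subring (f @^-1` S).
Proof.
case=> h1 hB hM; split; rewrite /preimage /= ?rmorph1 //.
  by move=> a b ha hb; rewrite rmorphB; apply: hB.
by move=> a b ha hb; rewrite rmorphM; apply: hM.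
Qed.

Lemma subring_gen_image (A A' : comNzRingType) (f : {rmorphism A -> A'})
  (G : set A) : subring_gen (f @` G) = f @` subring_gen G.
Proof.
apply/seteqP; split.
  apply: subring_gen_min; first by apply/subring_image/subring_genP.
  by move=> _ [a ha <-]; exists a => //; apply: sub_subring_gen.
move=> _ [a ha <-]; move: a ha.
apply: subring_gen_min; first by apply/subring_preimage/subring_genP.
by move=> a ha; apply: sub_subring_gen; exists a.
Qed.

Lemma subring_setT (A : comNzRingType) : is_subring [set: A].
Proof. by []. Qed.

Lemma subring_range (A A' : comNzRingType) (f : {rmorphism A -> A'}) :
  is_subring (range f).
Proof. exact/subring_image/subring_setT. Qed.
(** * Local rings and models *)

Section Models.
Variable K : fieldType.
Implicit Types (O P Q C S G J : set K).

Definition unitin O (x : K) := [/\ O x, x != 0 & O x^-1].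

Definition local O :=
  is_subring O /\ (forall a b, O a -> O b -> a + b = 1 -> unitin O a \/ unitin O b).

(** Membership in [Spec_model C] without mention of a prime: the prime is the contraction of the
    maximal ideal of O. In this form one O can be compared over several rings C, which is how charts
    are changed. *)
Definition over C O :=
  [/\ local O, C `<=` O
    & forall x, O x -> exists a b, [/\ C a, C b, unitin O b & x = a / b]].

Lemma divM_div (a b c d e : K) : e != 0 ->
  a * b / (c * d) = (a / c) * ((b / e) / (d / e)).
Proof.
move=> e0; have -> : b / e / (d / e) = b / d by rewrite invf_div mulrA divfK.
by rewrite mulf_div.
Qed.

Lemma unitin1 O : is_subring O -> unitin O 1.
Proof. by case=> h1 _ _; split; rewrite ?invr1 ?oner_eq0. Qed.

Lemma unitinV O x : unitin O x -> unitin O x^-1.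
Proof. by case=> h1 h2 h3; split; rewrite ?invr_eq0 ?invrK. Qed.

Lemma unitinM O x y : is_subring O -> unitin O x -> unitin O y -> unitin O (x * y).
Proof.
move=> [_ _ hM] [h1 h2 h3] [k1 k2 k3]; split; rewrite ?mulf_neq0 ?invfM //.
  exact: hM.
exact: hM.
Qed.

Lemma unitinX O x n : is_subring O -> unitin O x -> unitin O (x ^+ n).
Proof.
move=> hO hx; elim: n => [|n IH]; first by rewrite expr0; apply: unitin1.
by rewrite exprS; apply: unitinM.
Qed.

Lemma unitinMl O x y : is_subring O -> O x -> O y -> unitin O (x * y) -> unitin O x.
Proof.
move=> [_ _ hM] hx hy [_ h2 h3]; move: (h2); rewrite mulf_eq0 => /norP[nx ny].
split=> //; have -> : x^-1 = y * (x * y)^-1 by rewrite invfM mulrCA mulfV ?mulr1.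
exact: hM.
Qed.

Lemma unitin_sub O O' x : O `<=` O' -> unitin O x -> unitin O' x.
Proof. by move=> h [h1 h2 h3]; split=> //; apply: h. Qed.

Lemma local_sum O (s : seq K) : local O -> (forall x, x \in s -> O x) ->
  unitin O (\sum_(x <- s) x) -> exists2 x, x \in s & unitin O x.
Proof.
move=> [hO hl]; elim: s => [|x s IH] hs; first by rewrite big_nil => -[_]; rewrite eqxx.
rewrite big_cons => hu; case: (hu) => h1 h2 h3; case: (hO) => _ _ hM.
have hx : O x by apply: hs; rewrite inE eqxx.
have hS : O (\sum_(j <- s) j).
  rewrite big_seq; apply: subring_sum => // y hy; apply: hs.
  by rewrite inE hy orbT.
have := hl _ _ (hM _ _ hx h3) (hM _ _ hS h3).
rewrite -mulrDl mulfV // => /(_ erefl)[]/(unitinMl hO) hh.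
  by exists x; rewrite ?inE ?eqxx //; apply: hh.
case: IH => [y hy||y hy hu']; first by apply: hs; rewrite inE hy orbT.
  exact: hh.
by exists y; rewrite // inE hy orbT.
Qed.

Lemma max_idealP O x : max_ideal O x <-> O x /\ ~ unitin O x.
Proof.
split=> -[hx h]; split=> //.
  move=> [_ h2 h3]; apply: h; exists x^-1 => //; exact: mulfV.
move=> [y hy e]; apply: h; have nx : x != 0.
  by apply: contra_eqN e => /eqP->; rewrite mul0r eq_sym oner_eq0.
by split=> //; rewrite -[x^-1]mulr1 -e mulKf.
Qed.

Lemma max_ideal0 O : is_subring O -> max_ideal O 0.
Proof.
move=> hO; apply/max_idealP; split; first exact: subring0.
by case=> _; rewrite eqxx.
Qed.

Lemma max_idealN1 O : is_subring O -> ~ max_ideal O 1.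
Proof. by move=> hO /max_idealP[_]; case; apply: unitin1. Qed.

Lemma max_idealM O x y : is_subring O -> O x -> max_ideal O y -> max_ideal O (x * y).
Proof.
move=> hO hx /max_idealP[hy hn]; case: (hO) => _ _ hM.
apply/max_idealP; split; first exact: hM.
by rewrite mulrC => /(unitinMl hO hy hx).
Qed.

Lemma max_idealD O x y : local O -> max_ideal O x -> max_ideal O y ->
  max_ideal O (x + y).
Proof.
move=> hl /max_idealP[hx nx] /max_idealP[hy ny]; case: (hl) => hO _.
apply/max_idealP; split; first exact: subringD.
move=> hu; case: (@local_sum O [:: x; y] hl).
- by move=> z; rewrite !inE => /orP[]/eqP->.
- by rewrite big_cons big_seq1.
by move=> z; rewrite !inE => /orP[]/eqP->.
Qed.

Lemma max_idealB O x y : local O -> max_ideal O x -> max_ideal O y ->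
  max_ideal O (x - y).
Proof.
move=> hl hx hy; rewrite -mulN1r; apply: max_idealD => //.
case: hl => hO _; apply: max_idealM => //.
by apply: subringN => //; case: hO.
Qed.

Lemma max_idealDu O x y : local O -> unitin O x -> max_ideal O y ->
  unitin O (x + y).
Proof.
move=> hl hx hy; case: (hl) => hO _; apply: contrapT => hn.
have hxy : max_ideal O (x + y).
  apply/max_idealP; split=> //; apply: subringD => //; first by case: hx.
  by case/max_idealP: hy.
have /max_idealP[_] := max_idealB hl hxy hy.
by rewrite addrK.
Qed.

Lemma pw_max_ideal O J x : local O -> J `<=` max_ideal O -> pw O J 1 x ->
  max_ideal O x.
Proof.
move=> hl hJ h; case: (hl) => hO _.
remember 1%N as d; elim: h Heqd => // [d' a g ha _ hg [e]|d' e|d' a b _ IHa _ IHb e].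
- by subst; apply: max_idealM; [|apply: pw0P ha|apply: hJ].
- exact: max_ideal0.
- by apply: max_idealB => //; [apply: IHa|apply: IHb].
Qed.

Lemma Spec_modelP C O : is_subring C -> Spec_model C O <-> over C O.
Proof.
move=> hC; case: (hC) => c1 cB cM; split.
  move=> [P [hP [P0 PD] PM P1 Pp] ->].
  have nP0 b : ~ P b -> b != 0 by move=> h; apply/eqP=> e; apply: h; rewrite e.
  have hsub : C `<=` localization C P by move=> x hx; exists x, 1; rewrite divr1.
  have hun a b : C a -> C b -> ~ P a -> ~ P b -> unitin (localization C P) (a / b).
    move=> ha hb na nb; split; rewrite ?mulf_neq0 ?invr_eq0 ?nP0 //.
      by exists a, b.
    by exists b, a; rewrite invfM invrK mulrC.
  have hdM a b : C a -> C b -> ~ P a -> ~ P b -> ~ P (a * b).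
    by move=> ha hb na nb /Pp; case.
  have hsr : is_subring (localization C P).
    split; first exact: hsub.
      move=> _ _ [a [b [ha hb nb ->]]] [c [d [hc hd nd ->]]].
      exists (a * d - c * b), (b * d); split; [| |exact: hdM|].
      - by apply: cB; apply: cM.
      - exact: cM.
      by rewrite -mulNr addf_div ?nP0 // mulNr.
    move=> _ _ [a [b [ha hb nb ->]]] [c [d [hc hd nd ->]]].
    exists (a * c), (b * d); split; [exact: cM|exact: cM|exact: hdM|].
    by rewrite mulf_div.
  split=> //.
    split=> // _ _ [a [b [ha hb nb ->]]] [c [d [hc hd nd ->]]] e.
    have [pa|na] := pselect (P a); last by left; apply: hun.
    right; apply: hun => // pc; apply: (hdM b d) => //.
    have -> : b * d = d * a + b * c.
      move/eqP: e; rewrite addf_div ?nP0 // => /eqP e.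
      have := congr1 (fun z => z * (b * d)) e; rewrite mul1r mulfVK ?mulf_neq0 ?nP0 //.
      by move=> <-; rewrite mulrC [c * b]mulrC.
    by apply: PD; apply: PM.
  move=> _ [a [b [ha hb nb ->]]]; exists a, b; split=> //.
  by rewrite -[b]divr1; apply: hun.
move=> [hl hCO hf]; case: (hl) => hO _.
exists [set x | C x /\ max_ideal O x].
  split.
  - by move=> x [].
  - split; first by split; [exact: subring0|exact: max_ideal0].
    move=> a b [ha ma] [hb mb]; split; first exact: subringD.
    exact: max_idealD.
  - move=> a b ha [hb mb]; split; first exact: cM.
    by apply: max_idealM => //; apply: hCO.
  - by move=> [_ /(max_idealN1 hO)].
  - move=> a b ha hb [_ /max_idealP[_ hn]].
    have [ua|na] := pselect (unitin O a); last first.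
      by left; split=> //; apply/max_idealP; split=> //; apply: hCO.
    right; split=> //; apply/max_idealP; split; first exact: hCO.
    by move=> ub; apply: hn; apply: unitinM.
apply/seteqP; split=> [x /hf[a [b [ha hb ub ->]]]|_ [a [b [ha hb nb ->]]]].
  by exists a, b; split=> // -[_ /max_idealP[]].
have ub : unitin O b.
  by apply: contrapT => nu; apply: nb; split=> //; apply/max_idealP; split=> //; apply: hCO.
by case: (hO) => _ _; apply; [apply: hCO|case: ub].
Qed.

Lemma over_eq C P Q : over C P -> over C Q ->
  (forall z, C z -> unitin P z <-> unitin Q z) -> P = Q.
Proof.
move=> [[[_ _ pM] _] hCP hfP] [[[_ _ qM] _] hCQ hfQ] h.
apply/seteqP; split=> x.
  move=> /hfP[a [b [ha hb /h ub ->]]] //; apply: qM; first exact: hCQ.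
  by case: (ub hb) => //.
move=> /hfQ[a [b [ha hb ub ->]]]; apply: pM; first exact: hCP.
by case/h: ub.
Qed.

Lemma over_enlarge C C' O : over C O -> C `<=` C' -> C' `<=` O -> over C' O.
Proof.
move=> [hl hC hf] h h'; split=> // x /hf[a [b [ha hb ub ->]]].
by exists a, b; split=> //; apply: h.
Qed.

(** The numerator of the C'-fraction for the denominator b is b times a unit, hence a unit of O; so
    a quotient of two such fractions again has a unit denominator. *)
Lemma over_shrink C C' O : is_subring C' -> over C O -> C' `<=` O ->
  (forall x, C x -> exists a b, [/\ C' a, C' b, unitin O b & x = a / b]) ->
  over C' O.
Proof.
move=> [_ _ cM] [hl hC hf] h' h; split=> // x /hf[a [b [ha hb ub ->]]].
have [a1 [a2 [h1 h2 u2 ea]]] := h a ha; have [b1 [b2 [k1 k2 v2 eb]]] := h b hb.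
case: (hl) => hO _.
have u1 : unitin O b1.
  have -> : b1 = b * b2 by rewrite eb divfK //; case: v2.
  exact: unitinM.
exists (a1 * b2), (a2 * b1); split; [exact: cM|exact: cM|exact: unitinM|].
by rewrite ea eb invf_div mulf_div.
Qed.

(** The ring S[G/g]: the degree 0 part of S[G T] with g T inverted, an affine chart of the blow-up
    of G. *)
Definition chart S G (g : K) : set K :=
  [set x | exists e b, pw S G e b /\ x = b / g ^+ e].

Section Chart.
Variables (S G : set K) (hS : is_subring S) (g : K).
Hypotheses (hg : G g) (g0 : g != 0).

Lemma chart_pw e b : pw S G e b -> chart S G g (b / g ^+ e).
Proof. by move=> h; exists e, b. Qed.

Lemma chart_gen g' : G g' -> chart S G g (g' / g).
Proof. by move=> h; exists 1%N, g'; rewrite expr1; split=> //; apply: pw_gen. Qed.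

Lemma chart_sub s : S s -> chart S G g s.
Proof. by move=> h; exists 0%N, s; rewrite expr0 divr1; split=> //; apply: pw_base. Qed.

Lemma chart_lift e b n : pw S G e b -> exists2 b', pw S G (e + n) b' &
  b / g ^+ e = b' / g ^+ (e + n).
Proof.
move=> hb; exists (b * g ^+ n); first by apply: pwM => //; apply: pw_genX.
by rewrite exprD invfM [_^-1 * _]mulrC mulrA mulfK ?expf_neq0.
Qed.

Lemma chart_common x y : chart S G g x -> chart S G g y ->
  exists e a b, [/\ pw S G e a, pw S G e b, x = a / g ^+ e & y = b / g ^+ e].
Proof.
move=> [e [a [ha ->]]] [f [b [hb ->]]].
have [a' ha' ->] := chart_lift f ha; have [b' hb' ->] := chart_lift e hb.
by exists (e + f)%N, a', b'; rewrite [(f + e)%N]addnC in hb' *.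
Qed.

Lemma chart_subring : is_subring (chart S G g).
Proof.
split.
- by apply: chart_sub; case: hS.
- move=> x y hx hy; have [e [a [b [ha hb -> ->]]]] := chart_common hx hy.
  by exists e, (a - b); rewrite mulrBl; split=> //; apply: pw_sub.
- move=> x y [e [a [ha ->]]] [f [b [hb ->]]].
  by exists (e + f)%N, (a * b); rewrite mulf_div exprD; split=> //; apply: pwM.
Qed.

Lemma chart_min O : is_subring O -> S `<=` O -> (forall g', G g' -> O (g' / g)) ->
  chart S G g `<=` O.
Proof.
move=> hO hSO hGO x [e [b [hb ->]]]; elim: hb => [s /hSO hs|d a g' _ IH /hGO h|d|d a c _ IHa _ IHc].
- by rewrite expr0 divr1.
- by rewrite exprSr -mulf_div; case: hO => _ _; apply.
- by rewrite mul0r; apply: subring0.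
- by rewrite mulrBl; case: hO => _ hB _; apply: hB.
Qed.

End Chart.

Definition Bl S G : set (set K) :=
  [set O | exists g, [/\ G g, g != 0 & over (chart S G g) O]].

(* Every homogeneous localization of [S[G T]] is covered by those at the [g T]:
   if [a] is of degree [d] and [a = sum of monomials], a monomial divided by [a]
   is a unit, and so is [g ^ d / a] for each [g] occurring in it. *)
Lemma Proj_modelP S G : is_subring S ->
  Proj_model (subring_gen ([set c%:P | c in S] `|` [set c *: 'X | c in G])) = Bl S G.
Proof.
move=> hS; set R := subring_gen _.
have hR b n : R (b *: 'X^n) <-> pw S G n b.
  rewrite /R rees_coef //; split=> [/(_ n)|h d]; first by rewrite coefZ coefXn eqxx mulr1.
  rewrite coefZ coefXn; case: eqP => [->|_]; rewrite ?mulr1 ?mulr0 //.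
  exact: pw_zero.
have hlP a d x : homog_localization R a d x <->
    exists b e, pw S G (d * e) b /\ x = b / a ^+ e.
  by split=> -[b [e [/hR h ->]]]; exists b, e.
have hl_sub a d : a != 0 -> pw S G d a -> is_subring (homog_localization R a d).
  move=> a0 ha.
  have lift e b n : pw S G (d * e) b -> exists2 b', pw S G (d * (e + n)) b' &
      b / a ^+ e = b' / a ^+ (e + n).
    move=> hb; exists (b * a ^+ n).
      by rewrite mulnDr; apply: pwM => //; rewrite mulnC; apply: pwX.
    by rewrite exprD invfM [_^-1 * _]mulrC mulrA mulfK ?expf_neq0.
  split.
  - apply/hlP; exists 1, 0%N; rewrite muln0 divr1; split=> //.
    by apply: pw_base; case: hS.
  - move=> x y /hlP[b [e [hb ->]]] /hlP[c [f [hc ->]]]; apply/hlP.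
    have [b' hb' ->] := lift _ _ f hb; have [c' hc' ->] := lift _ _ e hc.
    exists (b' - c'), (e + f)%N; rewrite [(f + e)%N]addnC in hc' *.
    by rewrite mulrBl; split=> //; apply: pw_sub.
  - move=> x y /hlP[b [e [hb ->]]] /hlP[c [f [hc ->]]]; apply/hlP.
    exists (b * c), (e + f)%N; rewrite mulf_div exprD mulnDr; split=> //.
    exact: pwM.
apply/seteqP; split=> O.
  move=> [a [d [d0 a0 /hR ha]]]; rewrite Spec_modelP; last exact: hl_sub.
  move=> hov; case: (hov) => hl hCO hf; case: (hl) => hO _; case: (hO) => _ _ oM.
  have [s [hs es]] := pw_monos hS ha.
  have inO x : pw S G d x -> O (x / a).
    by move=> hx; apply: hCO; apply/hlP; exists x, 1%N; rewrite muln1 expr1.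
  have [x xs ux] : exists2 x, x \in s & unitin O (x / a).
    have [||y] := @local_sum O [seq x / a | x <- s] hl.
    - by move=> y /mapP[x hx ->]; apply: inO; apply/mono_pw/hs.
    - by rewrite big_map -mulr_suml -es mulfV //; apply: unitin1.
    - by case/mapP=> x hx -> ?; exists x.
  have gO g : G g -> O (g ^+ d / a) by move=> hg; apply: inO; apply: pw_genX.
  have inO2 e y : mono S G e y -> O (y ^+ d / a ^+ e).
    elim=> [b hb|f b g _ IH hg].
      apply: hCO; apply/hlP; exists (b ^+ d), 0%N; rewrite muln0; split=> //.
      by apply: pw_base; apply: subringX.
    by rewrite exprMn exprSr -mulf_div; apply: oM => //; apply: gO.
  have [g hg ug] : exists2 g, G g & unitin O (g ^+ d / a).
    move: (unitinX d hO ux); rewrite expr_div_n.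
    have /mono_inv [y [g [hy hg ->]]] : mono S G d.-1.+1 x by rewrite prednK //; apply: hs.
    have -> : (y * g) ^+ d / a ^+ d = (g ^+ d / a) * (y ^+ d / a ^+ d.-1).
      by rewrite mulf_div -exprS prednK // exprMn [y ^+ d * _]mulrC.
    move=> hu; exists g => //.
    by apply: unitinMl hu; [|apply: gO|apply: inO2].
  have g0 : g != 0.
    apply: contraTneq isT => e; case: ug; rewrite e expr0n eqn0Ngt d0 mul0r.
    by rewrite eqxx.
  exists g; split=> //; have agu : unitin O (a / g ^+ d).
    by rewrite -invf_div; apply: unitinV.
  have dvd e y : pw S G (d * e) y -> y / a ^+ e = y / g ^+ (d * e) * (g ^+ d / a) ^+ e.
    by move=> _; rewrite expr_div_n -exprM mulrA divfK // expf_neq0.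
  apply: (over_shrink (chart_subring hS hg g0) hov).
    apply: chart_min => //; first by move=> z hz; apply: hCO; apply/hlP; exists z, 0%N;
      rewrite muln0 divr1; split=> //; apply: pw_base.
    move=> g' hg'; have -> : g' / g = g' * g ^+ d.-1 / a * (a / g ^+ d).
      rewrite mulrA divfK //; apply/eqP.
      by rewrite eqr_div ?expf_neq0 // -mulrA -exprSr prednK.
    apply: oM; last by case: agu.
    apply: inO; rewrite -(prednK d0) mulrC; apply: pw_mulg => //.
    by rewrite -pred_Sn; apply: pw_genX.
  move=> z /hlP[b [e [hb ->]]]; exists (b / g ^+ (d * e)), ((a / g ^+ d) ^+ e).
  split; [exact: chart_pw| |exact: unitinX|].
    apply: subringX; first exact: chart_subring.
    exact: chart_pw.
  have -> : (a / g ^+ d) ^+ e = ((g ^+ d / a) ^+ e)^-1.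
    by rewrite -[((g ^+ d / a) ^+ e)^-1]exprVn invf_div.
  by rewrite invrK dvd.
move=> [g [hg g0 hov]]; exists g, 1%N; split=> //.
  by apply/hR; apply: pw_gen.
rewrite Spec_modelP; last by apply: hl_sub => //; apply: pw_gen.
suff -> : homog_localization R g 1 = chart S G g by [].
by apply/seteqP; split=> z; [move/hlP=> [b [e [hb ->]]]; exists e, b|
  move=> [e [b [hb ->]]]; apply/hlP; exists b, e]; rewrite ?mul1n in hb *.
Qed.

Lemma exc_divisorP P Q : is_subring P ->
  exc_divisor P Q <-> Bl P (max_ideal P) Q /\ dominates Q P.
Proof. by move=> hP; rewrite /exc_divisor /= /rees Proj_modelP. Qed.

(** When C is contained in the local ring O, this is the localization of C at the contraction of the
    maximal ideal of O; [over C O] then says that it is all of O. *)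
Definition fracs C O : set K :=
  [set x | exists a b, [/\ C a, C b, unitin O b & x = a / b]].

Lemma fracs_sub C O : is_subring C -> is_subring O -> C `<=` fracs C O.
Proof.
by move=> [c1 _ _] hO x hx; exists x, 1; rewrite divr1; split=> //; apply: unitin1.
Qed.

Lemma fracs_subring C O : is_subring C -> is_subring O -> is_subring (fracs C O).
Proof.
move=> hC hO; case: (hC) => c1 cB cM; split; first exact: fracs_sub.
  move=> _ _ [a [b [ha hb ub ->]]] [c [d [hc hd ud ->]]].
  exists (a * d - c * b), (b * d).
  split; [by apply: cB; apply: (cM)|exact: cM|exact: unitinM|].
  by case: ub ud => _ b0 _ [_ d0 _]; rewrite -mulNr addf_div // mulNr.
move=> _ _ [a [b [ha hb ub ->]]] [c [d [hc hd ud ->]]].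
exists (a * c), (b * d).
by split; [exact: cM|exact: cM|exact: unitinM|rewrite mulf_div].
Qed.

Lemma fracsV C O x : is_subring O -> fracs C O x -> unitin O x -> fracs C O x^-1.
Proof.
move=> hO [a [b [ha hb ub ->]]] hu; exists b, a; rewrite invf_div; split=> //.
have -> : a = (a / b) * b by rewrite divfK //; case: ub.
exact: unitinM.
Qed.

(** Dividing by z an expression of z through the u / h writes 1 as a sum in the local ring Q, so one
    term is a unit there. Applied to a local equation z of the exceptional divisor at Q, it
    exchanges z for some t / h with t in J. *)
Lemma pw_unit_div P Q J h z : is_subring P -> local Q -> P `<=` Q -> z != 0 ->
  pw P [set u / h | u in J] 1 z -> (forall u, J u -> Q (u / (h * z))) ->
  exists2 t, J t & unitin Q (t / (h * z)).
Proof.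
move=> hPr hl hPQ z0 hpw hQ; case: (hl) => hQr _.
have [s [hs ez]] := pw_monos hPr hpw.
have hs' x : x \in s -> exists c u, [/\ P c, J u & x = c * (u / h)].
  move=> /hs/mono_inv[c [_ [hc [u hu <-] ->]]]; exists c, u; split=> //.
  by apply: pw0P (mono_pw hc).
have [||x hx] := @local_sum Q [seq x / z | x <- s] hl.
- move=> _ /mapP[x /hs'[c [u [hc hu ->]]] ->]; rewrite -!mulrA -invfM.
  by case: hQr => _ _; apply; [apply: hPQ|apply: hQ].
- by rewrite big_map -mulr_suml -ez divff //; apply: unitin1.
case/mapP: hx => y /hs'[c [u [hc hu ->]]] ->; rewrite -!mulrA -invfM => hun.
exists u => //; rewrite mulrC in hun; apply: (unitinMl hQr _ _ hun); last exact: hPQ.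
exact: hQ.
Qed.

Lemma chart_mulset S G J g t : is_subring S -> g != 0 -> t != 0 -> G g -> J t ->
  chart S G g `<=` chart S (mulset G J) (g * t).
Proof.
move=> hS g0 t0 hg ht; have gt0 : g * t != 0 by rewrite mulf_neq0.
have hgt : mulset G J (g * t) by exists g, t.
apply: chart_min => //; first exact: chart_subring.
  by move=> s hs; apply: chart_sub.
move=> g' hg'; have -> : g' / g = (g' * t) / (g * t) by rewrite -mulf_div divff ?mulr1.
by apply: chart_gen => //; exists g', t.
Qed.

Lemma pw_div_fracs S G J P Q h t w : is_subring S -> is_subring P -> is_subring Q ->
  h != 0 -> t != 0 -> G h -> J t ->
  P `<=` fracs (chart S (mulset G J) (h * t)) Q ->
  pw P [set u / h | u in J] 1 w -> fracs (chart S (mulset G J) (h * t)) Q (w / (t / h)).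
Proof.
move=> hS hPr hQ h0 t0 hh ht hPL hw; have [s [hs ->]] := pw_monos hPr hw.
have hht : mulset G J (h * t) by exists h, t.
have ht0 : h * t != 0 by rewrite mulf_neq0.
have hC := chart_subring hS hht ht0; have hL := fracs_subring hC hQ.
rewrite mulr_suml big_seq; apply: subring_sum => // x /hs/mono_inv[c [_ [hc [u hu <-] ->]]].
have -> : c * (u / h) / (t / h) = c * ((h * u) / (h * t)).
  by rewrite invf_div -mulrA mulf_div [u * h]mulrC.
case: (hL) => _ _; apply; first by apply/hPL/(pw0P hPr (mono_pw hc)).
by apply: fracs_sub => //; apply: chart_gen => //; exists h, u.
Qed.

Section BlowupBl.
Variables (S G J P : set K) (h : K).
Hypotheses (hS : is_subring S) (hh : G h) (h0 : h != 0).
Hypothesis hP : over (chart S G h) P.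
Hypothesis hJ : forall t, J t -> pw S G 1 t.
Hypothesis hJm : forall t, J t -> max_ideal P (t / h).
Hypothesis hgen : forall z, max_ideal P z -> pw P [set t / h | t in J] 1 z.
Hypothesis hsep : forall Q g, G g -> g != 0 -> over (chart S G g) Q ->
  (forall t, J t -> ~ unitin Q (t / g)) -> Q = P.

Let chJ Q g t : over (chart S G g) Q -> J t -> Q (t / g).
Proof.
by move=> [_ hC _] ht; apply: hC; rewrite -[g]expr1; apply/chart_pw/hJ.
Qed.

Let chG Q g g' : over (chart S G g) Q -> G g' -> Q (g' / g).
Proof.
move=> [_ hC _] hg'; apply: hC; rewrite -[X in _ / X]expr1; apply/chart_pw.
exact: pw_gen.
Qed.

Let chS Q g s : over (chart S G g) Q -> S s -> Q s.
Proof. by move=> [_ hC _] hs; apply: hC; apply: chart_sub. Qed.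

(** The J / h generate the maximal ideal of P ([hgen]), and P is the only point of [Bl S G] at which
    all the t / g vanish ([hsep]). So multiplying by J changes nothing away from P, where a chart g
    is also the chart g t with t / g a unit, and over P the charts h t are those of the blow-up of
    the maximal ideal. *)
Lemma blowup_Bl : blowup (Bl S G) P = Bl S (mulset G J).
Proof.
case: (hP) => hPl hCP hfP; case: (hPl) => hPr _; case: (hPr) => p1 pB pM.
apply/seteqP; split=> Q.
  case=> [[[g [hg g0 hov]] nQP]|].
    have [t ht ut] : exists2 t, J t & unitin Q (t / g).
      apply: contrapT => hn; apply: nQP; apply: (hsep hg g0 hov) => t ht ut.
      by apply: hn; exists t.
    have t0 : t != 0 by case: ut => _ + _; rewrite mulf_eq0 => /norP[].
    exists (g * t); split; [by exists g, t|exact: mulf_neq0|].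
    apply: (over_enlarge hov); first exact: chart_mulset.
    case: (hov) => -[hQ _] _ _; apply: chart_min => //; first by move=> s; apply: chS hov.
    move=> _ [g1 [t1 [hg1 ht1 ->]]].
    have -> : g1 * t1 / (g * t) = (g1 / g) * ((t1 / g) * (t / g)^-1).
      exact: divM_div.
    case: (hQ) => _ _ qM; apply: (qM); first exact: chG hov _.
    by apply: (qM); [exact: chJ hov _|case: ut].
  move=> /(exc_divisorP _ hPr)[[z [hz z0 hov]] [hPQ hmm]].
  case: (hov) => hQl hCQ hfQ; case: (hQl) => hQr _; case: (hQr) => _ _ qM.
  have hzP : P z by case/max_idealP: hz.
  have hmz w : max_ideal P w -> Q (w / z).
    move=> hw; apply: hCQ; rewrite -[X in _ / X]expr1; apply/chart_pw.
    exact: pw_gen.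
  have hJz u : J u -> Q (u / (h * z)) by move=> hu; rewrite invfM mulrA; apply/hmz/hJm.
  have [t ht ut] := pw_unit_div hPr hQl hPQ z0 (hgen hz) hJz.
  have t0 : t != 0 by case: ut => _ + _; rewrite mulf_eq0 => /norP[].
  have ht0 : h * t != 0 by rewrite mulf_neq0.
  have hht : mulset G J (h * t) by exists h, t.
  exists (h * t); split=> //.
  have hC'Q : chart S (mulset G J) (h * t) `<=` Q.
    apply: chart_min => //; first by move=> s hs; apply/hPQ/(chS hP).
    move=> _ [g1 [t1 [hg1 ht1 ->]]].
    have -> : g1 * t1 / (h * t) = (g1 / h) * ((t1 / (h * z)) * (t / (h * z))^-1).
      by apply: divM_div; rewrite mulf_neq0.
    apply: (qM); first by apply: hPQ; exact: chG hP _.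
    by apply: (qM); [exact: hJz|case: ut].
  have hC := chart_subring hS hht ht0.
  (* L is shown to contain P and the quotients of its maximal ideal by z; this makes Q a
     localization of the chart at h t. *)
  pose L := fracs (chart S (mulset G J) (h * t)) Q.
  have hLC : chart S (mulset G J) (h * t) `<=` L by apply: fracs_sub.
  have hLr : is_subring L by apply: fracs_subring.
  have hLV x : L x -> unitin Q x -> L x^-1 by apply: fracsV.
  case: (hLr) => _ lB lM.
  have hPL : P `<=` L.
    move=> x /hfP[a [b [ha hb ub ->]]]; apply: (lM).
      by apply/hLC/chart_mulset.
    apply: hLV; first by apply/hLC/chart_mulset.
    exact: unitin_sub ub.
  have hmt w : max_ideal P w -> L (w / (t / h)).
    by move=> /hgen; apply: pw_div_fracs.
  have utz : unitin Q (z / (t / h)).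
    by have := unitinV ut; rewrite !invf_div [h * z]mulrC mulrA.
  apply: (over_shrink (chart_subring hS hht ht0) hov hC'Q).
  apply: chart_min => // w hw.
  have -> : w / z = (w / (t / h)) * (z / (t / h))^-1.
    by rewrite [(z / _)^-1]invf_div mulrA divfK // mulf_neq0 ?invr_eq0.
  by apply: (lM); [exact: hmt|apply: hLV; [exact: hmt|exact: utz]].
move=> [_ [[g [t [hg ht ->]]] gt0 hov]].
move: (gt0); rewrite mulf_eq0 => /norP[g0 t0].
case: (hov) => hQl hCQ hfQ; case: (hQl) => hQr _; case: (hQr) => q1 qB qM.
have hCg : chart S G g `<=` Q by move=> x hx; apply/hCQ/chart_mulset.
have hCr := chart_subring hS hg g0.
have hGJ g' t' : G g' -> J t' -> Q (g' * t' / (g * t)).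
  move=> hg' ht'; apply: hCQ; rewrite -[X in _ / X]expr1; apply/chart_pw/pw_gen => //.
  by exists g', t'.
pose O := fracs (chart S G g) Q.
have hOC : chart S G g `<=` O by apply: fracs_sub.
have hOQ : O `<=` Q.
  by move=> _ [a [b [ha hb [_ _ hb'] ->]]]; apply: (qM) => //; apply: hCg.
have hOV x : O x -> unitin Q x -> unitin O x.
  by move=> hx hu; split=> //; [case: hu|apply: fracsV].
have hOr : is_subring O by apply: fracs_subring.
have hOv : over (chart S G g) O.
  split=> //.
    split=> // a b ha hb e.
    by case: (hQl) => _ /(_ a b (hOQ a ha) (hOQ b hb) e)[]/hOV; [left|right]; auto.
  by move=> x [a [b [ha hb ub ->]]]; exists a, b; split=> //; apply: hOV => //; apply: hOC.
have hOm : max_ideal O `<=` max_ideal Q.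
  move=> x /max_idealP[hx nx]; apply/max_idealP; split; first exact: hOQ.
  by move=> hu; apply: nx; apply: hOV.
have hOt : O (t / g) by exact: chJ hOv _.
have [eOP|nOP] := pselect (O = P); last first.
  have [t' ht' ut'] : exists2 t', J t' & unitin O (t' / g).
    apply: contrapT => hn; apply: nOP; apply: (hsep hg g0 hOv) => t' ht' ut'.
    by apply: hn; exists t'.
  have utg : unitin O (t / g).
    apply: hOV => //; have e : (t / g) * (g * t' / (g * t)) = t' / g.
      by rewrite -[g * t' / _]mulf_div divff // mul1r mulrC mulrA divfK.
    apply: (@unitinMl Q _ (g * t' / (g * t)) hQr (hOQ _ hOt)); first exact: hGJ.
    by rewrite e; apply: unitin_sub hOQ ut'.
  left; suff <- : O = Q by split=> //; exists g; split.
  apply/seteqP; split=> // x /hfQ[a [b [ha hb ub ->]]].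
  have hC'O : chart S (mulset G J) (g * t) `<=` O.
    apply: chart_min => //; first by move=> s hs; apply/hOC/chart_sub.
    move=> _ [g1 [t1 [hg1 ht1 ->]]]; case: (hOr) => _ _ oM.
    have -> : g1 * t1 / (g * t) = (g1 / g) * ((t1 / g) * (t / g)^-1).
      exact: divM_div.
    apply: (oM); first exact: chG hOv _.
    by apply: (oM); [exact: chJ hOv _|case: utg].
  case: (hOr) => _ _; apply; first exact: hC'O.
  by case: (hOV b (hC'O _ hb) ub).
right; apply/(exc_divisorP _ hPr); rewrite -eOP in hPr *.
split; last by split.
have hm : max_ideal O (t / g).
  rewrite eOP; have -> : t / g = (h / g) * (t / h) by rewrite [RHS]mulrC mulrA divfK.
  by apply: max_idealM; [rewrite -eOP|rewrite -eOP; exact: chG hOv _|exact: hJm].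
have tg0 : t / g != 0 by rewrite mulf_neq0 ?invr_eq0.
exists (t / g); split=> //; apply: (over_enlarge hov).
  apply: chart_min; first exact: chart_subring.
    by move=> s hs; apply: chart_sub; apply/hOC/chart_sub.
  have [_ _ kM] := chart_subring hPr hm tg0.
  move=> _ [g1 [t1 [hg1 ht1 ->]]].
  have -> : g1 * t1 / (g * t) = (g1 / g) * ((t1 / g) / (t / g)).
    exact: divM_div.
  apply: (kM); first by apply/chart_sub/(chG hOv).
  apply: chart_gen => //; rewrite eOP.
  have -> : t1 / g = (h / g) * (t1 / h) by rewrite [RHS]mulrC mulrA divfK.
  by apply: max_idealM; [rewrite -eOP|rewrite -eOP; exact: chG hOv _|exact: hJm].
apply: chart_min => // w; rewrite {1}eOP => /hgen hw; rewrite -eOP in hw.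
have [s [hs ->]] := pw_monos hPr hw.
rewrite mulr_suml big_seq; apply: subring_sum => // x /hs/mono_inv[c [_ [hc [u hu <-] ->]]].
have -> : c * (u / h) / (t / g) = c * ((g / h) * (g * u / (g * t))).
  by rewrite invf_div -[g * u / _]mulf_div divff // mul1r -!mulrA; congr (_ * _); ring.
apply: (qM); first by apply/hOQ/(pw0P hPr (mono_pw hc)).
by apply: (qM); [apply: hOQ; rewrite eOP; exact: chG hP _|exact: hGJ].
Qed.

End BlowupBl.

End Models.
(** * Fractions of polynomials and substitutions *)

Section FracMap.
Variables (R : idomainType) (E : fieldType).
Local Notation "x %:F" := (@FracField.tofrac R x).

Lemma frac_repr (x : {fraction R}) : x = (\n_(generic_quotient.repr x))%:F / (\d_(generic_quotient.repr x))%:F.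
Proof.
rewrite -[x in LHS]reprK; move: (generic_quotient.repr x) => r.
have d0 : \d_r != 0 by apply: denom_ratioP.
apply: (mulIf (_ : (\d_r)%:F != 0)); first by rewrite tofrac_eq0.
rewrite mulfVK ?tofrac_eq0 //.
rewrite /GRing.mul /=; unlock FracField.tofrac.
rewrite -[LHS](FracField.pi_mul r) /FracField.mulf.
apply/eqmodP => /=; rewrite FracField.equivfE.
by rewrite !numden_Ratio ?oner_eq0 ?mulr1 // ?mulf_neq0 ?oner_eq0 // mulrC.
Qed.

Lemma fracE (x : {fraction R}) : exists a b, b != 0 /\ x = a%:F / b%:F.
Proof.
by exists \n_(generic_quotient.repr x), \d_(generic_quotient.repr x); split; [apply: denom_ratioP|apply: frac_repr].
Qed.

Lemma frac_eq (a b c d : R) : b != 0 -> d != 0 ->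
  (a%:F / b%:F = c%:F / d%:F) <-> a * d = c * b.
Proof.
move=> b0 d0; split=> [/eqP|e].
  by rewrite eqr_div ?tofrac_eq0 // -!tofracM tofrac_eq => /eqP.
by apply/eqP; rewrite eqr_div ?tofrac_eq0 // -!tofracM e.
Qed.

Variables (h : {rmorphism R -> E}) (h_inj : injective h).

(** The proof of injectivity is an argument so that the morphism instances, which rest on it, can be
    attached to the function. *)
Definition fracmap of injective h := fun x : {fraction R} =>
  h \n_(generic_quotient.repr x) / h \d_(generic_quotient.repr x).

Let h0 x : (h x == 0) = (x == 0).
Proof. by rewrite -{1}(rmorph0 h) (inj_eq h_inj). Qed.

Lemma fracmap_div a b : b != 0 -> fracmap h_inj (a%:F / b%:F) = h a / h b.
Proof.
move=> b0; pose x : {fraction R} := a%:F / b%:F; rewrite -/x /fracmap.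
have d0 : \d_(generic_quotient.repr x) != 0 by apply: denom_ratioP.
have e := frac_repr x.
move: e; rewrite {1}/x => /frac_eq => /(_ b0 d0) e.
by apply/eqP; rewrite eqr_div ?h0 // -!rmorphM e.
Qed.

Lemma fracmap_tofrac a : fracmap h_inj a%:F = h a.
Proof. by rewrite -[a%:F]divr1 -tofrac1 fracmap_div ?oner_eq0 // rmorph1 divr1. Qed.

Lemma fracmap_zmod : zmod_morphism (fracmap h_inj).
Proof.
move=> x y; have [a [b [b0 ->]]] := fracE x; have [c [d [d0 ->]]] := fracE y.
rewrite -mulNr addf_div ?tofrac_eq0 // -tofracN -!tofracM -tofracD.
rewrite !fracmap_div ?mulf_neq0 // rmorphD !rmorphM rmorphN -addf_div ?h0 //.
by rewrite mulNr.
Qed.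

Lemma fracmap_monoid : monoid_morphism (fracmap h_inj).
Proof.
split=> [|x y]; first by rewrite -tofrac1 fracmap_tofrac rmorph1.
have [a [b [b0 ->]]] := fracE x; have [c [d [d0 ->]]] := fracE y.
rewrite mulf_div -!tofracM !fracmap_div ?mulf_neq0 // !rmorphM.
by rewrite mulf_div.
Qed.

HB.instance Definition _ := GRing.isZmodMorphism.Build _ _ (fracmap h_inj) fracmap_zmod.
HB.instance Definition _ := GRing.isMonoidMorphism.Build _ _ (fracmap h_inj) fracmap_monoid.

End FracMap.

Section Subst.
Variable N : nat.

Lemma mpoly_rmorph_ext (B A : comNzRingType) (f g : {rmorphism {mpoly B[N]} -> A}) :
  (forall c, f c%:MP = g c%:MP) -> (forall i, f 'X_i = g 'X_i) -> f =1 g.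
Proof.
move=> hc hX p; elim/mpolyind: p => [|c m p _ _ IH]; first by rewrite !rmorph0.
rewrite !rmorphD IH -mul_mpolyC !rmorphM hc; congr (_ * _ + _).
rewrite mpolyXE_id !rmorph_prod; apply: eq_bigr => i _.
by rewrite !rmorphXn hX.
Qed.

Definition step (B : Type) := ('I_N * ('I_N -> B))%type.

Variable B : idomainType.
Local Notation poly := {mpoly B[N]}.
Local Notation K := {fraction poly}.
Local Notation "x %:F" := (@FracField.tofrac poly x).
Implicit Types (s : step B) (w : seq (step B)).

(* The chart [x_j -> x_j, x_l -> x_j (x_l + a_l)] of the blow-up of the origin,
   centred at the point [x_l / x_j = a_l] of the exceptional divisor. *)
Definition stepX s (l : 'I_N) : poly :=
  if l == s.1 then 'X_l else 'X_(s.1) * ('X_l + (s.2 l)%:MP).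

Definition sub1 s : poly -> poly := mmap (@mpolyC N B) (stepX s).
HB.instance Definition _ s := GRing.RMorphism.on (sub1 s).

Lemma sub1C s c : sub1 s c%:MP = c%:MP.
Proof. exact: mmapC. Qed.

Lemma sub1X s i : sub1 s 'X_i = stepX s i.
Proof. by rewrite /sub1 mmapX mmap1U. Qed.

(** The first step of w is substituted first, so that a point of the next exceptional divisor is
    named by adding a step at the end of the word of the centre. *)
Definition subw w (f : poly) : poly := foldl (fun f s => sub1 s f) f w.

Lemma subw_zmod w : zmod_morphism (subw w).
Proof. by elim: w => [|s w IH] x y //=; rewrite /subw /= rmorphB; apply: IH. Qed.

Lemma subw_monoid w : monoid_morphism (subw w).
Proof.
split; first by elim: w => [|s w IH] //=; rewrite /subw /= rmorph1; apply: IH.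
by elim: w => [|s w IH] x y //=; rewrite /subw /= rmorphM; apply: IH.
Qed.

HB.instance Definition _ w := GRing.isZmodMorphism.Build _ _ (subw w) (subw_zmod w).
HB.instance Definition _ w := GRing.isMonoidMorphism.Build _ _ (subw w) (subw_monoid w).

Lemma subwC w c : subw w c%:MP = c%:MP.
Proof. by elim: w => //= s w IH; rewrite /subw /= sub1C; apply: IH. Qed.

Lemma subw_cons s w f : subw (s :: w) f = subw w (sub1 s f).
Proof. by []. Qed.

Lemma subw_rcons w s f : subw (rcons w s) f = sub1 s (subw w f).
Proof. by rewrite /subw -cats1 foldl_cat. Qed.

(** The inverse of the chart; it divides by the exceptional coordinate and so has values in the
    function field. *)
Definition unstepX s (l : 'I_N) : K :=
  if l == s.1 then ('X_l)%:F else ('X_l)%:F / ('X_(s.1))%:F - ((s.2 l)%:MP)%:F.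

Let constK : B -> K := @FracField.tofrac poly \o @mpolyC N B.
Definition unsub1 s : poly -> K := mmap constK (unstepX s).
HB.instance Definition _ s := GRing.RMorphism.on (unsub1 s).

Lemma mpolyX_neq0 i : 'X_i != 0 :> poly.
Proof.
apply/eqP => /(congr1 (mcoeff U_(i))); rewrite mcoeffX eqxx mcoeff0 => /eqP.
by rewrite oner_eq0.
Qed.

Lemma XF_neq0 i : ('X_i)%:F != 0 :> K.
Proof. by rewrite tofrac_eq0 mpolyX_neq0. Qed.

Lemma unsub1X s i : unsub1 s 'X_i = unstepX s i.
Proof. by rewrite /unsub1 mmapX mmap1U. Qed.

Lemma unsub1_sub1 s f : unsub1 s (sub1 s f) = f%:F.
Proof.
apply: (@mpoly_rmorph_ext B K (unsub1 s \o sub1 s) (@FracField.tofrac poly)) => [c|i] /=.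
  by rewrite sub1C /unsub1 mmapC.
rewrite sub1X /stepX; case: eqP => [->|/eqP ne].
  by rewrite unsub1X /unstepX eqxx.
rewrite rmorphM rmorphD /= !unsub1X /unstepX eqxx (negPf ne) /unsub1 mmapC.
by rewrite subrK mulrC divfK ?XF_neq0.
Qed.

Lemma sub1_inj s : injective (sub1 s).
Proof.
move=> f g e; apply/eqP; rewrite -(tofrac_eq f) -!(unsub1_sub1 s) e; exact/eqP.
Qed.

Lemma subw_inj w : injective (subw w).
Proof. by elim: w => [|s w IH] f g //= /IH /sub1_inj. Qed.

Lemma subwF_inj w : injective (@FracField.tofrac poly \o subw w).
Proof. by move=> f g /= /eqP; rewrite tofrac_eq => /eqP /subw_inj. Qed.

Definition theta w : K -> K := fracmap (@subwF_inj w).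
HB.instance Definition _ w := GRing.RMorphism.on (theta w).

Lemma thetaF w f : theta w f%:F = (subw w f)%:F.
Proof. exact: fracmap_tofrac. Qed.

Lemma frac_rmorph_ext (f g : {rmorphism K -> K}) :
  (forall p, f p%:F = g p%:F) -> f =1 g.
Proof.
move=> h x; have [a [b [_ ->]]] := fracE x.
by rewrite !rmorphM !fmorphV !h.
Qed.

Lemma theta_rcons w s x : theta (rcons w s) x = theta [:: s] (theta w x).
Proof.
apply: (@frac_rmorph_ext (theta (rcons w s)) (theta [:: s] \o theta w)) => p /=.
by rewrite !thetaF subw_rcons.
Qed.

Lemma theta_nil x : theta [::] x = x.
Proof. by apply: (@frac_rmorph_ext (theta [::]) idfun) => p /=; rewrite thetaF. Qed.

Lemma theta_inj w : injective (theta w).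
Proof. exact: fmorph_inj. Qed.

Lemma theta_unsub s l : theta [:: s] (unstepX s l) = ('X_l)%:F.
Proof.
rewrite /unstepX; case: eqP => [->|/eqP ne].
  by rewrite thetaF subw_cons sub1X /stepX eqxx.
rewrite rmorphB fmorph_div /= !thetaF !subw_cons !sub1X sub1C /stepX eqxx (negPf ne).
by rewrite tofracM mulrC mulKf ?XF_neq0 // tofracD addrK.
Qed.

Lemma theta_surj w x : exists y, theta w y = x.
Proof.
elim/last_ind: w x => [|w s IH] x; first by exists x; rewrite theta_nil.
suff [y hy] : exists y, theta [:: s] y = x.
  by have [z hz] := IH y; exists z; rewrite theta_rcons hz.
have hp p : exists y, theta [:: s] y = p%:F.
  exists (unsub1 s p).
  apply: (@mpoly_rmorph_ext B K (theta [:: s] \o unsub1 s) (@FracField.tofrac poly)).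
    by move=> c /=; rewrite /unsub1 mmapC /constK /= thetaF subwC.
  by move=> i /=; rewrite unsub1X theta_unsub.
have [a [b [_ ->]]] := fracE x; have [ya ea] := hp a; have [yb eb] := hp b.
by exists (ya / yb); rewrite fmorph_div /= ea eb.
Qed.

End Subst.
(** * The local ring of the origin *)

Section Order.
Variable N : nat.

Section Mord.
Variable B : comNzRingType.
Local Notation poly := {mpoly B[N]}.
Implicit Types (f g : poly).

Definition mord (d : nat) f := forall m, (mdeg m < d)%N -> f@_m = 0.

Lemma mordP d f : mord d f <-> (forall m, m \in msupp f -> (d <= mdeg m)%N).
Proof.
split=> h m; first by rewrite mcoeff_msupp leqNgt; apply: contraNN => /h ->.
by rewrite ltnNge; apply: contraNeq; rewrite -mcoeff_msupp => /h.
Qed.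

Lemma mord0 f : mord 0 f. Proof. by []. Qed.
Lemma mord_zero d : mord d (0 : poly). Proof. by move=> m _; rewrite mcoeff0. Qed.

Lemma mord_le d e f : (d <= e)%N -> mord e f -> mord d f.
Proof. by move=> hde h m hm; apply/h/(leq_trans hm). Qed.

Lemma mordD d f g : mord d f -> mord d g -> mord d (f + g).
Proof. by move=> hf hg m hm; rewrite mcoeffD hf ?hg ?addr0. Qed.

Lemma mordN d f : mord d f -> mord d (- f).
Proof. by move=> hf m hm; rewrite mcoeffN hf ?oppr0. Qed.

Lemma mordB d f g : mord d f -> mord d g -> mord d (f - g).
Proof. by move=> hf hg; apply/mordD/mordN. Qed.

Lemma mord_sum d (I : Type) (r : seq I) (Q : pred I) (F : I -> poly) :
  (forall i, Q i -> mord d (F i)) -> mord d (\sum_(i <- r | Q i) F i).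
Proof.
move=> h; elim/big_ind: _ => //; first exact: mord_zero.
by move=> *; apply: mordD.
Qed.

Lemma mordM d e f g : mord d f -> mord e g -> mord (d + e) (f * g).
Proof.
move=> /mordP hf /mordP hg; apply/mordP => m /msuppM_le /allpairsP[[m1 m2] /= [h1 h2 ->]].
by rewrite mdegD leq_add ?hf ?hg.
Qed.

Lemma mordMl d f g : mord d g -> mord d (f * g).
Proof. exact: (@mordM 0). Qed.

Lemma mordMr d f g : mord d f -> mord d (f * g).
Proof. by rewrite mulrC; apply: mordMl. Qed.

Lemma mord1P f : mord 1 f <-> f@_0 = 0.
Proof.
split=> [|h m]; first by apply; rewrite mdeg0.
by rewrite ltnS leqn0 mdeg_eq0 => /eqP->.
Qed.

Lemma mordXn d f n : mord d f -> mord (n * d) (f ^+ n).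
Proof.
move=> h; elim: n => [|n IH]; first exact: mord0.
by rewrite exprS mulSn; apply: mordM.
Qed.

Lemma mord_X i : mord 1 ('X_i : poly).
Proof. by apply/mord1P; rewrite mcoeffX; case: eqP => // /(congr1 mdeg); rewrite mdeg1 mdeg0. Qed.

Lemma mord_Xm m : mord (mdeg m) ('X_[m] : poly).
Proof. by move=> m' h; rewrite mcoeffX; case: eqP => // e; rewrite e ltnn in h. Qed.

Lemma mcoeff0_C (c : B) : (c%:MP_[N])@_0 = c.
Proof. by rewrite mcoeffC eqxx mulr1. Qed.

Lemma mord_subC f : mord 1 (f - (f@_0)%:MP).
Proof. by apply/mord1P; rewrite mcoeffB mcoeff0_C subrr. Qed.

Lemma mcoeffM_mord d f g m : mord d f -> mdeg m = d -> (g * f)@_m = g@_0 * f@_m.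
Proof.
move=> hf hm; rewrite -{1}[g](subrK (g@_0)%:MP) mulrDl mcoeffD.
rewrite (mordM (mord_subC g) hf) ?hm ?add1n // add0r.
by rewrite mul_mpolyC mcoeffZ.
Qed.

Lemma mord_decomp d f : mord d.+1 f ->
  exists F : 'I_N -> poly, f = \sum_l 'X_l * F l /\ forall l, mord d (F l).
Proof.
move=> /mordP hf.
suff : exists F : 'I_N -> poly,
    \sum_(m <- msupp f) f@_m *: 'X_[m] = \sum_l 'X_l * F l /\ forall l, mord d (F l).
  by rewrite -mpolyE.
rewrite big_seq; elim/big_ind: _ => [|f1 f2 [F1 [-> h1]] [F2 [-> h2]]|m hm].
- exists (fun _ => 0); split=> [|l]; last exact: mord_zero.
  by rewrite big1 // => l _; rewrite mulr0.
- exists (fun l => F1 l + F2 l); split=> [|l]; last exact: mordD.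
  by rewrite -big_split; apply: eq_bigr => l _; rewrite mulrDr.
have hdm := hf m hm; have : mdeg m != 0%N by case: (mdeg m) hdm.
rewrite mdeg_eq0 => mn0; have [l hl] : exists l, m l != 0%N.
  apply/existsP; apply: contraNT mn0; rewrite negb_exists => /forallP h.
  by apply/eqP/mnmP => i; rewrite mnm0E; apply/eqP; rewrite -[_ == _]negbK h.
have em : m = (U_(l) + (m - U_(l)))%MM.
  by rewrite addmC submK //; apply/mnm_lepP => i; rewrite mnm1E; case: eqP => //= <-; rewrite lt0n.
exists (fun i => if i == l then f@_m *: 'X_[m - U_(l)] else 0); split=> [|i].
  rewrite (bigD1 l) //= eqxx big1 ?addr0 => [|i /negPf->]; last by rewrite mulr0.
  by rewrite -scalerAr -mpolyXD -em.
case: eqP => _; last exact: mord_zero.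
rewrite -mul_mpolyC; apply: mordMl; apply: (mord_le _ (@mord_Xm _)).
by move: hdm; rewrite {1}em mdegD mdeg1 add1n ltnS.
Qed.

Lemma mord_sub (h : 'I_N -> poly) d f :
  (forall i, mord 1 (h i)) -> mord d f -> mord d (mmap (@mpolyC N B) h f).
Proof.
move=> hh /mordP hf; rewrite /mmap big_seq; apply: mord_sum => m hm.
apply: mordMl; apply: (@mord_le _ (mdeg m)); first exact: hf.
rewrite mdegE /mmap1; elim/big_ind2: _ => // [x1 x2 y1 y2 h1 h2|i _].
  exact: mordM.
by rewrite -{1}[m i]muln1; apply/mordXn.
Qed.

End Mord.

Lemma mord_map (B B' : comNzRingType) (r : {rmorphism B -> B'}) d (f : {mpoly B[N]}) :
  mord d f -> mord d (map_mpoly r f).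
Proof. by move=> h m hm; rewrite mcoeff_map_mpoly (h m hm) raddf0. Qed.

Lemma mord_mul (B : idomainType) d (f g : {mpoly B[N]}) :
  g@_0 != 0 -> mord d (g * f) -> mord d f.
Proof.
move=> g0; elim: d => [|d IH] h; first exact: mord0.
have hf : mord d f by apply: IH; apply: mord_le h.
move=> m; rewrite ltnS leq_eqVlt => /orP[/eqP hm|]; last exact: hf.
have := mcoeffM_mord g hf hm; rewrite h ?hm // => /esym/eqP.
by rewrite mulf_eq0 (negPf g0) => /eqP.
Qed.

End Order.

Section Origin.
Variables (N : nat) (B : idomainType).
Local Notation poly := {mpoly B[N]}.
Local Notation K := {fraction poly}.
Local Notation "x %:F" := (@FracField.tofrac poly x).
Implicit Types (s : step N B) (w : seq (step N B)) (x y : K) (a b f : poly).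

Lemma stepX_mord s i : mord 1 (stepX s i).
Proof.
by rewrite /stepX; case: eqP => _; [apply: mord_X|apply/mordMr/mord_X].
Qed.

Lemma sub1_mord s d f : mord d f -> mord d (sub1 s f).
Proof. by apply: mord_sub => i; apply: stepX_mord. Qed.

Lemma subw_mord w d f : mord d f -> mord d (subw w f).
Proof. by elim: w f => //= s w IH f /(sub1_mord s)/IH. Qed.

Lemma subw_coef0 w f : (subw w f)@_0 = f@_0.
Proof.
have /mord1P := subw_mord w (mord_subC f).
by rewrite rmorphB /= subwC mcoeffB mcoeff0_C => /eqP; rewrite subr_eq0 => /eqP.
Qed.

Lemma poly_unit0 b : b@_0 \is a GRing.unit -> b != 0.
Proof. by apply: contraTneq => ->; rewrite mcoeff0 unitr0. Qed.

Definition constK (c : B) : K := (c%:MP)%:F.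
HB.instance Definition _ := GRing.RMorphism.copy constK
  (@FracField.tofrac poly \o @mpolyC N B).

(* The local ring of the origin, for [B] a field. *)
Definition Loc : set K := [set x | exists a b, b@_0 \is a GRing.unit /\ x = a%:F / b%:F].

(** The kernel of evaluation at the origin, which has values in B; it is the maximal ideal of [Loc]
    when B is a field. *)
Definition LocM : set K :=
  [set x | exists a b, [/\ b@_0 \is a GRing.unit, a@_0 = 0 & x = a%:F / b%:F]].

(* The elements of order at least [d] of the local ring of the origin over the
   field of fractions of [B]. *)
Definition ordge d : set K :=
  [set x | exists a b, [/\ b@_0 != 0, mord d a & x = a%:F / b%:F]].

Lemma LocM_Loc : LocM `<=` Loc.
Proof. by move=> _ [a [b [h1 h2 ->]]]; exists a, b. Qed.

Lemma Loc_poly f : Loc f%:F.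
Proof. by exists f, 1; rewrite mcoeff1 eqxx tofrac1 divr1 unitr1. Qed.

Lemma Loc_const c : Loc (constK c). Proof. exact: Loc_poly. Qed.

Lemma LocM_poly f : f@_0 = 0 -> LocM f%:F.
Proof. by exists f, 1; rewrite mcoeff1 eqxx tofrac1 divr1 unitr1. Qed.

Lemma Loc_subring : is_subring Loc.
Proof.
split; first by rewrite -tofrac1; apply: Loc_poly.
  move=> _ _ [a [b [ub ->]]] [c [d [ud ->]]]; exists (a * d - c * b), (b * d).
  rewrite rmorphM unitrM ub ud; split=> //.
  by rewrite -mulNr addf_div ?tofrac_eq0 ?poly_unit0 // tofracB !tofracM mulNr.
move=> _ _ [a [b [ub ->]]] [c [d [ud ->]]]; exists (a * c), (b * d).
by rewrite rmorphM unitrM ub ud mulf_div !tofracM.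
Qed.

Lemma LocM_mul x y : Loc x -> LocM y -> LocM (x * y).
Proof.
move=> [a [b [ub ->]]] [c [d [ud hc ->]]]; exists (a * c), (b * d).
by rewrite !rmorphM unitrM ub ud /= hc mulr0 mulf_div.
Qed.

Lemma LocM_sub x y : LocM x -> LocM y -> LocM (x - y).
Proof.
move=> [a [b [ub ha ->]]] [c [d [ud hc ->]]]; exists (a * d - c * b), (b * d).
rewrite !rmorphM rmorphB !rmorphM unitrM ub ud /= ha hc !mul0r subrr; split=> //.
by rewrite -mulNr addf_div ?tofrac_eq0 ?poly_unit0 // rmorphB !rmorphM mulNr.
Qed.

Lemma LocM0 : LocM 0.
Proof. by rewrite -tofrac0; apply: LocM_poly; rewrite mcoeff0. Qed.

Lemma LocM_add x y : LocM x -> LocM y -> LocM (x + y).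
Proof.
by move=> hx hy; rewrite -[y]opprK -[- y]sub0r; do 2?apply: LocM_sub => //; apply: LocM0.
Qed.

Lemma LocM_const c : LocM (constK c) -> c = 0.
Proof.
move=> [a [b [ub ha e]]]; have : constK c * b%:F = a%:F.
  by rewrite e divfK // tofrac_eq0 poly_unit0.
rewrite /constK -tofracM => /eqP; rewrite tofrac_eq => /eqP/(congr1 (mcoeff 0%MM)).
rewrite rmorphM /= mcoeff0_C ha => /eqP; rewrite mulf_eq0 => /orP[/eqP//|/eqP b0].
by rewrite b0 unitr0 in ub.
Qed.

(** Evaluation at the origin is kept as the relation [LocM (x - constK c)]: a fraction has no
    preferred representative from which to compute c. *)
Lemma Loc_ev x : Loc x -> exists c, LocM (x - constK c).
Proof.
move=> [a [b [ub ->]]]; exists (a@_0 / b@_0).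
exists (a - (a@_0 / b@_0)%:MP * b), b; split=> //.
  by rewrite mcoeffB mul_mpolyC mcoeffZ divrK // subrr.
by rewrite tofracB mulrBl tofracM mulfK // tofrac_eq0 poly_unit0.
Qed.

Lemma ev_uniq x c d : LocM (x - constK c) -> LocM (x - constK d) -> c = d.
Proof.
move=> hc hd; apply/eqP; rewrite -subr_eq0; apply/eqP/LocM_const.
rewrite rmorphB /=; have := LocM_sub hd hc.
by rewrite opprB addrC addrA addrNK.
Qed.

Lemma Loc_of_ev x c : LocM (x - constK c) -> Loc x.
Proof.
move=> h; rewrite -[x](subrK (constK c)); apply: subringD Loc_subring _ _.
  exact: LocM_Loc.
exact: Loc_const.
Qed.

Lemma ev_mul x y c d : LocM (x - constK c) -> LocM (y - constK d) ->
  LocM (x * y - constK (c * d)).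
Proof.
move=> hx hy; have -> : x * y - constK (c * d) =
   x * (y - constK d) + constK d * (x - constK c) by rewrite rmorphM /=; ring.
by apply: LocM_add; apply: LocM_mul => //; [apply: Loc_of_ev hx|apply: Loc_const].
Qed.

Lemma Loc_unit x c : LocM (x - constK c) -> c \is a GRing.unit -> unitin Loc x.
Proof.
move=> [a [b [ub ha e]]] uc.
have b0 : b%:F != 0 by rewrite tofrac_eq0 poly_unit0.
have ex : x = (a + c%:MP * b)%:F / b%:F.
  by rewrite tofracD mulrDl -e tofracM mulfK // subrK.
have un : (a + c%:MP * b)@_0 \is a GRing.unit.
  by rewrite mcoeffD ha add0r mul_mpolyC mcoeffZ unitrM uc.
have n0 : (a + c%:MP * b)%:F != 0 by rewrite tofrac_eq0 poly_unit0.
move: (a + c%:MP * b) ex un n0 => u ex un n0; rewrite ex; split.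
- by exists u, b.
- exact: mulf_neq0 n0 (invr_neq0 b0).
- by rewrite invf_div; exists b, u.
Qed.

Lemma unit_Loc x : unitin Loc x -> exists2 c, LocM (x - constK c) & c \is a GRing.unit.
Proof.
move=> [hx x0 hV]; have [c hc] := Loc_ev hx; have [d hd] := Loc_ev hV.
exists c => //; have := ev_mul hc hd; rewrite mulfV // => h1.
have /(ev_uniq h1) e : LocM (1 - constK 1) by rewrite rmorph1 subrr; apply: LocM0.
by apply/unitrP; exists d; rewrite mulrC e.
Qed.

Lemma LocM_theta w x : LocM x -> LocM (theta w x).
Proof.
move=> [a [b [ub ha ->]]]; exists (subw w a), (subw w b).
by rewrite !subw_coef0 fmorph_div /= !thetaF.
Qed.

Lemma theta_const w c : theta w (constK c) = constK c.
Proof. by rewrite /constK thetaF subwC. Qed.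

Lemma Loc_theta w x : Loc x -> Loc (theta w x).
Proof.
move=> /Loc_ev[c hc]; apply: (@Loc_of_ev _ c).
by rewrite -(theta_const w c) -rmorphB /=; apply: LocM_theta.
Qed.

Definition local_dom := forall a b : B, a + b = 1 ->
  a \is a GRing.unit \/ b \is a GRing.unit.

Lemma Loc_local : local_dom -> local Loc.
Proof.
move=> hB; split; first exact: Loc_subring.
move=> x y /Loc_ev[c hc] /Loc_ev[d hd] e.
have : c + d = 1.
  apply: (@ev_uniq 1); last by rewrite rmorph1 subrr; apply: LocM0.
  have -> : 1 - constK (c + d) = (x - constK c) + (y - constK d).
    by rewrite -e rmorphD /=; ring.
  exact: LocM_add.
by move=> /hB[] u; [left; apply: Loc_unit hc u|right; apply: Loc_unit hd u].
Qed.

Lemma LocM_ordge : LocM `<=` ordge 1.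
Proof.
move=> _ [a [b [ub ha ->]]]; exists a, b; split=> //; last exact/mord1P.
by apply: contraTneq ub => ->; rewrite unitr0.
Qed.

Lemma Loc_ordge : Loc `<=` ordge 0.
Proof.
move=> _ [a [b [ub ->]]]; exists a, b; split=> //.
by apply: contraTneq ub => ->; rewrite unitr0.
Qed.

Let nz b : b@_0 != 0 -> b%:F != 0.
Proof. by rewrite tofrac_eq0; apply: contraNneq => ->; rewrite mcoeff0. Qed.

Lemma ordge_sub d x y : ordge d x -> ordge d y -> ordge d (x - y).
Proof.
move=> [a [b [hb ha ->]]] [c [e [he hc ->]]]; exists (a * e - c * b), (b * e).
rewrite rmorphM mulf_neq0 //; split=> //; first by apply: mordB; apply: mordMr.
by rewrite -mulNr addf_div ?nz // rmorphB !rmorphM mulNr.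
Qed.

Lemma ordge0 d : ordge d 0.
Proof.
exists 0, 1; rewrite mcoeff1 eqxx oner_eq0 tofrac0 mul0r; split=> //.
exact: mord_zero.
Qed.

Lemma ordge_add d x y : ordge d x -> ordge d y -> ordge d (x + y).
Proof.
by move=> hx hy; rewrite -[y]opprK -[- y]sub0r; do 2?apply: ordge_sub => //; apply: ordge0.
Qed.

Lemma ordge_mul d e x y : ordge d x -> ordge e y -> ordge (d + e) (x * y).
Proof.
move=> [a [b [hb ha ->]]] [c [f [hf hc ->]]]; exists (a * c), (b * f).
by rewrite !rmorphM mulf_neq0 // mulf_div; split=> //; apply: mordM.
Qed.

Lemma ordge_le d e x : (d <= e)%N -> ordge e x -> ordge d x.
Proof. by move=> h [a [b [hb ha ->]]]; exists a, b; split=> //; apply: mord_le ha. Qed.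

Lemma ordge_poly d f : ordge d f%:F <-> mord d f.
Proof.
split=> [[a [b [hb ha e]]]|h]; last first.
  by exists f, 1; rewrite mcoeff1 eqxx oner_eq0 tofrac1 divr1.
apply: (mord_mul hb); suff -> : b * f = a by [].
by apply/eqP; rewrite -tofrac_eq tofracM e mulrC divfK // nz.
Qed.

Lemma ordge_constM d c x : c != 0 -> ordge d (constK c * x) -> ordge d x.
Proof.
move=> c0 [a [b [hb ha e]]]; exists a, (c%:MP * b); split=> //.
  by rewrite mul_mpolyC mcoeffZ mulf_neq0.
have cF : constK c != 0 by rewrite tofrac_eq0 mpolyC_eq0.
by rewrite tofracM invfM mulrCA -e mulrC -/(constK c) [RHS]mulrC mulKf // mulrC.
Qed.

End Origin.
(** * Points infinitely near to the origin on a blow-up *)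

Section Points.
Variable N : nat.

Definition step_map (B B' : Type) (r : B -> B') (s : step N B) : step N B' :=
  (s.1, fun l => r (s.2 l)).

Lemma divf_neq0 (E : fieldType) (a b : E) : a / b != 0 -> a != 0.
Proof. by apply: contraNneq => ->; rewrite mul0r. Qed.

Lemma div_div_mul (E : fieldType) (a b h : E) : b != 0 -> h != 0 -> a / h / (b / h) * b = a.
Proof. by move=> b0 h0; rewrite invf_div mulrA divfK // divfK. Qed.

Lemma unitin_div (E : fieldType) (O : set E) a b : unitin O (a / b) -> unitin O (b / a).
Proof. by move=> /unitinV; rewrite invf_div. Qed.

Lemma max_ideal_unit (E : fieldType) (O : set E) a z :
  local O -> unitin O a -> max_ideal O (z - a) -> unitin O z.
Proof. by move=> hl ha hz; have := max_idealDu hl ha hz; rewrite addrC subrK. Qed.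

Lemma div_div (E : fieldType) (a b h : E) : h != 0 -> a / b = a / h / (b / h).
Proof. by move=> h0; rewrite invf_div mulrA divfK. Qed.

Lemma subMdiv (E : fieldType) (g c h : E) : g != 0 -> (g - c * h) / g = 1 - c * (h / g).
Proof. by move=> g0; rewrite mulrBl divff // mulrA. Qed.

Section Pt.
Variable B : idomainType.
Local Notation poly := {mpoly B[N]}.
Local Notation K := {fraction poly}.
Local Notation "x %:F" := (@FracField.tofrac poly x).
Implicit Types (s : step N B) (w : seq (step N B)) (x y : K) (a b f h u v : poly).
Implicit Types (G J : set poly).

(* The local ring of the infinitely near point [w], for [B] a field. *)
Definition pt w : set K := [set x | Loc (theta w x)].
Definition ptM w : set K := [set x | LocM (theta w x)].

Lemma pt_subring w : is_subring (pt w).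
Proof. exact: (@subring_preimage _ _ (theta w) _ (@Loc_subring N B)). Qed.

Lemma unit_ptE w x : unitin (pt w) x <-> unitin (@Loc N B) (theta w x).
Proof.
by split=> -[h1 h2 h3]; split; rewrite ?fmorph_eq0 -?fmorphV // in h1 h2 h3 *;
  rewrite /pt /= ?fmorphV // -(fmorph_eq0 (theta w)).
Qed.

Lemma pt_local w : local_dom B -> local (pt w).
Proof.
move=> hB; split; first exact: pt_subring.
move=> x y hx hy e; have [_ hl] := Loc_local N hB.
have := hl _ _ hx hy; rewrite -rmorphD e rmorph1 => /(_ erefl).
by case=> hu; [left|right]; apply/unit_ptE.
Qed.

Lemma pt_poly w f : pt w f%:F.
Proof. by rewrite /pt /= thetaF; apply: Loc_poly. Qed.

Lemma pt_const w c : pt w (constK N c).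
Proof. exact: pt_poly. Qed.

Lemma ptM_pt w : ptM w `<=` pt w.
Proof. by move=> x; apply: LocM_Loc. Qed.

Lemma ptM_mul w x y : pt w x -> ptM w y -> ptM w (x * y).
Proof. by move=> hx hy; rewrite /ptM /= rmorphM; apply: LocM_mul. Qed.

Lemma ptM_sub w x y : ptM w x -> ptM w y -> ptM w (x - y).
Proof. by move=> hx hy; rewrite /ptM /= rmorphB; apply: LocM_sub. Qed.

Lemma ptM0 w : ptM w 0.
Proof. by rewrite /ptM /= rmorph0; apply: LocM0. Qed.

Lemma ptM_const w c : ptM w (constK N c) -> c = 0.
Proof. by rewrite /ptM /= theta_const => /LocM_const. Qed.

Lemma pt_ev w x : pt w x -> exists c, ptM w (x - constK N c).
Proof. by move=> /Loc_ev[c hc]; exists c; rewrite /ptM /= rmorphB /= theta_const. Qed.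

Lemma pt_ev_unit w x c : ptM w (x - constK N c) ->
  unitin (pt w) x <-> c \is a GRing.unit.
Proof.
rewrite /ptM /= rmorphB /= theta_const => hc; rewrite unit_ptE; split.
  by move=> /unit_Loc[d hd ud]; rewrite (ev_uniq hc hd).
exact: Loc_unit.
Qed.

Lemma pt_rcons w s x : pt w x -> pt (rcons w s) x.
Proof. by rewrite /pt /= theta_rcons; apply: Loc_theta. Qed.

Lemma ptM_rcons w s x : ptM w x -> ptM (rcons w s) x.
Proof. by rewrite /ptM /= theta_rcons; apply: LocM_theta. Qed.

Lemma sub1_div s a : a@_0 = 0 -> exists a', sub1 s a = 'X_(s.1) * a'.
Proof.
move=> /mord1P/mord_decomp[F [-> _]]; rewrite rmorph_sum /=.
exists (\sum_l (if l == s.1 then 1 else 'X_l + (s.2 l)%:MP) * sub1 s (F l)).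
rewrite mulr_sumr; apply: eq_bigr => l _; rewrite rmorphM /= sub1X /stepX.
by case: eqP => [->|_]; rewrite ?mul1r // mulrA.
Qed.

(** y is the equation of the exceptional divisor in the chart of s, and the substitution s makes
    everything that vanishes at the centre divisible by it. *)
Lemma ptM_div w s x y : ptM w x -> theta w y = ('X_(s.1))%:F -> pt (rcons w s) (x / y).
Proof.
move=> [a [b [ub ha e]]] hy; rewrite /pt /= theta_rcons.
have -> : theta w (x / y) = a%:F / b%:F / ('X_(s.1))%:F by rewrite fmorph_div /= hy e.
rewrite !fmorph_div /= !thetaF !subw_cons /= sub1X /stepX eqxx.
have [a' ->] := sub1_div s ha; exists a', (sub1 s b).
rewrite (subw_coef0 [:: s] b); split=> //.
by rewrite tofracM mulrAC -[_ * _ / _ / _]mulrA mulrC mulrAC mulKf ?XF_neq0 // mulrC.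
Qed.

(* [u / v] lies in the local ring of [w] and has value [c] there. *)
Definition fval w u v c := v != 0 /\ exists a b,
  [/\ b@_0 \is a GRing.unit, a@_0 = c * b@_0 & b * subw w u = a * subw w v].

Lemma subw_neq0 w v : v != 0 -> subw w v != 0.
Proof. by move=> v0; rewrite -(rmorph0 (subw w)) (inj_eq (@subw_inj _ _ w)). Qed.

Lemma fvalP w u v c : v != 0 ->
  fval w u v c <-> ptM w (u%:F / v%:F - constK N c).
Proof.
move=> v0; have wv0 := subw_neq0 w v0.
rewrite /ptM /= rmorphB fmorph_div /= theta_const !thetaF; split.
  case=> _ [a [b [ub ha e]]]; have b0 := poly_unit0 ub.
  exists (a - c%:MP * b), b; split=> //.
    by rewrite mcoeffB ha mul_mpolyC mcoeffZ subrr.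
  rewrite tofracB mulrBl tofracM mulfK ?tofrac_eq0 //; congr (_ - _).
  by apply/frac_eq => //; rewrite mulrC.
case=> a [b [ub ha e]]; split=> //; have b0 := poly_unit0 ub.
exists (a + c%:MP * b), b; split=> //.
  by rewrite mcoeffD ha add0r mul_mpolyC mcoeffZ.
rewrite mulrC; apply/frac_eq => //.
rewrite tofracD mulrDl -e /constK tofracM mulfK ?tofrac_eq0 // subrK //.
Qed.

(** A certificate that w is a B-point of the chart h of the blow-up of G: the g / h have values in B
    at w, and each local coordinate at w, the inverse image of X_l under [theta w], is a quotient of
    elements a / h^e and b / h^e of the chart ring, the second a unit at w. It is phrased by
    identities and units so that it can be reduced modulo p as well as embedded in a field. *)
Definition Bpt w G h :=
  [/\ G h, h != 0, forall g, G g -> exists c, fval w g h c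
    & forall l, exists e a b c, [/\ pw [set: poly] G e a, pw [set: poly] G e b,
        fval w b (h ^+ e) c, c \is a GRing.unit & 'X_l * subw w b = subw w a]].

(* [J] generates the elements of [G] vanishing at [w]. *)
Definition Jspec w G h J :=
  [/\ forall g, G g -> exists c, J (g - c%:MP * h),
      forall l g, G g -> J ('X_l * g)
    & forall t, J t -> pw [set: poly] G 1 t /\ fval w t h 0].

Definition SP : set K := range (fun f : poly => f%:F).
Definition GF G : set K := [set g%:F | g in G].

Lemma SP_subring : is_subring SP.
Proof. exact: (subring_range (@FracField.tofrac poly)). Qed.

Lemma SP_poly f : SP f%:F. Proof. by exists f. Qed.

Lemma pwF G e (x : K) : pw SP (GF G) e x <-> exists2 a, pw [set: poly] G e a & x = a%:F.
Proof.
have := pw_image (@FracField.tofrac poly) [set: poly] G e => E.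
rewrite /SP /GF E; split=> [[a ha <-]|[a ha ->]]; by exists a.
Qed.

Lemma GF_mulset G J : GF (mulset G J) = mulset (GF G) (GF J).
Proof. exact: (mulset_image (@FracField.tofrac poly)). Qed.

Lemma GF_mem G g : G g -> GF G g%:F. Proof. by exists g. Qed.

Lemma Bpt_G w G h g : Bpt w G h -> G g -> pt w (g%:F / h%:F).
Proof.
move=> [_ h0 hG _] /hG[c /(fvalP _ _ _ h0)]; rewrite /ptM /= rmorphB /= theta_const.
exact: Loc_of_ev.
Qed.

Lemma Bpt_chart w G h : Bpt w G h -> chart SP (GF G) h%:F `<=` pt w.
Proof.
move=> hb; apply: chart_min; first exact: pt_subring.
  by move=> _ [f _ <-]; apply: pt_poly.
by move=> _ [g hg <-]; apply: Bpt_G hb hg.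
Qed.

Lemma Bpt_intro w G h : G h -> h != 0 -> (forall g, G g -> pt w (g%:F / h%:F)) ->
  (forall l, exists2 y, theta w y = ('X_l)%:F &
     fracs (chart SP (GF G) h%:F) (pt w) y) -> Bpt w G h.
Proof.
move=> hG h0 hg hl; split=> // [g /hg/pt_ev[c hc]|l]; first by exists c; apply/fvalP.
have [y hy [a' [b' [ha hb ub ey]]]] := hl l.
have hF0 : h%:F != 0 by rewrite tofrac_eq0.
have [e [a [b [/pwF[a1 ha1 ->] /pwF[b1 hb1 ->] ea eb]]]] :=
  chart_common SP_subring (GF_mem hG) hF0 ha hb.
have [c hc] : exists c, ptM w (b' - constK N c) by case: ub => /pt_ev.
exists e, a1, b1, c; split=> //.
- by apply/fvalP; rewrite ?expf_neq0 // tofracXn -eb.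
- by apply/(pt_ev_unit hc).
apply/eqP; rewrite -tofrac_eq tofracM -hy -!(thetaF w) -rmorphM /=; apply/eqP.
congr (theta w _); rewrite ey ea eb.
have b10 : b1%:F != 0.
  by case: ub => _ + _; rewrite eb => /divf_neq0.
exact: div_div_mul b10 (expf_neq0 e hF0).
Qed.

Lemma Bpt_coord w G h l : Bpt w G h -> exists2 y, theta w y = ('X_l)%:F &
  fracs (chart SP (GF G) h%:F) (pt w) y.
Proof.
move=> [_ h0 _ /(_ l)[e [a [b [c [ha hb hc uc hX]]]]]].
have he0 : h ^+ e != 0 by rewrite expf_neq0.
have hv := hc; rewrite fvalP // in hv; have ub := (pt_ev_unit hv).2 uc.
have b0 : b%:F != 0 by case: ub => _ + _ => /divf_neq0.
exists (a%:F / b%:F).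
  rewrite fmorph_div /= !thetaF -hX tofracM; apply: mulfK.
  by rewrite tofrac_eq0 subw_neq0 // -tofrac_eq0.
exists (a%:F / h%:F ^+ e), (b%:F / h%:F ^+ e); split.
- by apply: chart_pw; apply/pwF; exists a.
- by apply: chart_pw; apply/pwF; exists b.
- by rewrite -tofracXn.
have hF0 : h%:F != 0 by rewrite tofrac_eq0.
exact: (div_div _ _ (expf_neq0 e hF0)).
Qed.

(** The coordinates at w are fractions over the chart, hence so are all polynomials in them, and
    then all elements of the local ring. *)
Lemma over_pt w G h : local_dom B -> Bpt w G h ->
  over (chart SP (GF G) h%:F) (pt w).
Proof.
move=> hB hb; have h0 : h%:F != 0 by rewrite tofrac_eq0; case: hb.
have hC : is_subring (chart SP (GF G) h%:F).
  by apply: chart_subring => //; [exact: SP_subring|apply: GF_mem; case: hb].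
split; [exact: pt_local|exact: Bpt_chart|move=> x].
have hL := fracs_subring hC (pt_subring w).
have hpoly f : exists2 z, theta w z = f%:F & fracs (chart SP (GF G) h%:F) (pt w) z.
  elim/mpolyind: f => [|c m f _ _ [z hz hzL]].
    by exists 0; [rewrite rmorph0 tofrac0|apply: subring0].
  have [z' hz' hL'] : exists2 z, theta w z = ('X_[m])%:F &
      fracs (chart SP (GF G) h%:F) (pt w) z.
    rewrite mpolyXE_id; elim/big_ind: _ => [|p q [z1 e1 h1] [z2 e2 h2]|i _].
    - by exists 1; [rewrite rmorph1 tofrac1|case: hL].
    - exists (z1 * z2); first by rewrite rmorphM /= e1 e2 tofracM.
      by case: hL => _ _; apply.
    - have [y ey hy] := Bpt_coord i hb; exists (y ^+ m i); last exact: subringX.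
      by rewrite rmorphXn /= ey tofracXn.
  exists (constK N c * z' + z).
    by rewrite rmorphD rmorphM /= theta_const hz' hz -tofracM -tofracD mul_mpolyC.
  apply: subringD => //; case: (hL) => _ _; apply=> //.
  by apply: fracs_sub => //; [exact: pt_subring|apply/chart_sub/SP_poly].
move=> [a [b [ub e]]]; have [za ea ha] := hpoly a; have [zb eb hb'] := hpoly b.
have uzb : unitin (pt w) zb.
  apply/unit_ptE; rewrite eb; apply: (@Loc_unit _ _ _ (b@_0)) => //.
  by rewrite /constK -tofracB; apply: LocM_poly; rewrite mcoeffB mcoeff0_C subrr.
have -> : x = za / zb by apply: (@theta_inj _ _ w); rewrite fmorph_div /= ea eb.
by case: (hL) => _ _; apply=> //; apply: fracsV => //; apply: pt_subring.
Qed.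

(** Modulo the J / h the chart ring consists of constants: each g / h is congruent to its value, and
    X_l, being X_l h / h, to 0. With [pw_ptM] this identifies the ideal generated by J / h with the
    functions of the chart that vanish at w. *)
Lemma chart_value w G h J z : Bpt w G h -> Jspec w G h J ->
  chart SP (GF G) h%:F z -> exists c,
  pw (chart SP (GF G) h%:F) [set t / h%:F | t in GF J] 1 (z - constK N c).
Proof.
move=> hb [hJ1 hJ2 hJ3] [e [b [hpw ->]]].
have hG : GF G h%:F by apply: GF_mem; case: hb.
have h0 : h%:F != 0 by rewrite tofrac_eq0; case: hb.
set C := chart _ _ _; set T := [set _ | _ in _].
have hC : is_subring C by apply: chart_subring => //; exact: SP_subring.
have hCc c : C (constK N c) by apply/chart_sub/SP_poly.
have hT t : J t -> pw C T 1 (t%:F / h%:F).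
  by move=> ht; apply: pw_gen => //; exists t%:F => //; exists t.
elim: hpw => [_ [f _ <-]|d a _ _ [c IH] [g hg <-]|d|d a a' _ [c IH] _ [c' IH']].
- exists f@_0; rewrite expr0 divr1 /constK -tofracB.
  have /mord1P/mord_decomp[F [-> _]] : (f - (f@_0)%:MP)@_0 = 0.
    by rewrite mcoeffB mcoeff0_C subrr.
  rewrite rmorph_sum /=; apply: pw_sum => l _.
  have -> : ('X_l * F l)%:F = (F l)%:F * (('X_l * h)%:F / h%:F).
    by rewrite !tofracM mulfK // mulrC.
  apply: pw_scale => //; first by apply/chart_sub/SP_poly.
  by apply/hT/hJ2; case: hb.
- have [c' hc'] := hJ1 _ hg; exists (c * c').
  have eg : g%:F / h%:F = (g - c'%:MP * h)%:F / h%:F + constK N c'.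
    by rewrite tofracB mulrBl tofracM mulfK // subrK.
  have gC : C (g%:F / h%:F) by apply: chart_gen => //; [exact: SP_subring|exists g].
  have -> : a * g%:F / h%:F ^+ d.+1 - constK N (c * c') =
     g%:F / h%:F * (a / h%:F ^+ d - constK N c) +
     constK N c * ((g - c'%:MP * h)%:F / h%:F).
    rewrite exprSr -mulf_div rmorphM /= mulrBr eg; ring.
  by apply: pwD; apply: pw_scale => //; apply: hT.
- by exists 0; rewrite mul0r rmorph0 subrr; apply: pw_zero.
- exists (c - c'); rewrite mulrBl rmorphB /=.
  have -> : forall p q r s : K, p - q - (r - s) = (p - r) - (q - s) by move=> *; ring.
  exact: pw_sub.
Qed.

Lemma pw_ptM w (C T : set K) x : C `<=` pt w -> T `<=` ptM w -> pw C T 1 x -> ptM w x.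
Proof.
move=> hC hT h; remember 1%N as d; elim: h Heqd => // [d' a g ha _ hg [e]|d' e|d' a b _ IHa _ IHb e].
- subst; apply: ptM_mul; last exact: hT.
  apply: (@pw0P _ _ T _ (pt_subring w)); exact: pw_mono ha.
- exact: ptM0.
- by apply: ptM_sub; [apply: IHa|apply: IHb].
Qed.

Lemma Jspec_ptM w G h J : h != 0 -> Jspec w G h J ->
  [set t / h%:F | t in GF J] `<=` ptM w.
Proof.
move=> h0 [_ _ hJ] _ [_ [t /hJ[_ ht] <-] <-].
by move/(fvalP _ _ _ h0): ht; rewrite rmorph0 subr0.
Qed.

(** Write z = a / b over the chart. The value of a at w is 0, so [chart_value] puts a into the ideal
    of the J / h. *)
Lemma ptM_gen w G h J z : local_dom B -> Bpt w G h -> Jspec w G h J -> ptM w z ->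
  pw (pt w) [set t / h%:F | t in GF J] 1 z.
Proof.
move=> hB hb hJ hz; have h0 : h != 0 by case: hb.
have [_ hC hf] := over_pt hB hb.
have [a [b [ha hb' ub ez]]] := hf z (ptM_pt hz).
have [c hc] := chart_value hb hJ ha.
have hcM : ptM w (a - constK N c) by apply: pw_ptM (Jspec_ptM h0 hJ) hc.
have haM : ptM w a.
  have -> : a = b * z by rewrite ez mulrC divfK //; case: ub.
  by apply: ptM_mul => //; case: ub.
have c0 : c = 0.
  apply: (@ptM_const w); rewrite -[constK N c](subKr a); exact: ptM_sub.
rewrite ez mulrC; apply: pw_scale; [exact: pt_subring|by case: ub|].
by rewrite c0 rmorph0 subr0 in hc; apply: pw_mono hc.
Qed.

End Pt.

Section Field.
Variable F : fieldType.
Local Notation poly := {mpoly F[N]}.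
Local Notation K := {fraction poly}.
Local Notation "x %:F" := (@FracField.tofrac poly x).
Implicit Types (w : seq (step N F)) (G J : set poly).

Lemma field_local : local_dom F.
Proof.
move=> a b e; have [a0|a0] := eqVneq a 0; last by left; rewrite unitfE.
by right; rewrite unitfE; move: e; rewrite a0 add0r => ->; apply: oner_neq0.
Qed.

Lemma max_ideal_pt w x : max_ideal (pt w) x <-> ptM w x.
Proof.
rewrite max_idealP; split=> [[/pt_ev[c hc] hn]|hx].
  have c0 : c = 0.
    by apply/eqP; apply: contrapT => /negP c0; apply: hn; apply/(pt_ev_unit hc); rewrite unitfE.
  by move: hc; rewrite c0 rmorph0 subr0.
split; first exact: ptM_pt.
have hc : ptM w (x - constK N 0) by rewrite rmorph0 subr0.
by rewrite (pt_ev_unit hc) unitr0.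
Qed.

Lemma unit_const w (C : set K) (hC : local C) c :
  (forall c, C (constK N c)) -> c != 0 -> unitin C (constK N c).
Proof.
move=> h c0; split=> //; first by rewrite /constK tofrac_eq0 mpolyC_eq0.
by rewrite -fmorphV; apply: h.
Qed.

(** If no t / g is a unit at Q, then g = c h + t with t in J forces h / g to be a unit, which moves
    Q to the chart h. There the J / h vanish both at Q and at w, and everything is a constant modulo
    them, so Q and w invert the same elements. *)
Lemma pt_sep w G h J Q g : Bpt w G h -> Jspec w G h J ->
  GF G g -> g != 0 -> over (chart (@SP F) (GF G) g) Q ->
  (forall t, GF J t -> ~ unitin Q (t / g)) -> Q = pt w.
Proof.
move=> hb hJ hg g0 hov hn; case: (hov) => hQl hCQ hfQ; case: (hQl) => hQr _.
have hG : GF G h%:F by apply: GF_mem; case: hb.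
have h0 : h%:F != 0 by rewrite tofrac_eq0; case: hb.
have hQc c : Q (constK N c) by apply/hCQ/chart_sub/SP_poly.
have hQG g' : GF G g' -> Q (g' / g).
  by move=> hg'; apply: hCQ; apply: chart_gen => //; exact: (SP_subring F).
have hQJ t : J t -> Q (t%:F / g).
  case: hJ => _ _ hJ3 /hJ3[ht _]; apply: hCQ.
  by rewrite -[g]expr1; apply: chart_pw; apply/pwF; exists t.
have hmJ t : J t -> max_ideal Q (t%:F / g).
  by move=> ht; apply/max_idealP; split; [apply: hQJ|apply: hn; exists t].
have uhg : unitin Q (h%:F / g).
  case: (hg) => g' hg' eg; case: (hJ) => /(_ _ hg')[c hc] _ _.
  have hm := hmJ _ hc.
  have e : (g' - c%:MP * h)%:F / g = 1 - constK N c * (h%:F / g).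
    by rewrite tofracB tofracM eg; exact: (subMdiv (constK N c) h%:F g0).
  rewrite e in hm.
  apply: contrapT => nu; apply: (max_idealN1 hQr).
  rewrite -[1](subrK (constK N c * (h%:F / g))); apply: max_idealD => //.
  by apply: max_idealM => //; apply/max_idealP; split=> //; apply: hQG.
have hovh : over (chart (@SP F) (GF G) h%:F) Q.
  have hCh : chart (@SP F) (GF G) h%:F `<=` Q.
    apply: chart_min => //; first by move=> s hs; apply/hCQ/chart_sub.
    move=> g' hg'; have -> : g' / h%:F = (g' / g) * (h%:F / g)^-1.
      exact: (div_div _ _ g0).
    by case: (hQr) => _ _; apply; [apply: hQG|case: uhg].
  apply: (over_shrink (chart_subring (SP_subring F) hG h0) hov hCh).
  move=> x [e [b [hpw ->]]]; exists (b / h%:F ^+ e), ((g / h%:F) ^+ e); split.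
  - exact: chart_pw.
  - apply: subringX; first by apply: chart_subring => //; exact: (SP_subring F).
    by apply: chart_gen => //; exact: (SP_subring F).
  - exact: (unitinX e hQr (unitin_div uhg)).
  by rewrite expr_div_n; exact: (div_div _ _ (expf_neq0 e h0)).
apply: (over_eq hovh (over_pt field_local hb)) => z hz.
have [c hc] := chart_value hb hJ hz.
have hzP : ptM w (z - constK N c).
  by apply: pw_ptM (Jspec_ptM _ hJ) hc; [exact: Bpt_chart|rewrite -tofrac_eq0].
have hzQ : max_ideal Q (z - constK N c).
  apply: (@pw_max_ideal _ Q _ _ hQl _ _); last first.
    by apply: pw_mono hc; [case: hovh|exact: subset_refl].
  move=> _ [_ [t ht <-] <-].
  have -> : t%:F / h%:F = (h%:F / g)^-1 * (t%:F / g).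
    by rewrite [RHS]mulrC; exact: (div_div _ _ g0).
  by apply: max_idealM => //; [case: uhg|apply: hmJ].
rewrite (pt_ev_unit hzP) unitfE; split=> [hu|c0].
  apply/eqP => c0; move: hzQ; rewrite c0 rmorph0 subr0 => /max_idealP[_].
  by apply.
exact: (max_ideal_unit hQl (unit_const w hQl hQc c0) hzQ).
Qed.

Lemma blowup_pt w G h J : Bpt w G h -> Jspec w G h J ->
  blowup (Bl (@SP F) (GF G)) (pt w) = Bl (@SP F) (GF (mulset G J)).
Proof.
move=> hb hJ; rewrite GF_mulset.
have hG : GF G h%:F by apply: GF_mem; case: hb.
have h0 : h%:F != 0 by rewrite tofrac_eq0; case: hb.
have := @blowup_Bl _ _ _ (GF J) _ _ (SP_subring F) hG h0 (over_pt field_local hb).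
apply.
- move=> _ [t ht <-]; apply/pwF; exists t => //.
  by case: hJ => _ _ /(_ _ ht)[].
- move=> t ht; apply/max_ideal_pt; apply: (Jspec_ptM _ hJ); first by case: hb.
  by exists t.
- by move=> z /max_ideal_pt; exact: (ptM_gen field_local hb hJ).
- move=> Q g hg g0 hov hn; exact: (pt_sep hb hJ hg g0 hov hn).
Qed.

End Field.
End Points.
(** * Persistence of points under blow-up *)

Section Transport.
Variables (N : nat) (B B' : idomainType) (r : {rmorphism B -> B'}).
Local Notation mapp := (map_mpoly r).
Local Notation mapw := (map (step_map r)).
Implicit Types (w : seq (step N B)) (u v h : {mpoly B[N]}) (G J : set {mpoly B[N]}).

Lemma mcoeff_mapr m u : (mapp u)@_m = r u@_m.
Proof. exact: mcoeff_map_mpoly. Qed.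

Lemma sub1_map s u : mapp (sub1 s u) = sub1 (step_map r s) (mapp u).
Proof.
apply: (@mpoly_rmorph_ext _ _ _ (map_mpoly r \o sub1 s)
  (sub1 (step_map r s) \o map_mpoly r)) => [c|i] /=.
  by rewrite sub1C !map_mpolyC sub1C.
rewrite sub1X map_mpolyX sub1X /stepX; case: eqP => _; first by rewrite map_mpolyX.
by rewrite rmorphM rmorphD /= !map_mpolyX map_mpolyC.
Qed.

Lemma subw_map w u : mapp (subw w u) = subw (mapw w) (mapp u).
Proof. by elim: w u => [|s w IH] u //; rewrite subw_cons IH sub1_map. Qed.

Lemma pw_map (S G : set {mpoly B[N]}) d u : pw S G d u ->
  pw (mapp @` S) (mapp @` G) d (mapp u).
Proof. by move=> h; rewrite pw_image; exists u. Qed.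

Lemma pw_mapT G d u : pw [set: {mpoly B[N]}] G d u ->
  pw [set: {mpoly B'[N]}] (mapp @` G) d (mapp u).
Proof. by move=> /pw_map; apply: pw_mono. Qed.

Lemma fval_map w u v c : mapp v != 0 -> fval w u v c ->
  fval (mapw w) (mapp u) (mapp v) (r c).
Proof.
move=> v0 [_ [a [b [ub ha e]]]]; split=> //; exists (mapp a), (mapp b).
rewrite !mcoeff_mapr ha; split; [exact: rmorph_unit|exact: rmorphM|].
by rewrite -!subw_map -!rmorphM e.
Qed.

Lemma Bpt_map w G h : mapp h != 0 -> Bpt w G h ->
  Bpt (mapw w) (mapp @` G) (mapp h).
Proof.
move=> h0 [hG _ hg hl]; split; [by exists h|by []| |].
  by move=> _ [g /hg[c hc] <-]; exists (r c); apply: fval_map.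
move=> l; have [e [a [b [c [ha hb hc uc hX]]]]] := hl l.
exists e, (mapp a), (mapp b), (r c); split; [exact: pw_mapT|exact: pw_mapT| | |].
- by rewrite -rmorphXn; apply: fval_map => //; rewrite rmorphXn expf_neq0.
- exact: rmorph_unit.
- by rewrite -!subw_map -hX rmorphM /= map_mpolyX.
Qed.

Lemma Jspec_map w G h J : mapp h != 0 -> Jspec w G h J ->
  Jspec (mapw w) (mapp @` G) (mapp h) (mapp @` J).
Proof.
move=> h0 [h1 h2 h3]; split.
- move=> _ [g /h1[c hc] <-]; exists (r c); exists (g - c%:MP * h) => //.
  by rewrite rmorphB rmorphM /= map_mpolyC.
- move=> l _ [g /h2 hg <-]; exists ('X_l * g) => //.
  by rewrite rmorphM /= map_mpolyX.
- move=> _ [t /h3[ht1 ht2] <-]; split; first exact: pw_mapT.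
  by rewrite -(rmorph0 r); apply: fval_map.
Qed.

End Transport.

Section Persist.
Variables (N : nat) (B : idomainType) (F : fieldType) (r : {rmorphism B -> F}).
Hypothesis hr : forall b, r b != 0 -> b \is a GRing.unit.
Local Notation poly := {mpoly B[N]}.
Local Notation K := {fraction poly}.
Local Notation "x %:F" := (@FracField.tofrac poly x).
Local Notation mapp := (map_mpoly r).
Local Notation mapw := (map (step_map r)).
Implicit Types (w : seq (step N B)) (u v h : {mpoly B[N]}) (G J : set {mpoly B[N]}).

Lemma res_local : local_dom B.
Proof.
move=> a b e; have [ra|ra] := eqVneq (r a) 0; last by left; apply: hr.
right; apply: hr; have := congr1 r e; rewrite rmorphD ra add0r rmorph1 => ->.
exact: oner_neq0.
Qed.

(** Over the residue field u differs from the centre, so [pt_sep] gives t in J with t / hu a unit at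
    u. The value of t / hu in B has nonzero residue, hence is a unit, and hu t is the new chart. *)
Lemma Bpt_other (u w : seq (step N B)) G hu h J : Bpt u G hu -> Bpt w G h -> Jspec w G h J ->
  mapp hu != 0 -> mapp h != 0 -> pt (mapw u) <> pt (mapw w) ->
  exists2 h', mapp h' != 0 & Bpt u (mulset G J) h'.
Proof.
move=> hbu hbw hJ hu0 h0 hne.
have hbu' := Bpt_map hu0 hbu; have hbw' := Bpt_map h0 hbw; have hJ' := Jspec_map h0 hJ.
have huF : (hu%:F : K) != 0 by rewrite tofrac_eq0; case: hbu.
have huF' : @FracField.tofrac {mpoly F[N]} (mapp hu) != 0 by rewrite tofrac_eq0.
have [t ht ut] : exists2 t, J t & unitin (pt (mapw u))
    (@FracField.tofrac {mpoly F[N]} (mapp t) / @FracField.tofrac {mpoly F[N]} (mapp hu)).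
  apply: contrapT => hn; apply: hne.
  apply: (pt_sep hbw' hJ' _ huF' (over_pt (@field_local F) hbu')).
    by apply: GF_mem; case: hbu'.
  by move=> _ [_ [t ht <-] <-] hut; apply: hn; exists t.
have t0' : mapp t != 0.
  by case: ut => _ + _ => /divf_neq0; rewrite tofrac_eq0.
have t0 : t != 0 by apply: contraNneq t0' => ->; rewrite rmorph0.
have tF : (t%:F : K) != 0 by rewrite tofrac_eq0.
have hJpt t1 : J t1 -> pt u (t1%:F / hu%:F).
  move=> ht1; apply: (Bpt_chart hbu); rewrite -[X in _ / X]expr1; apply: chart_pw.
  by apply/pwF; exists t1 => //; case: hJ => _ _ /(_ _ ht1)[].
have [c hc] := pt_ev (hJpt t ht).
have uc : c \is a GRing.unit.
  apply: hr; have hu00 : hu != 0 by case: hbu.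
  have := fval_map hu0 ((fvalP u t c hu00).2 hc).
  by rewrite fvalP // => /pt_ev_unit[/(_ ut)]; rewrite unitfE.
have utu : unitin (pt u) (t%:F / hu%:F) by apply/(pt_ev_unit hc).
exists (hu * t); first by rewrite rmorphM mulf_neq0.
have hg : G hu by case: hbu.
apply: Bpt_intro; first by exists hu, t.
- by rewrite mulf_neq0 //; case: hbu.
- move=> _ [g1 [t1 [hg1 ht1 ->]]].
  have -> : (g1 * t1)%:F / (hu * t)%:F =
      (g1%:F / hu%:F) * ((t1%:F / hu%:F) / (t%:F / hu%:F)).
    by rewrite !tofracM; exact: (divM_div _ _ _ _ huF).
  case: (pt_subring u) => _ _ hM.
  apply: (hM); first exact: Bpt_G hbu hg1.
  by apply: (hM); [exact: hJpt|case: utu].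
move=> l; have [y hy [a [b [ha hb ub ey]]]] := Bpt_coord l hbu.
exists y => //; exists a, b; rewrite GF_mulset tofracM; split=> //.
- apply: (chart_mulset (@SP_subring _ _) huF tF (GF_mem hg) _ ha); exact: GF_mem.
- apply: (chart_mulset (@SP_subring _ _) huF tF (GF_mem hg) _ hb); exact: GF_mem.
Qed.

(** The exceptional divisor has the equation y_j at the new point, and y_j is a combination of the J
    / h. So some t in J differs from h y_j by a unit there, which gives the chart h t; the
    coordinates are y_j and the y_l / y_j minus constants. *)
Lemma Bpt_child w G h J s : Bpt w G h -> Jspec w G h J -> mapp h != 0 ->
  exists2 h', mapp h' != 0 & Bpt (rcons w s) (mulset G J) h'.
Proof.
move=> hb hJ h0'; set ws := rcons w s.
have h0 : h != 0 by case: hb.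
have hG : G h by case: hb.
have hF : (h%:F : K) != 0 by rewrite tofrac_eq0.
have hloc := pt_local ws res_local.
have hovr := over_pt res_local hb.
have hPQ : pt w `<=` pt ws by move=> x; apply: pt_rcons.
have [y hy] : exists2 y : 'I_N -> K, (forall l, theta w (y l) = ('X_l)%:F) &
    forall l, fracs (chart (@SP N B) (GF G) h%:F) (pt w) (y l).
  pose y l := projT1 (cid2 (Bpt_coord l hb)).
  by exists y => l; rewrite /y; case: cid2.
move=> hyf; pose j := s.1.
have yM l : ptM w (y l).
  by rewrite /ptM /= hy; apply: LocM_poly; rewrite mcoeffX -mdeg_eq0 mdeg1.
have y0 : y j != 0 by rewrite -(fmorph_eq0 (theta w)) /= hy XF_neq0.
have hJdiv t1 : J t1 -> pt ws (t1%:F / (h%:F * y j)).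
  move=> ht1; rewrite invfM mulrA; apply: ptM_div (hy j).
  by apply: (Jspec_ptM h0 hJ); exists t1%:F => //; exists t1.
have [_ [t ht <-] ut] : exists2 t, GF J t & unitin (pt ws) (t / (h%:F * y j)).
  apply: (pw_unit_div (pt_subring w) hloc hPQ y0 (ptM_gen res_local hb hJ (yM j))).
  by move=> _ [t1 ht1 <-]; apply: hJdiv.
have hy0 : h%:F * y j != 0 := mulf_neq0 hF y0.
have tF : (t%:F : K) != 0 by case: ut => _ + _ => /divf_neq0.
have t0 : t != 0 by rewrite -tofrac_eq0.
(* The value c of t / (h y_j) is a unit. Clearing denominators after the substitution gives an
   identity b t = (a + c b) h X_j over B, whose right side is not killed by r. *)
have t0' : mapp t != 0.
  move/unit_ptE: ut => /unit_Loc[c [a [b [ub ha e]]] uc].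
  have hws : theta ws (t%:F / (h%:F * y j)) =
      (subw ws t)%:F / ((subw ws h)%:F * ('X_j)%:F).
    rewrite fmorph_div rmorphM /= !thetaF /ws !theta_rcons hy.
    by rewrite !thetaF !subw_cons /= sub1X /stepX eqxx.
  have hn0 : subw ws h * 'X_j != 0 by rewrite mulf_neq0 ?subw_neq0 // mpolyX_neq0.
  have b0 := poly_unit0 ub.
  have e2 : b * subw ws t = (a + c%:MP * b) * (subw ws h * 'X_j).
    rewrite mulrC; apply/frac_eq => //.
    have bF : (b%:F : K) != 0 by rewrite tofrac_eq0.
    rewrite tofracD mulrDl -e (tofracM c%:MP) /constK.
    have -> : (c%:MP)%:F * b%:F / b%:F = (c%:MP)%:F :> K by apply: mulfK.
    by rewrite subrK hws tofracM.
  apply/eqP => mt0; have := congr1 mapp e2.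
  rewrite !rmorphM /= !subw_map mt0 rmorph0 mulr0 map_mpolyX => /esym/eqP.
  have hn1 : subw (mapw ws) (mapp h) * 'X_j != 0.
    exact: (mulf_neq0 (subw_neq0 (mapw ws) h0') (@mpolyX_neq0 _ F j)).
  rewrite mulf_eq0 (negPf hn1) orbF => /eqP/(congr1 (mcoeff 0%MM)).
  rewrite mcoeff_mapr mcoeffD ha add0r mul_mpolyC mcoeffZ mcoeff0 => /eqP.
  have : r (c * b@_0) \is a GRing.unit by apply: rmorph_unit; rewrite unitrM uc ub.
  by rewrite unitfE => /negPf->.
exists (h * t); first by rewrite rmorphM mulf_neq0.
have ht0F : h%:F * t%:F != 0 :> K := mulf_neq0 hF tF.
have hGJ : mulset (GF G) (GF J) (h%:F * t%:F).
  by exists h%:F, t%:F; split=> //; apply: GF_mem.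
have hC' : is_subring (chart (@SP N B) (mulset (GF G) (GF J)) (h%:F * t%:F)).
  refine (@chart_subring _ _ _ (@SP_subring N B) _ hGJ ht0F).
set L := fracs (chart (@SP N B) (mulset (GF G) (GF J)) (h%:F * t%:F)) (pt ws).
have hL : is_subring L := fracs_subring hC' (pt_subring ws).
have hCL : chart (@SP N B) (mulset (GF G) (GF J)) (h%:F * t%:F) `<=` L.
  exact: fracs_sub hC' (pt_subring ws).
case: (hL) => _ lB lM.
have hCC : chart (@SP N B) (GF G) h%:F `<=` L.
  move=> x hx; apply: hCL.
  exact: (chart_mulset (@SP_subring _ _) hF tF (GF_mem hG) (GF_mem ht) hx).
have hPL : pt w `<=` L.
  case: hovr => _ _ hf x /hf[a [b [ha hb' ub ->]]]; apply: (lM); first exact: hCC.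
  apply: (fracsV (pt_subring ws) (hCC _ hb')); exact: unitin_sub ub.
have hmt x : ptM w x -> L (x / (t%:F / h%:F)).
  move=> /(ptM_gen res_local hb hJ) hx.
  exact: (pw_div_fracs (@SP_subring _ _) (pt_subring w) (pt_subring ws) hF tF
    (GF_mem hG) (GF_mem ht) hPL hx).
have thF : t%:F / h%:F != 0 := mulf_neq0 tF (invr_neq0 hF).
have uyt : unitin (pt ws) (y j / (t%:F / h%:F)).
  by have := unitin_div ut; rewrite invf_div mulrA [y j * _]mulrC.
have hyy l : L (y l / y j).
  rewrite (div_div _ _ thF); apply: (lM); first exact: hmt (yM l).
  exact: (fracsV (pt_subring ws) (hmt _ (yM j)) uyt).
apply: Bpt_intro; first by exists h, t.
- exact: (mulf_neq0 h0 t0).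
- move=> _ [g1 [t1 [hg1 ht1 ->]]].
  have -> : (g1 * t1)%:F / (h * t)%:F =
     (g1%:F / h%:F) * ((t1%:F / (h%:F * y j)) / (t%:F / (h%:F * y j))).
    by rewrite !tofracM; exact: (divM_div _ _ _ _ hy0).
  case: (pt_subring ws) => _ _ hM.
  apply: (hM); first exact: pt_rcons (Bpt_G hb hg1).
  by apply: (hM); [exact: hJdiv|case: ut].
move=> l; rewrite GF_mulset tofracM -/L.
have [->|nlj] := eqVneq l j.
  exists (y j); last by apply: hPL; apply: ptM_pt.
  by rewrite /ws theta_rcons hy thetaF subw_cons /= sub1X /stepX eqxx.
exists (y l / y j - constK N (s.2 l)).
  rewrite /ws theta_rcons rmorphB fmorph_div /= !hy theta_const.
  rewrite -[RHS](theta_unsub s l) /unstepX (negPf nlj).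
  by rewrite rmorphB fmorph_div /= -/(constK N _) theta_const.
apply: (lB); first exact: hyy.
by apply: hPL; apply: pt_const.
Qed.

End Persist.
(** * Torsion in the Rees algebra of a blow-up *)

Section AddClosure.
Variable A : comNzRingType.
Implicit Types (X Y G J S : set A).

Inductive addcl X : set A :=
| addcl_in x : X x -> addcl X x
| addcl_zero : addcl X 0
| addcl_sub x y : addcl X x -> addcl X y -> addcl X (x - y).

Definition prodset X Y : set A := addcl [set z | exists x y, [/\ X x, Y y & z = x * y]].

Lemma addcl_add X x y : addcl X x -> addcl X y -> addcl X (x + y).
Proof.
by move=> hx hy; rewrite -[y]opprK -[- y]sub0r; do 2?apply: addcl_sub => //; apply: addcl_zero.
Qed.

Lemma addcl_sum X (I : Type) (r : seq I) (Q : pred I) (F : I -> A) :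
  (forall i, Q i -> addcl X (F i)) -> addcl X (\sum_(i <- r | Q i) F i).
Proof.
move=> h; elim/big_ind: _ => //; first exact: addcl_zero.
by move=> *; apply: addcl_add.
Qed.

Lemma prodset_in X Y x y : X x -> Y y -> prodset X Y (x * y).
Proof. by move=> hx hy; apply: addcl_in; exists x, y. Qed.

Lemma prodset_mul X Y X' Y' c : (forall x y, X x -> Y y -> prodset X' Y' (c * (x * y))) ->
  forall z, prodset X Y z -> prodset X' Y' (c * z).
Proof.
move=> h z; elim=> [_ [x [y [hx hy ->]]]||x y _ IHx _ IHy]; first exact: h.
  by rewrite mulr0; apply: addcl_zero.
by rewrite mulrBr; apply: addcl_sub.
Qed.

Lemma mono_split S G d e x : is_subring S -> mono S G (d + e) x ->
  exists y z, [/\ mono S G d y, mono S G e z & x = y * z].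
Proof.
move=> hS; elim: e x => [|e IH] x; rewrite ?addn0 ?addnS.
  move=> hx; exists x, 1; rewrite mulr1; split=> //; apply: mono_base; by case: hS.
move=> /mono_inv[x' [g [/IH[y [z [hy hz ->]]] hg ->]]].
by exists y, (z * g); rewrite mulrA; split=> //; apply: mono_mulg.
Qed.

Lemma pw_split S G d e x : is_subring S -> pw S G (d + e) x ->
  prodset (pw S G d) (pw S G e) x.
Proof.
move=> hS /(pw_monos hS)[s [hs ->]]; rewrite big_seq; apply: addcl_sum => y /hs.
by move=> /(mono_split hS)[a [b [ha hb ->]]]; apply: prodset_in; apply: mono_pw.
Qed.

Lemma pw_mulset_prod S G J d x : is_subring S -> pw S (mulset G J) d x ->
  prodset (pw S G d) (pw S J d) x.
Proof.
move=> hS; elim=> [b hb|e a _ _ IH [g [t [hg ht ->]]]|e|e a b _ IHa _ IHb].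
- by rewrite -[b]mulr1; apply: prodset_in; apply: pw_base => //; case: hS.
- rewrite mulrC; apply: prodset_mul IH => y z hy hz.
  have -> : g * t * (y * z) = (y * g) * (z * t) by ring.
  by apply: prodset_in; apply: pw_mulg.
- exact: addcl_zero.
- exact: addcl_sub.
Qed.

Lemma mono_mulset S G J d x y : is_subring S -> mono S G d x -> mono S J d y ->
  pw S (mulset G J) d (x * y).
Proof.
move=> hS; elim: d x y => [|d IH] x y hx hy.
  case: (hS) => _ _ hM; apply: pw_base; apply: hM.
    by apply: (@pw0P _ _ G _ hS); apply: mono_pw.
  by apply: (@pw0P _ _ J _ hS); apply: mono_pw.
have [a [g [ha hg ->]]] := mono_inv hx; have [b [t [hb ht ->]]] := mono_inv hy.
have -> : a * g * (b * t) = (a * b) * (g * t) by ring.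
by apply: pw_mulg; [apply: IH|exists g, t].
Qed.

Lemma prod_pw_mulset S G J d x : is_subring S ->
  prodset (pw S G d) (pw S J d) x -> pw S (mulset G J) d x.
Proof.
move=> hS; elim=> [_ [a [b [ha hb ->]]]||a b _ IHa _ IHb].
- have [s [hs ->]] := pw_monos hS ha; have [t [ht ->]] := pw_monos hS hb.
  rewrite mulr_suml big_seq; apply: pw_sum => y /hs hy.
  rewrite mulr_sumr big_seq; apply: pw_sum => z /ht hz; exact: mono_mulset.
- exact: pw_zero.
- exact: pw_sub.
Qed.

Lemma pw_sub_gen S J G d x : is_subring S -> (forall t, J t -> pw S G 1 t) ->
  pw S J d x -> pw S G d x.
Proof. by move=> hS hJ hx; have := pw_trans hS hJ hx; rewrite muln1. Qed.

Lemma prod_pw S G J d k x : is_subring S -> (forall t, J t -> pw S G 1 t) ->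
  prodset (pw S G k) (pw S J d) x -> pw S G (k + d) x.
Proof.
move=> hS hJ; elim=> [_ [a [b [ha hb ->]]]||a b _ IHa _ IHb].
- by apply: pwM => //; rewrite -[d]muln1; apply: pw_trans hb.
- exact: pw_zero.
- exact: pw_sub.
Qed.

(** Taylor expansion in h: substitute g = c h + t, with t in J, for each factor and collect by the
    number of factors t. *)
Lemma pw_expand S G J h e x : is_subring S ->
  (forall g, G g -> exists2 c, S c & J (g - c * h)) -> pw S G e x ->
  exists u : nat -> A, (forall i, pw S J i (u i)) /\
    x = \sum_(i < e.+1) h ^+ (e - i) * u i.
Proof.
move=> hS hG; elim=> [b hb|d a g _ [u [hu ea]] hg|d|d a b _ [u [hu ->]] _ [v [hv ->]]].
- exists (fun i => if i == 0%N then b else 0); split=> [i|]; last first.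
    by rewrite big_ord1 expr0 mul1r.
  by case: eqP => [->|_]; [apply: pw_base|apply: pw_zero].
- have [c hc ht] := hG g hg; set t := g - c * h in ht.
  (* The guard is needed because nothing is known about u beyond d, where the new sum has one more
     term. *)
  exists (fun i => (if (i <= d)%N then c * u i else 0) +
                   (if i is i'.+1 then u i' * t else 0)); split=> [i|].
    apply: pwD.
      by case: ifP => _; [apply: pw_scale|apply: pw_zero].
    by case: i => [|i]; [apply: pw_zero|apply: pw_mulg].
  under eq_bigr => i _ do rewrite mulrDr; rewrite big_split /=.
  rewrite big_ord_recr /= ltnn mulr0 addr0 [X in _ + X]big_ord_recl /= mulr0 add0r.
  have -> : g = c * h + t by rewrite /t addrC subrK.
  rewrite mulrDr ea; congr (_ + _); rewrite mulr_suml; apply: eq_bigr => i _.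
    have hi : (i <= d)%N by rewrite -ltnS.
    by rewrite hi subSn // exprS; ring.
  by rewrite /bump leq0n add1n subSS; ring.
- by exists (fun _ => 0); split=> [i|]; [apply: pw_zero|rewrite big1 // => i _; rewrite mulr0].
- exists (fun i => u i - v i); split=> [i|]; first exact: pw_sub.
  by rewrite -sumrB; apply: eq_bigr => i _; rewrite mulrBr.
Qed.

End AddClosure.

Section CommonDenom.
Variable K : fieldType.

Lemma mulKdiv (a b c : K) : c != 0 -> a / b = c * a / (c * b).
Proof. by move=> c0; rewrite -mulf_div divff // mul1r. Qed.

Lemma common_denom (C O : set K) (I : finType) (x : I -> K) : is_subring C ->
  over C O -> (forall i, O (x i)) ->
  exists m, [/\ C m, unitin O m & forall i, C (m * x i)].
Proof.
move=> hC [[hO _] _ hf] hx.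
have /choice[m hm] : forall i, exists m, [/\ C m, unitin O m & C (m * x i)].
  move=> i; have [a [b [ha hb ub ->]]] := hf _ (hx i); exists b; split=> //.
  by rewrite mulrC divfK //; case: ub.
exists (\prod_i m i); split.
- by apply: subring_prod => // i _; case: (hm i).
- elim/big_ind: _ => [||i _]; [exact: unitin1|by move=> *; apply: unitinM|by case: (hm i)].
move=> i; rewrite (bigD1 i) //= mulrAC; case: (hC) => _ _; apply; first by case: (hm i).
by apply: subring_prod => // j _; case: (hm j).
Qed.

End CommonDenom.

Section Filtration.
Variables (N : nat) (B : idomainType).
Local Notation poly := {mpoly B[N]}.
Local Notation K := {fraction poly}.
Local Notation "x %:F" := (@FracField.tofrac poly x).

Lemma ordge_close (d e : nat) (x x' y y' : K) :
  ordge d x -> ordge d.+1 (x - x') -> ordge e y' -> ordge e.+1 (y - y') ->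
  ordge (d + e).+1 (x * y - x' * y').
Proof.
move=> hx hxx hy hyy.
have -> : x * y - x' * y' = x * (y - y') + (x - x') * y' by ring.
apply: ordge_add; first by rewrite -addnS; apply: ordge_mul.
by rewrite -addSn; apply: ordge_mul.
Qed.

Definition evK (a : 'I_N -> K) : poly -> K := mmap (@constK N B) a.
HB.instance Definition _ a := GRing.RMorphism.on (evK a).

Lemma evKX a l : evK a 'X_l = a l.
Proof. by rewrite /evK mmapX mmap1U. Qed.

Lemma evKC a c : evK a c%:MP = constK N c.
Proof. exact: mmapC. Qed.

(** Replacing the variables by elements with the same linear parts does not change the initial
    form. *)
Lemma evK_homog (u : 'I_N -> K) (d : nat) (G : poly) :
  (forall l, ordge 2 (u l - ('X_l)%:F)) -> G \is d.-homog ->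
  ordge d.+1 (evK u G - G%:F).
Proof.
move=> hu /dhomogP hG; rewrite {2}[G]mpolyE /evK /mmap rmorph_sum /= -sumrB big_seq.
elim/big_ind: _ => [||m /hG/= hm]; first exact: ordge0.
  by move=> *; apply: ordge_add.
have hmm : ordge (mdeg m).+1 (mmap1 u m - ('X_[m])%:F).
  suff [_ _ h] : [/\ ordge (mdeg m) (mmap1 u m), ordge (mdeg m) ('X_[m])%:F &
    ordge (mdeg m).+1 (mmap1 u m - ('X_[m])%:F)] by [].
  rewrite mpolyXE_id rmorph_prod /= mdegE /mmap1.
  have h1 l : ordge 1 (u l).
    rewrite -[u l](subrK ('X_l)%:F); apply: ordge_add; first exact: ordge_le (hu l).
    by apply/ordge_poly/mord_X.
  pose R d (x y : K) := [/\ ordge d x, ordge d y & ordge d.+1 (x - y)].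
  have RM d1 d2 x1 y1 x2 y2 : R d1 x1 y1 -> R d2 x2 y2 ->
      R (d1 + d2)%N (x1 * x2) (y1 * y2).
    move=> [p1 p2 p3] [q1 q2 q3]; split; [exact: ordge_mul|exact: ordge_mul|].
    exact: ordge_close.
  have R1 : R 0%N 1 1.
    split; rewrite ?subrr; [| |exact: ordge0];
      by rewrite -tofrac1; apply/ordge_poly; apply: mord0.
  have RX l n : R n (u l ^+ n) ('X_l ^+ n)%:F.
    rewrite tofracXn; elim: n => [|n IH]; first by rewrite !expr0.
    rewrite !exprS -add1n; apply: RM => //; split=> //.
    by apply/ordge_poly/mord_X.
  rewrite -/(R _ _ _).
  by apply: (big_ind3 R R1) => [x1 x2 x3 y1 y2 y3|l _]; [exact: RM|exact: RX].
rewrite -mul_mpolyC tofracM -mulrBr -hm; apply: (@ordge_mul _ _ 0) => //.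
by apply/ordge_poly; apply: mord0.
Qed.

End Filtration.

Section Torsion.
Variables (N : nat) (B : idomainType) (p : B).
Hypotheses (p0 : p != 0) (hloc : local_dom B).
Local Notation poly := {mpoly B[N]}.
Local Notation K := {fraction poly}.
Local Notation "x %:F" := (@FracField.tofrac poly x).
Local Notation T := [set: poly].
Implicit Types (w : seq (step N B)) (G J : set poly) (h f : poly).

Section AtPoint.
Variables (w : seq (step N B)) (G J : set poly) (h : poly).
Hypotheses (hb : Bpt w G h) (hJ : Jspec w G h J).
Let C : set K := chart (@SP N B) (GF G) h%:F.
Let TJ : set K := [set t / h%:F | t in GF J].

Let h0 : h != 0. Proof. by case: hb. Qed.
Let hF : (h%:F : K) != 0. Proof. by rewrite tofrac_eq0. Qed.
Let hG : GF G h%:F. Proof. by apply: GF_mem; case: hb. Qed.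
Let hC : is_subring C := @chart_subring _ _ _ (@SP_subring N B) _ hG hF.
Let hCpt : C `<=` pt w := Bpt_chart hb.
Let hCc c : C (constK N c).
Proof. by apply: chart_sub; exists c%:MP. Qed.
Let hTM : TJ `<=` ptM w := Jspec_ptM h0 hJ.
Let hTC : TJ `<=` C.
Proof.
move=> _ [_ [t ht <-] <-]; rewrite -[X in _ / X]expr1; apply: chart_pw.
by apply/pwF; exists t => //; case: hJ => _ _ /(_ _ ht)[].
Qed.

Let pw_ord d x : pw C TJ d x -> ordge d (theta w x).
Proof.
elim=> [b /hCpt|e a g _ IH /hTM hg|e|e a b _ IHa _ IHb].
- exact: Loc_ordge.
- by rewrite rmorphM -addn1; apply: ordge_mul => //; apply: LocM_ordge.
- by rewrite rmorph0; apply: ordge0.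
- by rewrite rmorphB; apply: ordge_sub.
Qed.

Let chart_ptM z : C z -> ptM w z -> pw C TJ 1 z.
Proof.
move=> hz hM; have [c hc] := chart_value hb hJ hz.
have c0 : c = 0.
  apply: (@ptM_const _ _ w); rewrite -[constK N c](subKr z); apply: ptM_sub => //.
  exact: pw_ptM hc.
by rewrite c0 rmorph0 subr0 in hc.
Qed.

(** Elements of the chart ring itself, and not only of its localization, with initial forms X_l at
    w: the numerators of the coordinates, divided by the values of the denominators. *)
Let coords : exists a : 'I_N -> K, (forall l, pw C TJ 1 (a l)) /\
  (forall l, ordge 2 (theta w (a l) - ('X_l)%:F)) /\
  forall l, exists2 s, pt w s & theta w (a l * s) = ('X_l)%:F.
Proof.
suff /choice[a ha] : forall l, exists a, [/\ pw C TJ 1 a,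
    ordge 2 (theta w a - ('X_l)%:F) &
    exists2 s, pt w s & theta w (a * s) = ('X_l)%:F].
  by exists a; split; [|split] => l; case: (ha l).
move=> l; have [y hy [al [be [hal hbe ube ey]]]] := Bpt_coord l hb.
have [c hc] := pt_ev (hCpt hbe); have uc := (pt_ev_unit hc).1 ube.
have be0 : be != 0 by case: ube.
have cc : constK N c^-1 * constK N c = 1 by rewrite -rmorphM mulVr // rmorph1.
exists (constK N c^-1 * al).
have e1 : constK N c^-1 * al = constK N c^-1 * be * y.
  by rewrite ey -[RHS]mulrA; congr (_ * _); rewrite mulrC divfK.
have hyM : ptM w y.
  by rewrite /ptM /= hy; apply: LocM_poly; rewrite mcoeffX -mdeg_eq0 mdeg1.
split.
- apply: chart_ptM; first by case: hC => _ _; apply.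
  rewrite e1; apply: ptM_mul => //; case: (pt_subring w) => _ _; apply; last exact: hCpt.
  exact: pt_const.
- have -> : theta w (constK N c^-1 * al) - ('X_l)%:F =
      constK N c^-1 * (theta w (be - constK N c) * ('X_l)%:F).
    rewrite e1 !rmorphM rmorphB /= hy !theta_const.
    rewrite -[X in _ - X = _]mul1r -cc; ring.
  apply: (@ordge_mul _ _ 0); first by apply: Loc_ordge; apply: Loc_const.
  apply: (@ordge_mul _ _ 1); first exact: LocM_ordge.
  by apply/ordge_poly/mord_X.
exists (constK N c * be^-1).
  case: (pt_subring w) => _ _; apply; first exact: pt_const.
  by case: ube.
rewrite -hy; congr (theta w _); rewrite ey.
have -> : constK N c^-1 * al * (constK N c * be^-1) =
  constK N c^-1 * constK N c * (al * be^-1) by ring.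
by rewrite cc mul1r.
Qed.

(** The graded ring of the chart along the ideal of the J / h is generated over B by the classes of
    the a_l. So an element of the d-th power is, modulo the next power, a form Q of degree d in the
    a_l with coefficients in B; order d + 1 at w forces Q = 0, since the initial forms X_l are
    independent. This is where it matters that the centre is a B-point. *)
Lemma ord_pw d z : C z -> ordge d (theta w z) -> pw C TJ d z.
Proof.
have [a [ha [hau hs]]] := coords.
(* Modulo the square of the ideal, every element of it is a B-combination of the a_l. *)
have lin z1 : pw C TJ 1 z1 -> exists b : 'I_N -> B,
    pw C TJ 2 (z1 - \sum_l constK N (b l) * a l).
  move=> hz1; have hz1M : ptM w z1 by apply: pw_ptM hz1.
  have [s hsp hsX] : exists2 s : 'I_N -> K, (forall l, pt w (s l)) &
      forall l, theta w (a l * s l) = ('X_l)%:F.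
    by have /choice[s hs'] : forall l, exists s, pt w s /\ theta w (a l * s) = ('X_l)%:F;
      [move=> l; have [x ? ?] := hs l; exists x|exists s => l; case: (hs' l)].
  have [t ht ez] : exists2 t : 'I_N -> K, (forall l, pt w (t l)) & z1 = \sum_l a l * t l.
    case: hz1M => A [D [uD A0 e]].
    have /mord1P/mord_decomp[AF [eA _]] := A0.
    have [u hu] := theta_surj w (D%:F)^-1.
    have /choice[v hv] : forall l, exists v, theta w v = (AF l)%:F by move=> l; apply: theta_surj.
    exists (fun l => s l * (v l * u)).
      move=> l; case: (pt_subring w) => _ _ hM; apply: (hM); first exact: hsp.
      rewrite /pt /= rmorphM /= hv hu; by exists (AF l), D.
    apply: (@theta_inj _ _ w); rewrite e eA rmorph_sum /= mulr_suml rmorph_sum /=.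
    apply: eq_bigr => l _.
    have -> : theta w (a l * (s l * (v l * u))) =
        theta w (a l * s l) * (theta w (v l) * theta w u).
      by rewrite (mulrA (a l)) !rmorphM.
    by rewrite hsX hv hu tofracM mulrA.
  have [m [hm um hmt]] := common_denom hC (over_pt hloc hb) ht.
  have [mu hmu] := chart_value hb hJ hm.
  have /choice[nu hnu] : forall l, exists nu, pw C TJ 1 (m * t l - constK N nu).
    by move=> l; apply: (chart_value hb hJ (hmt l)).
  have umu : mu \is a GRing.unit.
    by apply/(pt_ev_unit _ : unitin (pt w) m <-> _) => //; apply: pw_ptM hmu.
  exists (fun l => mu^-1 * nu l).
  have cc : constK N mu^-1 * constK N mu = 1 by rewrite -rmorphM mulVr // rmorph1.
  have -> : z1 - \sum_l constK N (mu^-1 * nu l) * a l =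
    constK N mu^-1 * (\sum_l a l * (m * t l - constK N (nu l)) - (m - constK N mu) * z1).
    have -> : \sum_l a l * (m * t l - constK N (nu l)) =
        m * z1 - \sum_l constK N (nu l) * a l.
      rewrite ez mulr_sumr -sumrB; apply: eq_bigr => l _; ring.
    have -> : \sum_l constK N (mu^-1 * nu l) * a l =
        constK N mu^-1 * \sum_l constK N (nu l) * a l.
      by rewrite mulr_sumr; apply: eq_bigr => l _; rewrite rmorphM mulrA.
    rewrite -{1}[z1]mul1r -cc; ring.
  apply: pw_scale => //; apply: pw_sub.
    by apply: pw_sum => l _; apply: (@pwM _ _ _ 1 1).
  exact: (@pwM _ _ _ 1 1).
have approx e z1 : pw C TJ e z1 -> exists Q : poly,
    [/\ Q \is e.-homog, pw C TJ e (evK a Q) & pw C TJ e.+1 (z1 - evK a Q)].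
  elim=> [b hb'|e' b g hpb [Q [hQ hQp hQz]] hg|e'|e' b c _ [Q [hQ hQp hQz]] _ [R [hR hRp hRz]]].
  - have [c hc] := chart_value hb hJ hb'; exists c%:MP; rewrite evKC; split=> //.
      by rewrite -[c%:MP]mulr1 mul_mpolyC; apply: rpredZ; apply: dhomog1.
    exact: pw_base.
  - have [be hbe] := lin g (pw_gen hC hg).
    have e1 : evK a (\sum_l be l *: 'X_l) = \sum_l constK N (be l) * a l.
      by rewrite rmorph_sum; apply: eq_bigr => l _; rewrite -mul_mpolyC rmorphM /= evKX evKC.
    have h1p : pw C TJ 1 (\sum_l constK N (be l) * a l).
      by apply: pw_sum => l _; apply: pw_scale.
    exists (Q * (\sum_l be l *: 'X_l)); rewrite rmorphM /= e1; split.
    + rewrite -addn1; apply: dhomogM => //; apply: rpred_sum => l _; apply: rpredZ.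
      by rewrite dhomogX /= mdeg1.
    + by rewrite -addn1; apply: pwM.
    have -> : b * g - evK a Q * (\sum_l constK N (be l) * a l) =
      b * (g - \sum_l constK N (be l) * a l) + (b - evK a Q) * (\sum_l constK N (be l) * a l).
      ring.
    apply: pwD; first by rewrite -addn2; apply: pwM.
    by rewrite -addn1; apply: pwM.
  - exists 0; rewrite rmorph0 subrr; split; [exact: rpred0|exact: pw_zero|exact: pw_zero].
  - exists (Q - R); rewrite rmorphB; split; [exact: rpredB|exact: pw_sub|].
    have -> : b - c - (evK a Q - evK a R) = (b - evK a Q) - (c - evK a R) by ring.
    exact: pw_sub.
elim: d => [|d IH] hz ho; first exact: pw_base.
have [Q [hQ hQp hQz]] := approx _ _ (IH hz (ordge_le (leqnSn d) ho)).
suff Q0 : Q = 0 by rewrite Q0 rmorph0 subr0 in hQz.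
have eQ : theta w (evK a Q) = evK (theta w \o a) Q.
  apply: (@mpoly_rmorph_ext _ _ _ (theta w \o evK a) (evK (theta w \o a))) => [c|l] /=.
    by rewrite !evKC theta_const.
  by rewrite !evKX.
have : mord d.+1 Q.
  apply/ordge_poly; rewrite -[Q%:F](subKr (evK (theta w \o a) Q)) -eQ.
  rewrite {1}eQ -[evK (theta w \o a) Q]eQ.
  apply: ordge_sub; last by rewrite eQ; apply: evK_homog.
  rewrite -(subKr (theta w z) (theta w (evK a Q))) -rmorphB /=.
  by apply: ordge_sub => //; apply: pw_ord.
move=> hm; apply/mpolyP => m; rewrite mcoeff0; apply/eqP; apply: contraTT isT => hmn.
have hms : m \in msupp Q by rewrite mcoeff_msupp.
have /mordP/(_ m hms) := hm; by rewrite (dhomog_mf hQ hms) ltnn.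
Qed.

(* [J^d G^k] *)
Local Notation JG d k := (prodset (pw T G k) (pw T J d)).

Let JG_mul d k e f m : pw T G e m -> JG d k f -> JG d (k + e) (m * f).
Proof.
move=> hm; apply: prodset_mul => x y hx hy; rewrite mulrA mulrC [m * x]mulrC mulrC.
by apply: prodset_in => //; apply: pwM.
Qed.

Let JG_mulJ d k e f u : pw T J e u -> JG d k f -> JG (d + e) k (u * f).
Proof.
move=> hm; apply: prodset_mul => x y hx hy; rewrite mulrCA [u * y]mulrC.
by apply: prodset_in => //; apply: pwM.
Qed.

Let pw_homogenize d z : pw C TJ d z -> exists k u, JG d k u /\ z = u%:F / h%:F ^+ (k + d).
Proof.
have lift d' k u n : JG d' k u -> JG d' (k + n) (h ^+ n * u) /\
    (u%:F / h%:F ^+ (k + d') = (h ^+ n * u)%:F / h%:F ^+ (k + n + d')).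
  move=> hu; split; first by apply: JG_mul => //; apply: pw_genX => //; case: hb.
  have -> : (k + n + d' = n + (k + d'))%N by lia.
  rewrite [h%:F ^+ (n + _)]exprD tofracM tofracXn; exact: mulKdiv (expf_neq0 n hF).
elim=> [b [e [c [/pwF[c1 hc1 ->] ->]]]|e a g _ [k [u [hu ->]]] [_ [t ht <-] <-]|e|
   e a b _ [k [u [hu ->]]] _ [k' [u' [hu' ->]]]].
- exists e, c1; rewrite addn0; split=> //; rewrite -[c1]mulr1; apply: prodset_in => //.
  exact: pw_base.
- exists k, (t * u); split.
    by rewrite -addn1; apply: JG_mulJ => //; apply: pw_gen.
  by rewrite addnS exprSr [t * u]mulrC tofracM; exact: mulf_div.
- by exists 0%N, 0; split; [apply: addcl_zero|rewrite tofrac0 mul0r].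
have [h1 ->] := lift _ _ _ k' hu; have [h2 ->] := lift _ _ _ k hu'.
exists (k + k')%N, (h ^+ k' * u - h ^+ k * u'); rewrite [(k' + k)%N]addnC in h2 *.
by split; [apply: addcl_sub|rewrite tofracB mulrBl].
Qed.

Let pw_ordF d f : pw T J d f -> forall k g, pw T G k g ->
  ordge d (theta w ((g * f)%:F / h%:F ^+ (k + d))).
Proof.
elim=> [b _|e a t _ IH ht|e|e a b _ IHa _ IHb] k g hg.
- rewrite addn0; apply: Loc_ordge; apply: hCpt; apply: chart_pw; apply/pwF.
  by exists (g * b) => //; rewrite mulrC; apply: pw_scale.
- rewrite mulrA tofracM addnS exprSr -mulf_div rmorphM -addn1; apply: ordge_mul.
    exact: IH.
  by apply: LocM_ordge; apply: hTM; exists t%:F => //; exists t.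
- by rewrite mulr0 tofrac0 mul0r rmorph0; apply: ordge0.
- by rewrite mulrBr tofracB mulrBl rmorphB; apply: ordge_sub; [apply: IHa|apply: IHb].
Qed.

Let JG_ord d k f : JG d k f -> ordge d (theta w (f%:F / h%:F ^+ (k + d))).
Proof.
elim=> [_ [x [y [hx hy ->]]]||x y _ IHx _ IHy]; first exact: pw_ordF.
  by rewrite tofrac0 mul0r rmorph0; apply: ordge0.
by rewrite tofracB mulrBl rmorphB; apply: ordge_sub.
Qed.

Let ord_JG d s f : pw T G s f -> ordge d (theta w (f%:F / h%:F ^+ s)) ->
  exists M, JG d (s + M) (h ^+ (M + d) * f).
Proof.
move=> hf ho; have hz : C (f%:F / h%:F ^+ s) by apply: chart_pw; apply/pwF; exists f.
have [k [u [hu e]]] := pw_homogenize (ord_pw hz ho); exists k.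
have -> : h ^+ (k + d) * f = h ^+ s * u.
  move: e; rewrite -!tofracXn => /frac_eq.
  by move=> /(_ (expf_neq0 _ h0) (expf_neq0 _ h0)) e; rewrite mulrC e mulrC.
by rewrite addnC; apply: JG_mul => //; apply: pw_genX => //; case: hb.
Qed.

(** In the expansion of m along h, the terms of degree at most d in J still contain h^M, and those
    of higher degree contain J^d by themselves. So an exponent that works for h works for all of
    G. *)
Let JG_all d s M f : (d <= s)%N -> pw T G s f -> JG d (s + M - d) (h ^+ M * f) ->
  forall m, pw T G (M + d) m -> JG d (s + M) (m * f).
Proof.
move=> hds hf hMf m hm.
have hexp : forall g, G g -> exists2 c, T c & J (g - c * h).
  by case: hJ => hJ1 _ _ g /hJ1[c hc]; exists c%:MP.
have [u [hu ->]] := pw_expand (@subring_setT poly) hexp hm.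
rewrite mulr_suml; apply: addcl_sum => i _.
have [hi|hi] := leqP i d.
  have hu1 : pw T G i (u i).
    apply: (@pw_sub_gen _ T J G) => //.
    by case: hJ => _ _ h3 t /h3[].
  have -> : h ^+ (M + d - i) * u i * f = (h ^+ (d - i) * u i) * (h ^+ M * f).
    by rewrite -addnBA // exprD; ring.
  have -> : (s + M)%N = (s + M - d + (d - i + i))%N by rewrite (subnK hi); lia.
  apply: JG_mul => //; apply: pwM => //; apply: pw_genX => //; by case: hb.
have -> : h ^+ (M + d - i) * u i * f = (h ^+ (M + d - i) * f) * u i by ring.
have [v hv] : exists v, prodset (pw T J (i - d)) (pw T J d) v /\ v = u i.
  by exists (u i); split=> //; apply: pw_split => //; rewrite subnK // ltnW.
case: hv => hv <-; apply: prodset_mul hv => x y hx hy.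
rewrite mulrA; apply: prodset_in => //.
have hx1 : pw T G (i - d) x.
  apply: (@pw_sub_gen _ T J G) => //.
  by case: hJ => _ _ h3 t /h3[].
have hiM : (i <= M + d)%N by rewrite -ltnS.
have -> : (s + M)%N = (M + d - i + s + (i - d))%N by lia.
apply: pwM => //; apply: pwM => //; apply: pw_genX => //; by case: hb.
Qed.

(** The p-torsion of B[x][T] modulo the Rees algebra is killed, element by element, by powers of G.
    This weak form is what passes through a blow-up; with finitely many generators it becomes
    saturation in high degrees. *)
Definition torsion_free_eventually G := forall d f f0, pw T G d f -> f = p%:MP * f0 ->
  exists e, forall m, pw T G e m -> exists2 f', pw T G (d + e) f' & m * f = p%:MP * f'.

Let pF0 : p%:MP != 0 :> poly. Proof. by rewrite mpolyC_eq0. Qed.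

(** (G J)^d is G^d J^d. For f = p f0 in it, the hypothesis on G puts m f0 into a power of G. As p is
    a nonzero constant, m f0 has the same order at w as m f, and [ord_JG] and [JG_all] turn this
    order back into factors from J, at the cost of more factors from G. Multiplying by a power of J
    then makes the two exponents equal. *)
Lemma torsion_mulset : torsion_free_eventually G ->
  torsion_free_eventually (mulset G J).
Proof.
move=> hT d f f0 hf ef; have hJ1 t : J t -> pw T G 1 t by case: hJ => _ _ h3 /h3[].
have hfJ := pw_mulset_prod (@subring_setT poly) hf.
have hf2 : pw T G (d + d) f by apply: prod_pw hfJ.
have [e he] := hT _ _ _ hf2 ef.
have ord_f' m f' : pw T G e m -> m * f = p%:MP * f' ->
    ordge d (theta w (f'%:F / h%:F ^+ (d + d + e))).
  move=> hm efm; apply: (ordge_constM p0).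
  rewrite -(theta_const w) -rmorphM /= mulrA -tofracM -efm addnAC.
  by apply: JG_ord; apply: JG_mul.
have hhe : pw T G e (h ^+ e) by apply: pw_genX => //; case: hb.
have [f1 hf1 ef1] := he _ hhe.
have [M hM] := ord_JG hf1 (ord_f' _ _ hhe ef1).
(* M is found for the single multiplier h^e; the identity h^M' f' = m h^(M + d) f1 carries it over
   to every m in G^e. *)
pose M' := (M + d + e)%N.
have hall m f' : pw T G e m -> pw T G (d + d + e) f' -> m * f = p%:MP * f' ->
    forall m2, pw T G (M' + d) m2 -> JG d (d + d + e + M') (m2 * f').
  move=> hm hf' efm m2 hm2; apply: JG_all => //; first by lia.
  have -> : h ^+ M' * f' = m * (h ^+ (M + d) * f1).
    apply: (mulfI pF0); rewrite /M' exprD.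
    have -> : p%:MP * (h ^+ (M + d) * h ^+ e * f') =
      h ^+ (M + d) * h ^+ e * (p%:MP * f') by ring.
    have -> : p%:MP * (m * (h ^+ (M + d) * f1)) =
      m * h ^+ (M + d) * (p%:MP * f1) by ring.
    rewrite -efm -ef1; ring.
  have -> : (d + d + e + M' - d = d + d + e + M + e)%N by rewrite /M'; lia.
  exact: JG_mul.
pose E := (e + (M' + d))%N; exists E => v hv.
have hb' b : pw T G E b -> exists2 u, JG d (d + E) u & b * f = p%:MP * u.
  move=> /(pw_split (@subring_setT poly)); elim=> [_ [m [m2 [hm hm2 ->]]]||x y _ [u hu eu] _ [u' hu' eu']].
  - have [f' hf' efm] := he _ hm; exists (m2 * f').
      have -> : (d + E = d + d + e + M')%N by rewrite /E; lia.
      exact: hall hm hf' efm _ hm2.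
    by rewrite mulrAC efm; ring.
  - by exists 0; [apply: addcl_zero|rewrite mul0r mulr0].
  - by exists (u - u'); [apply: addcl_sub|rewrite mulrBl eu eu' mulrBr].
suff [u hu eu] : exists2 u, JG (d + E) (d + E) u & v * f = p%:MP * u.
  by exists u => //; apply: prod_pw_mulset.
have := pw_mulset_prod (@subring_setT poly) hv.
elim=> [_ [b [t [hb1 ht ->]]]||x y _ [u hu eu] _ [u' hu' eu']].
- have [u hu eu] := hb' _ hb1; exists (t * u); first exact: JG_mulJ.
  by rewrite mulrAC eu; ring.
- by exists 0; [apply: addcl_zero|rewrite mul0r mulr0].
- by exists (u - u'); [apply: addcl_sub|rewrite mulrBl eu eu' mulrBr].
Qed.

End AtPoint.

Lemma torsion_one : torsion_free_eventually [set 1].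
Proof.
move=> d f f0 _ ef; exists 0%N => m _; exists (m * f0); last by rewrite ef mulrCA.
rewrite addn0 -[m * f0]mulr1; apply: pw_scale => //.
have := @pw_genX poly T [set 1] 1 d (@subring_setT poly) erefl.
by rewrite expr1n.
Qed.

End Torsion.
(** * Saturation with respect to a prime *)

Section Noether.
Variable A : comNzRingType.
Implicit Types (S I : set A) (s : seq A).

Definition ideal_of S I :=
  [/\ I `<=` S, I 0, (forall a b, I a -> I b -> I (a - b))
    & forall a b, S a -> I b -> I (a * b)].

Definition seqset s : set A := [set x | x \in s].

(** [pw S _ 1] is the S-linear span, so this is finite generation of all ideals of the subring S. *)
Definition noetherian S := forall I, ideal_of S I ->
  exists s, seqset s `<=` I /\ forall x, I x -> pw S (seqset s) 1 x.

Lemma noetherian_int : noetherian (subring_gen (set0 : set A)).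
Proof.
have hS := subring_genP (set0 : set A).
have eS x : subring_gen (set0 : set A) x <-> exists z : int, x = z%:~R.
  split.
    have hR : is_subring [set x : A | exists z : int, x = z%:~R].
      split; first by exists 1; rewrite mulr1z.
        by move=> _ _ [a ->] [b ->]; exists (a - b); rewrite rmorphB.
      by move=> _ _ [a ->] [b ->]; exists (a * b); rewrite rmorphM.
    by apply: (subring_gen_min hR).
  move=> [z ->]; case: (hS) => h1 _ _; case: (z) => n; first exact: (subringMn n hS h1).
  by rewrite NegzE mulrNz; exact: (subringN hS (subringMn n.+1 hS h1)).
move=> I [IS I0 IB IM].
have IN x : I x -> I (- x) by move=> hx; rewrite -sub0r; apply: IB.
have [[n hn]|hno] := pselect (exists n, (0 < n)%N && `[< I (n%:R) >]).
  have hex : exists n, (0 < n)%N && `[< I n%:R >] by exists n.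
  case: (ex_minnP hex) => m /andP[m0 /asboolP hm] hmin.
  exists [:: m%:R]; split=> [x|x hx]; first by rewrite /seqset /= inE => /eqP->.
  have [z ez] := (eS x).1 (IS _ hx).
  have hr : I ((z %% m)%Z)%:~R.
    have -> : (z %% m)%Z = z - (z %/ m)%Z * m.
      by apply/eqP; rewrite eq_sym subr_eq addrC -divz_eq.
    rewrite rmorphB rmorphM /=; apply: IB; first by rewrite -ez.
    by apply: IM => //; apply/eS; eexists.
  have hm0 : m%:Z != 0 by rewrite eqz_nat -lt0n.
  have r0 : (z %% m)%Z = 0.
    have := ltz_pmod z (_ : 0 < m%:Z); rewrite ltz_nat => /(_ m0).
    have := modz_ge0 z hm0; case: (z %% m)%Z hr => // r hr _; rewrite ltz_nat => hrm.
    case: r hr hrm => // r hr hrm; have : (m <= r.+1)%N by apply: hmin; apply/asboolP.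
    by rewrite leqNgt hrm.
  rewrite ez (divz_eq z m) r0 addr0 rmorphM /=; apply: pw_scale => //.
    by apply/eS; eexists.
  by apply: pw_gen => //; rewrite /seqset /= inE.
exists [::]; split=> // x hx; have [z ez] := (eS x).1 (IS _ hx).
have : I (`|z|%N)%:R.
  case: z ez => n e /=; first by rewrite e in hx.
  by have := IN _ hx; rewrite e NegzE mulrNz opprK.
case ez0 : `|z|%N => [|k] hk.
  by move/eqP: ez0; rewrite absz_eq0 => /eqP z0; rewrite ez z0 mulr0z; apply: pw_zero.
by case: hno; exists k.+1; apply/asboolP.
Qed.

Definition adjoin S (a : A) : set A :=
  [set x | exists P : {poly A}, (forall i, S P`_i) /\ x = P.[a]].

Lemma adjoin_subring S a : is_subring S -> is_subring (adjoin S a).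
Proof.
move=> hS; case: (hS) => h1 hB hM; split.
- exists 1; rewrite hornerC; split=> // i; rewrite coefC; case: eqP => // _.
  exact: subring0.
- move=> _ _ [P [hP ->]] [Q [hQ ->]]; exists (P - Q); rewrite hornerD hornerN.
  by split=> // i; rewrite coefB; apply: hB.
- move=> _ _ [P [hP ->]] [Q [hQ ->]]; exists (P * Q); rewrite hornerM.
  by split=> // i; rewrite coefM; apply: subring_sum => // j _; apply: hM.
Qed.

Lemma adjoin_gen S a : is_subring S -> subring_gen (S `|` [set a]) = adjoin S a.
Proof.
move=> hS; apply/seteqP; split.
  apply: subring_gen_min; first exact: adjoin_subring.
  case: (hS) => h1 _ _ x [hx|->].
    by exists x%:P; rewrite hornerC; split=> // i; rewrite coefC; case: eqP => // _; apply: subring0.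
  exists 'X; rewrite hornerX; split=> // i; rewrite coefX.
  by case: eqP => _ //; apply: subring0.
move=> _ [P [hP ->]]; rewrite horner_coef; apply: subring_sum; first exact: subring_genP.
move=> i _; case: (subring_genP (S `|` [set a])) => _ _; apply.
  by apply: sub_subring_gen; left.
have ha : subring_gen (S `|` [set a]) a by apply: sub_subring_gen; right.
exact: (subringX i (subring_genP _) ha).
Qed.

(* Hilbert's basis theorem: the ideals [L d] of leading coefficients of the
   polynomials of degree [d] that evaluate into [I] form a chain. *)
Lemma noetherian_adjoin S a : is_subring S -> noetherian S -> noetherian (adjoin S a).
Proof.
move=> hS hN I [IS I0 IB IM]; have hSa := adjoin_subring a hS.
case: (hS) => s1 sB sM.
pose V d (P : {poly A}) := [/\ forall i, S P`_i, (size P <= d.+1)%N & I P.[a]].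
pose L d : set A := [set c | exists P, V d P /\ P`_d = c].
have VB d P Q : V d P -> V d Q -> V d (P - Q).
  move=> [p1 p2 p3] [q1 q2 q3]; split=> [i||].
  - by rewrite coefB; apply: sB.
  - by rewrite (leq_trans (size_polyD _ _)) // size_polyN geq_max p2.
  - by rewrite hornerD hornerN; apply: IB.
have VC d c P : S c -> V d P -> V d (c%:P * P).
  move=> hc [p1 p2 p3]; split=> [i||].
  - by rewrite coefCM; apply: sM.
  - rewrite mul_polyC; exact: leq_trans (size_scale_leq _ _) p2.
  - rewrite hornerM hornerC; apply: IM => //.
    exists c%:P; rewrite hornerC; split=> // i; rewrite coefC.
    by case: eqP => // _; apply: subring0.
have V0 d : V d 0.
  by split=> [i||]; rewrite ?coef0 ?size_poly0 ?horner0 //; apply: subring0.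
have VX d n P : V d P -> V (n + d)%N ('X^n * P) /\ ('X^n * P)`_(n + d) = P`_d.
  move=> [p1 p2 p3]; split; last by rewrite coefXnM ltnNge leq_addr addKn.
  split=> [i||].
  - by rewrite coefXnM; case: ifP => // _; apply: subring0.
  - rewrite (leq_trans (size_polyMleq _ _)) // size_polyXn -addnS /= leq_add2l //.
  - rewrite hornerM hornerXn; apply: IM => //; exists 'X^n; rewrite hornerXn; split=> // i.
    by rewrite coefXn; case: eqP => _ //; apply: subring0.
have Lid d : ideal_of S (L d).
  split.
  - by move=> _ [P [[p1 _ _] <-]].
  - by exists 0; rewrite coef0.
  - move=> _ _ [P [hP <-]] [Q [hQ <-]]; exists (P - Q); rewrite coefB; split=> //.
    exact: VB.
  - move=> c _ hc [P [hP <-]]; exists (c%:P * P); rewrite coefCM; split=> //; exact: VC.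
have Lmono d e : (d <= e)%N -> L d `<=` L e.
  move=> hde _ [P [hP <-]]; have [h1 h2] := VX d (e - d)%N P hP.
  by exists ('X^(e - d) * P); rewrite (subnK hde) in h1 h2.
have Linf : ideal_of S [set c | exists d, L d c].
  split.
  - by move=> c [d]; case: (Lid d) => h _ _ _ /h.
  - by exists 0%N; case: (Lid 0%N).
  - move=> x y [d hx] [e hy]; exists (maxn d e); case: (Lid (maxn d e)) => _ _ h _.
    by apply: h; [apply: Lmono hx; apply: leq_maxl|apply: Lmono hy; apply: leq_maxr].
  - by move=> x y hx [d hy]; exists d; case: (Lid d) => _ _ _; apply.
have [s [hs hsL]] := hN _ Linf.
(* The chain of the L d is exhausted at D, as finitely many generators of its union lie in L D. *)
have [D hD] : exists D, seqset s `<=` L D.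
  elim: s hs {hsL} => [|x s IH] hs; first by exists 0%N.
  have [D hD] : exists D, seqset s `<=` L D.
    by apply: IH => y hy; apply: hs; apply: (@mem_behead _ (x :: s)).
  have [d hd] := hs x (mem_head x s).
  exists (maxn d D) => y; rewrite /seqset /= inE => /orP[/eqP->|hy].
    by apply: Lmono hd; apply: leq_maxl.
  by apply: (Lmono D); [apply: leq_maxr|apply: hD].
have /choice[t ht] : forall d, exists t : seq {poly A},
    (forall P, P \in t -> V d P) /\ forall c, L d c -> pw S (seqset [seq (P : {poly A})`_d | P <- t]) 1 c.
  move=> d; have [u [hu huL]] := hN _ (Lid d).
  have /choice[f hf] : forall x, exists P, x \in u -> V d P /\ P`_d = x.
    move=> x; have [hx|hx] := boolP (x \in u); last by exists 0.
    by have [P hP] := hu x hx; exists P.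
  exists (map f u); split=> [P /mapP[x hx ->]|c /huL]; first by case: (hf x hx).
  apply: pw_mono => // x hx; rewrite /seqset /= -map_comp.
  by apply/mapP; exists x => //=; case: (hf x hx).
have spanV d (Q : {poly A}) (T' : seq {poly A}) : (forall P, P \in T' -> V d P) ->
    pw S (seqset [seq (P : {poly A})`_d | P <- T']) 1 Q`_d -> exists P : {poly A},
    [/\ forall i, S P`_i, (size P <= d.+1)%N, P`_d = Q`_d &
      pw (adjoin S a) (seqset [seq (P : {poly A}).[a] | P <- T']) 1 P.[a]].
  move=> hT; move: Q`_d => c hc; remember 1%N as one.
  elim: hc Heqone => // [d' b g hb _ hg [e]|d' e|d' x y _ IHx _ IHy e].
  - subst; have Sb := pw0P hS hb; case/mapP: hg => P hP ->.
    have [p1 p2 p3] := VC _ _ _ Sb (hT P hP).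
    exists (b%:P * P); split=> //; first by rewrite coefCM.
    rewrite hornerM hornerC; apply: pw_scale => //.
      exists b%:P; rewrite hornerC; split=> // i; rewrite coefC.
      by case: eqP => // _; apply: subring0.
    by apply: pw_gen => //; apply/mapP; exists P.
  - exists 0; rewrite size_poly0 coef0 horner0; split=> //; last exact: pw_zero.
    by move=> i; rewrite coef0; apply: subring0.
  - have [P [p1 p2 p3 p4]] := IHx e; have [P' [q1 q2 q3 q4]] := IHy e.
    exists (P - P'); split=> [i||| ].
    + by rewrite coefB; apply: sB.
    + by rewrite (leq_trans (size_polyD _ _)) // size_polyN geq_max p2.
    + by rewrite coefB p3 q3.
    + by rewrite hornerD hornerN; apply: pw_sub.
pose gens := flatten [seq [seq (P : {poly A}).[a] | P <- t d] | d <- iota 0 D.+1].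
have gensP d P : (d <= D)%N -> P \in t d -> P.[a] \in gens.
  move=> hd hP; apply/flattenP; exists [seq (P : {poly A}).[a] | P <- t d]; last by apply/mapP; exists P.
  by apply/mapP; exists d => //; rewrite mem_iota.
exists gens; split.
  move=> x /flattenP[_ /mapP[d _ ->] /mapP[P hP ->]].
  by case: (ht d) => /(_ P hP)[].
have sub_gens d : (d <= D)%N ->
    pw (adjoin S a) (seqset [seq (P : {poly A}).[a] | P <- t d]) 1 `<=` pw (adjoin S a) (seqset gens) 1.
  by move=> hd; apply: pw_mono => // x /mapP[P hP ->]; apply: gensP hP.
suff main n (P : {poly A}) : (forall i, S P`_i) -> (size P <= n)%N -> I P.[a] ->
    pw (adjoin S a) (seqset gens) 1 P.[a].
  by move=> x hx; have [P [hP ex]] := IS x hx; rewrite ex; apply: (main (size P)) => //; rewrite -ex.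
elim: n P => [|n IH] P hP hsz hI.
  by move: hsz; rewrite leqn0 size_poly_eq0 => /eqP->; rewrite horner0; apply: pw_zero.
have hLn : L n P`_n by exists P.
have [Q [q1 q2 q3 q4]] : exists Q : {poly A}, [/\ forall i, S Q`_i, (size Q <= n.+1)%N, Q`_n = P`_n &
    pw (adjoin S a) (seqset gens) 1 Q.[a]].
  have [hn|hn] := leqP n D.
    have [Q [q1 q2 q3 q4]] := spanV n P (t n) (ht n).1 ((ht n).2 _ hLn).
    by exists Q; split=> //; apply: (sub_gens n hn).
  have hLD : L D P`_n.
    have : pw S (seqset s) 1 P`_n by apply: hsL; exists n.
    case: (Lid D) => _ l0 lB lM h; remember 1%N as one.
    elim: h Heqone => // [d' b g hb _ hg [e]|d' x y _ IHx _ IHy e].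
      by subst; apply: lM; [apply: pw0P hb|apply: hD].
    by apply: lB; [apply: IHx|apply: IHy].
  have hh := (ht D).2 _ hLD.
  have [Q [q1 q2 q3 q4]] : exists P' : {poly A},
    [/\ forall i, S P'`_i, (size P' <= D.+1)%N, P'`_D = P`_n &
      pw (adjoin S a) (seqset [seq (P : {poly A}).[a] | P <- t D]) 1 P'.[a]].
    have := spanV D ((P`_n)%:P * 'X^D) (t D) (ht D).1.
    by rewrite coefCM coefXn eqxx mulr1 => /(_ hh).
  exists ('X^(n - D) * Q); split=> [i|||].
  - by rewrite coefXnM; case: ifP => // _; apply: subring0.
  - rewrite (leq_trans (size_polyMleq _ _)) // size_polyXn /= -ltnS.
    rewrite ltnS (leq_trans (_ : _ <= n - D + D.+1)%N) ?leq_add2l //.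
    by rewrite addnS subnK // ltnW.
  - by rewrite coefXnM ltnNge leq_subr /= subKn ?q3 // ltnW.
  - rewrite hornerM hornerXn; apply: pw_scale => //.
      exists 'X^(n - D); rewrite hornerXn; split=> // i.
      by rewrite coefXn; case: eqP => _ //; apply: subring0.
    exact: (sub_gens D (leqnn D)).
have hQI : I Q.[a].
  remember 1%N as one; elim: q4 Heqone => // [d' b g hb _ hg [e]|d' x y _ IHx _ IHy e].
    subst; apply: IM; first exact: pw0P hb.
    move: hg => /flattenP[_ /mapP[d _ ->] /mapP[R hR ->]].
    by case: (ht d) => /(_ R hR)[].
  by apply: IB; [apply: IHx|apply: IHy].
rewrite -[P](subrK Q) hornerD; apply: pwD => //; apply: IH.
- by move=> i; rewrite coefB; apply: sB.
- apply/leq_sizeP => j; rewrite leq_eqVlt => /orP[/eqP<-|hj].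
    by rewrite coefB q3 subrr.
  rewrite coefB; have /leq_sizeP -> // := hsz; have /leq_sizeP -> // := q2.
  by rewrite subrr.
- by rewrite hornerD hornerN; apply: IB.
Qed.

Lemma noetherian_fg s : noetherian (subring_gen (seqset s)).
Proof.
elim: s => [|a s IH].
  have -> : seqset [::] = set0 :> set A by apply/seteqP; split.
  exact: noetherian_int.
have -> : subring_gen (seqset (a :: s)) = adjoin (subring_gen (seqset s)) a.
  rewrite -adjoin_gen; last exact: subring_genP.
  have -> : seqset (a :: s) = [set a] `|` seqset s.
    by apply/seteqP; split=> x; rewrite /seqset /= inE => -[]; do ?[by left|by right];
      [move=> /orP[/eqP->|h]; [left|right]|move=> ->; rewrite eqxx|move=> ->; rewrite orbT].
  rewrite -subring_genU; congr subring_gen.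
  by apply/seteqP; split=> x [h|h]; [right|left|right|left].
by apply: noetherian_adjoin => //; apply: subring_genP.
Qed.

End Noether.

(** * Veronese subalgebras and saturation in high degrees *)

Section Veronese.
Variable A : comNzRingType.
Implicit Types (S G : set A) (gs : seq A).

Lemma pw1_ind S G (Q : A -> Prop) : is_subring S ->
  (forall b g, S b -> G g -> Q (b * g)) -> Q 0 ->
  (forall x y, Q x -> Q y -> Q (x - y)) -> forall x, pw S G 1 x -> Q x.
Proof.
move=> hS hM h0 hB x h; remember 1%N as d.
elim: h Heqd => // [d' a g ha _ hg e|d' a b _ IHa _ IHb e].
  by case: e ha => -> ha; apply: hM => //; apply: pw0P ha.
by apply: hB; [apply: IHa|apply: IHb].
Qed.

Fixpoint mons gs (e : nat) : seq A :=
  if e is e'.+1 then [seq m * g | m <- mons gs e', g <- gs] else [:: 1].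

Lemma mons_pw S gs e m : is_subring S -> m \in mons gs e -> pw S (seqset gs) e m.
Proof.
move=> hS; elim: e m => [|e IH] m /=.
  by rewrite inE => /eqP->; apply: pw_base; case: hS.
by case/allpairsP=> -[m' g] /= [/IH hm hg ->]; apply: pw_mulg.
Qed.

Lemma pw_mons S gs e x : is_subring S ->
  pw S (seqset gs) e x <-> pw S (seqset (mons gs e)) 1 x.
Proof.
move=> hS; split; last first.
  by move=> /(pw_trans hS (fun m hm => mons_pw hS hm)); rewrite mul1n.
elim=> [b hb|d a g _ IH hg|d|d a b _ IHa _ IHb].
- rewrite -[b]mulr1; apply: pw_scale => //; apply: pw_gen => //.
  by rewrite /seqset /= inE.
- move: a IH; apply: pw1_ind => // [b m hb hm||x' y hx hy].
  + rewrite -mulrA; apply: pw_mulg; first exact: pw_base.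
    by rewrite /seqset /=; apply/allpairsP; exists (m, g).
  + by rewrite mul0r; apply: pw_zero.
  + by rewrite mulrBl; apply: pw_sub.
- exact: pw_zero.
- exact: pw_sub.
Qed.

Lemma pw_veronese S gs e d x : is_subring S ->
  pw S (seqset (mons gs e)) d x <-> pw S (seqset gs) (d * e) x.
Proof.
move=> hS; split; first by apply: pw_trans => // g; apply: mons_pw.
elim: d x => [|d IH] x; first by move=> /(pw0P hS); apply: pw_base.
rewrite mulSn => /(pw_split hS); elim=> [_ [a [b [ha hb ->]]]||a b _ IHa _ IHb].
- rewrite -add1n; apply: pwM => //; last exact: IH.
  by apply/(pw_mons gs e a hS).
- exact: pw_zero.
- exact: pw_sub.
Qed.

End Veronese.

Section Saturation.
Variables (N : nat) (B : idomainType) (p : B).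
Hypothesis (p0 : p != 0).
Local Notation poly := {mpoly B[N]}.
Implicit Types (Sg : set B) (G : set poly) (f : poly) (s : B).

Definition polyS Sg : set poly := [set f | forall m, Sg f@_m].

Lemma polyS_subring Sg : is_subring Sg -> is_subring (polyS Sg).
Proof.
move=> hS; case: (hS) => h1 hB hM; split.
- move=> m; rewrite mcoeff1; case: eqP => _ //; exact: subring0.
- by move=> f g hf hg m; rewrite mcoeffB; apply: hB.
- by move=> f g hf hg m; rewrite mcoeffM; apply: subring_sum => // k _; apply: hM.
Qed.

Lemma polyS_mono Sg Sg' : Sg `<=` Sg' -> polyS Sg `<=` polyS Sg'.
Proof. by move=> h f hf m; apply: h. Qed.

Lemma polyS_const Sg c : is_subring Sg -> Sg c -> polyS Sg c%:MP.
Proof.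
move=> hS hc m; rewrite mcoeffC; case: eqP => _; rewrite ?mulr1 ?mulr0 //.
exact: subring0.
Qed.

Lemma polyS_X Sg i : is_subring Sg -> polyS Sg 'X_i.
Proof.
move=> hS m; rewrite mcoeffX; case: eqP => _; last exact: subring0.
by case: hS.
Qed.

Lemma polyS_fg (sg : seq B) : polyS (subring_gen (seqset sg)) =
  subring_gen (seqset ([seq (c%:MP : poly) | c <- sg] ++ [seq ('X_i : poly) | i <- enum 'I_N])).
Proof.
set R := subring_gen (seqset (_ ++ _)).
have hR : is_subring R by exact: subring_genP.
have hS : is_subring (subring_gen (seqset sg)) by exact: subring_genP.
apply/seteqP; split.
  have hc c : subring_gen (seqset sg) c -> R c%:MP.
    move: c; have hpre : is_subring [set c : B | R c%:MP].
      exact: (subring_preimage (@mpolyC N B) hR).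
    suff h : subring_gen (seqset sg) `<=` [set c : B | R c%:MP] by move=> c; apply: h.
    apply: (subring_gen_min hpre) => c hc; apply: sub_subring_gen.
    by rewrite /seqset /= mem_cat; apply/orP; left; apply/mapP; exists c.
  have hX i : R 'X_i.
    apply: sub_subring_gen; rewrite /seqset /= mem_cat; apply/orP; right.
    by apply/mapP; exists i; rewrite ?mem_enum.
  move=> f hf; rewrite [f]mpolyE; apply: (subring_sum _ hR) => m _.
  rewrite -mul_mpolyC mpolyXE_id; case: (hR) => _ _; apply; first exact: (hc _ (hf m)).
  apply: (subring_prod _ hR) => i _; exact: (subringX _ hR (hX i)).
apply: (subring_gen_min (polyS_subring hS)) => f.
rewrite /seqset /= mem_cat => /orP[/mapP[c hc ->]|/mapP[i _ ->]]; last exact: polyS_X.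
by apply: polyS_const => //; apply: sub_subring_gen.
Qed.

Lemma rees_fg (T : set poly) (ts gs : seq poly) : T = subring_gen (seqset ts) ->
  subring_gen ([set c%:P | c in T] `|` [set c *: 'X | c in seqset gs]) =
  subring_gen (seqset ([seq c%:P | c <- ts] ++ [seq g *: 'X | g <- gs])).
Proof.
move=> ->; set R := subring_gen (seqset (_ ++ _)).
have hR : is_subring R by exact: subring_genP.
apply/seteqP; split.
  apply: (subring_gen_min hR) => _ [] [c hc <-].
    have hpre : is_subring [set c : poly | R c%:P].
      exact: (subring_preimage (@polyC poly) hR).
    move: c hc; suff h : subring_gen (seqset ts) `<=` [set c : poly | R c%:P] by move=> c; apply: h.
    apply: (subring_gen_min hpre) => c hc; apply: sub_subring_gen.
    by rewrite /seqset /= mem_cat; apply/orP; left; apply/mapP; exists c.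
  apply: sub_subring_gen.
  by rewrite /seqset /= mem_cat; apply/orP; right; apply/mapP; exists c.
apply: (subring_gen_min (subring_genP _)) => f.
rewrite /seqset /= mem_cat => /orP[/mapP[c hc ->]|/mapP[g hg ->]]; apply: sub_subring_gen.
  by left; exists c => //; apply: sub_subring_gen.
by right; exists g.
Qed.

(** This is Sg[1/s] when s is a unit of B, written without inverses. *)
Definition locz Sg s : set B := [set b | exists n, Sg (s ^+ n * b)].

Lemma locz_sub Sg s : Sg `<=` locz Sg s.
Proof. by move=> b hb; exists 0%N; rewrite expr0 mul1r. Qed.

Lemma locz_subring Sg s : is_subring Sg -> Sg s -> is_subring (locz Sg s).
Proof.
move=> hS hs; case: (hS) => h1 hB hM.
have hX n : Sg (s ^+ n) by apply: subringX.
split; first exact: locz_sub.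
  move=> a b [n ha] [m hb]; exists (n + m)%N.
  have -> : s ^+ (n + m) * (a - b) = s ^+ m * (s ^+ n * a) - s ^+ n * (s ^+ m * b).
    by rewrite exprD; ring.
  by apply: hB; apply: hM.
move=> a b [n ha] [m hb]; exists (n + m)%N.
have -> : s ^+ (n + m) * (a * b) = (s ^+ n * a) * (s ^+ m * b) by rewrite exprD; ring.
exact: hM.
Qed.

Lemma locz_gen (sg : seq B) s : s \is a GRing.unit -> subring_gen (seqset sg) s ->
  locz (subring_gen (seqset sg)) s = subring_gen (seqset (s^-1 :: sg)).
Proof.
move=> us hs; have hS := subring_genP (seqset sg); have hS' := subring_genP (seqset (s^-1 :: sg)).
have sub : subring_gen (seqset sg) `<=` subring_gen (seqset (s^-1 :: sg)).
  apply: (subring_gen_min hS') => b hb; apply: sub_subring_gen.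
  by rewrite /seqset /= inE; apply/orP; right.
apply/seteqP; split=> [b [n hb]|].
  have -> : b = s^-1 ^+ n * (s ^+ n * b) by rewrite mulrA -exprMn mulVr // expr1n mul1r.
  case: (hS') => _ _; apply; last exact: sub.
  apply: (subringX _ hS'); apply: sub_subring_gen.
  by rewrite /seqset /= inE eqxx.
apply: (subring_gen_min (locz_subring hS hs)) => b.
rewrite /seqset /= inE => /orP[/eqP->|hb]; last by apply: locz_sub; apply: sub_subring_gen.
by exists 1%N; rewrite expr1 divrr //; case: hS.
Qed.

Lemma pw_locz Sg s G d f : is_subring Sg -> Sg s ->
  pw (polyS (locz Sg s)) G d f -> exists n, pw (polyS Sg) G d ((s ^+ n)%:MP * f).
Proof.
move=> hS hs; have hX n : polyS Sg (s ^+ n)%:MP.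
  by apply: polyS_const => //; apply: subringX.
have hP := polyS_subring hS.
elim=> [b hb|e a g _ [n IH] hg|e|e a b _ [n IHa] _ [m IHb]].
- suff [n hn] : exists n, forall m, m \in msupp b -> Sg (s ^+ n * b@_m).
    exists n; apply: pw_base => m; rewrite mul_mpolyC mcoeffZ.
    have [/hn//|] := boolP (m \in msupp b); rewrite mcoeff_msupp negbK => /eqP->.
    by rewrite mulr0; apply: subring0.
  elim: (msupp b) => [|m t [n hn]]; first by exists 0%N.
  have [k hk] := hb m; exists (n + k)%N => m'.
  rewrite inE exprD => /orP[/eqP->|/hn h]; case: (hS) => _ _ hM.
    by rewrite -mulrA; apply: hM => //; apply: subringX.
  by rewrite mulrAC mulrC; apply: hM => //; apply: subringX.
- by exists n; rewrite mulrA; apply: pw_mulg.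
- by exists 0%N; rewrite mulr0; apply: pw_zero.
- exists (n + m)%N; rewrite exprD mpolyCM mulrBr; apply: pw_sub.
    by rewrite -mulrA mulrCA; apply: pw_scale.
  by rewrite -mulrA; apply: pw_scale.
Qed.

(** In degree d, divisibility by p in B[x] is divisibility inside the Rees algebra over Sg[x]; this
    makes p generate the kernel of reduction in that degree. *)
Definition saturated Sg G d := forall f f0, pw (polyS Sg) G d f -> f = p%:MP * f0 ->
  exists2 f', pw (polyS Sg) G d f' & f = p%:MP * f'.

Lemma mpolyC_unit s : s \is a GRing.unit -> s^-1%:MP * s%:MP = 1 :> poly.
Proof. by move=> us; rewrite -mpolyCM mulVr // mpolyC1. Qed.

Lemma saturated_locz Sg G s d : is_subring Sg -> Sg s -> s \is a GRing.unit ->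
  saturated Sg G d -> saturated (locz Sg s) G d.
Proof.
move=> hS hs us h f f0 hf ef; have [n hn] := pw_locz hS hs hf.
have [f' hf' e] : exists2 f', pw (polyS Sg) G d f' & (s ^+ n)%:MP * f = p%:MP * f'.
  by apply: (h _ ((s ^+ n)%:MP * f0)) => //; rewrite ef mulrCA.
have us' : s ^+ n \is a GRing.unit by rewrite unitrX.
exists ((s ^+ n)^-1%:MP * f'); last first.
  by rewrite mulrCA -e mulrA mpolyC_unit // mul1r.
have hL := locz_subring hS hs.
apply: (pw_scale (polyS_subring hL)).
  apply: polyS_const => //; exists n; rewrite divrr //; by case: hS.
by apply: pw_mono hf' => //; apply: polyS_mono; apply: locz_sub.
Qed.

Variable sg : seq B.
Local Notation Sg := (subring_gen (seqset sg)).
Let hS : is_subring Sg. Proof. exact: subring_genP. Qed.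
Let hP : is_subring (polyS Sg). Proof. exact: polyS_subring. Qed.
Hypothesis hfr : forall b : B, exists s, [/\ Sg s, s \is a GRing.unit & Sg (s * b)].

Lemma clear_denom (bs : seq B) : exists s, [/\ Sg s, s \is a GRing.unit &
  forall b, b \in bs -> Sg (s * b)].
Proof.
case: (hS) => h1 _ hM; elim: bs => [|b bs [s [hs us hb]]].
  by exists 1; rewrite unitr1.
have [t [ht ut hb']] := hfr b; exists (s * t); rewrite unitrM us ut; split=> //.
  exact: hM.
move=> c; rewrite inE => /orP[/eqP->|/hb hc].
  by rewrite -mulrA; apply: hM.
by rewrite mulrAC mulrC; apply: hM.
Qed.

Lemma pw_clear G d f : pw [set: poly] G d f -> exists s,
  [/\ Sg s, s \is a GRing.unit & pw (polyS Sg) G d (s%:MP * f)].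
Proof.
case: (hS) => h1 _ hM.
elim=> [b _|e a g _ [s [hs us IH]] hg|e|e a b _ [s [hs us IHa]] _ [t [ht ut IHb]]].
- have [s [hs us hb]] := clear_denom [seq b@_m | m <- msupp b].
  exists s; split=> //; apply: pw_base => m; rewrite mul_mpolyC mcoeffZ.
  have [hm|] := boolP (m \in msupp b); first by apply: hb; apply/mapP; exists m.
  by rewrite mcoeff_msupp negbK => /eqP->; rewrite mulr0; apply: subring0.
- by exists s; split=> //; rewrite mulrA; apply: pw_mulg.
- by exists 1; rewrite unitr1 mulr0; split=> //; apply: pw_zero.
- exists (s * t); rewrite unitrM us ut; split=> //; first exact: hM.
  rewrite mpolyCM mulrBr; apply: pw_sub.
    by rewrite -mulrA mulrCA; apply: pw_scale => //; apply: polyS_const.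
  by rewrite -mulrA; apply: pw_scale => //; apply: polyS_const.
Qed.

Variable gs : seq poly.
Hypothesis htors : torsion_free_eventually p (seqset gs).

Let kills s E d f := forall m, pw (polyS Sg) (seqset gs) E m ->
  exists2 f', pw (polyS Sg) (seqset gs) (d + E) f' & s%:MP * (m * f) = p%:MP * f'.

Let kills_le s E d f t k : Sg t -> kills s E d f -> kills (s * t) (E + k) d f.
Proof.
move=> ht h m /(pw_split hP); elim=> [_ [a [b [ha hb ->]]]||a b _ [a' ha ea] _ [b' hb eb]].
- have [f' hf' e] := h a ha; exists (t%:MP * (f' * b)).
    apply: pw_scale => //; first exact: polyS_const.
    by rewrite addnA; apply: pwM.
  have -> : (s * t)%:MP * (a * b * f) = t%:MP * b * (s%:MP * (a * f)).
    by rewrite mpolyCM; ring.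
  by rewrite e; ring.
- by exists 0; [apply: pw_zero|rewrite mul0r !mulr0].
- by exists (a' - b'); [apply: pw_sub|rewrite mulrBl mulrBr ea eb mulrBr].
Qed.

Let kills_one d f f0 : pw (polyS Sg) (seqset gs) d f -> f = p%:MP * f0 ->
  exists s E, [/\ Sg s, s \is a GRing.unit & kills s E d f].
Proof.
move=> hf ef; case: (hS) => h1 _ hM.
have hf' : pw [set: poly] (seqset gs) d f by apply: pw_mono hf.
have [E hE] := htors hf' ef.
suff [s [hs us hk]] : exists s, [/\ Sg s, s \is a GRing.unit &
    forall m, m \in mons gs E ->
    exists2 f', pw (polyS Sg) (seqset gs) (d + E) f' & s%:MP * (m * f) = p%:MP * f'].
  exists s, E; split=> // m0 /(pw_mons _ _ _ hP); move: m0.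
  apply: (pw1_ind hP) => [b g hb hg||x y [a' ha ea] [b' hb eb]].
  - have [f' hf2 e2] := hk g hg; exists (b * f'); first exact: pw_scale.
    by rewrite -[b * g * f]mulrA mulrCA e2 mulrCA.
  - by exists 0; [apply: pw_zero|rewrite mul0r !mulr0].
  - by exists (a' - b'); [apply: pw_sub|rewrite mulrBl mulrBr ea eb mulrBr].
have hmT m : m \in mons gs E -> pw [set: poly] (seqset gs) E m by apply: mons_pw.
elim: (mons gs E) hmT => [|m ms IH] hmT; first by exists 1; rewrite unitr1.
have [s [hs us hk]] := IH (fun m hm => hmT m (mem_behead (s := _ :: _) hm)).
have [f' hf1 e] := hE m (hmT m (mem_head m ms)).
have [t [ht ut hf2]] := pw_clear hf1.
exists (s * t); rewrite unitrM us ut; split=> //; first exact: hM.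
move=> m'; rewrite inE => /orP[/eqP->|/hk[f2 hf3 e3]].
  exists (s%:MP * (t%:MP * f')); first by apply: pw_scale => //; apply: polyS_const.
  by rewrite e mpolyCM; ring.
exists (t%:MP * f2); first by apply: pw_scale => //; apply: polyS_const.
have -> : (s * t)%:MP * (m' * f) = t%:MP * (s%:MP * (m' * f)) by rewrite mpolyCM; ring.
by rewrite e3; ring.
Qed.

Let kills_poly (F : {poly poly}) :
  (forall d, pw (polyS Sg) (seqset gs) d F`_d) -> (forall d, exists f0, F`_d = p%:MP * f0) ->
  exists s E, [/\ Sg s, s \is a GRing.unit & forall d, kills s E d F`_d].
Proof.
move=> hF hp; case: (hS) => h1 _ hM.
suff [s [E [hs us hk]]] : exists s E, [/\ Sg s, s \is a GRing.unit &
    forall d, (d < size F)%N -> kills s E d F`_d].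
  exists s, E; split=> // d; have [hd|hd] := ltnP d (size F); first exact: hk.
  by rewrite nth_default // => m _; exists 0; rewrite ?mulr0 //; apply: pw_zero.
elim: (size F) => [|n [s [E [hs us hk]]]]; first by exists 1, 0%N; rewrite unitr1.
have [f0 ef] := hp n; have [t [E' [ht ut hk']]] := kills_one (hF n) ef.
exists (s * t), (E + E')%N; rewrite unitrM us ut; split=> //; first exact: hM.
move=> d; rewrite ltnS leq_eqVlt => /orP[/eqP->|/hk h]; last exact: kills_le.
by rewrite mulrC addnC; apply: kills_le.
Qed.

(** The elements of the Rees algebra that are divisible by p over B form an ideal, finitely
    generated by Hilbert's theorem. For each generator F, s G^E F is p times elements of the Rees
    algebra, where s clears denominators from B. If D bounds the degrees of the generators, an
    element of degree at least D + E is a combination of them with coefficients of degrees at least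
    E. *)
Lemma saturate : exists s d0, [/\ Sg s, s \is a GRing.unit &
  forall d, (d0 <= d)%N -> saturated (locz Sg s) (seqset gs) d].
Proof.
case: (hS) => h1 _ hM.
suff [s [d0 [hs us hk]]] : exists s d0, [/\ Sg s, s \is a GRing.unit &
    forall d f f0, (d0 <= d)%N -> pw (polyS Sg) (seqset gs) d f -> f = p%:MP * f0 ->
    exists2 f', pw (polyS Sg) (seqset gs) d f' & s%:MP * f = p%:MP * f'].
  exists s, d0; split=> // d hd f f0 hf ef; have hL := locz_subring hS hs.
  have [n hn] := pw_locz hS hs hf.
  have [f' hf' e] : exists2 f', pw (polyS Sg) (seqset gs) d f' &
      s%:MP * ((s ^+ n)%:MP * f) = p%:MP * f'.
    by apply: (hk _ _ ((s ^+ n)%:MP * f0) hd hn); rewrite ef mulrCA.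
  have us' : s ^+ n.+1 \is a GRing.unit by rewrite unitrX.
  exists ((s ^+ n.+1)^-1%:MP * f'); last first.
    rewrite mulrCA -e [s%:MP * _]mulrA -mpolyCM -exprS mulrA mpolyC_unit //.
    by rewrite mul1r.
  apply: (pw_scale (polyS_subring hL)).
    by apply: polyS_const => //; exists n.+1; rewrite divrr.
  by apply: pw_mono hf' => //; apply: polyS_mono; apply: locz_sub.
pose R := subring_gen ([set c%:P | c in polyS Sg] `|` [set c *: 'X | c in seqset gs]).
have hR : is_subring R by exact: subring_genP.
have RP F : R F <-> forall d, pw (polyS Sg) (seqset gs) d F`_d by apply: rees_coef.
have hN : noetherian R by rewrite /R (rees_fg _ (polyS_fg sg)); apply: noetherian_fg.
pose I : set {poly poly} := [set F | R F /\ forall d, exists f0, F`_d = p%:MP * f0].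
have [|Fs [hFs hI]] := hN I.
  split.
  - by move=> F [].
  - split; first exact: subring0.
    by move=> d; exists 0; rewrite coef0 mulr0.
  - move=> F F' [hF hp] [hF' hp']; split; first by case: hR => _ + _; apply.
    by move=> d; have [x ex] := hp d; have [y ey] := hp' d; exists (x - y);
      rewrite coefB ex ey mulrBr.
  - move=> F F' hF [hF' hp']; split; first by case: hR => _ _; apply.
    have /choice[q hq] := hp'; move=> d; exists (\sum_(j < d.+1) F`_j * q (d - j)%N).
    by rewrite coefM mulr_sumr; apply: eq_bigr => j _; rewrite hq mulrCA.
have [s [E [hs us hk]]] : exists s E, [/\ Sg s, s \is a GRing.unit &
    forall F, F \in Fs -> forall d, kills s E d F`_d].
  elim: Fs hFs {hI} => [|F Fs IH] hFs; first by exists 1, 0%N; rewrite unitr1.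
  have [s [E [hs us hk]]] := IH (fun F hF => hFs F (mem_behead (s := _ :: _) hF)).
  have [/RP hF hp] := hFs F (mem_head F Fs).
  have [t [E' [ht ut hk']]] := kills_poly hF hp.
  exists (s * t), (E + E')%N; rewrite unitrM us ut; split=> //; first exact: hM.
  move=> F'; rewrite inE => /orP[/eqP->|/hk h] d; last exact: kills_le.
  by rewrite mulrC addnC; apply: kills_le.
pose D := \max_(F <- Fs) size F.
exists s, (D + E)%N; split=> // d f f0 hd hf ef.
have hfI : I (f *: 'X^d).
  split; first (apply/RP => e; rewrite coefZ coefXn; case: eqP => [->|_]).
  - by rewrite mulr1.
  - by rewrite mulr0; apply: pw_zero.
  - move=> e; rewrite coefZ coefXn; case: eqP => _; rewrite ?mulr1 ?mulr0.
      by exists f0.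
    by exists 0; rewrite mulr0.
suff : exists2 f', pw (polyS Sg) (seqset gs) d f' &
    s%:MP * (f *: 'X^d)`_d = p%:MP * f' by rewrite coefZ coefXn eqxx mulr1.
have := hI _ hfI; move: (f *: 'X^d); apply: (pw1_ind hR) => [r F hr hF||x y [x' hx ex] [y' hy ey]].
- rewrite coefM mulr_sumr; elim/big_ind: _ => [|x y [x' hx ex] [y' hy ey]|j _].
  + by exists 0; rewrite ?mulr0 //; apply: pw_zero.
  + by exists (x' + y'); [apply: pwD|rewrite ex ey mulrDr].
  have [hj|hj] := leqP (size F) (d - j).
    by rewrite (nth_default _ hj) !mulr0; exists 0; rewrite ?mulr0 //; exact: pw_zero.
  have hsz : (size F <= D)%N by apply: leq_bigmax_seq.
  have hjE : (E <= j)%N by have := ltn_ord j; lia.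
  have := (RP r).1 hr j; rewrite -{1}(subnKC hjE) => /(pw_split hP).
  elim=> [_ [a [b [ha hb ->]]]||a b _ [a' ha ea] _ [b' hb eb]].
  * have [f' hf' e2] := hk F hF (d - j)%N a ha; exists (f' * b).
      have -> : d = (d - j + E + (j - E))%N by have := ltn_ord j; lia.
      exact: pwM.
    have -> : s%:MP * (a * b * F`_(d - j)) = b * (s%:MP * (a * F`_(d - j))) by ring.
    by rewrite e2; ring.
  * by exists 0; [apply: pw_zero|rewrite mul0r !mulr0].
  * by exists (a' - b'); [apply: pw_sub|rewrite mulrBl mulrBr ea eb mulrBr].
- by exists 0; rewrite ?coef0 ?mulr0 //; apply: pw_zero.
- by exists (x' - y'); [apply: pw_sub|rewrite coefB mulrBr ex ey mulrBr].
Qed.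

End Saturation.

(** * Extending compatible skeletons of the base fields *)

Definition hom_on (R R' : comNzRingType) (S : set R) (phi : R -> R') :=
  [/\ phi 1 = 1, (forall a b, S a -> S b -> phi (a - b) = phi a - phi b)
    & (forall a b, S a -> S b -> phi (a * b) = phi a * phi b)].

Section SubringType.
Variables (L : fieldType) (S : set L) (hS : is_subring S).

Definition in_subring of is_subring S : {pred L} := fun x => `[< S x >].

Lemma in_subring_closed : subring_closed (in_subring hS).
Proof.
case: (hS) => h1 hB hM; split; first exact/asboolP.
  by move=> x y /asboolP hx /asboolP hy; apply/asboolP/hB.
by move=> x y /asboolP hx /asboolP hy; apply/asboolP/hM.
Qed.

HB.instance Definition _ :=
  GRing.isSubringClosed.Build L (in_subring hS) in_subring_closed.

(** A subring given as a set becomes a domain in its own right, so that statements about an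
    arbitrary coefficient domain apply to it. *)
Record subring_type := SubringElt {sval : L; _ : sval \in in_subring hS}.
HB.instance Definition _ := [isSub for sval].
HB.instance Definition _ := [Choice of subring_type by <:].
HB.instance Definition _ := [SubChoice_isSubComNzRing of subring_type by <:].

Lemma svalP (x : subring_type) : S (sval x).
Proof. exact/asboolP/(valP x). Qed.

Definition mksub (x : L) (hx : S x) : subring_type := SubringElt (introT (asboolP (S x)) hx).

Definition subring_unit : {pred subring_type} := fun x => (sval x != 0) && `[< S (sval x)^-1 >].

Definition subring_inv (x : subring_type) : subring_type :=
  if pselect (S (sval x)^-1) is left h then
    if sval x == 0 then x else mksub h else x.

Lemma subring_mulVx : {in subring_unit, left_inverse 1 subring_inv *%R}.
Proof.
move=> x; rewrite -topredE /= /subring_unit => /andP[x0 /asboolP hx]; apply: val_inj => /=.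
by rewrite /subring_inv; case: pselect => // h; rewrite (negbTE x0) /= mulVf.
Qed.

Lemma subring_unitPl x y : y * x = 1 -> subring_unit x.
Proof.
move=> /(congr1 val); rewrite rmorphM rmorph1 /= => e; apply/andP.
have x0 : sval x != 0 by apply: contra_eq_neq e => ->; rewrite mulr0 eq_sym oner_neq0.
split=> //; apply/asboolP; have -> : (sval x)^-1 = sval y by rewrite -[RHS](mulfK x0) e mul1r.
exact: svalP.
Qed.

Lemma subring_inv_out : {in [predC subring_unit], subring_inv =1 id}.
Proof.
move=> x; rewrite inE /= -topredE /= /subring_unit negb_and negbK /subring_inv.
by case: pselect => // h /orP[->//|/asboolP].
Qed.

HB.instance Definition _ := GRing.ComNzRing_hasMulInverse.Build subring_type
  subring_mulVx subring_unitPl subring_inv_out.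

Lemma subring_integral : GRing.integral_domain_axiom subring_type.
Proof.
move=> x y /(congr1 val); rewrite rmorphM rmorph0 /= => /eqP; rewrite mulf_eq0.
by case/orP=> /eqP e; apply/orP; [left|right]; apply/eqP/val_inj; rewrite rmorph0.
Qed.

HB.instance Definition _ := GRing.ComUnitRing_isIntegral.Build subring_type subring_integral.

Definition subring_val : subring_type -> L := val.
HB.instance Definition _ := GRing.RMorphism.copy subring_val (val : subring_type -> L).

Lemma subring_val_inj : injective subring_val. Proof. exact: val_inj. Qed.

Section Hom.
Variables (F : fieldType) (phi : L -> F).

Hypothesis (hphi : hom_on S phi).
Definition subring_hom of hom_on S phi := fun x : subring_type => phi (sval x).

Lemma subring_hom_zmod : zmod_morphism (subring_hom hphi).
Proof. by have [_ hB _] := hphi => x y; apply: hB; apply: svalP. Qed.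
Lemma subring_hom_monoid : monoid_morphism (subring_hom hphi).
Proof. by have [h1 _ hM] := hphi; split=> // x y; apply: hM; apply: svalP. Qed.
HB.instance Definition _ := GRing.isZmodMorphism.Build _ _ (subring_hom hphi) subring_hom_zmod.
HB.instance Definition _ := GRing.isMonoidMorphism.Build _ _ (subring_hom hphi) subring_hom_monoid.

End Hom.
End SubringType.

Lemma hom_on_image (R L F : comNzRingType) (ev : {rmorphism R -> L})
  (ev' : {rmorphism R -> F}) : (forall x, ev x = 0 -> ev' x = 0) ->
  exists2 phi : L -> F, hom_on (range ev) phi & forall x, phi (ev x) = ev' x.
Proof.
move=> hk; have hc y : exists b, (exists2 x, ev x = y & b = ev' x) \/ ~ range ev y.
  have [[x _ <-]|h] := pselect (range ev y); last by exists 0; right.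
  by exists (ev' x); left; exists x.
have /choice[phi hphi] := hc.
have e x : phi (ev x) = ev' x.
  case: (hphi (ev x)) => [[x' e ->]|[]]; last by exists x.
  by apply/eqP; rewrite -subr_eq0 -rmorphB /= hk // rmorphB /= e subrr.
exists phi => //; split; first by rewrite -(rmorph1 ev) e rmorph1.
  by move=> _ _ [a _ <-] [b _ <-]; rewrite -rmorphB !e rmorphB.
by move=> _ _ [a _ <-] [b _ <-]; rewrite -rmorphM !e rmorphM.
Qed.

(** * Extending a residue morphism by one element *)

Section Residue.
Variables (T : idomainType) (k : fieldType) (r : {rmorphism T -> k}) (p : T).
Hypotheses (p0 : p != 0) (rp : r p = 0).
Hypothesis hker : forall a, r a = 0 -> exists b, a = p * b.
Hypothesis hsep : forall a, (forall n, exists b, a = p ^+ n * b) -> a = 0.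
Implicit Types (f g h q : {poly T}) (s u v : T).
Local Notation "f ^r" := (map_poly r f) (at level 2, format "f ^r").

Lemma poly_ker f : f^r = 0 -> exists g, f = p *: g.
Proof.
move=> hf; have hc i : exists b, f`_i = p * b.
  by apply: hker; have := congr1 (coefp i) hf; rewrite /= coef_map coef0.
have /choice[b hb] := hc; exists (\poly_(i < size f) b i).
apply/polyP => i; rewrite coefZ coef_poly; case: ltnP => hi; first exact: hb.
by rewrite nth_default ?mulr0.
Qed.

Lemma poly_sep f : (forall n, exists g, f = p ^+ n *: g) -> f = 0.
Proof.
move=> hf; apply/polyP => i; rewrite coef0; apply: hsep => n.
by have [g ->] := hf n; exists g`_i; rewrite coefZ.
Qed.

(** Separatedness bounds the power of p that divides f, and the last quotient is not killed by r.
    This is the content, obtained without a valuation. *)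
Lemma poly_content f : f != 0 -> exists n g, f = p ^+ n *: g /\ g^r != 0.
Proof.
move=> f0.
have /existsNP[n hn] : ~ forall n, exists g, f = p ^+ n *: g.
  by move=> /poly_sep/eqP; rewrite (negbTE f0).
elim: n hn => [|n IH] hn; first by case: hn; exists f; rewrite expr0 scale1r.
have [[g e]|/IH//] := pselect (exists g, f = p ^+ n *: g).
exists n, g; split=> //; apply/eqP => /poly_ker[g' e']; apply: hn; exists g'.
by rewrite e e' scalerA -exprSr.
Qed.

Lemma elt_content u : u != 0 -> exists n v, u = p ^+ n * v /\ r v != 0.
Proof.
rewrite -polyC_eq0 => /poly_content[n [g [e g0]]]; exists n, g`_0.
have e0 := congr1 (coefp 0) e; rewrite /= coefC eqxx coefZ in e0; split=> //.
apply: contraNneq g0 => g0; apply/eqP/polyP => i; rewrite coef0 coef_map /=.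
case: i => [//|i]; have := congr1 (coefp i.+1) e; rewrite /= coefC /= coefZ => /esym/eqP.
by rewrite mulf_eq0 expf_eq0 (negbTE p0) andbF /= => /eqP->; rewrite rmorph0.
Qed.

Lemma unit_cancel s n u v : r s != 0 -> s * u = p ^+ n * v -> exists w, u = p ^+ n * w.
Proof.
move=> s0; elim: n u v => [|n IH] u v e; first by exists u; rewrite expr0 mul1r.
have [u' eu] : exists u', u = p * u'.
  apply: hker; have := congr1 r e; rewrite !rmorphM rmorphXn /= rp expr0n /= mul0r => /eqP.
  by rewrite mulf_eq0 (negbTE s0) => /eqP.
have [w ew] : exists w, u' = p ^+ n * w.
  by apply: (IH _ v); apply: (mulfI p0); rewrite mulrCA -eu e exprS mulrA.
by exists w; rewrite eu ew mulrA -exprS.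
Qed.

Section Extend.
Variables (L : fieldType) (iota : {rmorphism T -> L}) (iota_inj : injective iota).
Variables (t : L) (a : k).
Local Notation "f ^i" := (map_poly iota f) (at level 2, format "f ^i").

(** What makes T[t] satisfy the same conditions as T, with t sent to a: the map is well defined, p
    generates its kernel, and T[t] is separated for p. *)
Definition ext_spec := [/\ forall f, f^i.[t] = 0 -> f^r.[a] = 0,
  (forall f, f^r.[a] = 0 -> exists g, f^i.[t] = iota p * g^i.[t])
  & forall f, (forall n, exists g, f^i.[t] = iota p ^+ n * g^i.[t]) -> f^i.[t] = 0].

Lemma ext_transcendental : (forall f, f^i.[t] = 0 -> f = 0) ->
  (forall f, f^r.[a] = 0 -> f^r = 0) -> ext_spec.
Proof.
move=> ht ha; split=> [f /ht ->|f /ha /poly_ker[g ->]|f hf].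
- by rewrite rmorph0 horner0.
- by exists g; rewrite map_polyZ hornerZ.
suff -> : f = 0 by rewrite rmorph0 horner0.
apply: poly_sep => n; have [g e] := hf n; exists g; apply/eqP; rewrite -subr_eq0; apply/eqP.
by apply: ht; rewrite rmorphB /= hornerD hornerN map_polyZ hornerZ rmorphXn e subrr.
Qed.

(** An element of T[1/s] is u / s^n with u in T, and the three conditions pass to u because s is
    prime to p ([unit_cancel]). *)
Lemma ext_inv s : r s != 0 -> t = (iota s)^-1 -> a = (r s)^-1 -> ext_spec.
Proof.
move=> rs et ea; have s0 : s != 0 by apply: contraNneq rs => ->; rewrite rmorph0.
have is0 : iota s != 0 by rewrite -(rmorph0 iota) (inj_eq iota_inj).
have hX n : s ^+ n != 0 by rewrite expf_neq0.
have key f : exists n u, f^i.[t] = iota u / iota s ^+ n /\ f^r.[a] = r u / r s ^+ n.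
  elim/poly_ind: f => [|f c [n [u [e1 e2]]]].
    by exists 0%N, 0; rewrite !rmorph0 !horner0 !mul0r.
  exists n.+1, (u + c * s ^+ n.+1).
  rewrite !rmorphD !rmorphM /= !map_polyX !map_polyC /= !hornerMXaddC e1 e2 et ea.
  by rewrite !rmorphXn /= !mulrDl !mulfK ?expf_neq0 // !exprSr !invfM !mulrA.
have tX n : t ^+ n = (iota s ^+ n)^-1 by rewrite et exprVn.
have cmp f g n : f^i.[t] = iota p ^+ n * g^i.[t] ->
    forall m u, f^i.[t] = iota u / iota s ^+ m -> exists w, u = p ^+ n * w.
  move=> e m u e1; have [l [v [e2 _]]] := key g.
  apply: (@unit_cancel (s ^+ l) n u (v * s ^+ m)).
    by rewrite rmorphXn expf_neq0.
  apply: iota_inj; rewrite !rmorphM !rmorphXn /=.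
  move: e; rewrite e1 e2 mulrA => /eqP; rewrite eqr_div ?expf_neq0 // => /eqP e.
  by rewrite mulrC e mulrA.
split=> f.
- have [n [u [-> ->]]] := key f; move=> /eqP; rewrite mulf_eq0 invr_eq0 expf_eq0 (negbTE is0).
  by rewrite andbF orbF -(rmorph0 iota) (inj_eq iota_inj) => /eqP->; rewrite rmorph0 mul0r.
- have [n [u [e ->]]] := key f; move=> /eqP; rewrite mulf_eq0 invr_eq0 expf_eq0 (negbTE rs).
  rewrite andbF orbF => /eqP/hker[v ev]; exists (v *: 'X^n).
  by rewrite map_polyZ hornerZ map_polyXn hornerXn tX e ev rmorphM mulrA.
- move=> hf; have [m [u [e _]]] := key f.
  suff u0 : u = 0 by rewrite e u0 rmorph0 mul0r.
  by apply: hsep => n; have [g eg] := hf n; apply: (cmp _ _ _ eg _ _ e).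
Qed.

Lemma poly_unit_cancel n c f q h : h^r != 0 -> (p ^+ n * c) *: f = q * h ->
  exists q', c *: f = q' * h.
Proof.
move=> h0; elim: n q => [|n IH] q e; first by exists q; rewrite -e expr0 mul1r.
have /poly_ker[q' eq'] : q^r = 0.
  apply/eqP; have /eqP := congr1 (map_poly r) e.
  rewrite exprS -mulrA map_polyZ /= !rmorphM /= rp !mul0r scale0r eq_sym mulf_eq0 (negbTE h0).
  by rewrite orbF.
apply: (IH q'); apply: (mulfI (x := p%:P)); first by rewrite polyC_eq0.
by rewrite mulrA !mul_polyC -eq' -e scalerA mulrA -exprS.
Qed.

(** The reduction of f is a relation of least degree for a. A shorter relation for t, of least
    degree and with its content removed, would divide f up to a factor prime to p, as in Gauss's
    lemma, and one of the two reduced factors would be too short a relation for a. So remainders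
    modulo f represent T[t] faithfully, and the conditions are checked on their coefficients. *)
Lemma ext_algebraic f : f \is monic -> f^i.[t] = 0 -> f^r.[a] = 0 ->
  (forall g, (size g < size f)%N -> g^r.[a] = 0 -> g^r = 0) -> ext_spec.
Proof.
move=> mf ft fa hmin.
have f0 : f != 0 by apply: monic_neq0.
have ip0 n : iota p ^+ n != 0.
  by rewrite expf_neq0 // -(rmorph0 iota) (inj_eq iota_inj).
have hker0 g : (size g < size f)%N -> g^i.[t] = 0 -> g = 0.
  move=> sg gt; apply/eqP; apply: contrapT => /negP g0.
  pose Q n := `[< exists g, [/\ g != 0, (size g < size f)%N, g^i.[t] = 0 & size g = n] >].
  have hQ : exists n, Q n by exists (size g); apply/asboolP; exists g.
  case: (ex_minnP hQ) => n /asboolP[h1 [h10 sh1 ht1 en]] hn.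
  have [m [h [e hr0]]] := poly_content h10.
  have sh : size h = n by rewrite -en e size_scale // expf_neq0.
  have ht : h^i.[t] = 0.
    move: ht1; rewrite e map_polyZ hornerZ rmorphXn => /eqP.
    by rewrite mulf_eq0 (negbTE (ip0 m)) => /eqP.
  have h0 : h != 0 by apply: contraNneq hr0 => ->; rewrite rmorph0.
  have := Pdiv.Idomain.divp_eq f h; set c := lead_coef h ^+ _; set q := f %/ h => ed.
  have c0 : c != 0 by rewrite expf_neq0 ?lead_coef_eq0.
  have rem0 : f %% h = 0.
    apply/eqP; apply: contrapT => /negP r0.
    have sr : (size (f %% h)%R < n)%N by rewrite -sh Pdiv.Idomain.ltn_modp.
    suff : (n <= size (f %% h)%R)%N by rewrite leqNgt sr.
    apply: hn; apply/asboolP; exists (f %% h); split=> //.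
      by apply: (ltn_trans sr); rewrite -en.
    move: (congr1 (fun z => z^i.[t]) ed); rewrite /= rmorphD rmorphM /= hornerD hornerM ht.
    by rewrite map_polyZ hornerZ ft !mulr0 add0r.
  rewrite rem0 addr0 in ed; have [l [c' [ec rc0]]] := elt_content c0.
  rewrite ec in ed; have [q' eq'] := poly_unit_cancel hr0 ed.
  have c'0 : c' != 0 by apply: contraNneq rc0 => ->; rewrite rmorph0.
  have sz : size f = (size q' + size h).-1.
    rewrite -(size_scale f c'0) eq' size_mul //; apply: contraNneq c'0 => q0.
    by move: eq'; rewrite q0 mul0r -mul_polyC => /eqP; rewrite mulf_eq0 polyC_eq0 (negbTE f0) orbF.
  have := congr1 (map_poly r) eq'; rewrite map_polyZ rmorphM /= => er.
  have qr0 : q'^r != 0.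
    apply/eqP => q0; move/eqP: er; rewrite q0 mul0r scaler_eq0 (negbTE rc0) /=.
    by rewrite (negbTE (monic_neq0 (monic_map r mf))).
  have shf : (size h < size f)%N by rewrite sh -en.
  have := congr1 (horner^~ a) er; rewrite hornerZ hornerM fa mulr0 => /esym/eqP.
  rewrite mulf_eq0 => /orP[]/eqP hz; last by move: hr0; rewrite hmin ?eqxx.
  have [sh2|sh1'] := ltnP 1 (size h); first by move: qr0; rewrite hmin ?eqxx //; lia.
  have hc := size1_polyC sh1'; move: ht h0; rewrite hc map_polyC hornerC polyC_eq0.
  by rewrite -(rmorph0 iota) => /iota_inj->; rewrite eqxx.
have modf g : g^i.[t] = (g %% f)^i.[t] /\ g^r.[a] = (g %% f)^r.[a].
  by split; rewrite {1}(Pdiv.IdomainMonic.divp_eq mf g) rmorphD rmorphM /= hornerD hornerM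
    ?ft ?fa mulr0 add0r.
have szm g : (size (g %% f)%R < size f)%N by rewrite Pdiv.Idomain.ltn_modp.
split=> g.
- by have [-> ->] := modf g => /(hker0 _ (szm g)) ->; rewrite rmorph0 horner0.
- have [-> ->] := modf g => /(hmin _ (szm g))/poly_ker[g' ->]; exists g'.
  by rewrite map_polyZ hornerZ.
move=> hg; rewrite (modf g).1; suff -> : g %% f = 0 by rewrite rmorph0 horner0.
apply: poly_sep => n; have [g' e] := hg n; exists (g' %% f).
apply/eqP; rewrite -subr_eq0; apply/eqP/hker0.
  apply: (leq_ltn_trans (size_polyD _ _)); rewrite gtn_max szm size_polyN.
  exact: leq_ltn_trans (size_scale_leq _ _) (szm _).
by rewrite rmorphB /= hornerD hornerN map_polyZ hornerZ rmorphXn -(modf g).1 -(modf g').1 e subrr.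
Qed.

End Extend.
End Residue.

(** * Transcendental complex numbers *)

Section Uncountable.
Variable Rr : realType.

(** Cantor's nested intervals: the n-th step keeps an outer third that avoids u n. *)
Lemma uncountable_real (u : nat -> Rr) : exists x, forall n, x <> u n.
Proof.
pose next (n : nat) (ab : Rr * Rr) := let: (a, b) := ab in
  if u n < (a + 2 * b) / 3 then ((a + 2 * b) / 3, b) else (a, (2 * a + b) / 3).
pose I := fix I n : Rr * Rr := if n is m.+1 then next m (I m) else (0, 1).
have hI n : (I n).1 < (I n).2.
  elim: n => [|n] /=; first exact: ltr01.
  by case: (I n) => a b /=; case: ifP => _ /=; lra.
have hS n : (I n).1 <= (I n.+1).1 /\ (I n.+1).2 <= (I n).2.
  by have := hI n; rewrite /=; case: (I n) => a b /=; case: ifP => _ /=; split; lra.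
have hm1 n m : (I n).1 <= (I (n + m)%N).1.
  by elim: m => [|m IH]; rewrite ?addn0 ?addnS //; apply: le_trans IH _; case: (hS (n + m)%N).
have hm2 n m : (I (n + m)%N).2 <= (I n).2.
  by elim: m => [|m IH]; rewrite ?addn0 ?addnS //; apply: le_trans IH; case: (hS (n + m)%N).
have hb n m : (I n).1 <= (I m).2.
  by apply: (le_trans (hm1 n m)); apply: (le_trans (ltW (hI _))); rewrite addnC.
pose E := range (fun n => (I n).1).
have hE : has_ubound E by exists 1 => _ [n _ <-]; apply: (hb n 0%N).
exists (sup E) => n e.
have h1 : (I n.+1).1 <= u n by rewrite -e; apply: ub_le_sup => //; exists n.+1.
have h2 : u n <= (I n.+1).2.
  by rewrite -e; apply: ge_sup; [exists (I 0%N).1; exists 0%N|move=> _ [m _ <-]].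
have := hI n; move: h1 h2; rewrite /=; case: (I n) => a b /=.
by case: ltP => /= h h1 h2 hab; lra.
Qed.

Lemma countable_subring (L : comNzRingType) (sg : seq L) :
  exists e : nat -> L, subring_gen [set a | a \in sg] `<=` range e.
Proof.
(* The subring consists of values of expression trees, of which there are countably many; malformed
   trees get the value 1. *)
pose ev := fix ev (t : GenTree.tree nat) : L := match t with
  | GenTree.Leaf i => sg`_i
  | GenTree.Node 0 [:: a; b] => ev a - ev b
  | GenTree.Node 1 [:: a; b] => ev a * ev b
  | _ => 1 end.
exists (fun n => if unpickle n is Some t then ev t else 0).
have h t : range (fun n => if unpickle n is Some t then ev t else 0) (ev t).
  by exists (pickle t) => //; rewrite pickleK.
suff hs : subring_gen [set a | a \in sg] `<=` range ev.
  by move=> x /hs[t _ <-].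
apply: subring_gen_min; last by move=> x /= hx; exists (GenTree.Leaf (index x sg)) => //=; rewrite nth_index.
split; first by exists (GenTree.Node 2 [::]).
  by move=> _ _ [a _ <-] [b _ <-]; exists (GenTree.Node 0 [:: a; b]).
by move=> _ _ [a _ <-] [b _ <-]; exists (GenTree.Node 1 [:: a; b]).
Qed.

(** The nonzero polynomials over a finitely generated ring are countable, and so are the real parts
    of their roots; a real number outside this list is a root of none. *)
Lemma exists_transcendental (sg : seq Rr[i]) : exists t : Rr[i], forall f : {poly Rr[i]},
  (forall i, subring_gen [set a | a \in sg] f`_i) -> root f t -> f = 0.
Proof.
have [e he] := countable_subring sg.
have hr (f : {poly Rr[i]}) : exists rs : seq Rr[i], f != 0 -> forall x, root f x -> x \in rs.
  have [rs ->] := closed_field_poly_normal f; exists rs => f0 x.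
  rewrite rootZ ?root_prod_XsubC // lead_coef_eq0; move: f0; rewrite scaler_eq0 negb_or.
  by rewrite lead_coef_eq0 => /andP[].
have /choice[rs hrs] := hr.
pose P (s : seq nat) := Poly [seq e i | i <- s].
have [x hx] := uncountable_real (fun n => if unpickle n is Some (s, i)
  then complex.Re (rs (P s))`_i else 0).
exists (x%:C)%C => f hf hroot; apply/eqP; apply: contrapT => /negP f0.
have hc i : exists n, e n = f`_i by have [n _ <-] := he _ (hf i); exists n.
have /choice[c ec] := hc.
have ef : f = P (mkseq c (size f)).
  apply/polyP => i; rewrite coef_Poly /mkseq -map_comp.
  have [hi|hi] := ltnP i (size f); first by rewrite (nth_map 0%N) ?size_iota // nth_iota //= ec.
  by rewrite !nth_default // size_map size_iota.
have hin := hrs _ f0 _ hroot.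
apply: (hx (pickle (mkseq c (size f), index (x%:C)%C (rs f)))).
by rewrite pickleK -ef nth_index.
Qed.

End Uncountable.

(** * Bases: finitely generated subrings with a reduction map *)

Section Bases.
Variables (L : closedFieldType) (k : fieldType) (p : nat).
Hypotheses (hp : p \in [pchar k]) (char0 : forall n, n.+1%:R != 0 :> L).
Hypothesis htr : forall sg : seq L, exists t, forall f : {poly L},
  (forall i, subring_gen (seqset sg) f`_i) -> root f t -> f = 0.
Implicit Types (sg : seq L) (phi : L -> k).
Local Notation "<< sg >>" := (subring_gen (seqset sg)) : classical_set_scope.

(** phi is meaningful only on the subring generated by sg. The last condition, separatedness for p,
    is carried along for the sake of [poly_content]. *)
Definition base sg phi := [/\ hom_on <<sg>> phi,
  (forall a, <<sg>> a -> phi a = 0 -> exists2 b, <<sg>> b & a = p%:R * b)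
  & (forall a, (forall n, exists2 b, <<sg>> b & a = p%:R ^+ n * b) -> a = 0)].

Definition extends sg phi sg' phi' :=
  <<sg>> `<=` <<sg'>> /\ forall c, <<sg>> c -> phi' c = phi c.

Lemma extends_refl sg phi : extends sg phi sg phi. Proof. by split. Qed.

Lemma extends_trans sg phi sg' phi' sg'' phi'' : extends sg phi sg' phi' ->
  extends sg' phi' sg'' phi'' -> extends sg phi sg'' phi''.
Proof.
move=> [h1 e1] [h2 e2]; split=> c hc; first by apply: h2; apply: h1.
by rewrite e2 ?e1 //; apply: h1.
Qed.

Lemma charp_neq0 : p%:R != 0 :> L.
Proof. by have := pcharf_prime hp; case: p => // n _; apply: char0. Qed.

Section Ext.
Variables (sg : seq L) (phi : L -> k) (hb : base sg phi) (hphi : hom_on <<sg>> phi).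
Let hS := subring_genP (seqset sg).
Let T : idomainType := subring_type hS.
Let iota : {rmorphism T -> L} := @subring_val _ _ hS.
Let r : {rmorphism T -> k} := subring_hom hphi.

Lemma base_p0 : p%:R != 0 :> T.
Proof.
apply: contraNneq charp_neq0 => e; have := congr1 (iota : T -> L) e.
by rewrite rmorph_nat rmorph0 => ->.
Qed.

Lemma base_rp : r p%:R = 0.
Proof. by rewrite rmorph_nat (pcharf0 hp). Qed.

Lemma base_ker (a : T) : r a = 0 -> exists b, a = p%:R * b.
Proof.
have [_ hk _] := hb; move=> /(hk _ (svalP a))[b hb' e]; exists (mksub hS hb').
by apply: (@subring_val_inj _ _ hS); rewrite rmorphM rmorph_nat.
Qed.

Lemma base_sep (a : T) : (forall n, exists b, a = p%:R ^+ n * b) -> a = 0.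
Proof.
have [_ _ hs] := hb; move=> h; apply: (@subring_val_inj _ _ hS); rewrite rmorph0.
apply: hs => n; have [b ->] := h n; exists (subring_val b); first exact: svalP.
by rewrite rmorphM rmorphXn rmorph_nat.
Qed.

Lemma base_adjoin t a : ext_spec r p%:R iota t a ->
  exists phi', [/\ base (t :: sg) phi', extends sg phi (t :: sg) phi' & phi' t = a].
Proof.
move=> [h1 h2 h3].
pose ev : {rmorphism {poly T} -> L} := horner_eval t \o map_poly iota.
pose ev' : {rmorphism {poly T} -> k} := horner_eval a \o map_poly r.
have evE f : ev f = (map_poly iota f).[t] by [].
have evC c : ev c%:P = iota c by rewrite evE map_polyC hornerC.
have hrange : range ev = <<t :: sg>>.
  have hS' := subring_genP (seqset (t :: sg)).
  have sub : <<sg>> `<=` <<t :: sg>>.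
    by apply: subring_gen_mono => x hx; apply: sub_subring_gen; rewrite /seqset /= inE hx orbT.
  apply/seteqP; split.
    move=> _ [f _ <-]; rewrite evE horner_coef; apply: subring_sum => // i _.
    have [_ _ hM] := hS'; apply: hM; first by rewrite coef_map; exact: (sub _ (svalP _)).
    by apply: (subringX i hS'); apply: sub_subring_gen; exact: mem_head.
  apply: subring_gen_min; first exact: subring_range.
  move=> x; rewrite /seqset /= inE => /orP[/eqP->|hx].
    by exists 'X => //; rewrite -[RHS](hornerX t) -[X in _ = X.[t]](map_polyX iota).
  have hx' : <<sg>> x by apply: sub_subring_gen.
  by exists (mksub hS hx')%:P => //; exact: (evC (mksub hS hx')).
have [phi' hom' e'] := @hom_on_image _ _ _ ev ev' h1.
have phiE (f : {poly T}) : phi' (ev f) = (map_poly r f).[a] by rewrite e'.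
exists phi'; rewrite /extends /base -hrange; split; first split=> //.
- move=> _ [f _ <-]; rewrite phiE => /h2[g e]; exists (ev g); first by exists g.
  by rewrite !evE e rmorph_nat.
- move=> x hx; have [g _ eg] : range ev x.
    have [b hb' ->] := hx 0%N; rewrite expr0 mul1r; exact: hb'.
  rewrite -eg; apply: h3 => n; have [b [g' _ <-] e] := hx n; exists g'.
  by rewrite rmorph_nat -evE eg e.
- split=> c hc; first by exists (mksub hS hc)%:P; rewrite ?evC.
  by have h := phiE (mksub hS hc)%:P; rewrite evC map_polyC hornerC in h; exact: h.
- have -> : t = ev 'X by rewrite evE map_polyX hornerX.
  by rewrite phiE map_polyX hornerX.
Qed.

End Ext.

Lemma base_inv sg phi s : base sg phi -> <<sg>> s -> phi s != 0 ->
  exists phi', base (s^-1 :: sg) phi' /\ extends sg phi (s^-1 :: sg) phi'.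
Proof.
move=> hb hs s0; have hphi : hom_on <<sg>> phi by case: hb.
pose s' := mksub (subring_genP (seqset sg)) hs.
have [|phi' [h1 h2 _]] := @base_adjoin sg phi hphi s^-1 (phi s)^-1.
  exact: (ext_inv (base_p0 sg) (base_rp hphi) (base_ker hb (hphi := hphi)) (base_sep hb)
    (@subring_val_inj _ _ _) (s := s')).
by exists phi'.
Qed.

Lemma hom_on0 (S : set L) phi : is_subring S -> hom_on S phi -> phi 0 = 0.
Proof. by move=> [h1 _ _] [_ hB _]; rewrite -(subrr 1) hB // subrr. Qed.

Lemma base_locz sg phi s (g : {poly L}) : <<sg>> s -> s != 0 ->
  (forall i, <<s^-1 :: sg>> g`_i) -> exists m, forall i, <<sg>> (s ^+ m * g`_i).
Proof.
move=> hs s0 hg; have hS := subring_genP (seqset sg); have [_ _ hM] := hS.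
have hc i : exists m, <<sg>> (s ^+ m * g`_i).
  by have := hg i; rewrite -locz_gen ?unitfE // => -[m hm]; exists m.
have /choice[m hm] := hc; exists (\max_(i < size g) m i)%N => i.
have [hi|hi] := ltnP i (size g); last by rewrite nth_default // mulr0; apply: subring0.
have hle : (m i <= \max_(i < size g) m i)%N by apply: (leq_bigmax (Ordinal hi)).
by rewrite -(subnK hle) exprD -mulrA; apply: (hM _ _ _ (hm i)); exact: (subringX _ hS hs).
Qed.

(** If a satisfies no relation over the reduced base, it is lifted to an element transcendental over
    the base. Otherwise a relation of least degree is made monic by inverting a lift of its leading
    coefficient, and a is lifted to a root of the monic lift, which exists because L is
    algebraically closed. *)
Lemma base_extend1 sg phi a : base sg phi -> exists sg' phi',
  [/\ base sg' phi', extends sg phi sg' phi' & exists2 c, <<sg'>> c & phi' c = a].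
Proof.
move=> hb; have hphi : hom_on <<sg>> phi by case: hb.
have fin sg1 phi1 t : base sg1 phi1 -> extends sg phi sg1 phi1 ->
    (forall hphi1 : hom_on <<sg1>> phi1,
      ext_spec (subring_hom (hS := subring_genP (seqset sg1)) hphi1) p%:R
        (@subring_val _ _ (subring_genP (seqset sg1))) t a) ->
    exists sg' phi', [/\ base sg' phi', extends sg phi sg' phi' & exists2 c, <<sg'>> c & phi' c = a].
  move=> hb1 he1 hext; have hphi1 : hom_on <<sg1>> phi1 by case: hb1.
  have [|phi' [h1 h2 h3]] := @base_adjoin sg1 phi1 hphi1 t a; first exact: hext.
  exists (t :: sg1), phi'; split=> //; first exact: extends_trans he1 h2.
  by exists t => //; apply: sub_subring_gen; rewrite /seqset /= inE eqxx.
pose hS := subring_genP (seqset sg).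
pose T : idomainType := subring_type hS.
pose iota : {rmorphism T -> L} := @subring_val _ _ hS.
pose r : {rmorphism T -> k} := subring_hom (hS := hS) hphi.
pose rel n := `[< exists f : {poly T}, [/\ (map_poly r f).[a] = 0, map_poly r f != 0
  & size (map_poly r f) = n] >].
have [[n0 hrel]|hno] := pselect (exists n, rel n); last first.
  have [t ht] := htr sg; apply: (fin sg phi t hb (extends_refl _ _)) => hphi'.
  apply: (ext_transcendental (base_ker hb (hphi := hphi')) (base_sep hb)) => f.
  - move=> e; apply: (@map_inj_poly _ _ iota) => //; first exact: (@subring_val_inj _ _ hS).
    rewrite rmorph0; apply: ht; last exact/rootP.
    by move=> i; rewrite coef_map; exact: (svalP _).
  - move=> e; apply/eqP; apply: contrapT => /negP h0; apply: hno.
    by exists (size (map_poly r f)); apply/asboolP; exists f.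
case: (ex_minnP (ex_intro rel n0 hrel)) => n /asboolP[f [fa fr0 en]] hmin.
have r_phi (c : T) : r c = phi (iota c) by [].
have n1 : (1 < n)%N.
  by rewrite -en; apply: (root_size_gt1 (a := a) fr0); apply/rootP.
pose s := iota f`_n.-1.
have hs : <<sg>> s by exact: (svalP _).
have ps : phi s != 0.
  by rewrite -r_phi -coef_map -en; move: fr0; rewrite -lead_coef_eq0.
have s0 : s != 0 by apply: contraNneq ps => ->; rewrite (hom_on0 hS hphi).
have [phi1 [hb1 he1]] := base_inv hb hs ps.
have he1' := he1; have [sub e1] := he1'.
pose hS1 := subring_genP (seqset (s^-1 :: sg)).
have [_ _ hM1] := hS1.
have hsV : <<s^-1 :: sg>> s^-1 by apply: sub_subring_gen; rewrite /seqset /= inE eqxx.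
have hj (c : T) : <<s^-1 :: sg>> (iota c / s) by apply: hM1 => //; apply: sub; exact: (svalP _).
pose T1 : idomainType := subring_type hS1.
pose f1 : {poly T1} := \poly_(i < n) mksub hS1 (hj f`_i).
have f1n : f1`_n.-1 = 1.
  rewrite coef_poly ltn_predL (ltnW n1); apply: (@subring_val_inj _ _ hS1).
  by rewrite rmorph1 /subring_val /= mulfV.
have f1sz : size f1 = n.
  apply/eqP; rewrite eqn_leq size_poly /= leqNgt; apply/negP => h.
  by have := f1n; rewrite nth_default; [move/eqP; rewrite eq_sym oner_eq0|by rewrite -ltnS prednK // ltnW].
have f1m : f1 \is monic by rewrite monicE /lead_coef f1sz f1n.
have /closed_rootP[t ht] : size (map_poly (@subring_val _ _ hS1) f1) != 1%N.
  rewrite (size_map_inj_poly (@subring_val_inj _ _ hS1)) ?f1sz; last exact: rmorph0.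
  by rewrite gtn_eqF.
apply: (fin (s^-1 :: sg) phi1 t hb1 he1) => hphi'.
have [phi11 _ phiM] := hphi'.
have phi1s : phi1 s^-1 = (phi s)^-1.
  apply: (mulfI ps); rewrite mulfV // -e1 // -phiM //; last exact: sub.
  by rewrite mulfV.
apply: (ext_algebraic (base_p0 _) (base_rp hphi') (base_ker hb1 (hphi := hphi')) (base_sep hb1)
  (@subring_val_inj _ _ hS1) f1m).
- exact/rootP.
- have -> : map_poly (subring_hom (hS := hS1) hphi') f1 = (phi s)^-1 *: map_poly r f.
    apply/polyP => i; rewrite coefZ !coef_map coef_poly; case: ltnP => hi; last first.
      have e0 : r f`_i = 0.
        transitivity (map_poly r f)`_i; first by rewrite coef_map.
        by rewrite nth_default ?en.
      transitivity ((phi s)^-1 * 0); first by rewrite mulr0; exact: rmorph0.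
      by congr (_ * _); exact: esym e0.
    rewrite /= {1}/subring_hom /= phiM ?phi1s ?e1 //; [exact: mulrC|exact: (svalP _)|].
    by apply: sub; exact: (svalP _).
  by rewrite hornerZ fa mulr0.
move=> h sh ha; apply/eqP; apply: contrapT => /negP hr0.
(* Minimality was stated over the old base, while h has coefficients in its localization at s; s^m h
   returns to the old base without raising the degree or losing the root. *)
have [m hm] : exists m, forall i, <<sg>> (s ^+ m * (map_poly (@subring_val _ _ hS1) h)`_i).
  by apply: base_locz => // i; rewrite coef_map; exact: (svalP _).
have hm' i : <<sg>> (s ^+ m * sval h`_i) by have := hm i; rewrite coef_map.
pose h' : {poly T} := \poly_(i < size h) mksub hS (hm' i).
have phiX j : phi1 (s ^+ j) = phi s ^+ j.
  elim: j => [|j IH]; first by rewrite !expr0.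
  by rewrite !exprS phiM ?IH ?e1 //; [exact: sub|exact: (subringX _ hS1 (sub _ hs))].
have er : map_poly r h' = phi s ^+ m *: map_poly (subring_hom (hS := hS1) hphi') h.
  apply/polyP => i; rewrite coefZ !coef_map coef_poly; case: ltnP => hi; last first.
    have e0 : subring_hom (hS := hS1) hphi' h`_i = 0.
      by rewrite nth_default //; exact: (rmorph0 (subring_hom (hS := hS1) hphi')).
    transitivity (phi s ^+ m * 0); first by rewrite mulr0; exact: (rmorph0 r).
    by congr (_ * _); exact: esym e0.
  rewrite /= {1}/subring_hom /= -e1 // phiM ?phiX //; last exact: (svalP _).
  exact: (subringX _ hS1 (sub _ hs)).
suff : (n <= size h)%N by rewrite leqNgt -f1sz sh.
apply: (@leq_trans (size (map_poly r h'))).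
  apply: hmin; apply/asboolP; exists h'; split=> //; first by rewrite er hornerZ ha mulr0.
  by rewrite er scaler_eq0 expf_eq0 (negbTE ps) andbF.
exact: leq_trans (size_poly _ _) (size_poly _ _).
Qed.

Lemma base_extend sg phi (s : seq k) : base sg phi -> exists sg' phi',
  [/\ base sg' phi', extends sg phi sg' phi' & forall a, a \in s -> exists2 c, <<sg'>> c & phi' c = a].
Proof.
elim: s sg phi => [|a s IH] sg phi hb; first by exists sg, phi; split=> //; split.
have [sg1 [phi1 [hb1 he1 [c hc ec]]]] := base_extend1 a hb.
have [sg2 [phi2 [hb2 he2 hs]]] := IH _ _ hb1.
exists sg2, phi2; split=> //; first exact: extends_trans he1 he2.
move=> b; rewrite inE => /orP[/eqP->|/hs//].
by case: he2 => h e; exists c; [apply: h|rewrite e].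
Qed.

(** The first base is the image of Z, which is separated for p because |m| < p^|m|. *)
Lemma base_start : exists phi, base [::] phi.
Proof.
have pr := pcharf_prime hp.
have intL (m : int) : m%:~R = 0 :> L -> m = 0.
  case: m => [[|m]|m] // /eqP; first by rewrite -pmulrn (negbTE (char0 _)).
  by rewrite NegzE mulrNz oppr_eq0 -pmulrn (negbTE (char0 _)).
have [|phi hphi e] := @hom_on_image int L k (intmul 1) (intmul 1).
  by move=> m /intL->.
have hr : range (intmul 1 : int -> L) = <<[::]>>.
  have hS := subring_genP (seqset ([::] : seq L)).
  apply/seteqP; split; last first.
    by apply: subring_gen_min => //; exact: (subring_range (intmul 1 : {rmorphism int -> L})).
  have [h1 _ _] := hS.
  move=> _ [[m|m] _ <-]; first by rewrite -pmulrn; exact: (subringMn m hS h1).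
  by rewrite NegzE mulrNz -pmulrn; apply: (subringN hS); exact: (subringMn m.+1 hS h1).
have tr (m m' : int) n : m%:~R = p%:R ^+ n * m'%:~R :> L -> m = (p%:Z) ^+ n * m'.
  move=> em; apply/eqP; rewrite -subr_eq0; apply/eqP/intL.
  by rewrite rmorphB rmorphM rmorphXn /= -pmulrn em subrr.
exists phi; rewrite /base -hr; split=> //.
- move=> _ [m _ <-]; rewrite e => /eqP; rewrite -(dvdz_pcharf hp) => /dvdzP[q ->].
  by exists q%:~R; [exists q|rewrite rmorphM /= -pmulrn mulrC].
- move=> x hx; have [m _ em] : range (intmul 1 : int -> L) x.
    by have [b hb ->] := hx 0%N; rewrite expr0 mul1r.
  suff m0 : m = 0 by rewrite -em m0 mulr0z.
  have [b [m' _ <-]] := hx `|m|%N; rewrite -em => /tr/(congr1 absz).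
  rewrite abszM abszX absz_nat => e2; apply/eqP; rewrite -absz_eq0; apply/eqP.
  have [//|m'0] := posnP `|m'|; first by rewrite e2 => ->; rewrite muln0.
  have := ltn_expl `|m| (prime_gt1 pr); rewrite {1}e2 ltnNge => /negP[].
  exact: leq_pmulr.
Qed.

End Bases.

(** * Localizing the base at the kernel of reduction *)

Section LocalBase.
Variables (L k : fieldType) (p : nat) (sg : seq L) (phi : L -> k).
Local Notation Sg := (subring_gen (seqset sg)).
Hypothesis hphi : hom_on Sg phi.
Hypothesis hker : forall a, Sg a -> phi a = 0 -> exists2 b, Sg b & a = p%:R * b.

(* [B] is the localization of the base at the kernel of [phi], [sgB] the
   preimage in [B] of the generators of the base. *)
Definition local_base (B : idomainType) (iota : {rmorphism B -> L})
    (r : {rmorphism B -> k}) (sgB : seq B) :=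
  [/\ injective iota, [/\ forall b, r b != 0 -> b \is a GRing.unit,
        forall b, r b = 0 -> exists b', b = p%:R * b' &
        forall b, exists u v, [/\ Sg u, Sg v, phi v != 0 & iota b = u / v]],
      iota @` subring_gen (seqset sgB) = Sg /\
        forall b, subring_gen (seqset sgB) b -> r b = phi (iota b)
    & (forall b, subring_gen (seqset sgB) b -> r b = 0 ->
         exists2 b', subring_gen (seqset sgB) b' & b = p%:R * b')].

Lemma exists_local_base : exists B iota r sgB, @local_base B iota r sgB.
Proof.
have hS := subring_genP (seqset sg); have [S1 SB SM] := hS.
have [phi1 phiB phiM] := hphi.
have phi0 : phi 0 = 0 by rewrite -(subrr 1) phiB // subrr.
have phi_neq0 v : phi v != 0 -> v != 0 by apply: contraNneq => ->; rewrite phi0.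
pose Bs : set L := [set x | exists u v, [/\ Sg u, Sg v, phi v != 0 & x = u / v]].
have SBs u : Sg u -> Bs u by move=> hu; exists u, 1; rewrite phi1 oner_neq0 divr1.
have hB : is_subring Bs.
  split; first exact: SBs.
  - move=> _ _ [u [v [hu hv pv ->]]] [u' [v' [hu' hv' pv' ->]]].
    exists (u * v' - u' * v), (v * v'); rewrite phiM // mulf_neq0 //; split=> //.
    + by apply: SB; apply: SM.
    + exact: SM.
    + by rewrite -mulNr addf_div ?phi_neq0 // mulNr.
  - move=> _ _ [u [v [hu hv pv ->]]] [u' [v' [hu' hv' pv' ->]]].
    exists (u * u'), (v * v'); rewrite phiM // mulf_neq0 // mulf_div.
    by split=> //; apply: SM.
pose val x u v := [/\ Sg u, Sg v, phi v != 0 & x = u / v].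
have hval x : exists y : k, (exists u v, val x u v /\ y = phi u / phi v) \/ ~ Bs x.
  have [[u [v h]]|h] := pselect (Bs x); last by exists 0; right.
  by exists (phi u / phi v); left; exists u, v.
have /choice[phi' hphi'] := hval.
have phi'E x u v : val x u v -> phi' x = phi u / phi v.
  move=> [hu hv pv e].
  case: (hphi' x) => [[u' [v' [[hu' hv' pv' e'] ->]]]|[]]; last by exists u, v.
  apply/eqP; rewrite eqr_div // -!phiM //; apply/eqP; congr phi.
  by apply/eqP; rewrite -eqr_div ?phi_neq0 // -e -e'.
have hphi1 : hom_on Bs phi'.
  split.
  - by rewrite (@phi'E 1 1 1) ?phi1 ?divr1 //; split; rewrite ?phi1 ?oner_neq0 ?divr1.
  - move=> x y [u [v hx]] [u' [v' hy]]; rewrite (phi'E _ _ _ hx) (phi'E _ _ _ hy).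
    case: hx hy => hu hv pv ex [hu' hv' pv' ey].
    rewrite (@phi'E _ (u * v' - u' * v) (v * v')).
      rewrite (phiB _ _ (SM _ _ hu hv') (SM _ _ hu' hv)) !phiM //.
      by rewrite -[in RHS]mulNr addf_div // mulNr.
    split; [by apply: SB; apply: SM|exact: SM|by rewrite phiM ?mulf_neq0|].
    by rewrite ex ey -mulNr addf_div ?phi_neq0 // mulNr.
  - move=> x y [u [v hx]] [u' [v' hy]]; rewrite (phi'E _ _ _ hx) (phi'E _ _ _ hy).
    case: hx hy => hu hv pv ex [hu' hv' pv' ey].
    rewrite (@phi'E _ (u * u') (v * v')); first by rewrite !phiM // mulf_div.
    by split; rewrite ?phiM ?mulf_neq0 ?ex ?ey ?mulf_div //; apply: SM.
have phi'S u : Sg u -> phi' u = phi u.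
  by move=> hu; rewrite (@phi'E u u 1) ?phi1 ?divr1 //; split; rewrite ?phi1 ?oner_neq0 ?divr1.
pose B : idomainType := subring_type hB.
pose iota : {rmorphism B -> L} := @subring_val _ _ hB.
pose r : {rmorphism B -> k} := subring_hom (hS := hB) hphi1.
have iota_inj : injective iota by exact: (@subring_val_inj _ _ hB).
have lift x : Bs x -> exists b, iota b = x by move=> hx; exists (mksub hB hx).
have sgP x : Sg x -> exists b : B, iota b = x by move=> hx; exact: (lift _ (SBs _ hx)).
have [sgB esg] : exists sgB : seq B, map iota sgB = sg.
  have hl x : x \in sg -> exists b : B, iota b = x.
    by move=> hx; apply: sgP; apply: sub_subring_gen.
  elim: (sg) hl => [|x s IH] hs; first by exists [::].
  have [s' e'] := IH (fun y hy => hs y (mem_behead (s := _ :: _) hy)).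
  have [b eb] := hs x (mem_head x s).
  by exists (b :: s'); rewrite /= e' eb.
have eSg : iota @` subring_gen (seqset sgB) = Sg.
  rewrite -subring_gen_image; congr subring_gen.
  apply/seteqP; split=> [_ [b hb <-]|x]; rewrite /seqset /= -?esg.
    by apply: map_f.
  by move=> /mapP[b hb ->]; exists b.
have inB b : subring_gen (seqset sgB) b -> Sg (iota b) by rewrite -eSg; exists b.
exists B, iota, r, sgB; split=> //.
- split=> b.
  + have [u [v [hu hv pv e]]] : Bs (iota b) := svalP b.
    rewrite -[r b]/(phi' (iota b)) (@phi'E _ u v) // mulf_eq0 invr_eq0 (negbTE pv) orbF => pu.
    have [c ec] : exists c, iota c = v / u by apply: lift; exists v, u.
    apply/unitrPr; exists c; apply: iota_inj; rewrite rmorphM rmorph1 e ec.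
    by rewrite mulrA divfK ?divff ?phi_neq0.
  + have [u [v [hu hv pv e]]] : Bs (iota b) := svalP b.
    rewrite -[r b]/(phi' (iota b)) (@phi'E _ u v) // => /eqP.
    rewrite mulf_eq0 invr_eq0 (negbTE pv) orbF => /eqP/(hker hu)[u' hu' eu].
    have [c ec] : exists c, iota c = u' / v by apply: lift; exists u', v.
    by exists c; apply: iota_inj; rewrite rmorphM rmorph_nat e eu ec mulrA.
  + exact: svalP b.
- by split=> // b /inB hb; rewrite -[r b]/(phi' (iota b)) phi'S.
- move=> b /inB hb; rewrite -[r b]/(phi' (iota b)) phi'S // => /(hker hb)[b'].
  by rewrite -eSg => -[c hc <-] e; exists c => //; apply: iota_inj; rewrite rmorphM rmorph_nat.
Qed.

End LocalBase.

(** * Compatible skeletons from saturated Rees algebras *)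

Section MonsMem.
Variables (K : comNzRingType) (gs : seq K).

Lemma mons_head e m : m \in mons gs e.+1 ->
  exists m' g, [/\ m' \in mons gs e, g \in gs & m = m' * g].
Proof. by case/allpairsP=> -[m' g] /= [h1 h2 ->]; exists m', g. Qed.

Lemma mons_exp e g : g \in gs -> g ^+ e \in mons gs e.
Proof.
move=> hg; elim: e => [|n IH] /=; first by rewrite expr0 inE.
by apply/allpairsP; exists (g ^+ n, g); rewrite exprSr.
Qed.

Lemma mons_map (K' : comNzRingType) (f : {rmorphism K -> K'}) e :
  map f (mons gs e) = mons (map f gs) e.
Proof.
elim: e => [|e IH] /=; first by rewrite rmorph1.
rewrite -IH map_allpairs allpairs_mapl allpairs_mapr.
by apply: eq_allpairs => m g; rewrite rmorphM.
Qed.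

End MonsMem.

(** The chart at a power g^(e + 1) is the old chart at g. A mixed generator g = m' g1 gives nothing
    new: g / g1^(e + 1) is a unit on its chart, so its points lie in the chart g1. *)
Lemma Bl_mons (K : fieldType) (S : set K) (gs : seq K) (e : nat) : is_subring S ->
  Bl S (seqset (mons gs e.+1)) = Bl S (seqset gs).
Proof.
move=> hS; have pwE d x := pw_veronese gs e.+1 d x hS.
have ge g : g \in gs -> g ^+ e.+1 \in mons gs e.+1 by exact: mons_exp.
have ch g : g \in gs -> g != 0 ->
    chart S (seqset (mons gs e.+1)) (g ^+ e.+1) = chart S (seqset gs) g.
  move=> hg g0; apply/seteqP; split=> x.
    by move=> [d [b [/pwE hb ->]]]; exists (d * e.+1)%N, b; rewrite -exprM [(e.+1 * d)%N]mulnC.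
  move=> [d [b [hb ->]]]; exists d, (b * g ^+ (d * e)); split.
    by apply/pwE; rewrite mulnS; apply: pwM => //; apply: pw_genX.
  by rewrite -exprM [(e.+1 * d)%N]mulnC mulnS exprD -mulf_div divff ?mulr1 // expf_neq0.
apply/seteqP; split=> O [g [hg g0 hO]]; last first.
  by exists (g ^+ e.+1); rewrite expf_neq0 // (ch g) //; split=> //; apply: ge.
have [m' [g1 [hm' hg1 eg]]] := mons_head hg.
have /andP[m'0 g10] : (m' != 0) && (g1 != 0) by rewrite -negb_or -mulf_eq0 -eg.
case: (hO) => -[hOr hOl] hC hf.
have hC1 : chart S (seqset gs) g1 `<=` O.
  apply: chart_min => // [s hs|g' hg']; first by apply: hC; apply: chart_sub.
  have -> : g' / g1 = (m' * g') / g by rewrite eg -mulf_div divff // mul1r.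
  apply: hC; apply: chart_gen => //.
  by rewrite /seqset /=; apply/allpairsP; exists (m', g').
have ug : unitin O (g / g1 ^+ e.+1).
  split; first by apply: hC1; apply: chart_pw; apply: mons_pw.
    by rewrite mulf_neq0 // invr_eq0 expf_neq0.
  by rewrite invf_div; apply: hC; apply: chart_gen => //; apply: ge.
exists g1; split=> //; apply: (over_shrink (chart_subring hS hg1 g10) hO hC1) => x [d [b [/pwE hb ->]]].
exists (b / g1 ^+ (d * e.+1)), ((g / g1 ^+ e.+1) ^+ d); split.
- exact: chart_pw.
- apply: subringX; first exact: chart_subring.
  by apply: chart_pw; apply: mons_pw.
- exact: unitinX.
- have h0 : g1 ^+ (d * e.+1) != 0 by rewrite expf_neq0.
  by rewrite expr_div_n -exprM [(e.+1 * d)%N]mulnC invf_div mulrA divfK.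
Qed.

Section Reduce.
Variables (N p : nat) (L k : fieldType) (sg : seq L) (phi : L -> k).
Variables (B : idomainType) (iota : {rmorphism B -> L}) (r : {rmorphism B -> k}) (sgB : seq B).
Hypotheses (hB : local_base p sg phi iota r sgB) (rp : p%:R = 0 :> k) (p0 : p%:R != 0 :> B).
Variables (gs : seq {mpoly B[N]}) (d0 : nat).
Local Notation SgB := (subring_gen (seqset sgB)).
Local Notation P := (polyS SgB).
Hypothesis hsat : forall d, (d0 < d)%N -> saturated p%:R SgB (seqset gs) d.
Local Notation ms := (mons gs d0.+1).
Local Notation KL := (funfield L N).
Local Notation Kk := (funfield k N).
Local Notation "x %:F" := (@FracField.tofrac _ x).
Let hSB : is_subring SgB := subring_genP _.
Let hP : is_subring P := polyS_subring N hSB.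

Section Image.
Variables (F : fieldType) (rho : {rmorphism B -> F}).
Local Notation K := (funfield F N).
Local Notation f_ := (@FracField.tofrac {mpoly F[N]} \o map_mpoly rho).
Definition rees_map : {rmorphism {poly {mpoly B[N]}} -> {poly K}} := map_poly f_.
Definition rees_base : set {poly {mpoly B[N]}} :=
  subring_gen ([set c%:P | c in P] `|` [set c *: 'X | c in seqset ms]).
Definition rees_field : set {poly K} :=
  subring_gen ([set c%:P | c in @SP N F] `|` [set c *: 'X | c in seqset (map f_ ms)]).

Lemma rees_mapC c : rees_map c%:P = ((map_mpoly rho c)%:F)%:P.
Proof. exact: map_polyC. Qed.

Lemma rees_baseP x : rees_base x <-> forall d, pw P (seqset ms) d x`_d.
Proof. exact: rees_coef. Qed.

Lemma rees_base_graded : forall f d, rees_base f -> rees_base (f`_d *: 'X^d).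
Proof.
move=> f d /rees_baseP hf; apply/rees_baseP => e; rewrite coefZ coefXn.
by case: eqP => [->|_]; rewrite ?mulr1 // mulr0; apply: pw_zero.
Qed.

Lemma image_graded : is_graded (rees_map @` rees_base).
Proof.
move=> _ d [x hx <-]; exists (x`_d *: 'X^d); first exact: rees_base_graded.
by rewrite /rees_map /= map_polyZ map_polyXn coef_map.
Qed.

Lemma rees_field_graded : is_graded rees_field.
Proof.
move=> f d /(rees_coef _ _ (@SP_subring N F)) hf; apply/(rees_coef _ _ (@SP_subring N F)) => e.
by rewrite coefZ coefXn; case: eqP => [->|_]; rewrite ?mulr1 // mulr0; apply: pw_zero.
Qed.

(** Stated for an arbitrary morphism from B to a field, since it serves both the inclusion into L
    and the reduction to k. *)
Lemma image_skeleton : is_skeleton (fun c => (constF N c)%:P) rees_field (rees_map @` rees_base).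
Proof.
have hR : is_subring rees_field by exact: subring_genP.
set Im := rees_map @` rees_base.
split.
  exists (map rees_map ([seq c%:P | c <- [seq (c%:MP : {mpoly B[N]}) | c <- sgB] ++
    [seq ('X_i : {mpoly B[N]}) | i <- enum 'I_N]] ++ [seq g *: 'X | g <- ms])).
  rewrite /Im /rees_base (rees_fg _ (polyS_fg N sgB)) -subring_gen_image; congr subring_gen.
  apply/seteqP; split=> [_ [x hx <-]|x /mapP[y hy ->]]; last by exists y.
  by rewrite /seqset /=; apply: map_f.
apply/seteqP; split; apply: subring_gen_min; rewrite ?/rees_field //; try exact: subring_genP.
  move=> _ [[c _ <-]|[x /rees_baseP hx <-]].
    by apply: sub_subring_gen; left; exists (constF N c) => //; exists c%:MP.
  apply/(rees_coef _ _ (@SP_subring N F)) => d; rewrite coef_map.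
  have -> : seqset (map f_ ms) = f_ @` seqset ms.
    by apply/seteqP; split=> [z /mapP[y hy ->]|_ [y hy <-]]; [exists y|exact: map_f].
  have h : pw (f_ @` P) (f_ @` seqset ms) d (f_ x`_d) by rewrite (pw_image f_); exists x`_d.
  by apply: pw_mono h => // _ [z _ <-]; exists (map_mpoly rho z).
have hG := @sub_subring_gen _ (range (fun c => (constF N c)%:P) `|` Im).
have hS := subring_genP (range (fun c : F => (constF N c)%:P : {poly K}) `|` Im).
move=> _ [[_ [f _ <-] <-]|[g hg <-]]; last first.
  apply: hG; right; move: hg; rewrite /seqset /= => /mapP[m hm ->].
  exists (m *: 'X); last by rewrite /rees_map /= map_polyZ map_polyX.
  by apply: sub_subring_gen; right; exists m.
have hpre : is_subring [set g : {mpoly F[N]} |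
    subring_gen (range (fun c : F => (constF N c)%:P : {poly K}) `|` Im) (g%:F)%:P].
  exact: (subring_preimage (polyC \o @FracField.tofrac {mpoly F[N]}) hS).
have [_ _ hM] := hpre.
rewrite [f]mpolyE; apply: (subring_sum _ hpre) => m _; rewrite -mul_mpolyC; apply: hM.
  by apply: hG; left; exists f@_m.
rewrite mpolyXE_id; apply: (subring_prod _ hpre) => i _; apply: (subringX _ hpre).
apply: hG; right; exists ('X_i)%:P; last by rewrite /rees_map /= map_polyC /= map_mpolyX.
by apply: sub_subring_gen; left; exists 'X_i => //; apply: polyS_X.
Qed.

Lemma rees_model : Proj_model rees_field = Bl (@SP N F) (GF (seqset (map (map_mpoly rho) gs))).
Proof.
rewrite /rees_field Proj_modelP; last exact: SP_subring.
rewrite (mons_map gs f_) Bl_mons; last exact: SP_subring.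
congr Bl; rewrite map_comp /GF; apply/seteqP; split=> [z /mapP[y hy ->]|_ [y hy <-]].
  by exists y.
exact: map_f.
Qed.

End Image.

Lemma lift_poly (ft : {mpoly L[N]}) : (forall m, subring_gen (seqset sg) ft@_m) ->
  exists2 g, P g & map_mpoly iota g = ft.
Proof.
case: hB => _ _ [eSg _] _; rewrite -eSg => h.
have /choice[b hb] : forall m, exists b, SgB b /\ iota b = ft@_m.
  by move=> m; have [b hb e] := h m; exists b.
exists (\sum_(m <- msupp ft) (b m)%:MP * 'X_[m]).
  apply: (subring_sum _ hP) => m _; have [_ _ hM] := hP; apply: hM.
    by apply: polyS_const => //; case: (hb m).
  rewrite mpolyXE_id; apply: (subring_prod _ hP) => i _; apply: (subringX _ hP).
  exact: polyS_X.
rewrite rmorph_sum /= [RHS]mpolyE; apply: eq_bigr => m _.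
by rewrite rmorphM /= map_mpolyC map_mpolyX mul_mpolyC /= -(hb m).2.
Qed.

Lemma map_iota_inj : injective (map_mpoly iota : {mpoly B[N]} -> {mpoly L[N]}).
Proof.
case: hB => inj _ _ _ f g e; apply/mpolyP => m; apply: inj.
by rewrite -!mcoeff_mapr e.
Qed.

Lemma mpoly_div (Q : set B) (f : {mpoly B[N]}) : Q 0 ->
  (forall m, exists b, Q b /\ f@_m = p%:R * b) ->
  exists f', (forall m, Q f'@_m) /\ f = p%:R%:MP * f'.
Proof.
move=> Q0 /choice[b hb]; exists (\sum_(m <- msupp f) b m *: 'X_[m]).
have cf m : (\sum_(m <- msupp f) b m *: 'X_[m])@_m = if m \in msupp f then b m else 0.
  rewrite linear_sum /=; case: ifP => hm.
    rewrite (bigD1_seq m) //= ?msupp_uniq // mcoeffZ mcoeffX eqxx mulr1 big1 ?addr0 // => m' /negbTE ne.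
    by rewrite mcoeffZ mcoeffX ne mulr0.
  rewrite big1_seq // => m' /andP[_ hm']; rewrite mcoeffZ mcoeffX.
  by case: eqP hm' hm => [->->//|_ _ _]; rewrite mulr0.
split=> [m|]; first by rewrite cf; case: ifP => // _; case: (hb m).
apply/mpolyP => m; rewrite mul_mpolyC mcoeffZ cf; case: ifP => [_|/negbT]; first by case: (hb m).
by rewrite mcoeff_msupp negbK => /eqP->; rewrite mulr0.
Qed.

(** Phi lifts an element back to the Rees algebra over B, which is unambiguous as iota is injective,
    and reduces it. A coefficient with zero reduction is divisible by p over B; in degree 0 the
    quotient stays in the base by the kernel condition of [local_base], and in positive degrees it
    stays in the Rees algebra by saturation, since the twist by d0 + 1 leaves only degrees above
    d0. *)
Lemma reduction : reduces_to p phi (subring_gen (seqset sg))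
  (Bl (@SP N L) (GF (seqset (map (map_mpoly iota) gs))))
  (Bl (@SP N k) (GF (seqset (map (map_mpoly r) gs)))).
Proof.
case: (hB) => inj [_ hker _] [eSg er] hker'.
have rpB : r p%:R = 0 by rewrite rmorph_nat.
pose ev := rees_map iota; pose ev' := rees_map r.
have fLI (f : {mpoly B[N]}) : (map_mpoly iota f)%:F = 0 -> f = 0.
  move=> e; apply: map_iota_inj; apply/eqP.
  by rewrite -(@tofrac_eq {mpoly L[N]}) rmorph0 tofrac0 e.
have evI x : ev x = 0 -> x = 0.
  move=> e; apply/polyP => d; rewrite coef0; apply: fLI.
  by have := congr1 (coefp d) e; rewrite /= coef_map coef0.
have [Phi [Phi1 PhiB PhiM] PhiE] : exists2 Phi, hom_on (range ev) Phi & forall x, Phi (ev x) = ev' x.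
  by apply: hom_on_image => x /evI ->; rewrite rmorph0.
right; exists (rees_field iota), (ev @` rees_base), (rees_field r), (ev' @` rees_base), Phi.
have sub : ev @` rees_base `<=` range ev by move=> _ [x _ <-]; exists x.
split; [split; exact: image_skeleton| | | |].
- by split; [exact: rees_field_graded|exact: image_graded|exact: rees_field_graded|exact: image_graded].
- split; last first.
    move=> b d [x hx ex].
    have exd : x = x`_d *: 'X^d.
      apply/polyP => e; rewrite coefZ coefXn; case: eqP => [->|ne]; rewrite ?mulr1 // mulr0.
      apply: fLI; have := congr1 (coefp e) ex; rewrite /= coef_map coefZ coefXn.
      by case: eqP ne => // _ _; rewrite mulr0.
    exists (map_mpoly r x`_d)%:F; rewrite -ex PhiE {1}exd /ev' /rees_map /=.
    by rewrite map_polyZ map_polyXn.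
  split; [exact: Phi1|by move=> a b /sub ha /sub hb; apply: PhiB
    |by move=> a b /sub ha /sub hb; apply: PhiM| |].
    apply/seteqP; split=> [_ [_ [x hx <-] <-]|_ [x hx <-]]; first by rewrite PhiE; exists x.
    by exists (ev x); [exists x|rewrite PhiE].
  move=> _ [x hx <-]; rewrite PhiE; split; last first.
    case=> _ [y hy <-] e; have -> : x = y *+ p.
      by apply/eqP; rewrite -subr_eq0; apply/eqP/evI; rewrite rmorphB rmorphMn /= -e subrr.
    have e1 : y *+ p = ((p%:R)%:MP_[N])%:P * y by rewrite !rmorph_nat mulr_natl.
    have e2 : ev' ((p%:R)%:MP_[N])%:P = 0.
      have z : map_mpoly r (p%:R)%:MP_[N] = 0 by rewrite map_mpolyC /= rpB mpolyC0.
      rewrite /ev' rees_mapC z; exact: (rmorph0 (polyC \o @FracField.tofrac {mpoly k[N]})).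
    rewrite e1; transitivity (ev' ((p%:R)%:MP_[N])%:P * ev' y); first exact: rmorphM.
    by rewrite e2; exact: mul0r.
  move=> e; have /rees_baseP hx' := hx.
  have hd d : exists x', pw P (seqset ms) d x' /\ x`_d = p%:R%:MP * x'.
    have xr : map_mpoly r x`_d = 0.
      apply/eqP; rewrite -(@tofrac_eq {mpoly k[N]}) tofrac0; apply/eqP.
      by have := congr1 (coefp d) e; rewrite /= coef_map coef0.
    have xm m : r (x`_d)@_m = 0 by rewrite -mcoeff_mapr xr mcoeff0.
    case: d xr xm => [|d] xr xm.
      have [||x' [hx2 ex]] := @mpoly_div SgB x`_0.
      - exact: subring0 hSB.
      - move=> m; have [b hb eb] := hker' _ (pw0P hP (hx' 0%N) m) (xm m).
        by exists b.
      by exists x'; split=> //; apply: pw_base.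
    have [||x0 [_ ex]] := @mpoly_div setT x`_d.+1 => //.
      by move=> m; have [b eb] := hker _ (xm m); exists b.
    have /(pw_veronese _ _ _ _ hP) hv := hx' d.+1.
    have [|x' hx2 ex2] := hsat _ hv ex; first by rewrite mulSn; lia.
    by exists x'; split=> //; apply/(pw_veronese _ _ _ _ hP).
  have /choice[x' hx2] := hd.
  pose y := \poly_(d < size x) x' d.
  have ey : x = y *+ p.
    apply/polyP => d; rewrite coefMn coef_poly; case: ltnP => hs.
      by rewrite (hx2 d).2 rmorph_nat mulr_natl.
    by rewrite nth_default ?mul0rn.
  exists (ev y); last by rewrite ey rmorphMn.
  exists y => //; apply/rees_baseP => d; rewrite coef_poly; case: ltnP => _; first by case: (hx2 d).
  exact: pw_zero.
- move=> ft f hlift; have [g hg eg] := lift_poly (fun m => (hlift m).1).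
  have egr : map_mpoly r g = f.
    apply/mpolyP => m; rewrite mcoeff_mapr (er _ (hg m)) -(hlift m).2 -eg.
    by rewrite mcoeff_mapr.
  have ->: (polyF ft)%:P = ev g%:P by rewrite /ev rees_mapC eg.
  split; last (rewrite PhiE /ev' rees_mapC egr; exact: erefl).
  by exists g%:P => //; apply: sub_subring_gen; left; exists g.
- split; exact: (esym (rees_model _)).
Qed.

End Reduce.

Lemma prime_preimage (A A' : comNzRingType) (h : {rmorphism A -> A'}) (Q : set A') :
  prime_ideal setT Q -> prime_ideal setT (h @^-1` Q).
Proof.
case=> _ [q0 qD] qM q1 qp; split=> [//||x y _ hy||x y _ _]; rewrite /preimage /mkset.
- by split=> [|x y hx hy]; rewrite ?rmorph0 // rmorphD; apply: qD.
- by rewrite rmorphM; apply: qM.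
- by rewrite rmorph1.
- by rewrite rmorphM => /qp; apply.
Qed.

(** * Closed points over the origin *)

Section NullstellensatzStep.
Variables (k : closedFieldType) (R : idomainType) (Q : set {poly R}).
Hypothesis hQ : prime_ideal setT Q.
Implicit Types (f g q : {poly R}).

Let Qadd f g : Q f -> Q g -> Q (f + g). Proof. by case: hQ => _ [_ h] _ _ _; apply: h. Qed.
Let Qmul f g : Q g -> Q (f * g). Proof. by case: hQ => _ _ h _ _; apply: h. Qed.
Let Q0 : Q 0. Proof. by case: hQ => _ []. Qed.
Let Qsub f g : Q f -> Q g -> Q (f - g).
Proof. by move=> hf hg; rewrite -mulN1r; apply: Qadd => //; apply: Qmul. Qed.
Let Qpr f g : Q (f * g) -> Q f \/ Q g. Proof. by case: hQ => _ _ _ _ h; apply: h. Qed.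
Let P c := Q c%:P.
Let QX f n : Q (f ^+ n) -> Q f.
Proof.
elim: n => [|n IH]; first by rewrite expr0 => h; case: hQ.
by rewrite exprS => /Qpr[|/IH].
Qed.

Let Q_coef f : (forall i, P f`_i) -> Q f.
Proof.
move=> h; rewrite -[f]coefK poly_def; elim/big_ind: _ => [//||i _]; first exact: Qadd.
by rewrite -mul_polyC mulrC; apply: Qmul; apply: h.
Qed.

(** A shortest element of I with a coefficient outside P. Its leading coefficient is outside P,
    since otherwise that term could be removed. *)
Let least (I : set {poly R}) : (forall f g, I f -> I g -> I (f - g)) -> Q `<=` I ->
  (exists g i, I g /\ ~ P g`_i) -> exists g, [/\ I g, ~ P (lead_coef g) &
    forall q, I q -> (size q < size g)%N -> forall i, P q`_i].
Proof.
move=> IB IQ [g0 [i0 [hg0 hi0]]].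
pose A n := `[< exists g, [/\ I g, (exists i, ~ P g`_i) & size g = n] >].
have hA : exists n, A n by exists (size g0); apply/asboolP; exists g0; split=> //; exists i0.
case: (ex_minnP hA) => n /asboolP[g [hg [i hi] en]] hmin.
have hlt q : I q -> (size q < size g)%N -> forall i, P q`_i.
  move=> hq hs j; apply: contrapT => hj.
  have : (n <= size q)%N by apply: hmin; apply/asboolP; exists q; split=> //; exists j.
  by rewrite -en leqNgt hs.
exists g; split=> // hl.
have g0' : g != 0.
  by apply/eqP => g0'; apply: hi; rewrite g0' coef0 /P polyC0.
pose g' := g - lead_coef g *: 'X^((size g).-1).
have hg' : I g'.
  apply: IB => //; apply: IQ; apply: Q_coef => j; rewrite coefZ coefXn; case: eqP => _.
    by rewrite mulr1.
  by rewrite mulr0 /P polyC0.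
have sg' : (size g' < size g)%N.
  have hsz : (0 < size g)%N by rewrite size_poly_gt0.
  rewrite -(prednK hsz) ltnS; apply/leq_sizeP => j hj.
  rewrite /g' coefB coefZ coefXn; case: eqP => [->|/eqP ne]; first by rewrite mulr1 /lead_coef subrr.
  rewrite mulr0 subr0 nth_default //; move: hj.
  by rewrite leq_eqVlt eq_sym (negbTE ne) /= prednK.
apply: hi; have := hlt _ hg' sg' i; rewrite /g' coefB coefZ coefXn /P.
case: eqP => [-> _|_]; first exact: hl.
by rewrite mulr0 subr0.
Qed.

(** Elimination of one variable: a zero of P off d = 0 lifts to a zero of Q off f = 0. Let g be a
    shortest element of Q, and e one of the ideal (Q, f), with leading coefficients outside P.
    Pseudo-division shows that e is a constant. At a root of g all of Q vanishes, while f does not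
    because e = u f + q; so d is e times the leading coefficient of g. If all coefficients of Q are
    in P, a coefficient of f serves as d. *)
Lemma nullstellensatz_step f : ~ Q f -> exists2 d, ~ P d &
  forall h : {rmorphism R -> k}, (forall c, P c -> h c = 0) -> h d != 0 ->
  exists a, (forall q, Q q -> (map_poly h q).[a] = 0) /\ (map_poly h f).[a] != 0.
Proof.
move=> nf; have [hex|hno] := pselect (exists g i, Q g /\ ~ P g`_i); last first.
  have [i hi] : exists i, ~ P f`_i.
    by apply/existsNP => h; apply: nf; apply: Q_coef.
  exists f`_i => // h hk hd.
  have /closed_nonrootP[a ha] : map_poly h f != 0.
    by apply: contraNneq hd => e; rewrite -coef_map e coef0.
  exists a; split=> // q hq; have -> : map_poly h q = 0; last by rewrite horner0.
  apply/polyP => j; rewrite coef_map coef0; apply: hk; apply: contrapT => hj.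
  by apply: hno; exists q, j.
have [g [hg lg ming]] := least Qsub (fun _ h => h) hex.
pose J : set {poly R} := [set x | exists u q, Q q /\ x = u * f + q].
have JB x y : J x -> J y -> J (x - y).
  move=> [u [q [hq ->]]] [u' [q' [hq' ->]]]; exists (u - u'), (q - q'); split; first exact: Qsub.
  by rewrite mulrBl opprD addrACA.
have JM x y : J y -> J (x * y).
  move=> [u [q [hq ->]]]; exists (x * u), (x * q); split; first exact: Qmul.
  by rewrite mulrDr mulrA.
have JQ : Q `<=` J by move=> q hq; exists 0, q; rewrite mul0r add0r.
have Jf : J f by exists 1, 0; rewrite mul1r addr0.
have [e [he le mine]] := least JB JQ (ex_intro _ g (ex_intro _ _ (conj (JQ _ hg) lg))).
have e0 : e != 0 by apply/eqP => e0; apply: le; rewrite e0 lead_coef0 /P polyC0.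
have g0 : g != 0 by apply/eqP => g0; apply: lg; rewrite g0 lead_coef0 /P polyC0.
have divJ x : J x -> Q (x %% e).
  move=> hx; apply: Q_coef; apply: mine; last by rewrite Pdiv.Idomain.ltn_modp.
  have -> : x %% e = (lead_coef e ^+ scalp x e)%:P * x - (x %/ e) * e.
    by rewrite mul_polyC Pdiv.Idomain.divp_eq addrC addKr.
  by apply: JB; apply: JM.
have nlead x n : ~ P x -> ~ Q (x ^+ n)%:P by move=> hx; rewrite polyC_exp => /QX.
have ne : ~ Q e.
  move=> hqe; have /Qpr[] // : Q ((lead_coef e ^+ scalp f e)%:P * f); last exact: nlead.
  by rewrite mul_polyC Pdiv.Idomain.divp_eq; apply: Qadd; [exact: Qmul|exact: divJ].
have se : (size e <= 1)%N.
  rewrite leqNgt; apply/negP => se.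
  have hge := Pdiv.Idomain.divp_eq g e; set c := lead_coef e ^+ _ in hge.
  have c0 : c != 0 by rewrite expf_neq0 // lead_coef_eq0.
  have hqe : Q (g %/ e).
    have /Qpr[] // : Q (g %/ e * e).
    have -> : g %/ e * e = c%:P * g - g %% e by rewrite mul_polyC hge addrK.
    by apply: Qsub; [exact: Qmul|apply: divJ; exact: JQ].
  have heg : (size e <= size g)%N.
    by rewrite leqNgt; apply/negP => h; apply: lg; apply: mine => //; exact: JQ.
  have sm : (size (g %% e)%R < size e)%N by rewrite Pdiv.Idomain.ltn_modp.
  have sq : (size (g %/ e)%R < size g)%N.
    have [->|q0] := eqVneq (g %/ e) 0; first by rewrite size_poly0 size_poly_gt0.
    have : (size (g %/ e * e)%R <= size g)%N.
      have -> : g %/ e * e = c *: g - g %% e by rewrite hge addrK.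
      apply: (leq_trans (size_polyD _ _)); rewrite size_polyN size_scale //.
      by rewrite (maxn_idPl (ltnW (leq_trans sm heg))).
    rewrite size_mul //; apply: leq_trans.
    by rewrite -[(_ + size e)%N.-1]subn1 ltn_subRL addnC ltn_add2l.
  have hco := ming _ hqe sq.
  have : P (c *: g)`_(size g).-1.
    rewrite hge coefD [(g %% e)`_ _]nth_default ?addr0; last first.
      by rewrite -ltnS prednK ?size_poly_gt0 //; exact: leq_trans sm heg.
    rewrite coefM /P rmorph_sum /=; elim/big_ind: _ => [//||i _]; first exact: Qadd.
    by rewrite polyCM mulrC; apply: Qmul; apply: hco.
  rewrite coefZ /P polyCM => /Qpr[|//]; exact: nlead.
have [u [q1 [hq1 eu]]] := he; pose d := e`_0.
have ed : e = d%:P by apply: size1_polyC.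
exists (d * lead_coef g).
  by rewrite /P polyCM => /Qpr[|//]; rewrite -ed.
move=> h hk; rewrite rmorphM mulf_eq0 negb_or => /andP[hd hl].
have sg : (1 < size g)%N.
  rewrite ltnNge; apply/negP => /size1_polyC eg; apply: lg.
  by rewrite /P eg lead_coefC -eg.
have /closed_rootP[a ha] : size (map_poly h g) != 1%N.
  by rewrite size_map_poly_id0 // gtn_eqF.
have kill q : Q q -> (map_poly h q).[a] = 0.
  move=> hq; have eq := Pdiv.Idomain.divp_eq q g.
  have hr : map_poly h (q %% g) = 0.
    apply/polyP => i; rewrite coef_map coef0; apply: hk.
    apply: ming; last by rewrite Pdiv.Idomain.ltn_modp.
    have -> : q %% g = (lead_coef g ^+ scalp q g)%:P * q - (q %/ g) * g.
      by rewrite mul_polyC eq addrC addKr.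
    by apply: Qsub; apply: Qmul.
  have := congr1 (fun z => (map_poly h z).[a]) eq.
  rewrite /= rmorphD rmorphM /= hr addr0 hornerM (rootP ha) mulr0 map_polyZ hornerZ rmorphXn.
  by move/eqP; rewrite mulf_eq0 expf_eq0 (negbTE hl) andbF => /eqP.
exists a; split=> //; apply: contraNneq hd => hf.
have := congr1 (fun z => (map_poly h z).[a]) eu.
by rewrite /= rmorphD rmorphM /= hornerD hornerM hf (kill _ hq1) mulr0 addr0 ed map_polyC hornerC => ->.
Qed.

End NullstellensatzStep.

Lemma nullstellensatz (k : closedFieldType) (N : nat) (Q : set {mpoly k[N]}) f :
  prime_ideal setT Q -> ~ Q f ->
  exists a : 'I_N -> k, (forall g, Q g -> g.@[a] = 0) /\ f.@[a] != 0.
Proof.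
elim: N Q f => [|N IH] Q f hQ nf.
  have cst (g : {mpoly k[0]}) : g = (g@_0)%:MP.
    apply/mpolyP => m; rewrite mcoeffC.
    have -> : m = 0%MM by apply/mnmP => -[].
    by rewrite eqxx mulr1.
  exists (fun=> 0); split.
    move=> g hg; rewrite (cst g) mevalC; apply/eqP; apply: contrapT => /negP g0.
    case: hQ => _ _ hM h1 _; apply: h1; have -> : 1 = (g@_0)^-1%:MP * g :> {mpoly k[0]}.
      by rewrite {2}(cst g) -mpolyCM mulVf // mpolyC1.
    exact: hM.
  apply/eqP => e; apply: nf; case: hQ => _ [h0 _] _ _ _; suff -> : f = 0 by [].
  by move: e; rewrite (cst f) mevalC => ->; rewrite mpolyC0.
pose bk : {rmorphism {poly {mpoly k[N]}} -> {mpoly k[N.+1]}} :=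
  horner_eval 'X_ord_max \o map_poly (@mwiden N k).
have bkC c : bk c%:P = mwiden c by rewrite /= map_polyC /horner_eval hornerC.
have bkX : bk 'X = 'X_ord_max by rewrite /= map_polyX /horner_eval hornerX.
have hR := subring_range bk.
have bk_surj g : exists q, bk q = g.
  suff [q _ e] : range bk g by exists q.
  rewrite [g]mpolyE; apply: (subring_sum _ hR) => m _; rewrite -mul_mpolyC; case: (hR) => _ _; apply.
    by exists (g@_m)%:MP%:P => //; rewrite bkC mwidenC.
  rewrite mpolyXE_id; apply: (subring_prod _ hR) => i _; apply: (subringX _ hR).
  have [hi|hi] := ltnP i N; last first.
    by exists 'X => //; rewrite bkX; congr 'X__; apply: val_inj => /=; have := ltn_ord i; lia.
  exists ('X_(Ordinal hi))%:P => //; rewrite bkC mwidenX mnmwiden1.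
  by congr 'X__; apply: val_inj.
have hQ' : prime_ideal setT (bk @^-1` Q) := prime_preimage bk hQ.
have [f' ef] := bk_surj f.
have nf' : ~ (bk @^-1` Q) f' by change (~ Q (bk f')); rewrite ef.
have [d nd hd] := nullstellensatz_step k hQ' nf'.
have hP := prime_preimage (@polyC {mpoly k[N]}) hQ'.
have [a' [ha' hda']] := IH _ _ hP nd.
have [|a0 [h1 h2]] := hd (meval a') _ hda'; first by move=> c hc; apply: ha'.
pose a (i : 'I_N.+1) := if insub (i : nat) is Some j then a' j else a0.
have ev (q : {poly {mpoly k[N]}}) : (bk q).@[a] = (map_poly (meval a') q).[a0].
  have evC c : (mwiden c).@[a] = c.@[a'].
    apply: (@mpoly_rmorph_ext _ _ _ (meval a \o @mwiden N k) (meval a')) => [x|i] /=.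
      by rewrite mwidenC !mevalC.
    by rewrite mwidenX mnmwiden1 !mevalXU /a /= valK.
  elim/poly_ind: q => [|q c IHq]; first by rewrite !rmorph0 horner0.
  rewrite rmorphD rmorphM bkC bkX mevalD mevalM IHq evC mevalXU.
  rewrite rmorphD rmorphM /= map_polyX map_polyC /= hornerMXaddC.
  by rewrite {1}/a insubF //= ltnn.
exists a; split; last by rewrite -ef ev.
by move=> g hg; have [q eq] := bk_surj g; rewrite -eq ev; apply: h1; change (Q (bk q)); rewrite eq.
Qed.

(** * Points of an exceptional divisor *)

Lemma quot_neq0 (E : fieldType) (a b : E) : a != 0 -> b != 0 -> a / b != 0.
Proof. by move=> a0 b0; rewrite mulf_neq0 ?invr_eq0. Qed.

Lemma div_trans (E : fieldType) (a c b : E) : b != 0 -> a / c = (a / b) * (b / c).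
Proof. by move=> b0; rewrite mulrA divfK. Qed.

Lemma over_change (K : fieldType) (S G Q : set K) g g' : is_subring S ->
  over (chart S G g) Q -> G g -> g != 0 -> G g' -> unitin Q (g' / g) ->
  over (chart S G g') Q.
Proof.
move=> hS hov hg g0 hg' hu; case: (hov) => -[hQ hl] hC hf; case: (hQ) => _ _ hM.
have [_ /divf_neq0 g'0 hV] := hu; rewrite invf_div in hV.
have hC' : chart S G g' `<=` Q.
  apply: chart_min => // [x hx|x hx]; first by apply: hC; apply: chart_sub.
  have -> : x / g' = (x / g) * (g / g') by rewrite mulrA divfK.
  by apply: hM => //; apply: hC; apply: chart_gen.
apply: (over_shrink (chart_subring hS hg' g'0) hov hC') => x [e [b [hb ->]]].
exists (b / g' ^+ e), ((g / g') ^+ e); split.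
- exact: chart_pw.
- by apply: subringX; [exact: chart_subring|exact: chart_gen].
- by apply: unitinX => //; apply: unitin_div.
- by rewrite expr_div_n invf_div mulrA divfK // expf_neq0.
Qed.

Section Children.
Variables (F : fieldType) (N : nat).
Local Notation poly := {mpoly F[N]}.
Local Notation K := {fraction poly}.
Local Notation "x %:F" := (@FracField.tofrac poly x).
Implicit Types (c w : seq (step N F)) (f g : poly) (Q : set K).

Lemma theta_inv c : exists y : 'I_N -> K, forall l, theta c (y l) = ('X_l)%:F.
Proof.
have /choice[y hy] : forall l, exists z, theta c z = ('X_l)%:F by move=> l; apply: theta_surj.
by exists y.
Qed.

(* The coordinates [y_l / y_j] and [y_j] of the chart [y_j] of the blow-up, [y]
   being coordinates at the centre. *)
Definition chart_coord (y : 'I_N -> K) (j l : 'I_N) : K := if l == j then y j else y l / y j.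

Section Coord.
Variables (c : seq (step N F)) (y : 'I_N -> K) (s : step N F).
Hypotheses (hy : forall l, theta c (y l) = ('X_l)%:F) (hs : s.2 s.1 = 0).
Local Notation ev := (evK (chart_coord y s.1)).
Let R := pt (rcons c s).

Definition shift (a : 'I_N -> F) : poly -> poly := mmap (@mpolyC N F) (fun l => 'X_l + (a l)%:MP).
HB.instance Definition _ a := GRing.RMorphism.on (shift a).

Lemma shift_coef0 a f : (shift a f)@_0 = f.@[a].
Proof.
apply: (@mpoly_rmorph_ext _ _ _ (mcoeff 0%MM \o shift a) (meval a)) => [x|i] /=.
  by rewrite /shift mmapC mcoeff0_C mevalC.
by rewrite /shift mmapX mmap1U mevalXU mcoeffD mcoeff0_C mcoeffX mnm1_eq0 add0r.
Qed.

Lemma shiftX a i : shift a 'X_i = 'X_i + (a i)%:MP.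
Proof. by rewrite /shift mmapX mmap1U. Qed.

Lemma shiftC a x : shift a x%:MP = x%:MP.
Proof. exact: mmapC. Qed.

Lemma shiftK a f : shift a (shift (fun l => - a l) f) = f.
Proof.
apply: (@mpoly_rmorph_ext _ _ _ (shift a \o shift (fun l => - a l)) idfun) => [x|i] /=.
  by rewrite !shiftC.
by rewrite !shiftX rmorphD /= shiftX shiftC -addrA -mpolyCD subrr mpolyC0 addr0.
Qed.

Lemma theta_coord l : theta (rcons c s) (chart_coord y s.1 l) = ('X_l + (s.2 l)%:MP)%:F.
Proof.
rewrite theta_rcons /chart_coord; case: eqP => [->|/eqP ne].
  by rewrite hs mpolyC0 addr0 hy thetaF subw_cons sub1X /stepX eqxx.
rewrite (fmorph_div (theta c)) (fmorph_div (theta [:: s])) /= !hy !thetaF !subw_cons !sub1X /stepX eqxx (negPf ne).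
by rewrite rmorphM mulrAC mulfV ?mul1r ?XF_neq0.
Qed.

Lemma theta_ev f : theta (rcons c s) (ev f) = (shift s.2 f)%:F.
Proof.
apply: (@mpoly_rmorph_ext _ _ _ (theta (rcons c s) \o ev) (@FracField.tofrac poly \o shift s.2))
  => [x|i] /=.
  by rewrite evKC theta_const /shift mmapC.
by rewrite evKX theta_coord /shift mmapX mmap1U.
Qed.

Lemma pt_evP f : R (ev f) /\ (ptM (rcons c s) (ev f) <-> f.@[s.2] = 0).
Proof.
have key : ptM (rcons c s) (ev f - constK N f.@[s.2]).
  rewrite /ptM /= rmorphB /= theta_const theta_ev /constK -tofracB; apply: LocM_poly.
  by rewrite mcoeffB shift_coef0 mcoeff0_C subrr.
split.
  rewrite /R /pt /= theta_ev; exact: Loc_poly.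
split=> h; last by rewrite h rmorph0 subr0 in key.
by apply: (@ptM_const N F (rcons c s)); have := ptM_sub h key; rewrite subKr.
Qed.

Lemma pt_ev_div x : R x -> exists f g, g.@[s.2] != 0 /\ x = ev f / ev g.
Proof.
move=> [a [b [ub e]]].
exists (shift (fun l => - s.2 l) a), (shift (fun l => - s.2 l) b).
rewrite -shift_coef0 shiftK -unitfE; split=> //.
apply: (theta_inj (w := rcons c s)); rewrite e fmorph_div /= !theta_ev !shiftK //.
Qed.

Let O := pt c.
Let y0 l : y l != 0.
Proof.
by apply/eqP => e; have := hy l; rewrite e rmorph0 => /esym/eqP; rewrite (negbTE (XF_neq0 _ _)).
Qed.
Let hm l : max_ideal O (y l).
Proof.
apply/max_ideal_pt; rewrite /ptM /= hy; apply: LocM_poly.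
by rewrite mcoeffX mnm1_eq0.
Qed.
Let hO : is_subring O. Proof. exact: pt_subring. Qed.

Lemma chart_ev f : chart O (max_ideal O) (y s.1) (ev f).
Proof.
have hC : is_subring (chart O (max_ideal O) (y s.1)) by exact: (chart_subring hO (hm s.1) (y0 s.1)).
rewrite /evK /mmap; apply: (subring_sum _ hC) => m _; case: (hC) => _ _; apply.
  by apply: chart_sub; exact: pt_const.
apply: (subring_prod _ hC) => i _; apply: (subringX _ hC); rewrite /chart_coord.
case: eqP => _; first by apply: chart_sub; case: (hm s.1).
by apply: chart_gen => //; exact: hm.
Qed.

Lemma chart_sub_pt : chart O (max_ideal O) (y s.1) `<=` R.
Proof.
apply: chart_min; first exact: pt_subring.
  by move=> x; apply: pt_rcons.
by move=> z /max_ideal_pt hz; apply: (ptM_div hz (hy s.1)).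
Qed.

Lemma child_exc : exc_divisor O R.
Proof.
apply/(exc_divisorP _ hO); split; last first.
  by split=> x; [apply: pt_rcons|move=> /max_ideal_pt/ptM_rcons h; apply/max_ideal_pt].
exists (y s.1); split; [exact: hm|exact: y0|].
split; [exact: (pt_local (rcons c s) (@field_local F))|exact: chart_sub_pt|].
move=> x /pt_ev_div[f [g [g0 ->]]]; exists (ev f), (ev g); split; [exact: chart_ev|exact: chart_ev| |exact: erefl].
have [hR [h1 _]] := pt_evP g; apply: contrapT => hn.
by move/eqP: g0; apply; apply/h1/max_ideal_pt/max_idealP.
Qed.

Section Above.
Variable Q : set K.
Hypothesis hov : over (chart O (max_ideal O) (y s.1)) Q.
Let evQ f : Q (ev f). Proof. by case: hov => _ h _; apply/h/chart_ev. Qed.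
Let hQ : is_subring Q. Proof. by case: hov => -[]. Qed.
Hypothesis hpQ : forall f, max_ideal Q (ev f) -> f.@[s.2] = 0.

Let unitQ g : g.@[s.2] != 0 -> unitin Q (ev g).
Proof.
move=> g0; apply: contrapT => hn; move/eqP: g0; apply; apply: hpQ.
exact/max_idealP.
Qed.

(** [hpQ] says that functions vanishing at Q vanish at the point s, which thus lies on the closure
    of Q; so the denominators allowed at s are units at Q. *)
Lemma child_sub : R `<=` Q.
Proof.
move=> x /pt_ev_div[f [g [g0 ->]]]; case: (hQ) => _ _ hM.
by apply: hM; [exact: evQ|case: (unitQ g0)].
Qed.

Lemma child_eq : (forall f, f.@[s.2] = 0 -> max_ideal Q (ev f)) -> Q = R.
Proof.
move=> h; apply/seteqP; split; last exact: child_sub.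
case: (hov) => hl _ hf x /hf[a [b [ha hb ub ->]]].
have [_ _ hM] := pt_subring (rcons c s).
apply: hM; first exact: chart_sub_pt.
have hbR := chart_sub_pt hb; apply: contrapT => hn.
have hbM : ptM (rcons c s) b.
  apply/max_ideal_pt/max_idealP; split=> // -[_ _ /hn[]].
have [f [g [g0 eb]]] := pt_ev_div hbR.
have hfM : ptM (rcons c s) (ev f).
  have -> : ev f = ev g * b.
    rewrite eb mulrC divfK //; case: (unitQ g0) => _ //.
  by apply: ptM_mul => //; case: (pt_evP g).
have /h : f.@[s.2] = 0 by have [_ [h1 _]] := pt_evP f; apply: h1.
have -> : ev f = ev g * b by rewrite eb mulrC divfK //; case: (unitQ g0).
move=> /max_idealP[_]; apply; apply: unitinM => //; exact: unitQ.
Qed.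

End Above.
End Coord.

(** Some y_j / g is a unit because g is a combination of the y_l. Taking the least such j makes the
    earlier y_l / y_j vanish at Q, which is the condition in [normalised]. *)
Lemma exc_chart c (y : 'I_N -> K) Q : (forall l, theta c (y l) = ('X_l)%:F) ->
  exc_divisor (pt c) Q -> exists j, [/\ over (chart (pt c) (max_ideal (pt c)) (y j)) Q,
    max_ideal Q (y j) & forall l : 'I_N, (l < j)%N -> max_ideal Q (y l / y j)].
Proof.
move=> hy; set O := pt c; have hO : is_subring O := pt_subring c.
move=> /(exc_divisorP _ hO)[[g [hg g0 hov]] [hOQ hmQ]].
case: (hov) => hl hC hf; case: (hl) => hQ _; case: (hQ) => _ _ hQM.
have hm l : max_ideal O (y l).
  apply/max_ideal_pt; rewrite /ptM /= hy; apply: LocM_poly.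
  by rewrite mcoeffX mnm1_eq0.
have y0 l : y l != 0.
  by apply/eqP => e; have := hy l; rewrite e rmorph0 => /esym/eqP; rewrite (negbTE (XF_neq0 _ _)).
have Qyg l : Q (y l / g) by apply: hC; apply: chart_gen.
have [j0 hj0] : exists j, unitin Q (y j / g).
  have [d [hd eg]] : exists d : 'I_N -> K, (forall l, O (d l)) /\ g = \sum_l d l * y l.
    have /max_ideal_pt[a [b [ub ha eg]]] := hg.
    have /mord1P/mord_decomp[A [eA _]] := ha.
    have /choice[d hd] : forall l, exists z, theta c z = (A l)%:F / b%:F by move=> l; apply: theta_surj.
    exists d; split=> [l|]; first by rewrite /O /pt /= hd; exists (A l), b.
    apply: (theta_inj (w := c)); rewrite eg rmorph_sum eA rmorph_sum /= mulr_suml.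
    apply: eq_bigr => l _; rewrite (rmorphM (theta c)) /= hd hy tofracM.
    by rewrite [RHS]mulrC mulrA.
  have [||_ /mapP[l _ ->]] := @local_sum _ Q [seq d l * (y l / g) | l <- index_enum 'I_N] hl.
  - by move=> _ /mapP[l _ ->]; apply: hQM => //; apply: hOQ.
  - rewrite big_map; have -> : \sum_(l <- index_enum 'I_N) d l * (y l / g) = 1.
      transitivity ((\sum_l d l * y l) / g); last by rewrite -eg; exact: mulfV.
      by rewrite mulr_suml; apply: eq_bigr => l _; rewrite mulrA.
    exact: unitin1.
  - by rewrite mulrC => h; exists l; apply: (unitinMl hQ (Qyg l) (hOQ _ (hd l)) h).
pose Pj l := `[< unitin Q (y l / g) >].
have hPj : Pj j0 by apply/asboolP.
case: (arg_minnP (fun l : 'I_N => val l) hPj) => j /asboolP hj hmin {hPj hj0 j0}.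
have hovj := over_change hO hov hg g0 (hm j) hj.
have hCj : chart O (max_ideal O) (y j) `<=` Q by case: hovj.
exists j; split=> // [|l hlj]; first by apply: hmQ.
apply/max_idealP; split; first by apply: hCj; apply: chart_gen.
move=> hu; have : unitin Q (y l / g).
  rewrite (div_trans (y l) g (y0 j)); exact: (unitinM hQ hu hj).
move=> hu'; have := hmin l; rewrite /Pj; move/(_ (introT (asboolP _) hu')).
by rewrite leqNgt hlj.
Qed.

Lemma child_inj c (s s' : step N F) : s.1 = s'.1 -> s.2 s.1 = 0 -> s'.2 s'.1 = 0 ->
  pt (rcons c s) = pt (rcons c s') -> s = s'.
Proof.
case: s s' => j a [j' a'] /= <- h h' e; congr pair; apply/funext => l.
have [y hy] := theta_inv c.
have key (s : step N F) : s.1 = j -> s.2 s.1 = 0 ->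
    ptM (rcons c s) (evK (chart_coord y j) ('X_l - (s.2 l)%:MP)).
  move=> <- hs; have [_ [_ h1]] := pt_evP hy hs ('X_l - (s.2 l)%:MP); apply: h1.
  by rewrite mevalB mevalXU mevalC subrr.
have k1 := key (j, a) erefl h; have k2 := key (j, a') erefl h'.
have {}k2 : ptM (rcons c (j, a)) (evK (chart_coord y j) ('X_l - (a' l)%:MP)).
  by apply/max_ideal_pt; rewrite e; apply/max_ideal_pt.
have := ptM_sub k2 k1; rewrite -rmorphB /=.
have -> : 'X_l - (a' l)%:MP - ('X_l - (a l)%:MP) = (a l - a' l)%:MP :> poly.
  by rewrite mpolyCB; ring.
rewrite evKC.
by move=> /ptM_const/eqP; rewrite subr_eq0 => /eqP.
Qed.

(** The residue field at w is F. For a unit z at w with value a, the difference z - a is no unit at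
    w, hence none in the smaller ring Q, so z is already a unit of Q. *)
Lemma sub_pt_eq w (C Q : set K) : over C Q -> over C (pt w) -> (forall a, Q (constK N a)) ->
  Q `<=` pt w -> Q = pt w.
Proof.
move=> hQ hp hc hsub; apply: (over_eq hQ hp) => z hz; split; first exact: unitin_sub.
case: (hQ) => hl hCQ _ hu; have hzQ := hCQ _ hz.
have [a ha] := pt_ev (hsub _ hzQ); have := (pt_ev_unit ha).1 hu; rewrite unitfE => a0.
apply: (max_ideal_unit hl (unit_const w hl hc a0)).
apply/max_idealP; split; first by case: hl => -[_ hB _] _; apply: hB.
by move=> /(unitin_sub hsub) hu'; have /max_ideal_pt/max_idealP[_] := ha.
Qed.

Lemma Bl_closed_pt w (G : set poly) h Q : Bpt w G h -> Bl (@SP N F) (GF G) Q ->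
  Q `<=` pt w -> Q = pt w.
Proof.
move=> hb [g [hg g0 hov]] hsub; have h0 : h != 0 by case: hb.
have hG : GF G h%:F by apply: GF_mem; case: hb.
have hS := @SP_subring N F.
case: (hov) => hl hC hf; have hcQ a : Q (constK N a).
  by apply: hC; apply: chart_sub => //; exists a%:MP.
have hQ : Q (h%:F / g) by apply: hC; apply: chart_gen.
have hu : unitin (pt w) (h%:F / g).
  split; first exact: hsub.
    by apply: (quot_neq0 _ g0); rewrite tofrac_eq0.
  rewrite invf_div; case: hg => g' hg' <-; exact: (Bpt_G hb hg').
have huQ : unitin Q (h%:F / g).
  have [a ha] := pt_ev (hsub _ hQ); have := (pt_ev_unit ha).1 hu; rewrite unitfE => a0.
  apply: (max_ideal_unit hl (unit_const w hl hcQ a0)).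
  apply/max_idealP; split; first by case: hl => -[_ hB _] _; apply: hB.
  by move=> /(unitin_sub hsub) hu'; have /max_ideal_pt/max_idealP[_] := ha.
apply: (sub_pt_eq (over_change hS hov hg g0 hG huQ) _ hcQ hsub).
exact: (over_pt (@field_local F) hb).
Qed.

End Children.

(** * Naming the centres by words *)

Section Reach.
Variables (N : nat).

(** A point of the exceptional divisor lies in several charts; choosing the first possible one makes
    the earlier coordinates vanish. For N = 2 the normalised steps are the tangent directions: a
    slope, or the vertical one. *)
Definition normalised (B : nzRingType) (s : step N B) :=
  s.2 s.1 = 0 /\ forall l : 'I_N, (l < s.1)%N -> s.2 l = 0.

Variable k : closedFieldType.
Local Notation poly := {mpoly k[N]}.
Local Notation K := {fraction poly}.
Local Notation "x %:F" := (@FracField.tofrac poly x).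
Implicit Types (c w : seq (step N k)) (f g : poly) (Q : set K).

(** The Nullstellensatz is applied to the closure of Q in the chart y_j. The function fp is a
    product of functions that do not vanish at Q, one for each excluded word and vanishing at its
    point if that is on the closure, so the point found is none of the excluded ones. *)
Lemma exc_child c Q (excl : seq (seq (step N k))) : exc_divisor (pt c) Q ->
  (forall e, e \in excl -> Q <> pt e) ->
  exists s, [/\ normalised s, pt (rcons c s) `<=` Q &
    forall e, e \in excl -> pt (rcons c s) <> pt e].
Proof.
set O := pt c; have hO : is_subring O := pt_subring c.
move=> hexc hexcl.
have [y hy] := theta_inv c.
have [j [hovj hyj hlt]] := exc_chart hy hexc.
case: (hovj) => hl _ _; case: (hl) => hQ _.
pose ev : {rmorphism poly -> K} := evK (chart_coord y j).
have chev f : chart O (max_ideal O) (y j) (ev f).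
  by have h := @chart_ev _ _ c y ((j, fun=> 0) : step N k) hy f; exact: h.
have hCj : chart O (max_ideal O) (y j) `<=` Q by case: hovj.
have evQ f : Q (ev f) by apply: hCj.
pose p := ev @^-1` max_ideal Q.
have hp : prime_ideal setT p.
  split=> [//||a b _ hb||a b _ _]; rewrite /p /preimage /mkset.
  - rewrite rmorph0; split=> [|a b ha hb]; first exact: max_ideal0.
    by rewrite rmorphD; apply: max_idealD.
  - by rewrite rmorphM; apply: max_idealM.
  - by rewrite rmorph1; apply: max_idealN1.
  - rewrite rmorphM => /max_idealP[_ hn].
    have [ha|ha] := pselect (unitin Q (ev a)); last by left; apply/max_idealP.
    have [hb|hb] := pselect (unitin Q (ev b)); last by right; apply/max_idealP.
    by case: hn; apply: unitinM.
have pX (l : 'I_N) : (l <= j)%N -> p 'X_l.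
  have evX : ev 'X_l = chart_coord y j l by exact: evKX.
  change ((l <= j)%N -> max_ideal Q (ev 'X_l)); rewrite evX /chart_coord; case: eqP => [_ _|/eqP ne hlj].
    exact: hyj.
  by apply: hlt; rewrite ltn_neqAle hlj andbT (inj_eq val_inj).
have hfe (e : seq (step N k)) : e \in excl -> exists fe, ~ p fe /\ forall a : 'I_N -> k,
    a j = 0 -> pt (rcons c (j, a)) = pt e -> (forall f, p f -> f.@[a] = 0) -> fe.@[a] = 0.
  move=> he; have [[a [ha ea pa]]|hno] := pselect (exists a : 'I_N -> k,
    [/\ a j = 0, pt (rcons c (j, a)) = pt e & forall f, p f -> f.@[a] = 0]); last first.
    exists 1; split; first by case: hp.
    by move=> a ha ea pa; case: hno; exists a.
  have [fe hfe] : exists fe, fe.@[a] = 0 /\ ~ p fe.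
    apply: contrapT => hn; apply: (hexcl e he); rewrite -ea.
    apply: (@child_eq _ _ c y (j, a) hy ha Q hovj) => f hf0.
      exact: pa.
    by apply: contrapT => h; apply: hn; exists f.
  exists fe; split; first by case: hfe.
  move=> b hb eb pb; have := @child_inj _ _ c (j, a) (j, b) erefl ha hb.
  by rewrite ea eb => /(_ erefl)[<-]; case: hfe.
have [fp [nfp hfp]] : exists fp, ~ p fp /\ forall e, e \in excl -> forall a : 'I_N -> k,
    a j = 0 -> pt (rcons c (j, a)) = pt e -> (forall f, p f -> f.@[a] = 0) -> fp.@[a] = 0.
  elim: (excl) hfe => [|e s IH] hs.
    by exists 1; split=> //; case: hp.
  have [f1 [n1 h1]] := hs e (mem_head e s).
  have [f2 [n2 h2]] := IH (fun e' he' => hs e' (mem_behead (s := _ :: _) he')).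
  exists (f1 * f2); split; first by case: hp => _ _ _ _ hpr /hpr[].
  move=> e'; rewrite inE => /orP[/eqP->|he'] a ha ea pa; rewrite mevalM.
    by rewrite (h1 a) ?mul0r.
  by rewrite (h2 e' he' a) ?mulr0.
have [a [pa ha]] := nullstellensatz hp nfp.
have aj : a j = 0 by rewrite -(mevalXU a j); apply: pa; apply: pX.
exists (j, a); split.
- by split=> //= l hlj; rewrite -(mevalXU a l); apply: pa; apply: pX; exact: ltnW.
- by apply: (@child_sub _ _ c y (j, a) hy aj Q hovj) => f hf0; apply: pa.
- by move=> e he ee; move/eqP: ha; apply; apply: (hfp e he).
Qed.

Lemma meval0_coef f : f.@[fun=> 0] = f@_0.
Proof.
apply: (@mpoly_rmorph_ext _ _ _ (meval (fun=> 0)) (mcoeff 0%MM)) => [x|i] /=.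
  by rewrite mevalC mcoeff0_C.
by rewrite mevalXU mcoeffX mnm1_eq0.
Qed.

Lemma origin_pt : @origin k N = pt [::].
Proof.
have sub b : (@polyF k N @` [set f | f.@[fun=> 0] = 0]) b%:F -> b@_0 = 0.
  by move=> [f hf /eqP]; rewrite tofrac_eq => /eqP <-; rewrite -meval0_coef.
apply/seteqP; split=> x.
  move=> [_ [_ [[a _ <-] [b _ <-] hb ->]]]; rewrite /pt /= theta_nil; exists a, b; split=> //.
  rewrite unitfE; apply/negP => /eqP b0; apply: hb; exists b => //.
  by rewrite /mkset meval0_coef.
rewrite /pt /= theta_nil => -[a [b [ub ->]]].
exists a%:F, b%:F; split; [by exists a|by exists b| |by []].
by move=> /sub b0; move: ub; rewrite b0 unitr0.
Qed.

Lemma affine_over Q : @affine_space k N Q <-> over (@SP N k) Q.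
Proof. exact: (Spec_modelP _ (@SP_subring N k)). Qed.

Lemma affine_pt : @affine_space k N (pt [::]).
Proof.
apply/affine_over; split; [exact: (pt_local [::] (@field_local k))|by move=> _ [f _ <-]; apply: pt_poly|].
move=> x; rewrite /pt /= theta_nil => -[a [b [ub ->]]].
exists a%:F, b%:F; split; [exact: SP_poly|exact: SP_poly| |by []].
have hb : ptM [::] (b%:F - constK N b@_0).
  rewrite /ptM /= theta_nil /constK -tofracB; apply: LocM_poly.
  by rewrite mcoeffB mcoeff0_C subrr.
exact/(pt_ev_unit hb).
Qed.

Lemma affine_origin Q : @affine_space k N Q -> dominates Q (@origin k N) -> Q = pt [::].
Proof.
move=> /affine_over[_ _ hf]; rewrite origin_pt => -[h1 h2].
apply/seteqP; split=> // x /hf[_ [_ [[a _ <-] [b _ <-] ub ->]]].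
rewrite /pt /= theta_nil; exists a, b; split=> //; rewrite unitfE; apply/negP => /eqP b0.
have /h2/max_idealP[_] : max_ideal (pt [::]) b%:F.
  by apply/max_ideal_pt; rewrite /ptM /= theta_nil; apply: LocM_poly.
by apply.
Qed.

(* The points of the i-th model over the origin that are named by a word, the
   first [i] centres being those named by [ws]. *)
Fixpoint reach (ws : nat -> seq (step N k)) (i : nat) (w : seq (step N k)) : Prop :=
  if i is j.+1 then
    (reach ws j w /\ pt w <> pt (ws j)) \/ exists2 s, normalised s & w = rcons (ws j) s
  else w = [::].

Lemma reach_ext ws ws' i w : (forall j, (j < i)%N -> ws j = ws' j) -> reach ws i w -> reach ws' i w.
Proof.
elim: i w => [|i IH] w h //= [[hr hne]|[s hs ->]]; rewrite -?h //; last by right; exists s.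
by left; split; first by apply: IH hr => j hj; apply: h; apply: ltnW.
Qed.

Section Centres.
Variables (n : nat) (A : nat -> set (set K)) (P : nat -> set K).
Hypothesis hA : blowup_sequence n A P.

Let good ws m := forall i, (i < m)%N -> reach ws i (ws i) /\ P i.+1 = pt (ws i).

Lemma reach_mem ws m i w : good ws m -> (m <= n)%N -> (i <= m)%N -> reach ws i w -> A i (pt w).
Proof.
case: hA => hA0 hAS hg hm; elim: i w => [|i IH] w hi /=.
  by move=> ->; rewrite hA0; apply: affine_pt.
have [_ _ ->] := hAS i (leq_trans hi hm); have [_ ->] := hg i hi.
case=> [[hr hne]|[s hs ->]]; [left; split=> //; exact: IH (ltnW hi) hr|right].
have [y hy] := theta_inv (ws i); exact: (child_exc hy (proj1 hs)).
Qed.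

(** The list of exclusions makes the induction work: a point that is not a centre must be
    specialized to a named point that is not this centre either, in order to survive on the
    blow-up. *)
Lemma reach_below ws m i Q (excl : seq (seq (step N k))) : good ws m -> (m <= n)%N -> (i <= m)%N ->
  A i Q -> dominates Q (@origin k N) -> (forall e, e \in excl -> Q <> pt e) ->
  exists w, [/\ reach ws i w, pt w `<=` Q & forall e, e \in excl -> pt w <> pt e].
Proof.
case: hA => hA0 hAS hg hm; elim: i Q excl => [|i IH] Q excl hi.
  by rewrite hA0 => hQ ho he; exists [::]; split=> //; rewrite -(affine_origin hQ ho).
have [_ _ ->] := hAS i (leq_trans hi hm); have [hr ->] := hg i hi.
case=> [[hQ hne]|hQ] ho he.
  have [|w [hw hs hx]] := IH Q (ws i :: excl) (ltnW hi) hQ ho.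
    by move=> e; rewrite inE => /orP[/eqP->//|]; apply: he.
  exists w; split=> //; first by left; split=> //; apply: hx; rewrite inE eqxx.
  by move=> e hee; apply: hx; rewrite inE hee orbT.
have [s [hs hsub hx]] := exc_child hQ he.
by exists (rcons (ws i) s); split=> //; right; exists s.
Qed.

(** [reach_below] finds a named point in the closure of each centre; as the centre is closed, the
    two coincide. *)
Lemma exists_centres : exists ws, forall i, (i < n)%N ->
  reach ws i (ws i) /\ P i.+1 = pt (ws i).
Proof.
suff [ws hws] : exists ws, good ws n by exists ws.
have : (n <= n)%N by [].
elim: {1 3}n => [|m IH] hm; first by exists (fun=> [::]).
have [ws hws] := IH (ltnW hm); case: hA => _ /(_ m hm)[[hP hcl] ho _].
have [|w [hw hsub _]] := @reach_below ws m m (P m.+1) [::] hws (ltnW hm) (leqnn m) hP ho.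
  by [].
have e : pt w = P m.+1 by apply: hcl => //; exact: (reach_mem hws (ltnW hm) (leqnn m)).
pose ws' i := if i == m then w else ws i.
have ext i : (i <= m)%N -> forall j, (j < i)%N -> ws j = ws' j.
  by move=> hi j hj; rewrite /ws' ltn_eqF // (leq_trans hj).
exists ws' => i; rewrite ltnS leq_eqVlt => /orP[/eqP->|hi].
  by rewrite {2 3}/ws' eqxx; split=> //; apply: reach_ext hw; apply: ext.
have [h1 h2] := hws i hi; rewrite {2 3}/ws' ltn_eqF //; split=> //.
by apply: reach_ext h1; apply: ext; apply: ltnW.
Qed.

End Centres.
End Reach.

Lemma seqset_map (A A' : comNzRingType) (f : A -> A') (s : seq A) : seqset (map f s) = f @` seqset s.
Proof. by apply/seteqP; split=> [x /mapP[y hy ->]|_ [y hy <-]]; [exists y|exact: map_f]. Qed.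

(** * Chains of certified blow-ups *)

Section Chain.
Variable N : nat.

(** Over a field this certifies a blow-up sequence, by [chain_models]; over B it is the common
    source of the sequences over k and over L. *)
Definition chain (B : idomainType) (ws : nat -> seq (step N B))
    (Gs : nat -> seq {mpoly B[N]}) (hs : nat -> {mpoly B[N]})
    (Js : nat -> seq {mpoly B[N]}) (n : nat) :=
  Gs 0%N = [:: 1] /\ forall i, (i < n)%N ->
    [/\ Bpt (ws i) (seqset (Gs i)) (hs i), Jspec (ws i) (seqset (Gs i)) (hs i) (seqset (Js i))
      & Gs i.+1 = [seq g * t | g <- Gs i, t <- Js i]].

Lemma seqset_mul (A : comNzRingType) (s t : seq A) :
  seqset [seq g * u | g <- s, u <- t] = mulset (seqset s) (seqset t).
Proof.
apply/seteqP; split=> [x /allpairsP[[g u] /= [hg hu ->]]|x [g [u [hg hu ->]]]]; first by exists g, u.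
by apply/allpairsP; exists (g, u).
Qed.

Lemma chain_map (B B' : idomainType) (r : {rmorphism B -> B'}) ws Gs hs Js n :
  (forall i, (i < n)%N -> map_mpoly r (hs i) != 0) -> chain ws Gs hs Js n ->
  chain (fun i => map (step_map r) (ws i)) (fun i => map (map_mpoly r) (Gs i))
    (fun i => map_mpoly r (hs i)) (fun i => map (map_mpoly r) (Js i)) n.
Proof.
move=> h0 [hG hS]; split=> [|i hi]; first by rewrite hG /= rmorph1.
have [hb hJ ->] := hS i hi; rewrite !seqset_map; split.
- exact: Bpt_map (h0 i hi) hb.
- exact: Jspec_map (h0 i hi) hJ.
- rewrite map_allpairs allpairs_mapl allpairs_mapr.
  by apply: eq_allpairs => g t; rewrite rmorphM.
Qed.

Lemma chain_torsion (B : idomainType) (p : B) ws Gs hs Js n : p != 0 -> local_dom B ->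
  chain ws Gs hs Js n -> forall i, (i <= n)%N -> torsion_free_eventually p (seqset (Gs i)).
Proof.
move=> p0 hB [hG hS]; elim=> [_|i IH hi].
  rewrite hG; have -> : seqset [:: 1] = [set (1 : {mpoly B[N]})]; last exact: torsion_one.
  by apply/seteqP; split=> x; rewrite /seqset /= inE => /eqP.
have [hb hJ ->] := hS i hi; rewrite seqset_mul.
exact: (torsion_mulset p0 hB hb hJ (IH (ltnW hi))).
Qed.

Section Field.
Variable F : fieldType.
Local Notation K := {fraction {mpoly F[N]}}.
Local Notation "x %:F" := (@FracField.tofrac {mpoly F[N]} x).

Lemma pt_dom w : dominates (pt w) (@pt N F [::]).
Proof.
elim/last_ind: w => [|w s [h1 h2]]; first by split=> x.
split=> x hx; first by apply/pt_rcons/h1.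
by apply/max_ideal_pt/ptM_rcons/max_ideal_pt/h2.
Qed.

Lemma Bl_one : Bl (@SP N F) (GF (seqset [:: 1])) = @affine_space F N.
Proof.
have hS := @SP_subring N F.
have e1 : (1 : {mpoly F[N]})%:F = 1 :> K by exact: tofrac1.
have ch : chart (@SP N F) (GF (seqset [:: 1])) 1 = @SP N F.
  apply/seteqP; split; last by move=> x hx; apply: chart_sub.
  apply: chart_min => // _ [g hg <-]; rewrite divr1; exact: SP_poly.
apply/seteqP; split=> O.
  move=> [_ [[g hg <-] _ h]]; apply/(Spec_modelP _ hS).
  by move: hg h; rewrite /seqset /= inE => /eqP->; rewrite e1 ch.
move=> /(Spec_modelP _ hS) h; exists 1; rewrite ch oner_neq0; split=> //.
by exists 1; rewrite // /seqset /= inE.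
Qed.

Lemma chain_models ws Gs hs Js n : chain ws Gs hs Js n ->
  let M i := Bl (@SP N F) (GF (seqset (Gs i))) in
  M 0%N = @affine_space F N /\ forall i, (i < n)%N ->
    [/\ closed_point (M i) (pt (ws i)), dominates (pt (ws i)) (pt [::])
      & M i.+1 = blowup (M i) (pt (ws i))].
Proof.
move=> [hG hS] M; split=> [|i hi]; first by rewrite /M hG Bl_one.
have [hb hJ e] := hS i hi; split; last by rewrite /M (blowup_pt hb hJ) e seqset_mul.
  split; last by move=> Q; apply: (Bl_closed_pt hb).
  exists (hs i)%:F; rewrite tofrac_eq0; split; [by apply: GF_mem; case: hb|by case: hb|].
  exact: over_pt (@field_local F) hb.
exact: pt_dom.
Qed.

End Field.

Local Notation "x %:F" := (@FracField.tofrac _ x).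

Lemma exists_Jspec (B : idomainType) (w : seq (step N B)) (G : seq {mpoly B[N]}) h :
  Bpt w (seqset G) h -> exists J, Jspec w (seqset G) h (seqset J).
Proof.
move=> hb; have h0 : h != 0 by case: hb.
have hF : h%:F != 0 by rewrite tofrac_eq0.
have [hh _ hg _] := hb; have hT := @subring_setT {mpoly B[N]}.
have /choice[c hc] : forall g, exists c, seqset G g -> fval w g h c.
  move=> g; have [/hg[c]|hno] := pselect (seqset G g); first by exists c.
  by exists 0 => /hno.
have pg g : seqset G g -> pw [set: {mpoly B[N]}] (seqset G) 1 g by apply: pw_gen.
exists ([seq g - (c g)%:MP * h | g <- G] ++ [seq 'X_l * g | l <- enum 'I_N, g <- G]); split.
- by move=> g hgG; exists (c g); rewrite /seqset /= mem_cat; apply/orP; left; apply/mapP; exists g.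
- move=> l g hgG; rewrite /seqset /= mem_cat; apply/orP; right; apply/allpairsP; exists (l, g).
  by rewrite mem_enum.
- move=> t; rewrite /seqset /= mem_cat => /orP[/mapP[g hgG ->]|/allpairsP[[l g] /= [_ hgG ->]]].
    split; first by apply: pw_sub; [exact: pg|apply: pw_scale => //; exact: pg].
    apply/(fvalP _ _ _ h0); have /(fvalP _ _ _ h0) := hc g hgG.
    rewrite rmorph0 subr0 /constK tofracB tofracM => h1.
    rewrite mulrBl mulfK; [exact: h1|exact: hF].
  split; first by apply: pw_scale => //; exact: pg.
  apply/(fvalP _ _ _ h0); rewrite rmorph0 subr0 tofracM -mulrA mulrC.
  apply: ptM_mul; last by rewrite /ptM /= thetaF; apply: LocM_poly; rewrite subw_coef0 mcoeffX mnm1_eq0.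
  exact: (Bpt_G hb hgG).
Qed.

Lemma Bpt_nil (B : idomainType) : Bpt [::] (seqset [:: 1]) (1 : {mpoly B[N]}).
Proof.
apply: Bpt_intro; [by rewrite /seqset /= inE|exact: oner_neq0| |].
  move=> g; rewrite /seqset /= inE => /eqP->; rewrite /pt /= theta_nil divff ?tofrac_eq0 ?oner_eq0 //.
  by rewrite -tofrac1; exact: Loc_poly.
move=> l; exists ('X_l)%:F; first exact: theta_nil.
apply: fracs_sub; [|exact: pt_subring|by apply: chart_sub; exact: SP_poly].
by apply: chart_subring; [exact: SP_subring|apply: GF_mem; rewrite /seqset /= inE|rewrite tofrac_eq0 oner_eq0].
Qed.

Section Lift.
Variables (B : idomainType) (k : closedFieldType) (r : {rmorphism B -> k}) (tau : k -> B).
Hypothesis hr : forall b, r b != 0 -> b \is a GRing.unit.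
Variables (n : nat) (ws : nat -> seq (step N k)).
Hypothesis hws : forall i, (i < n)%N -> reach ws i (ws i).
Local Notation liftw := (map (step_map tau)).
Local Notation mapw := (map (step_map r)).
Hypothesis htau : forall i, (i < n)%N -> mapw (liftw (ws i)) = ws i.

(** The invariant [Inv] certifies every reachable word whose lift reduces to it, not only the next
    centre: a later centre may already be present, and each blow-up carries its certificate along by
    [Bpt_other] or creates it by [Bpt_child]. *)
Lemma exists_chain : exists Gs hs Js, chain (fun i => liftw (ws i)) Gs hs Js n /\
  forall i, (i < n)%N -> map_mpoly r (hs i) != 0.
Proof.
pose Inv i (G : seq {mpoly B[N]}) := forall w, reach ws i w -> mapw (liftw w) = w ->
  exists2 h, map_mpoly r h != 0 & Bpt (liftw w) (seqset G) h.
have hstep (x : nat * seq {mpoly B[N]}) : exists y : {mpoly B[N]} * seq {mpoly B[N]},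
    (x.1 < n)%N -> Inv x.1 x.2 ->
    [/\ Bpt (liftw (ws x.1)) (seqset x.2) y.1, map_mpoly r y.1 != 0,
        Jspec (liftw (ws x.1)) (seqset x.2) y.1 (seqset y.2) &
        Inv x.1.+1 [seq g * t | g <- x.2, t <- y.2]].
  case: x => i G /=; have [[hi hI]|hno] := pselect ((i < n)%N /\ Inv i G); last first.
    by exists (0, [::]) => h1 h2; case: hno.
  have [h h0 hb] := hI _ (hws hi) (htau hi).
  have [J hJ] := exists_Jspec hb; exists (h, J) => _ _ /=; split=> // w hw hl.
  rewrite seqset_mul; case: hw => [[hw hne]|[s _ e]].
    have [hu hu0 hbu] := hI _ hw hl.
    by apply: (Bpt_other hr hbu hb hJ hu0 h0); rewrite hl htau.
  by rewrite e map_rcons; apply: (Bpt_child hr _ hb hJ h0).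
have /choice[f hf] := hstep.
pose Gs := fix Gs i : seq {mpoly B[N]} :=
  if i is j.+1 then [seq g * t | g <- Gs j, t <- (f (j, Gs j)).2] else [:: 1].
have hI i : (i <= n)%N -> Inv i (Gs i).
  elim: i => [_|i IH hi]; last by have [] := hf (i, Gs i) hi (IH (ltnW hi)).
  move=> w /= -> _; exists 1; first by rewrite rmorph1 oner_neq0.
  exact: Bpt_nil.
exists Gs, (fun i => (f (i, Gs i)).1), (fun i => (f (i, Gs i)).2); split.
  by split=> // i hi; have [] := hf (i, Gs i) hi (hI i (ltnW hi)).
by move=> i hi; have [] := hf (i, Gs i) hi (hI i (ltnW hi)).
Qed.

End Lift.
End Chain.

(** * Enlarging the base inside its localization *)

Section LocalizedBase.
Variables (L : closedFieldType) (k : fieldType) (p N : nat).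
Hypotheses (hp : p \in [pchar k]) (char0 : forall n, n.+1%:R != 0 :> L).
Local Notation "<< sg >>" := (subring_gen (seqset sg)) : classical_set_scope.
Let rp : p%:R = 0 :> k := pcharf0 hp.

Section FixedRing.
Variables (B : idomainType) (iota : {rmorphism B -> L}) (r : {rmorphism B -> k}).

Definition lbase sg phi sgB := base p sg phi /\ local_base p sg phi iota r sgB.

(** Extensions of the base within a fixed B. They preserve saturation, so that finitely many ideals
    can be saturated one after the other. *)
Definition lext (sg : seq L) (phi : L -> k) (sgB : seq B) (sg' : seq L) (phi' : L -> k) (sgB' : seq B) :=
  [/\ extends sg phi sg' phi', <<sgB>> `<=` <<sgB'>> & forall (G : set {mpoly B[N]}) d,
    saturated p%:R <<sgB>> G d -> saturated p%:R <<sgB'>> G d].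

Lemma lext_refl sg phi sgB : lext sg phi sgB sg phi sgB. Proof. by split=> //; exact: extends_refl. Qed.

Lemma lext_trans sg phi sgB sg1 phi1 sgB1 sg2 phi2 sgB2 : lext sg phi sgB sg1 phi1 sgB1 ->
  lext sg1 phi1 sgB1 sg2 phi2 sgB2 -> lext sg phi sgB sg2 phi2 sgB2.
Proof.
move=> [h1 h2 h3] [k1 k2 k3]; split; first exact: extends_trans h1 k1.
  by move=> b hb; apply: k2; apply: h2.
by move=> G d h; apply: k3; apply: h3.
Qed.

Lemma local_base_denom sg phi sgB b : local_base p sg phi iota r sgB ->
  exists s, [/\ <<sgB>> s, s \is a GRing.unit & <<sgB>> (s * b)].
Proof.
case=> inj [hu _ hfr] [eSg er] _; have [u [v [+ + pv e]]] := hfr b.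
rewrite -eSg => -[bu hbu eu] [bv hbv ev]; exists bv.
have rv : r bv != 0 by rewrite er // ev.
have v0 : v != 0.
  rewrite -ev; apply: contraNneq rv => e0; have : bv = 0 by apply: inj; rewrite e0 rmorph0.
  by move=> ->; rewrite rmorph0.
split=> //; first exact: hu.
suff -> : bv * b = bu by [].
by apply: inj; rewrite rmorphM e eu ev mulrC divfK.
Qed.

Lemma lbase_inv sg phi sgB s : lbase sg phi sgB -> <<sgB>> s -> s \is a GRing.unit ->
  exists sg' phi' sgB', [/\ lbase sg' phi' sgB', lext sg phi sgB sg' phi' sgB' &
    <<sgB'>> = locz <<sgB>> s].
Proof.
move=> [hb hl] hs us; case: (hl) => inj [hu hker hfr] [eSg er] hker'.
have rs : r s != 0 by rewrite -unitfE rmorph_unit.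
have his : <<sg>> (iota s) by rewrite -eSg; exists s.
have [phi' [hb' he]] : exists phi', base p ((iota s)^-1 :: sg) phi' /\
    extends sg phi ((iota s)^-1 :: sg) phi'.
  by apply: base_inv => //; rewrite -er.
have [sub e1] := he.
have hS := subring_genP (seqset sgB).
have eB := locz_gen us hs.
have is0 : iota s != 0.
  apply: contraNneq rs => e0; have -> : s = 0 by apply: inj; rewrite e0 rmorph0.
  by rewrite rmorph0.
have eL : <<(iota s)^-1 :: sg>> = locz <<sg>> (iota s) by rewrite -locz_gen ?unitfE.
have hphi' : hom_on <<(iota s)^-1 :: sg>> phi' by case: hb'.
have [_ _ phiM] := hphi'.
exists ((iota s)^-1 :: sg), phi', (s^-1 :: sgB); split=> //; last first.
  split=> //; first by rewrite -eB; apply: locz_sub.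
  by move=> G d h; rewrite -eB; apply: saturated_locz.
have hsX n : <<sg>> (iota (s ^+ n)).
  by rewrite -eSg; exists (s ^+ n) => //; exact: (subringX n hS hs).
have erX n : phi' (iota (s ^+ n)) = r s ^+ n.
  rewrite e1 // -er ?rmorphXn //; exact: (subringX n hS hs).
split=> //; split=> //.
- split=> // b; have [u [v [hu' hv pv e]]] := hfr b.
  by exists u, v; rewrite e1 //; split=> //; apply: sub.
- split.
    rewrite eL -eB; apply/seteqP; split.
      move=> _ [b [n hn] <-]; exists n; rewrite -rmorphXn -rmorphM -eSg; by exists (s ^+ n * b).
    move=> x [n]; rewrite -eSg => -[c hc ec].
    have ex : x = iota (s^-1 ^+ n * c).
      rewrite rmorphM ec -rmorphXn mulrA -rmorphM -exprMn mulVr // expr1n rmorph1 mul1r //.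
    exists (s^-1 ^+ n * c) => //; exists n.
    by rewrite mulrA -exprMn divrr // expr1n mul1r.
  move=> b; rewrite -eB => -[n hn]; apply: (mulfI (expf_neq0 n rs)).
  have hib : <<(iota s)^-1 :: sg>> (iota b).
    by rewrite eL; exists n; rewrite -rmorphXn -rmorphM -eSg; exists (s ^+ n * b).
  have -> : r s ^+ n * r b = phi (iota (s ^+ n * b)) by rewrite -er // rmorphM rmorphXn.
  rewrite -erX -phiM //; last exact: sub.
  rewrite -rmorphM e1 //.
  by rewrite -eSg; exists (s ^+ n * b).
- move=> b; rewrite -eB => -[n hn] rb.
  have [|b' hb1 eb] := hker' _ hn; first by rewrite rmorphM rb mulr0.
  exists (s^-1 ^+ n * b').
    by exists n; rewrite mulrA -exprMn divrr // expr1n mul1r.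
  by rewrite mulrCA -eb mulrA -exprMn mulVr // expr1n mul1r.
Qed.

Lemma lbase_clear sg phi sgB (bs : seq B) : lbase sg phi sgB ->
  exists sg' phi' sgB', [/\ lbase sg' phi' sgB', lext sg phi sgB sg' phi' sgB' &
    forall b, b \in bs -> <<sgB'>> b].
Proof.
move=> h; have [s [hs us hb]] := clear_denom (fun b => local_base_denom b h.2) bs.
have [sg' [phi' [sgB' [h1 h2 e]]]] := lbase_inv h hs us.
exists sg', phi', sgB'; split=> // b /hb hsb; rewrite e; exists 1%N; by rewrite expr1.
Qed.

Lemma lbase_saturate sg phi sgB (gss : seq (seq {mpoly B[N]})) : lbase sg phi sgB ->
  p%:R != 0 :> B -> (forall gs, gs \in gss -> torsion_free_eventually p%:R (seqset gs)) ->
  exists sg' phi' sgB' d0, [/\ lbase sg' phi' sgB', lext sg phi sgB sg' phi' sgB' &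
    forall gs d, gs \in gss -> (d0 <= d)%N -> saturated p%:R <<sgB'>> (seqset gs) d].
Proof.
move=> + p0; elim: gss sg phi sgB => [|gs gss IH] sg phi sgB hl ht.
  by exists sg, phi, sgB, 0%N; split=> //; exact: lext_refl.
have [s [d1 [hs us hsat]]] := saturate p0 (fun b => local_base_denom b hl.2) (ht gs (mem_head _ _)).
have [sg2 [phi2 [sgB2 [h2 x2 e2]]]] := lbase_inv hl hs us.
have [|sg3 [phi3 [sgB3 [d3 [h3 x3 hsat3]]]]] := IH _ _ _ h2.
  by move=> g hg; apply: ht; rewrite inE hg orbT.
exists sg3, phi3, sgB3, (maxn d1 d3); split=> //.
  exact: lext_trans x2 x3.
move=> g d; rewrite inE geq_max => /orP[/eqP->|hg] /andP[hd1 hd3]; last exact: hsat3.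
by case: x3 => _ _; apply; rewrite e2; apply: hsat.
Qed.

Lemma lbase_reduces sg phi sgB (n : nat) (Gs : nat -> seq {mpoly B[N]}) : lbase sg phi sgB ->
  p%:R != 0 :> B -> (forall i, (i <= n)%N -> torsion_free_eventually p%:R (seqset (Gs i))) ->
  exists sg' phi' sgB', [/\ lbase sg' phi' sgB', lext sg phi sgB sg' phi' sgB' &
    forall i, (i <= n)%N -> reduces_to p phi' <<sg'>>
      (Bl (@SP N L) (GF (seqset (map (map_mpoly iota) (Gs i)))))
      (Bl (@SP N k) (GF (seqset (map (map_mpoly r) (Gs i)))))].
Proof.
move=> hl p0 ht.
have [|sg' [phi' [sgB' [d0 [h1 h2 hsat]]]]] := @lbase_saturate sg phi sgB [seq Gs i | i <- seq.iota 0 n.+1] hl p0.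
  move=> gs /mapP [i hi ->]; apply: ht; by move: hi; rewrite mem_iota add0n ltnS.
exists sg', phi', sgB'; split=> // i hi.
apply: (@reduction _ _ _ _ _ _ _ _ _ _ h1.2 rp p0 (Gs i) d0) => d hd.
apply: hsat; last exact: ltnW.
by apply/mapP; exists i; rewrite // mem_iota /=; lia.
Qed.

End FixedRing.
End LocalizedBase.

(** * Exceptional valuations and discrepancies *)

Lemma oppr_nz (V : zmodType) (y : V) : y != 0 -> - y != 0.
Proof. by rewrite oppr_eq0. Qed.

Section PolyOrder.
Variables (N : nat) (F : idomainType).
Local Notation poly := {mpoly F[N]}.
Implicit Types (f g : poly).

Lemma mcoeff_sumX (s : seq 'X_{1..N}) (b : 'X_{1..N} -> F) m : uniq s ->
  (\sum_(m' <- s) b m' *: 'X_[m'])@_m = if m \in s then b m else 0.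
Proof.
move=> us; rewrite linear_sum /=; case: ifP => hm.
  rewrite (bigD1_seq m) //= mcoeffZ mcoeffX eqxx mulr1 big1 ?addr0 // => m' /negbTE ne.
  by rewrite mcoeffZ mcoeffX ne mulr0.
rewrite big1_seq // => m' /andP[_ hm']; rewrite mcoeffZ mcoeffX.
by case: eqP hm' hm => [->->//|_ _ _]; rewrite mulr0.
Qed.

Definition homog_part d f : poly := \sum_(m <- [seq m <- msupp f | mdeg m == d]) f@_m *: 'X_[m].

Lemma homog_partE d f m : (homog_part d f)@_m = if mdeg m == d then f@_m else 0.
Proof.
rewrite /homog_part mcoeff_sumX ?filter_uniq ?msupp_uniq // mem_filter.
by case: eqP => //= _; case: ifP => //; rewrite mcoeff_msupp => /negbFE/eqP.
Qed.

Lemma homog_part_homog d f : homog_part d f \is d.-homog.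
Proof.
apply/dhomogP => m; rewrite mcoeff_msupp homog_partE.
by have [//|_] := eqVneq (mdeg m) d; rewrite eqxx.
Qed.

Lemma mord_homog_part d f : mord d f -> mord d.+1 (f - homog_part d f).
Proof.
move=> h m hm; rewrite mcoeffB homog_partE; case: eqP => [_|/eqP ne]; first by rewrite subrr.
by rewrite subr0 h //; move: hm; rewrite ltnS leq_eqVlt (negbTE ne).
Qed.

Lemma homog_part_eq0 d f : mord d f -> homog_part d f = 0 -> mord d.+1 f.
Proof. by move=> h e; have := mord_homog_part h; rewrite e subr0. Qed.

Lemma mord_dhomog d f : f \is d.-homog -> mord d f.
Proof. by move=> /dhomogP h; apply/mordP => m /h ->. Qed.

Lemma dhomog_mord d f : f \is d.-homog -> mord d.+1 f -> f = 0.
Proof.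
move=> /dhomogP h /mordP h'; apply/eqP; rewrite -msupp_eq0; case e: (msupp f) => [//|m s].
have hm : m \in msupp f by rewrite e mem_head.
by have := h' m hm; rewrite (h m hm) ltnn.
Qed.

(** The product of the two initial forms is nonzero, the coefficients being in a domain. *)
Lemma mord_notM d e f g : mord d f -> ~ mord d.+1 f -> mord e g -> ~ mord e.+1 g ->
  ~ mord (d + e).+1 (f * g).
Proof.
move=> hf nf hg ng h; pose f' := homog_part d f; pose g' := homog_part e g.
have f0 : f' != 0 by apply/eqP => /(homog_part_eq0 hf).
have g0 : g' != 0 by apply/eqP => /(homog_part_eq0 hg).
have hh : f' * g' \is (d + e).-homog by apply: dhomogM; apply: homog_part_homog.
have hf' := mord_dhomog (homog_part_homog d f).
suff : mord (d + e).+1 (f' * g').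
  by move=> /(dhomog_mord hh)/eqP; rewrite mulf_eq0 (negbTE f0) (negbTE g0).
have -> : f' * g' = f * g - ((f - f') * g + f' * (g - g')) by ring.
apply: mordB => //; apply: mordD.
  by rewrite -addSn; apply: mordM => //; apply: mord_homog_part.
by rewrite -addnS; apply: mordM => //; apply: mord_homog_part.
Qed.

(** The order at the origin; the zero polynomial, for which no n qualifies, gets the default 0. *)
Definition ordp f : nat := xget 0%N [set n | forall d, mord d f <-> (d <= n)%N].

Lemma ordp_spec f n : f != 0 -> mord n f -> ~ mord n.+1 f -> ordp f = n.
Proof.
move=> f0 h1 h2.
have hn : forall d, mord d f <-> (d <= n)%N.
  move=> d; split=> [hd|hd]; last exact: mord_le hd h1.
  by rewrite leqNgt; apply/negP => hlt; apply: h2; apply: mord_le hd.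
have := xgetPex 0%N (P := [set n | forall d, mord d f <-> (d <= n)%N]) (ex_intro _ n hn).
rewrite -/(ordp f) /mkset => h; apply/eqP; rewrite eqn_leq.
have /hn -> := (h (ordp f)).2 (leqnn _); by have /h -> := h1.
Qed.

Lemma ordpP f : f != 0 -> mord (ordp f) f /\ ~ mord (ordp f).+1 f.
Proof.
move=> f0; suff [n [h1 h2]] : exists n, mord n f /\ ~ mord n.+1 f by rewrite (ordp_spec f0 h1 h2).
have hex : exists n, ~~ `[< mord n f >].
  exists (mdeg (mlead f)).+1; apply/asboolPn => h.
  by move: f0; rewrite -mleadc_eq0 h ?eqxx.
case: (ex_minnP hex) => -[|n]; first by move=> /asboolPn h; case: h; apply: mord0.
move=> /asboolPn h hmin; exists n; split=> //; apply: contrapT => h'.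
by have := hmin n (introT (asboolPn _) h'); rewrite ltnn.
Qed.

Lemma mord_ordp f d : f != 0 -> mord d f <-> (d <= ordp f)%N.
Proof.
move=> f0; have [h1 h2] := ordpP f0; split=> [hd|hd]; last exact: mord_le hd h1.
by rewrite leqNgt; apply/negP => hlt; apply: h2; apply: mord_le hd.
Qed.

Lemma ordpM f g : f != 0 -> g != 0 -> ordp (f * g) = (ordp f + ordp g)%N.
Proof.
move=> f0 g0; have [h1 h2] := ordpP f0; have [k1 k2] := ordpP g0.
by apply: ordp_spec; [rewrite mulf_neq0|apply: mordM|apply: mord_notM].
Qed.

Lemma ordp_unit f : f@_0 != 0 -> ordp f = 0%N.
Proof.
move=> h; apply: ordp_spec; [|exact: mord0|by move=> /mord1P/eqP; rewrite (negbTE h)].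
by apply: contraNneq h => ->; rewrite mcoeff0.
Qed.

Lemma ordpX m : ordp ('X_[m] : poly) = mdeg m.
Proof.
apply: ordp_spec; [by rewrite -msupp_eq0 msuppX|exact: mord_Xm|].
by move=> /mordP/(_ m); rewrite msuppX inE eqxx ltnn => /(_ isT).
Qed.

End PolyOrder.

Section FracOrder.
Variables (N : nat) (F : fieldType).
Local Notation poly := {mpoly F[N]}.
Local Notation K := {fraction poly}.
Local Notation "x %:F" := (@FracField.tofrac poly x).
Implicit Types (f g : poly) (x y : K).

Definition ord x : int := (ordp \n_(generic_quotient.repr x))%:Z - (ordp \d_(generic_quotient.repr x))%:Z.

Lemma ord_div f g : f != 0 -> g != 0 -> ord (f%:F / g%:F) = (ordp f)%:Z - (ordp g)%:Z.
Proof.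
move=> f0 g0; rewrite /ord; set x := f%:F / g%:F.
have x0 : x != 0 by apply: quot_neq0; rewrite tofrac_eq0.
have d0 : \d_(generic_quotient.repr x) != 0 by apply: denom_ratioP.
have ex := frac_repr x.
have n0 : \n_(generic_quotient.repr x) != 0 by apply: contraNneq x0 => e; rewrite ex e tofrac0 mul0r.
move: ex => /(frac_eq _ _ g0 d0)/(congr1 (@ordp N F)); rewrite !ordpM //; lia.
Qed.

Lemma ordF f : f != 0 -> ord f%:F = (ordp f)%:Z.
Proof.
move=> f0; have := ord_div f0 (oner_neq0 _); rewrite tofrac1 divr1 => ->.
by rewrite (@ordp_unit _ _ 1) ?mcoeff1 ?eqxx ?oner_neq0 // subr0.
Qed.

Lemma frac_nz x : x != 0 -> exists f g, [/\ f != 0, g != 0 & x = f%:F / g%:F].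
Proof.
move=> x0; have [a [b [b0 e]]] := fracE x; exists a, b; split=> //.
by apply: contraNneq x0 => a0; rewrite e a0 tofrac0 mul0r.
Qed.

Lemma ordM x y : x != 0 -> y != 0 -> ord (x * y) = ord x + ord y.
Proof.
move=> /frac_nz[a [b [a0 b0 ->]]] /frac_nz[c [d [c0 d0 ->]]].
by rewrite mulf_div -!tofracM !ord_div ?mulf_neq0 // !ordpM // !PoszD; lia.
Qed.

Lemma ordD x y : x != 0 -> y != 0 -> x + y != 0 -> Num.min (ord x) (ord y) <= ord (x + y).
Proof.
move=> /frac_nz[a [b [a0 b0 ->]]] /frac_nz[c [d [c0 d0 ->]]].
rewrite addf_div ?tofrac_eq0 // -!tofracM -tofracD => h.
have h0 : a * d + c * b != 0.
  by apply: contraNneq h => ->; rewrite tofrac0 mul0r.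
rewrite !ord_div ?mulf_neq0 // ordpM // PoszD.
have : (minn (ordp a + ordp d) (ordp c + ordp b) <= ordp (a * d + c * b))%N.
  apply/(mord_ordp _ h0); apply: mordD.
    by apply: (mord_le (geq_minl _ _)); apply: mordM; apply/mord_ordp.
  by apply: (mord_le (geq_minr _ _)); apply: mordM; apply/mord_ordp.
rewrite ge_min => hm; apply/orP; move: hm.
move: (ordp a) (ordp b) (ordp c) (ordp d) (ordp (a * d + c * b)) => A B C D E.
by case: (leqP (A + D) (C + B)) => hle hm; [left|right]; lia.
Qed.

Lemma ordV x : x != 0 -> ord x^-1 = - ord x.
Proof.
move=> x0; have := ordM x0 (invr_neq0 x0); rewrite mulfV // -tofrac1 ordF ?oner_neq0 //.
rewrite ordp_unit ?mcoeff1 ?eqxx ?oner_neq0 //; lia.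
Qed.

Lemma ordX x (n : nat) : x != 0 -> ord (x ^+ n) = ord x *+ n.
Proof.
move=> x0; elim: n => [|n IH]; last by rewrite exprS ordM ?expf_neq0 // IH mulrS.
by rewrite expr0 -tofrac1 ordF ?oner_neq0 // ordp_unit ?mcoeff1 ?eqxx ?oner_neq0.
Qed.

Definition ordR : set K := [set x | x = 0 \/ 0 <= ord x].

Lemma ordR_subring : is_subring ordR.
Proof.
have h1 : ordR 1 by right; rewrite -tofrac1 ordF ?oner_neq0.
have hN x : ordR x -> ordR (- x).
  case=> [->|hx]; first by left; rewrite oppr0.
  have [->|x0] := eqVneq x 0; first by left; rewrite oppr0.
  right; rewrite -mulN1r ordM ?oppr_eq0 ?oner_eq0 //.
  by rewrite -(tofrac1) -tofracN ordF ?oppr_eq0 ?oner_eq0 // addr_ge0.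
split=> // x y.
  have [->|x0] := eqVneq x 0; first by rewrite sub0r => _; apply: hN.
  have [->|y0] := eqVneq y 0; first by rewrite subr0.
  move=> [/eqP|hx]; first by rewrite (negbTE x0).
  move=> /hN[/eqP|hy]; first by rewrite (negbTE (oppr_nz y0)).
  have [e|s0] := eqVneq (x - y) 0; [by left|right].
  have ym := oppr_nz y0.
  by apply: (le_trans _ (ordD x0 ym s0)); rewrite le_min hx hy.
move=> [->|hx]; first by rewrite mul0r; left.
move=> [->|hy]; first by rewrite mulr0; left.
have [->|x0] := eqVneq x 0; first by rewrite mul0r; left.
have [->|y0] := eqVneq y 0; first by rewrite mulr0; left.
by right; rewrite (ordM x0 y0); exact: addr_ge0 hx hy.
Qed.

Lemma ordR_unit x : x != 0 -> ordR x -> unitin ordR x <-> ord x = 0.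
Proof.
move=> x0 [/eqP|hx]; first by rewrite (negbTE x0).
split=> [[_ _ [/eqP|]]|e]; first by rewrite invr_eq0 (negbTE x0).
  by rewrite ordV // oppr_ge0 => h; apply/eqP; rewrite eq_le h.
by split=> //; right; rewrite ?ordV ?e.
Qed.

Lemma ordR_local : local ordR.
Proof.
split; first exact: ordR_subring.
move=> x y hx hy e; have [x0|x0] := eqVneq x 0.
  right; move: e; rewrite x0 add0r => ->; exact: (unitin1 ordR_subring).
have [y0|y0] := eqVneq y 0.
  left; move: e; rewrite y0 addr0 => ->; exact: (unitin1 ordR_subring).
have := ordD x0 y0; rewrite e => /(_ (oner_neq0 _)).
have -> : ord 1 = 0.
  by rewrite -tofrac1 ordF ?oner_neq0 // ordp_unit // mcoeff1 eqxx oner_neq0.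
rewrite ge_min => /orP[h|h]; [left; apply/(ordR_unit x0 hx)|right; apply/(ordR_unit y0 hy)].
  by case: hx => [/eqP|hx]; [rewrite (negbTE x0)|apply/eqP; rewrite eq_le h].
by case: hy => [/eqP|hy]; [rewrite (negbTE y0)|apply/eqP; rewrite eq_le h].
Qed.

End FracOrder.

Lemma unitin_preimage (E E' : fieldType) (f : {rmorphism E -> E'}) (O : set E') x :
  unitin (f @^-1` O) x <-> unitin O (f x).
Proof. by split=> -[h1 h2 h3]; split; rewrite ?fmorph_eq0 /preimage /= ?fmorphV // -?fmorphV -?(fmorph_eq0 f). Qed.

Lemma local_preimage (E E' : fieldType) (f : {rmorphism E -> E'}) (O : set E') :
  local O -> local (f @^-1` O).
Proof.
move=> [hO hl]; split; first exact: subring_preimage.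
move=> a b ha hb e; have := hl _ _ ha hb; rewrite -rmorphD e rmorph1 => /(_ erefl).
by case=> h; [left|right]; apply/unitin_preimage.
Qed.

Lemma div_unit_exp (E : fieldType) (a b y : E) (e : nat) : y != 0 -> a / b = a / y ^+ e / (b / y ^+ e).
Proof. by move=> y0; apply: div_div; rewrite expf_neq0. Qed.

Lemma div_expS (E : fieldType) (a y : E) (e : nat) : y != 0 -> a / y ^+ e = a / y ^+ e.+1 * y.
Proof. by move=> y0; rewrite exprS invfM mulrA mulrAC divfK. Qed.

Section ExceptionalValuation.
Variables (N : nat) (F : fieldType).
Hypothesis hN : (0 < N)%N.
Local Notation poly := {mpoly F[N]}.
Local Notation K := {fraction poly}.
Local Notation "x %:F" := (@FracField.tofrac poly x).
Implicit Types (c : seq (step N F)) (x z : K).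

Definition excR c : set K := theta c @^-1` (@ordR N F).
Definition excv c x : int := ord (theta c x).

Lemma theta_nz c x : x != 0 -> theta c x != 0.
Proof. by move=> x0; rewrite fmorph_eq0. Qed.

Lemma excR_local c : local (excR c).
Proof. exact: local_preimage (@ordR_local N F). Qed.

Lemma excR_unit c x : x != 0 -> excR c x -> unitin (excR c) x <-> excv c x = 0.
Proof.
move=> x0 hx; rewrite unitin_preimage; exact: (ordR_unit (theta_nz c x0) hx).
Qed.

Lemma excR_pt c : pt c `<=` excR c.
Proof.
move=> x [a [b [ub e]]]; rewrite /excR /preimage /mkset e.
have [->|a0] := eqVneq a 0; first by left; rewrite tofrac0 mul0r.
rewrite unitfE in ub; have b0 : b != 0 by apply: contraNneq ub => ->; rewrite mcoeff0.
by right; rewrite ord_div // (ordp_unit ub) subr0.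
Qed.

Lemma excv_ptM c x : ptM c x -> x != 0 -> 1 <= excv c x.
Proof.
move=> [a [b [ub ha e]]] x0; rewrite /excv e.
rewrite unitfE in ub; have b0 : b != 0 by apply: contraNneq ub => ->; rewrite mcoeff0.
have a0 : a != 0.
  apply: contraNneq x0 => a0; move: e; rewrite a0 tofrac0 mul0r => /eqP.
  by rewrite fmorph_eq0.
rewrite ord_div // (ordp_unit ub) subr0 lez_nat; apply/(mord_ordp _ a0).
exact/mord1P.
Qed.

Section Coord.
Variables (c : seq (step N F)) (y : 'I_N -> K).
Hypothesis hy : forall l, theta c (y l) = ('X_l)%:F.
Let O := pt c.
Let hO : is_subring O := pt_subring c.

Let y0 l : y l != 0.
Proof.
by apply/eqP => e; have := hy l; rewrite e rmorph0 => /esym/eqP; rewrite (negbTE (XF_neq0 _ _)).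
Qed.
Let hm l : max_ideal O (y l).
Proof.
apply/max_ideal_pt; rewrite /ptM /= hy; apply: LocM_poly.
by rewrite mcoeffX mnm1_eq0.
Qed.
Let vy l : excv c (y l) = 1.
Proof. by rewrite /excv hy ordF ?mpolyX_neq0 // ordpX mdeg1. Qed.

Lemma pw_mord e x a b : b@_0 != 0 -> mord e a -> theta c x = a%:F / b%:F ->
  pw O (max_ideal O) e x.
Proof.
move=> hb; elim: e x a => [|e IH] x a ha ex.
  by apply: pw_base; exists a, b; rewrite unitfE.
have [A [eA hA]] := mord_decomp ha.
have /choice[z hz] : forall l, exists z, theta c z = (A l)%:F / b%:F by move=> l; apply: theta_surj.
have -> : x = \sum_l z l * y l.
  apply: (theta_inj (w := c)); rewrite ex eA !rmorph_sum /= mulr_suml.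
  apply: eq_bigr => l _; rewrite (rmorphM (theta c)) /= hz hy tofracM.
  by rewrite [RHS]mulrC mulrA.
by apply: pw_sum => l _; apply: pw_mulg; [exact: (IH _ _ (hA l) (hz l))|exact: hm].
Qed.

Lemma excv_div x l (e : nat) : x != 0 -> excv c (x / y l ^+ e) = excv c x - e%:Z.
Proof.
move=> x0; have t0 := expf_neq0 e (theta_nz c (y0 l)).
rewrite /excv fmorph_div rmorphXn /= (ordM (theta_nz c x0) (invr_neq0 t0)) (ordV t0).
rewrite (ordX e (theta_nz c (y0 l))) -/(excv c (y l)) vy; congr (_ - _).
by rewrite -mulr_natr mul1r natz.
Qed.

Lemma chart_excR j : chart O (max_ideal O) (y j) `<=` excR c.
Proof.
apply: chart_min; [by case: (excR_local c)|exact: excR_pt|].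
move=> z hz; have [->|z0] := eqVneq z 0; first by rewrite mul0r; case: (excR_local c) => h _; exact: subring0 h.
right; rewrite -/(excv c _) -[y j]expr1 excv_div // subr_ge0.
by apply: excv_ptM => //; apply/max_ideal_pt.
Qed.

(** If theta x = A / B with e = ord B at most ord A, then x is a quotient of two chart elements with
    denominator y_j^e, the second of value 0. Conversely, let b = be / y_j^e be a unit at a point Q
    of the divisor. A positive value of b would put be into the power e + 1 of the maximal ideal,
    making b a multiple of y_j, which vanishes at Q. *)
Lemma exc_generic : generic_point (exc_divisor O) (excR c).
Proof.
have [hRs hRl] := excR_local c; split.
  apply/(exc_divisorP _ hO); split; last first.
    split; first exact: excR_pt.
    move=> z hz; apply/max_idealP; split; first by apply: excR_pt; case: hz.
    move=> hu; have z0 : z != 0 by case: hu.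
    have := excv_ptM ((max_ideal_pt _ _).1 hz) z0.
    by rewrite ((excR_unit z0 (excR_pt hz.1)).1 hu).
  exists (y (Ordinal hN)); split; [exact: hm|exact: y0|]; set j := Ordinal hN.
  split; [exact: excR_local|exact: chart_excR|].
  move=> x hx; have [x0|x0] := eqVneq x 0.
    exists 0, 1; rewrite x0 mul0r; split=> //; try exact: unitin1.
      by apply: subring0; apply: (chart_subring hO (hm j) (y0 j)).
    by apply: chart_sub; case: hO.
  have tx0 : theta c x != 0 by rewrite fmorph_eq0.
  have [A [B [A0 B0 e]]] := frac_nz tx0.
  have [al hal] := theta_surj c A%:F; have [be hbe] := theta_surj c B%:F.
  have eAB : (ordp B <= ordp A)%N.
    by case: hx => [/eqP|]; [rewrite (negbTE tx0)|rewrite e ord_div // subr_ge0].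
  have one0 : (1 : poly)@_0 != 0 by rewrite mcoeff1 eqxx oner_neq0.
  have be0 : be != 0.
    have : theta c be != 0 by rewrite hbe tofrac_eq0.
    by apply: contraNneq => ->; rewrite rmorph0.
  have hpw z f : theta c z = f%:F -> mord (ordp B) f -> pw O (max_ideal O) (ordp B) z.
    move=> hz hf; apply: (pw_mord one0 hf); rewrite hz tofrac1 divr1 //.
  have hchB : chart O (max_ideal O) (y j) (be / y j ^+ ordp B).
    by apply: chart_pw; apply: (hpw _ _ hbe); apply/(mord_ordp _ B0).
  exists (al / y j ^+ ordp B), (be / y j ^+ ordp B); split; [|exact: hchB| |].
  - by apply: chart_pw; apply: (hpw _ _ hal); apply/(mord_ordp _ A0).
  - apply/excR_unit; [exact: (quot_neq0 be0 (expf_neq0 _ (y0 j)))|exact: chart_excR hchB|].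
    by rewrite (excv_div _ _ be0) /excv hbe (ordF B0) subrr.
  - rewrite -(div_unit_exp al be (ordp B) (y0 j)).
    apply: (theta_inj (w := c)); rewrite fmorph_div /= e hal hbe; exact: erefl.
move=> Q hQ; have [j [[hl hC hf] hjm _]] := exc_chart hy hQ.
move=> x /hf[a [b [ha hb ub ->]]]; case: (hRs) => _ _ hM; apply: hM; first exact: chart_excR ha.
have b0 : b != 0 by case: ub.
have hbR := chart_excR hb.
suff /(excR_unit b0 hbR)[] : excv c b = 0 by [].
apply: contrapT => hv; have hv1 : 1 <= excv c b.
  by case: hbR => [/eqP|]; [rewrite fmorph_eq0 (negbTE b0)|rewrite -/(excv c b); lia].
have [e [be [hbe eb]]] := hb.
have be0 : be != 0 by apply: contraNneq b0 => be0; rewrite eb be0 mul0r.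
have hbO : O be.
  have hmO : max_ideal O `<=` O by move=> z [].
  elim: hbe => [//|d u g _ IH /hmO hg|d|d u v _ IHu _ IHv]; case: (hO) => _ hB hM'.
  - exact: hM'.
  - exact: subring0 hO.
  - exact: hB.
have [A [B [uB eA]]] := hbO; rewrite unitfE in uB.
have vb : excv c be = excv c b + e%:Z by rewrite eb excv_div // subrK.
have A0 : A != 0.
  have := theta_nz c be0; rewrite eA.
  by apply: contraNneq => ->; rewrite tofrac0 mul0r.
have B0 : B != 0 by apply: contraNneq uB => ->; rewrite mcoeff0.
have hAm : mord e.+1 A.
  apply/(mord_ordp _ A0); move: vb; rewrite /excv eA ord_div // (ordp_unit uB) subr0 -/(excv c b).
  by move=> vb; rewrite -lez_nat vb; lia.
have hpw := pw_mord uB hAm eA.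
have : max_ideal Q b.
  have -> : b = (be / y j ^+ e.+1) * y j by rewrite eb; exact: (div_expS _ _ (y0 j)).
  case: (hl) => hQs _; apply: (max_idealM hQs) => //; apply: hC.
  exact: chart_pw.
by move=> /max_idealP[_].
Qed.

Lemma exc_valuation_of : valuation_of (excR c) (excv c).
Proof.
split=> [x z x0 z0|x z x0 z0 s0||].
- rewrite /excv rmorphM; exact: (ordM (theta_nz c x0) (theta_nz c z0)).
- rewrite /excv rmorphD; have := theta_nz c s0; rewrite rmorphD.
  exact: (ordD (theta_nz c x0) (theta_nz c z0)).
- by exists (y (Ordinal hN)); [exact: y0|exact: vy].
- apply/seteqP; split=> x [h|h]; [left|by right|left|by right].
    by apply: (theta_inj (w := c)); rewrite h rmorph0.
  by rewrite h rmorph0.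
Qed.

End Coord.

Lemma exc_valuationP c : exc_valuation (pt c) (excR c) (excv c).
Proof.
have [y hy] := theta_inv c.
by split; [exact: exc_generic hy|exact: exc_valuation_of hy].
Qed.

End ExceptionalValuation.

(** * Derivations, Jacobians and discrepancies *)

Lemma quotient_rule_id (E : comNzRingType) (n n' d d' a a' b b' : E) :
  n * b = a * d -> n' * b + n * b' = a' * d + a * d' ->
  (n' * d - n * d') * b ^+ 2 = (a' * b - a * b') * d ^+ 2.
Proof.
move=> h h'.
have -> : (n' * d - n * d') * b ^+ 2 =
  d * b * (n' * b + n * b') - n * b * (d * b' + d' * b) by ring.
by rewrite h h'; ring.
Qed.

Lemma deriv_add_id (E : fieldType) (a a' b b' c c' d d' : E) : b != 0 -> d != 0 ->
  ((a' * d + a * d' - (c' * b + c * b')) * (b * d) - (a * d - c * b) * (b' * d + b * d'))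
    / (b * d) ^+ 2 = (a' * b - a * b') / b ^+ 2 - (c' * d - c * d') / d ^+ 2.
Proof. by move=> b0 d0; field; rewrite b0 d0. Qed.

Lemma deriv_mul_id (E : fieldType) (a a' b b' c c' d d' : E) : b != 0 -> d != 0 ->
  ((a' * c + a * c') * (b * d) - (a * c) * (b' * d + b * d')) / (b * d) ^+ 2 =
  (a' * b - a * b') / b ^+ 2 * (c / d) + a / b * ((c' * d - c * d') / d ^+ 2).
Proof. by move=> b0 d0; field; rewrite b0 d0. Qed.

Lemma leibniz_shuffle (E : comNzRingType) (a b c d e : E) :
  a * b * e + c * d * e = a * e * b + c * (d * e).
Proof. by rewrite mulrAC mulrA. Qed.

(** Off the diagonal only the column j is nonzero, and a permutation other than 1 sends some l to an
    index different from both l and j. *)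
Lemma det_arrow (R : comNzRingType) (n : nat) (j : 'I_n) (M : 'M[R]_n) :
  (forall l m, m != l -> m != j -> M l m = 0) -> \det M = \prod_l M l l.
Proof.
move=> hM; rewrite /determinant (bigD1 (1%g : 'S_n)) //= odd_perm1 expr0 mul1r.
rewrite [X in _ + X]big1 ?addr0; first by apply: eq_bigr => l _; rewrite perm1.
move=> s s1; have [l hl] : exists l, (s l != l) && (s l != j).
  apply/existsP; apply: contraNT s1; rewrite negb_exists => /forallP h.
  apply/eqP/permP => l; rewrite perm1; apply/eqP; apply: contraT => hl.
  have hlj : s l = j by have := h l; rewrite hl /= negbK => /eqP.
  have := h ((s^-1)%g l); rewrite permKV => /nandP[|]; rewrite negbK => /eqP e.
    by move: hl; rewrite {1}e permKV eqxx.
  by move: hl; rewrite hlj e eqxx.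
case/andP: hl => h1 h2; rewrite (bigD1 l) //= hM ?mul0r ?mulr0 //.
Qed.

Section Derivations.
Variables (N : nat) (F : fieldType).
Local Notation poly := {mpoly F[N]}.
Local Notation K := {fraction poly}.
Local Notation "x %:F" := (@FracField.tofrac poly x).
Implicit Types (f g a b : poly) (x y : K).

Lemma mderiv_X i j : ('X_i : poly)^`M(j) = (j == i)%:R.
Proof.
rewrite mderivX mnm1E eq_sym; case: eqP => [->|_]; last by rewrite scale0r.
have -> : (U_(i) - U_(i))%MM = 0%MM :> 'X_{1..N} by apply/mnmP => l; rewrite mnmBE subnn mnm0E.
by rewrite scale1r mpolyX0.
Qed.

Lemma pderiv_div j a b : b != 0 ->
  pderiv j (a%:F / b%:F) = (a^`M(j) * b - a * b^`M(j))%:F / b%:F ^+ 2.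
Proof.
move=> b0; rewrite /pderiv /polyF; set x := a%:F / b%:F.
have d0 : \d_(generic_quotient.repr x) != 0 by apply: denom_ratioP.
have h : a * \d_(generic_quotient.repr x) = \n_(generic_quotient.repr x) * b.
  apply/(frac_eq _ _ b0 d0); exact: frac_repr.
rewrite -!(rmorphXn (@FracField.tofrac poly)); apply/frac_eq; rewrite ?expf_neq0 //.
apply: quotient_rule_id; first exact: esym h.
by have := congr1 (mderiv j) h; rewrite !mderivM => ->.
Qed.

Lemma pderivF j f : pderiv j f%:F = (f^`M(j))%:F.
Proof.
have := pderiv_div j f (oner_neq0 _); rewrite tofrac1 divr1 => ->.
by rewrite expr1n divr1 -[1]mpolyC1 mderivC mulr0 subr0 mpolyC1 mulr1.
Qed.

(** Derivations with values in K regarded as a module through t, such as a partial derivative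
    composed with [theta w]. *)
Definition derivation_along (t : K -> K) (D : K -> K) :=
  (forall x y, D (x - y) = D x - D y) /\ (forall x y, D (x * y) = D x * t y + t x * D y).

Lemma pderiv_derivation j : derivation_along idfun (@pderiv F N j).
Proof.
split=> x y; have [a [b [b0 ->]]] := fracE x; have [c [d [d0 ->]]] := fracE y.
  have bd0 : b * d != 0 by rewrite mulf_neq0.
  have e : a%:F / b%:F - c%:F / d%:F = (a * d - c * b)%:F / (b * d)%:F.
    rewrite tofracB !tofracM -mulNr addf_div ?tofrac_eq0 // mulNr; exact: erefl.
  rewrite e !pderiv_div // mderivB !mderivM tofracB !tofracM.
  rewrite !(tofracB, tofracD, tofracM); apply: deriv_add_id; by rewrite tofrac_eq0.
have bd0 : b * d != 0 by rewrite mulf_neq0.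
rewrite mulf_div -!tofracM !pderiv_div // !mderivM.
rewrite !(tofracB, tofracD, tofracM); apply: deriv_mul_id; by rewrite tofrac_eq0.
Qed.

Lemma derivation_ext (t : {rmorphism K -> K}) D D' : derivation_along t D -> derivation_along t D' ->
  (forall c, D (constK N c) = D' (constK N c)) -> (forall i, D ('X_i)%:F = D' ('X_i)%:F) ->
  D =1 D'.
Proof.
move=> [hB hM] [hB' hM'] hc hX.
have hS : is_subring [set f : poly | D f%:F = D' f%:F].
  split=> [|f g hf hg|f g hf hg]; rewrite /mkset.
  - have := hc 1; by rewrite /constK mpolyC1.
  - by rewrite tofracB hB hB' hf hg.
  - by rewrite tofracM hM hM' hf hg.
have hP f : D f%:F = D' f%:F.
  suff : [set f : poly | D f%:F = D' f%:F] f by [].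
  rewrite [f]mpolyE; apply: (subring_sum _ hS) => m _; rewrite -mul_mpolyC.
  case: (hS) => _ _; apply; first exact: hc.
  rewrite mpolyXE_id; apply: (subring_prod _ hS) => i _; apply: (subringX _ hS); exact: hX.
move=> x; have [a [b [b0 ->]]] := fracE x; set z := a%:F / b%:F.
have bF : b%:F != 0 by rewrite tofrac_eq0.
have e : a%:F = z * b%:F by rewrite /z divfK.
have tb : t b%:F != 0 by rewrite fmorph_eq0.
apply: (mulIf tb); have := hP a; rewrite e hM hM' hP => /addIr; exact.
Qed.

Arguments pderiv : simpl never.

(** Both sides are derivations along [theta w] that agree on the constants and the variables. *)
Lemma pderiv_chain (w : seq (step N F)) j x :
  pderiv j (theta w x) = \sum_l theta w (pderiv l x) * pderiv j (theta w ('X_l)%:F).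
Proof.
have [hB hM] := pderiv_derivation j.
apply: (@derivation_ext (theta w) (fun x => pderiv j (theta w x))
  (fun x => \sum_l theta w (pderiv l x) * pderiv j (theta w ('X_l)%:F))) => [||c|i].
- by split=> u v /=; rewrite ?rmorphB ?rmorphM /= ?hB ?hM.
- split=> u v.
    rewrite -sumrB; apply: eq_bigr => l _; have [hBl _] := pderiv_derivation l.
    by rewrite hBl rmorphB mulrBl.
  rewrite mulr_suml mulr_sumr -big_split; apply: eq_bigr => l _ /=.
  have [_ hMl] := pderiv_derivation l; rewrite hMl; move: (pderiv l u) (pderiv l v) => du dv.
  rewrite /idfun rmorphD !(rmorphM (theta w)) mulrDl.
  exact: leibniz_shuffle.
- rewrite theta_const /constK pderivF mderivC tofrac0 big1 // => l _.
  by rewrite pderivF mderivC tofrac0 rmorph0 mul0r.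
- rewrite (bigD1 i) //= pderivF mderiv_X eqxx tofrac1 rmorph1 mul1r big1 ?addr0 // => l hl.
  by rewrite pderivF mderiv_X (negbTE hl) tofrac0 rmorph0 mul0r.
Qed.

Lemma jacobian_chain (w : seq (step N F)) (u : 'I_N -> K) :
  jacobian (fun i => theta w (u i)) =
  theta w (jacobian u) * jacobian (fun l => theta w ('X_l)%:F).
Proof.
rewrite /jacobian -det_map_mx -det_mulmx; congr (\det _); apply/matrixP => i j.
by rewrite !mxE pderiv_chain; apply: eq_bigr => l _; rewrite !mxE.
Qed.

Lemma jacobian_id : jacobian (fun l => ('X_l)%:F : K) = 1.
Proof.
rewrite /jacobian -(det1 _ N); congr (\det _); apply/matrixP => i j; rewrite !mxE pderivF mderiv_X.
by rewrite eq_sym; case: eqP => _; rewrite ?tofrac1 ?tofrac0.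
Qed.

End Derivations.

Section StepJacobian.
Variables (N : nat).

(* The Jacobian determinant of [theta w]. *)
Definition jacw (B : idomainType) (w : seq (step N B)) : {mpoly B[N]} :=
  foldl (fun d s => sub1 s d * 'X_(s.1) ^+ N.-1) 1 w.

Lemma jacw_rcons (B : idomainType) (w : seq (step N B)) s :
  jacw (rcons w s) = sub1 s (jacw w) * 'X_(s.1) ^+ N.-1.
Proof. by rewrite /jacw foldl_rcons. Qed.

Lemma jacw_map (B B' : idomainType) (r : {rmorphism B -> B'}) (w : seq (step N B)) :
  map_mpoly r (jacw w) = jacw (map (step_map r) w).
Proof.
elim/last_ind: w => [|w s IH]; first by rewrite /jacw /= rmorph1.
by rewrite map_rcons !jacw_rcons rmorphM rmorphXn /= map_mpolyX sub1_map IH.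
Qed.

(** For such coordinates X_l + a_l is either a variable or a unit at the origin, so that
    substitution turns monomials into monomials times units. *)
Definition good_step (B : idomainType) (s : step N B) :=
  [forall l, (s.2 l == 0) || (s.2 l \is a GRing.unit)].

(* Every factor of the monomial can vanish only at the strict transforms of the
   coordinate hyperplanes. *)
Definition mono_unit (B : idomainType) (f : {mpoly B[N]}) :=
  exists m u, f = 'X_[m] * u /\ u@_0 \is a GRing.unit.

Lemma mono_unit1 (B : idomainType) : mono_unit (1 : {mpoly B[N]}).
Proof. by exists 0%MM, 1; rewrite mpolyX0 mul1r mcoeff1 eqxx unitr1. Qed.

Lemma mono_unitX (B : idomainType) l : mono_unit ('X_l : {mpoly B[N]}).
Proof. by exists U_(l)%MM, 1; rewrite mulr1 mcoeff1 eqxx unitr1. Qed.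

Lemma mono_unitM (B : idomainType) (f g : {mpoly B[N]}) :
  mono_unit f -> mono_unit g -> mono_unit (f * g).
Proof.
move=> [m [u [-> hu]]] [m' [u' [-> hu']]]; exists (m + m')%MM, (u * u'); split.
  by rewrite mpolyXD mulrACA.
by rewrite (rmorphM (mcoeff 0%MM)) unitrM hu.
Qed.

Lemma mono_unitXn (B : idomainType) (f : {mpoly B[N]}) e : mono_unit f -> mono_unit (f ^+ e).
Proof.
by move=> hf; elim: e => [|e IH]; [exact: mono_unit1|rewrite exprS; apply: mono_unitM].
Qed.

Lemma mono_unit_sub1 (B : idomainType) (s : step N B) f :
  good_step s -> mono_unit f -> mono_unit (sub1 s f).
Proof.
move=> hs [m [u [-> hu]]]; rewrite rmorphM; apply: mono_unitM; last first.
  exists 0%MM, (sub1 s u); rewrite mpolyX0 mul1r; split=> //.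
  by rewrite -(subw_coef0 [:: s]) in hu.
rewrite mpolyXE_id rmorph_prod /=; apply: big_ind => [||l _].
- exact: mono_unit1.
- exact: mono_unitM.
have -> : sub1 s ('X_l ^+ m l) = sub1 s 'X_l ^+ m l by exact: rmorphXn.
apply: mono_unitXn; rewrite sub1X /stepX; case: eqP => _.
  exact: mono_unitX.
apply: mono_unitM; first exact: mono_unitX.
have /orP[/eqP e|e] := forallP hs l; first by rewrite e mpolyC0 addr0; exact: mono_unitX.
exists 0%MM, ('X_l + (s.2 l)%:MP); rewrite mpolyX0 mul1r; split=> //.
by rewrite mcoeffD mcoeffX mnm1_eq0 add0r mcoeffC eqxx mulr1.
Qed.

Lemma jacw_mono (B : idomainType) (w : seq (step N B)) : all (@good_step B) w -> mono_unit (jacw w).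
Proof.
elim/last_ind: w => [|w s IH]; first by move=> _; exact: mono_unit1.
rewrite all_rcons jacw_rcons => /andP[hs /IH hw].
by apply: mono_unitM; [exact: mono_unit_sub1|apply: mono_unitXn; exact: mono_unitX].
Qed.

Lemma ordp_mono (B B' : idomainType) (r : {rmorphism B -> B'}) (f : {mpoly B[N]}) :
  mono_unit f -> map_mpoly r f != 0 -> ordp (map_mpoly r f) = ordp f.
Proof.
move=> [m [u [-> hu]]]; rewrite rmorphM /= map_mpolyX => h.
have hx (C : idomainType) (v : {mpoly C[N]}) : v@_0 != 0 -> ordp ('X_[m] * v) = mdeg m.
  move=> v0; rewrite ordpM ?ordpX ?(ordp_unit v0) ?addn0 //; last by apply: contraNneq v0 => ->; rewrite mcoeff0.
  by rewrite -msupp_eq0 msuppX.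
rewrite !hx //; first by apply: contraTneq hu => ->; rewrite unitr0.
rewrite mcoeff_map_mpoly; have := rmorph_unit r hu.
by apply: contraTneq => ->; rewrite unitr0.
Qed.

End StepJacobian.

Section PolyDerivation.
Variables (N : nat) (F : comNzRingType).
Implicit Types (f : {mpoly F[N]}).

Lemma mord_mderiv d f j : mord d.+1 f -> mord d f^`M(j).
Proof.
move=> h m hm; rewrite mcoeff_mderiv h ?mul0rn //.
by rewrite mdegD mdeg1 addn1 ltnS.
Qed.

Definition euler f : {mpoly F[N]} := \sum_l 'X_l * f^`M(l).

Lemma euler_coef f m : (euler f)@_m = f@_m *+ mdeg m.
Proof.
elim/mpolyind: f => [|c n f _ _ IH].
  by rewrite /euler big1 ?mcoeff0 ?mul0rn // => l _; rewrite raddf0 mulr0.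
have -> : euler (c *: 'X_[n] + f) = c *: 'X_[n] *+ mdeg n + euler f.
  rewrite /euler mdegE -sumrMnr -big_split; apply: eq_bigr => l _ /=.
  rewrite mderivD mulrDr mderivZ mderivX scalerA -scalerAr; congr (_ + _).
  have [->|e] := eqVneq (n l) 0%N; first by rewrite mulr0 scale0r mulr0n.
  by rewrite -mpolyXD addmC submK ?lep1mP // mulr_natr scalerMnl.
rewrite !mcoeffD IH mulrnDl mcoeffMn mcoeffZ mcoeffX; congr (_ + _).
by case: eqP => [->//|_]; rewrite mulr0 !mul0rn.
Qed.

(** Euler's formula: forms of degree d are eigenvectors with eigenvalue d, so the part of degree d
    cancels. *)
Lemma mord_euler d f : mord d f -> mord d.+1 (euler f - f *+ d).
Proof.
move=> h m hm; rewrite mcoeffB mcoeffMn euler_coef.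
move: hm; rewrite ltnS leq_eqVlt => /orP[/eqP ->|hm]; first by rewrite subrr.
by rewrite h // !mul0rn subr0.
Qed.

End PolyDerivation.

Lemma eq_inv_of_mul (E : fieldType) (x y : E) : x * y = 1 -> x = y^-1.
Proof.
move=> h; have y0 : y != 0 by apply: contra_eq_neq h => ->; rewrite mulr0 eq_sym oner_eq0.
by apply: (mulIf y0); rewrite h mulVf.
Qed.

Section Discrepancy.
Variables (N : nat) (F : fieldType).
Local Notation poly := {mpoly F[N]}.
Local Notation K := {fraction poly}.
Local Notation "x %:F" := (@FracField.tofrac poly x).
Implicit Types (x y : K).

Lemma tofracXn (f : poly) n : (f ^+ n)%:F = f%:F ^+ n.
Proof. exact: rmorphXn. Qed.

Definition vge (m : int) x := x = 0 \/ m <= ord x.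

Lemma vge0 m : vge m 0. Proof. by left. Qed.

Lemma vgeD m x y : vge m x -> vge m y -> vge m (x + y).
Proof.
move=> [->|hx]; first by rewrite add0r.
move=> [->|hy]; first by rewrite addr0; right.
have [->|x0] := eqVneq x 0; first by rewrite add0r; right.
have [->|y0] := eqVneq y 0; first by rewrite addr0; right.
have [->|h] := eqVneq (x + y) 0; first by left.
by right; apply: le_trans (ordD x0 y0 h); rewrite le_min hx.
Qed.

Lemma vgeM m m' x y : vge m x -> vge m' y -> vge (m + m') (x * y).
Proof.
move=> [->|hx]; first by left; rewrite mul0r.
move=> [->|hy]; first by left; rewrite mulr0.
have [->|x0] := eqVneq x 0; first by left; rewrite mul0r.
have [->|y0] := eqVneq y 0; first by left; rewrite mulr0.
by right; rewrite (ordM x0 y0); apply: lerD.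
Qed.

Lemma vge_poly (d : nat) (f : poly) : mord d f -> vge d%:Z f%:F.
Proof.
move=> h; have [->|f0] := eqVneq f 0; first by left; rewrite tofrac0.
by right; rewrite ordF // lez_nat; apply/(mord_ordp d f0).
Qed.

Lemma vge_unit x : x = 1 \/ x = -1 -> vge 0 x.
Proof.
have h1 : vge 0 (1 : K) by rewrite -tofrac1; apply: (@vge_poly 0); apply: mord0.
have h2 : vge 0 (-1 : K) by rewrite -tofrac1 -tofracN; apply: (@vge_poly 0); apply: mord0.
by case=> ->.
Qed.

Lemma vge_prod (I : Type) (r : seq I) (f : I -> K) (c : I -> int) :
  (forall i, vge (c i) (f i)) -> vge (\sum_(i <- r) c i) (\prod_(i <- r) f i).
Proof.
move=> h; elim: r => [|i r IH]; first by rewrite !big_nil; apply: vge_unit; left.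
by rewrite !big_cons; apply: vgeM.
Qed.

Lemma vge_det (n : nat) (M : 'M[K]_n) (c : 'I_n -> int) :
  (forall i j, vge (c j) (M i j)) -> vge (\sum_j c j) (\det M).
Proof.
move=> h; rewrite /determinant; apply: (big_ind (vge _)) => [||s _].
- exact: vge0.
- exact: vgeD.
rewrite -[X in vge X]add0r; apply: vgeM.
  by apply: vge_unit; case: (odd_perm s); [right|left].
rewrite (reindex_inj (@perm_inj _ s)) /=; exact: vge_prod.
Qed.

Lemma vge_quot d (f b : poly) : b != 0 -> mord (d + (ordp b).*2) f ->
  vge d%:Z (f%:F / b%:F ^+ 2).
Proof.
move=> b0 hf; have [->|f0] := eqVneq f 0; first by left; rewrite tofrac0 mul0r.
right; rewrite -tofracXn ord_div ?expf_neq0 // expr2 (ordpM b0 b0).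
by move/(mord_ordp _ f0): hf; move: (ordp f) (ordp b) => e e'; lia.
Qed.

Lemma ordR_frac x (hx : ordR x) : exists f b : poly, [/\ b != 0, mord (ordp b) f & x = f%:F / b%:F].
Proof.
have [->|x0] := eqVneq x 0.
  by exists 0, 1; split; [exact: oner_neq0|exact: mord_zero|rewrite tofrac0 mul0r].
have [f [b [f0 b0 e]]] := frac_nz x0; exists f, b; split=> //.
have h : 0 <= ord x by case: hx => // e'; move: x0; rewrite e' eqxx.
by move: h; rewrite e ord_div // => h; apply/(mord_ordp _ f0); lia.
Qed.

Lemma vge_pderiv j x : ordR x -> vge (-1) (pderiv j x).
Proof.
move=> /ordR_frac[f [b [b0 hf ->]]]; rewrite pderiv_div //.
have [->|g0] := eqVneq (f^`M(j) * b - f * b^`M(j)) 0; first by left; rewrite tofrac0 mul0r.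
right; rewrite -tofracXn ord_div ?expf_neq0 // expr2 (ordpM b0 b0).
suff : mord (ordp b).*2.-1 (f^`M(j) * b - f * b^`M(j)).
  by move/(mord_ordp _ g0); move: (ordp _) (ordp b) => e e'; lia.
have [hb _] := ordpP b0; case: (ordp b) hf hb => [|e] hf hb; first exact: mord0.
have -> : e.+1.*2.-1 = (e + e.+1)%N by rewrite doubleS /= -addnn addnS.
apply: mordB; first by apply: mordM => //; exact: mord_mderiv.
by rewrite addnC; apply: mordM => //; exact: mord_mderiv.
Qed.

Definition eulerF x : K := \sum_l pderiv l x * ('X_l)%:F.

Lemma eulerF_div (f b : poly) : b != 0 ->
  eulerF (f%:F / b%:F) = (euler f * b - f * euler b)%:F / b%:F ^+ 2.
Proof.
move=> b0; rewrite /eulerF (eq_bigr (fun l => (('X_l * (f^`M(l) * b - f * b^`M(l)))%:F / b%:F ^+ 2))).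
  rewrite -mulr_suml -rmorph_sum /=; congr (_%:F / _).
  rewrite /euler mulr_suml mulr_sumr -sumrB; apply: eq_bigr => l _.
  by rewrite mulrBr mulrA mulrCA.
by move=> l _; rewrite pderiv_div // (tofracM 'X_l) mulrC mulrA.
Qed.

(** A partial derivative may lower the order by 1, so that X_l times it has order at least 0 only.
    The Euler operator gains one more, because the eigenvalues on numerator and denominator
    cancel. *)
Lemma vge_euler x : ordR x -> vge 1 (eulerF x).
Proof.
move=> /ordR_frac[f [b [b0 hf ->]]]; rewrite eulerF_div //; apply: (@vge_quot 1) => //.
have [hb _] := ordpP b0; set d := ordp b in hf hb *.
have -> : euler f * b - f * euler b = (euler f - f *+ d) * b - f * (euler b - b *+ d).
  by rewrite mulrBl mulrBr mulrnAl mulrnAr opprB addrA subrK.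
rewrite add1n -addnn; apply: mordB; first by rewrite -addSn; apply: mordM => //; exact: mord_euler.
by rewrite -addnS; apply: mordM => //; exact: mord_euler.
Qed.

Hypothesis hN : (0 < N)%N.
Let j0 : 'I_N := Ordinal hN.

(** Bounding each entry by [vge_pderiv] gives only -N. The matrix D replaces one column by Euler
    derivatives, of order at least 1, and multiplies the determinant by X_j0, so that the bound
    becomes 1 - (N - 1) - 1. *)
Lemma vge_jacobian (u : 'I_N -> K) : (forall i, ordR (u i)) -> vge (1 - N%:Z) (jacobian u).
Proof.
move=> hu; pose D : 'M[K]_N := \matrix_(j, l) if l == j0 then ('X_j)%:F else (j == l)%:R.
have hD : \det D = ('X_j0)%:F.
  rewrite (@det_arrow _ _ j0) => [|l m hml hmj]; last by rewrite mxE (negbTE hmj) eq_sym (negbTE hml).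
  rewrite (bigD1 j0) //= mxE eqxx big1 ?mulr1 // => l hl.
  by rewrite mxE (negbTE hl) eqxx.
have hX : ('X_j0)%:F != 0 :> K by rewrite tofrac_eq0; exact: mpolyX_neq0.
have hX1 : ord (('X_j0)%:F : K) = 1 by rewrite ordF ?ordpX ?mdeg1 //; exact: mpolyX_neq0.
pose M : 'M[K]_N := \matrix_(i, j) pderiv j (u i).
have hb : vge (2 - N%:Z) (\det (M *m D)).
  have -> : 2 - N%:Z = \sum_(j < N) (if j == j0 then 1 else -1 : int).
    rewrite (bigD1 j0) //= (eq_bigr (fun=> -1)) => [|i /negbTE -> //].
    rewrite sumr_const cardC1 card_ord; move: hN; case: (N) => // n _; lia.
  apply: vge_det => i l; case: eqP => [->|/eqP hl].
    have -> : (M *m D) i j0 = eulerF (u i).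
      by rewrite mxE; apply: eq_bigr => j _; rewrite !mxE eqxx.
    exact: vge_euler.
  have -> : (M *m D) i l = pderiv l (u i).
    rewrite mxE (bigD1 l) //= !mxE (negbTE hl) eqxx mulr1 big1 ?addr0 // => j hj.
    by rewrite !mxE (negbTE hl) (negbTE hj) mulr0.
  exact: vge_pderiv.
have -> : jacobian u = \det (M *m D) * ('X_j0)%:F^-1.
  by rewrite det_mulmx hD mulfK.
have -> : 1 - N%:Z = 2 - N%:Z + (- 1) by lia.
by apply: vgeM => //; right; rewrite ordV // hX1.
Qed.

Lemma jacobian_step (s : step N F) :
  jacobian (fun l => theta [:: s] ('X_l)%:F) = ('X_(s.1) ^+ N.-1)%:F.
Proof.
rewrite /jacobian (@det_arrow _ _ s.1) => [|l m hml hmj]; last first.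
  rewrite mxE thetaF subw_cons /= sub1X pderivF /stepX; case: eqP => [->|_].
    by rewrite mderiv_X (negbTE hmj) tofrac0.
  rewrite mderivM mderivD mderivC !mderiv_X (negbTE hmj) (negbTE hml).
  by rewrite mul0r addr0 mulr0 addr0 tofrac0.
have hd l : (\matrix_(i, j) pderiv j (theta [:: s] ('X_i)%:F)) l l =
    if l == s.1 then 1 else ('X_(s.1))%:F.
  rewrite mxE thetaF subw_cons /= sub1X pderivF /stepX; case: eqP => [->|/eqP hl].
    by rewrite mderiv_X eqxx tofrac1.
  by rewrite mderivM mderivD mderivC !mderiv_X (negbTE hl) eqxx mul0r addr0 mulr1 add0r.
rewrite (eq_bigr _ (fun l _ => hd l)) (bigD1 s.1) //= eqxx mul1r.
rewrite (eq_bigr (fun=> ('X_(s.1))%:F)) => [|i /negbTE -> //].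
by rewrite prodr_const cardC1 card_ord tofracXn.
Qed.

Lemma jacobian_theta (c : seq (step N F)) :
  jacobian (fun l => theta c ('X_l)%:F) = (jacw c)%:F.
Proof.
elim/last_ind: c => [|c s IH].
  rewrite /jacw /= tofrac1 -[RHS](jacobian_id N F).
  by congr (\det _); apply/matrixP => i j; rewrite !mxE theta_nil.
have -> : jacobian (fun l => theta (rcons c s) ('X_l)%:F) =
    jacobian (fun l => theta [:: s] (theta c ('X_l)%:F)).
  by congr (\det _); apply/matrixP => i j; rewrite !mxE theta_rcons.
by rewrite jacobian_chain IH jacobian_step thetaF -tofracM jacw_rcons.
Qed.

Lemma jacw_neq0 (c : seq (step N F)) : jacw c != 0.
Proof.
elim/last_ind: c => [|c s IH]; first exact: oner_neq0.
rewrite jacw_rcons mulf_neq0 ?expf_neq0 //; last exact: mpolyX_neq0.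
by apply: contra_neq IH => h; apply: (@sub1_inj _ _ s); rewrite h rmorph0.
Qed.

(** By the chain rule, the value of a Jacobian along the divisor of c is the order at the origin of
    another Jacobian minus that of [jacw c]. The former is at least 1 - N by [vge_jacobian], with
    equality for the chart coordinates of the blow-up of the origin. *)
Lemma discrepancy (c : seq (step N F)) :
  rel_canonical_coef (excR c) (excv c) (N.-1%:Z + (ordp (jacw c))%:Z).
Proof.
have hj0 : (jacw c)%:F != 0 :> K by rewrite tofrac_eq0 jacw_neq0.
have hv u : jacobian u != 0 ->
    excv c (jacobian u) = ord (jacobian (fun i => theta c (u i))) - (ordp (jacw c))%:Z.
  move=> h; have ht := theta_nz c h.
  by rewrite jacobian_chain jacobian_theta (ordM ht hj0) (ordF (jacw_neq0 c)) addrK.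
have hN1 : N.-1%:Z = N%:Z - 1 by move: hN; case: (N) => // n _; lia.
split.
  pose s : step N F := (j0, fun=> 0).
  have hs : jacobian (unstepX s) = ('X_j0 ^+ N.-1)%:F^-1.
    apply: (theta_inj (w := [:: s])).
    have := jacobian_chain [:: s] (unstepX s); rewrite jacobian_step.
    have -> : jacobian (fun i => theta [:: s] (unstepX s i)) = 1.
      rewrite -[RHS](jacobian_id N F).
      by congr (\det _); apply/matrixP => i j; rewrite !mxE theta_unsub.
    move=> h; have -> : theta [:: s] ('X_j0 ^+ N.-1)%:F^-1 = (theta [:: s] ('X_j0 ^+ N.-1)%:F)^-1.
      exact: fmorphV.
    rewrite thetaF subw_cons /=.
    have -> : sub1 s ('X_j0 ^+ N.-1) = 'X_j0 ^+ N.-1.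
      by rewrite (rmorphXn (sub1 s)) /= sub1X /stepX eqxx.
    exact: (eq_inv_of_mul (esym h)).
  have [u hu] : exists u : 'I_N -> K, forall i, theta c (u i) = unstepX s i.
    have h i : exists y, theta c y = unstepX s i by exact: theta_surj.
    by have /choice[u hu] := h; exists u.
  have ej : theta c (jacobian u) * (jacw c)%:F = ('X_j0 ^+ N.-1)%:F^-1.
    rewrite -hs -jacobian_theta -jacobian_chain.
    by congr (\det _); apply/matrixP => i j; rewrite !mxE hu.
  have j0' : jacobian u != 0.
    apply/eqP => e; move: ej; rewrite e rmorph0 mul0r => /esym/eqP.
    by rewrite invr_eq0 tofrac_eq0 expf_eq0 (negbTE (mpolyX_neq0 _ _)) andbF.
  exists u; split=> //.
    move=> i; rewrite /excR /= hu /unstepX; case: eqP => _.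
      by right; rewrite ordF ?mpolyX_neq0 ?ordpX ?mdeg1.
    rewrite rmorph0 subr0; right.
    by rewrite ord_div ?mpolyX_neq0 // !ordpX !mdeg1 subrr.
  rewrite hv //.
  have -> : jacobian (fun i => theta c (u i)) = ('X_j0 ^+ N.-1)%:F^-1.
    by rewrite -hs; congr (\det _); apply/matrixP => i j; rewrite !mxE hu.
  have hX : 'X_j0 ^+ N.-1 != 0 :> poly by rewrite expf_neq0 // mpolyX_neq0.
  rewrite ordV ?tofrac_eq0 // ordF // mpolyXn ordpX mdegMn mdeg1 mul1n; lia.
move=> u hu h; rewrite hv //.
have [e|] := vge_jacobian (fun i => hu i : ordR (theta c (u i))); last by rewrite hN1; lia.
move: h; have := jacobian_chain c u; rewrite e jacobian_theta => /esym/eqP.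
rewrite mulf_eq0 (negbTE hj0) orbF => /eqP ht.
by rewrite -(theta_inj (w := c) (etrans ht (esym (rmorph0 _)))) eqxx.
Qed.

End Discrepancy.

(** * Lifting polynomials in two variables *)

Section TwoVariables.
Variable B : comNzRingType.
Local Notation poly := {mpoly B[2]}.
Implicit Types (f g h t : poly) (l : 'I_2).

Lemma mpoly_subring_ind (n : nat) (Q : set {mpoly B[n]}) : is_subring Q ->
  (forall c, Q c%:MP) -> (forall i, Q 'X_i) -> forall u, Q u.
Proof.
move=> hQ hC hX f; rewrite [f]mpolyE; apply: (subring_sum _ hQ) => m _.
rewrite -mul_mpolyC; case: (hQ) => _ _; apply; first exact: hC.
rewrite mpolyXE_id; apply: (subring_prod _ hQ) => i _; apply: (subringX _ hQ); exact: hX.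
Qed.

Definition other l : 'I_2 := if l == 0 then 1 else 0.

Lemma otherK : involutive other.
Proof. by case=> -[|[|//]] h; apply/val_inj. Qed.

Lemma other_neq l : other l != l.
Proof. by case: l => -[|[|//]] h. Qed.

Lemma eq_other i l : i != l -> i = other l.
Proof. by case: i l => -[|[|//]] h [[|[|//]] h'] //= _; apply/val_inj. Qed.

(* Restriction to the [l]-th coordinate axis, and its section. *)
Definition res l f : {poly B} := mmap (@polyC B) (fun i => if i == l then 'X else 0) f.
Definition inc l (q : {poly B}) : poly := (map_poly (@mpolyC 2 B) q).['X_l].

Lemma resM l f g : res l (f * g) = res l f * res l g.
Proof. exact: rmorphM. Qed.

Lemma resB l f g : res l (f - g) = res l f - res l g.
Proof. exact: raddfB. Qed.

Lemma resX l : res l 'X_l = 'X.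
Proof. by rewrite /res mmapX mmap1U eqxx. Qed.

Lemma res_other l : res l 'X_(other l) = 0.
Proof. by rewrite /res mmapX mmap1U (negbTE (other_neq l)). Qed.

Lemma resC l c : res l c%:MP = c%:P.
Proof. exact: mmapC. Qed.

Lemma incB l p q : inc l (p - q) = inc l p - inc l q.
Proof. by rewrite /inc raddfB hornerD hornerN. Qed.

Lemma incM l p q : inc l (p * q) = inc l p * inc l q.
Proof. by rewrite /inc rmorphM hornerM. Qed.

Lemma incC l c : inc l c%:P = c%:MP.
Proof. by rewrite /inc map_polyC hornerC. Qed.

Lemma incX l : inc l 'X = 'X_l.
Proof. by rewrite /inc map_polyX hornerX. Qed.

Lemma incE l (q : {poly B}) n : (size q <= n)%N -> inc l q = \sum_(i < n) q`_i *: 'X_l ^+ i.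
Proof.
move=> h; rewrite /inc (horner_coef_wide _ (leq_trans (size_poly _ _) h)).
by apply: eq_bigr => i _; rewrite coef_map mul_mpolyC.
Qed.

Lemma incXn l n : inc l 'X^n = 'X_l ^+ n.
Proof. by rewrite /inc map_polyXn hornerXn. Qed.

Lemma axis_split l f : exists h, f = inc l (res l f) + 'X_(other l) * h.
Proof.
pose Q : set poly := [set f | exists h, f = inc l (res l f) + 'X_(other l) * h].
apply: (@mpoly_subring_ind 2 Q) => [|c|i].
- split=> [|f1 f2 [h1 e1] [h2 e2]|f1 f2 [h1 e1] [h2 e2]].
  + by exists 0; rewrite -mpolyC1 resC incC mulr0 addr0.
  + exists (h1 - h2); rewrite resB incB mulrBr {1}e1 {1}e2; ring.
  + exists (inc l (res l f1) * h2 + h1 * inc l (res l f2) + 'X_(other l) * h1 * h2).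
    by rewrite resM incM {1}e1 {1}e2; ring.
- by exists 0; rewrite resC incC mulr0 addr0.
- have [->|/eq_other ->] := eqVneq i l; first by exists 0; rewrite resX incX mulr0 addr0.
  by exists 1; rewrite res_other -[0]polyC0 incC mpolyC0 add0r mulr1.
Qed.

Lemma mnm2P (m n : 'X_{1..2}) l : m l = n l -> m (other l) = n (other l) -> m = n.
Proof.
by move=> h h'; apply/mnmP => i; have [->|/eq_other ->] := eqVneq i l.
Qed.

Lemma mnm_axis l e i : (U_(l) *+ e)%MM i = ((i == l) * e)%N.
Proof. by rewrite mulmnE mnm1E eq_sym. Qed.

Lemma mcoeff_inc l q e : (inc l q)@_(U_(l) *+ e) = q`_e.
Proof.
have hs : (size q <= maxn (size q) e.+1)%N by rewrite leq_maxl.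
have he : (e < maxn (size q) e.+1)%N by rewrite leq_maxr.
rewrite (incE l hs) raddf_sum /= (bigD1 (Ordinal he)) //=.
rewrite mpolyXn mcoeffZ mcoeffX eqxx mulr1 big1 ?addr0 // => i hi.
rewrite mpolyXn mcoeffZ mcoeffX; case: eqP => [h|_]; last by rewrite mulr0.
have := congr1 (fun m : 'X_{1..2} => m l) h; rewrite /= !mnm_axis eqxx !mul1n => h'.
by move: hi; rewrite -val_eqE /= h' eqxx.
Qed.

Lemma mcoeff_X_other l h e : ('X_(other l) * h)@_(U_(l) *+ e) = 0.
Proof.
apply: memN_msupp_eq0; apply/negP => /msuppM_le /allpairsP[[m1 m2] /= [h1 h2 h3]].
have := congr1 (fun m : 'X_{1..2} => m (other l)) h3.
move: h1; rewrite msuppX inE => /eqP ->.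
by rewrite mnmDE mnm1E eqxx mnm_axis (negbTE (other_neq l)).
Qed.

Lemma coef_res l f e : (res l f)`_e = f@_(U_(l) *+ e).
Proof. by have [h {2}->] := axis_split l f; rewrite mcoeffD mcoeff_inc mcoeff_X_other addr0. Qed.

Lemma axis_divide l n f : exists a b,
  [/\ f = inc l (take_poly n (res l f)) + 'X_l ^+ n * a + 'X_(other l) * b
    & a@_0 = f@_(U_(l) *+ n)].
Proof.
have [b e] := axis_split l f; exists (inc l (drop_poly n (res l f))), b; split.
  rewrite {1}e -{1}(poly_take_drop n (res l f)).
  have -> u v : inc l (u + v) = inc l u + inc l v by rewrite /inc raddfD hornerD.
  by rewrite incM incXn (mulrC ('X_l ^+ n)).
have -> : 0%MM = (U_(l) *+ 0)%MM :> 'X_{1..2} by apply/mnmP => i; rewrite !mnm0E.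
by rewrite mcoeff_inc coef_drop_poly coef_res.
Qed.

(** Contact of order at least M with the l-th axis at the origin. *)
Definition axis l M f := forall e, (e < M)%N -> f@_(U_(l) *+ e) = 0.

Lemma axisD l M f g : axis l M f -> axis l M g -> axis l M (f + g).
Proof. by move=> hf hg e he; rewrite mcoeffD hf ?hg ?addr0. Qed.

Lemma axisM l M f g : axis l M g -> axis l M (f * g).
Proof.
move=> hg e he; rewrite -coef_res resM coefM big1 // => i _.
by rewrite (coef_res l g) hg ?mulr0 // (leq_ltn_trans _ he) // leq_subr.
Qed.

Lemma axis_mord l M f : mord M f -> axis l M f.
Proof. by move=> h e he; apply: h; rewrite mdegMn mdeg1 mul1n. Qed.

Lemma axis_XM l M m f : axis l (m + M) ('X_l ^+ m * f) <-> axis l M f.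
Proof.
have hc e : ('X_l ^+ m * f)@_(U_(l) *+ (m + e)) = f@_(U_(l) *+ e).
  rewrite -!coef_res resM; have -> : res l ('X_l ^+ m) = 'X^m.
    by rewrite -(resX l) /res rmorphXn.
  by rewrite coefXnM ltnNge leq_addr /= addKn.
split=> h e he; first by rewrite -hc; apply: h; rewrite ltn_add2l.
have [hem|hme] := ltnP e m.
  have := coef_res l ('X_l ^+ m * f) e => <-; rewrite resM.
  have -> : res l ('X_l ^+ m) = 'X^m by rewrite -(resX l) /res rmorphXn.
  by rewrite coefXnM hem.
by rewrite -(subnKC hme) hc; apply: h; rewrite ltn_subLR.
Qed.

(** Each step corrects g by c times the error and gains one degree. *)
Lemma mord_inv (c : B) f L : c * f@_0 = 1 -> exists g, mord L (f * g - 1).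
Proof.
move=> hc; elim: L => [|L [g hg]]; first by exists 0.
exists (g - c%:MP * (f * g - 1)).
have -> : f * (g - c%:MP * (f * g - 1)) - 1 = - ((c%:MP * (f - (f@_0)%:MP)) * (f * g - 1)).
  have e : c%:MP * (f@_0)%:MP = 1 :> poly by rewrite -mpolyCM hc.
  have -> : c%:MP * (f - (f@_0)%:MP) = c%:MP * f - 1 by rewrite mulrBr e.
  ring.
apply/mordN/(mordM (d := 1) (e := L)) => //; apply: mordMl; exact: mord_subC.
Qed.

Lemma mord_prod (n : nat) (I : Type) (r : seq I) (Q : pred I) (d : I -> nat) (F : I -> {mpoly B[n]}) :
  (forall i, Q i -> mord (d i) (F i)) -> mord (\sum_(i <- r | Q i) d i) (\prod_(i <- r | Q i) F i).
Proof.
move=> h; elim: r => [|i r IH]; first by rewrite !big_nil; exact: mord0.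
by rewrite !big_cons; case: ifP => // /h hi; apply: mordM.
Qed.

(* The ideal (g, X_j, (X_0, X_1)^L). *)
Definition nbd j L g f := exists q t h, mord L h /\ f = q * g + 'X_j * t + h.

Lemma nbdD j L g f f' : nbd j L g f -> nbd j L g f' -> nbd j L g (f + f').
Proof.
move=> [q [t [h [hh ->]]]] [q' [t' [h' [hh' ->]]]].
exists (q + q'), (t + t'), (h + h'); split; first exact: mordD.
ring.
Qed.

Lemma nbdM j L g f f' : nbd j L g f -> nbd j L g (f' * f).
Proof.
move=> [q [t [h [hh ->]]]]; exists (f' * q), (f' * t), (f' * h); split; first exact: mordMl.
ring.
Qed.

Lemma nbd_X j L g f : nbd j L g ('X_j * f).
Proof. by exists 0, f, 0; rewrite mul0r addr0 add0r; split; [exact: mord_zero|]. Qed.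

Lemma nbd_mord j L g f : mord L f -> nbd j L g f.
Proof. by move=> h; exists 0, 0, f; rewrite mul0r mulr0 !add0r. Qed.

(** Up to multiples of the other variable, g is X_l^n times a unit, which is inverted to order L by
    [mord_inv]. *)
Lemma nbd_axis l L g n c : axis l n g -> c * g@_(U_(l) *+ n) = 1 ->
  nbd (other l) L g ('X_l ^+ n).
Proof.
move=> hg hc; have [a [b [e ea]]] := axis_divide l n g.
have et : take_poly n (res l g) = 0.
  by apply/polyP => i; rewrite coef_take_poly coef0; case: ltnP => // hi; rewrite coef_res hg.
rewrite et -[0]polyC0 incC mpolyC0 add0r in e.
rewrite -ea in hc; have [a' ha'] := mord_inv L hc.
have -> : 'X_l ^+ n = a' * g + 'X_(other l) * (- (a' * b)) + - ('X_l ^+ n * (a * a' - 1)).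
  by rewrite e; ring.
by exists a', (- (a' * b)), (- ('X_l ^+ n * (a * a' - 1))); split=> //; apply/mordN/mordMl.
Qed.

End TwoVariables.

(** * The Chinese remainder theorem on the exceptional line *)

Section Gluing.
Variable B : idomainType.
Local Notation poly := {mpoly B[2]}.
Implicit Types (s u : option B).

(* [Some a] is the tangent direction [x_1 = a x_0], [None] is [x_0 = 0]. *)
Definition dstep s : step 2 B :=
  if s is Some a then (0, fun l => if l == 0 then 0 else a) else (1, fun=> 0).

Definition dir s : poly := if s is Some a then 'X_1 - a *: 'X_0 else 'X_0.
Definition exc s : poly := 'X_((dstep s).1).

(* The cofactors of the exceptional coordinate in the transforms of [dir u] and
   [exc u]. *)
Definition dir_tr s u : poly :=
  match s, u with
  | Some a, Some b => 'X_1 + (a - b)%:MP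
  | Some a, None => 1
  | None, Some b => 1 - b *: 'X_0
  | None, None => 'X_0
  end.

Definition exc_tr s u : poly :=
  match s, u with
  | Some a, None => 'X_1 + a%:MP
  | None, Some _ => 'X_0
  | _, _ => 1
  end.

Lemma sub1Z (n : nat) (s : step n B) c (f : {mpoly B[n]}) : sub1 s (c *: f) = c *: sub1 s f.
Proof. by rewrite -!mul_mpolyC rmorphM /= sub1C. Qed.

Lemma sub1_dir s u : sub1 (dstep s) (dir u) = exc s * dir_tr s u.
Proof.
case: s u => [a|] [b|]; rewrite /dir /exc /dir_tr /= ?rmorphB /= ?sub1Z ?sub1X /stepX /=.
- rewrite -mul_mpolyC; ring.
- by rewrite mulr1.
- rewrite mpolyC0 -!mul_mpolyC; ring.
- rewrite mpolyC0; ring.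
Qed.

Lemma sub1_exc s u : sub1 (dstep s) (exc u) = exc s * exc_tr s u.
Proof.
case: s u => [a|] [b|]; rewrite /exc /exc_tr /= ?sub1X /stepX /= ?mulr1 //.
by rewrite mpolyC0 addr0.
Qed.

Lemma dir_tr_diag s : dir_tr s s = 'X_(other (dstep s).1).
Proof. by case: s => [a|] //=; rewrite subrr mpolyC0 addr0. Qed.

Lemma exc_tr_diag s : exc_tr s s = 1. Proof. by case: s. Qed.

(** Distinct slopes are to differ by a unit; over a localized base this means that they stay
    distinct after reduction. *)
Definition transverse s u :=
  if s is Some a then if u is Some b then exists c, c * (a - b) = 1 else True else True.

Lemma transverse_coef s u : s <> u -> transverse s u -> exists c, c * (dir_tr s u)@_0 = 1.
Proof.
case: s u => [a|] [b|] //= _.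
- by move=> [c hc]; exists c; rewrite mcoeffD mcoeffX mnm1_eq0 add0r mcoeffC eqxx mulr1.
- by move=> _; exists 1; rewrite mcoeff1 eqxx mul1r.
- by move=> _; exists 1; rewrite mcoeffB mcoeff1 eqxx mcoeffZ mcoeffX mnm1_eq0 mulr0 subr0 mul1r.
Qed.

Lemma mord_dir s : mord 1 (dir s).
Proof.
case: s => [a|] /=; last exact: mord_X.
by apply: mordB; [exact: mord_X|rewrite -mul_mpolyC; apply/mordMl/mord_X].
Qed.

Variables (S : seq (option B)) (n : option B -> nat) (m L : nat) (g : option B -> poly).
Hypothesis hS : uniq S.
Hypothesis hT : forall s u, s \in S -> u \in S -> s <> u -> transverse s u.
Hypothesis hn : (\sum_(s <- S) n s <= m)%N.
Hypothesis hg : forall s, s \in S ->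
  nbd (dstep s).1 L (g s) ('X_(other (dstep s).1) ^+ n s).

Let rest s := (\sum_(u <- S | u != s) n u)%N.
Let rest_le s : s \in S -> (rest s + n s <= m)%N.
Proof. by move=> h; apply: leq_trans hn; rewrite (bigD1_seq s) //= addnC. Qed.

(** The u-th term of the Chinese remainder theorem: a form of degree m + e divisible by
    [dir v ^+ n v] for every other v, with a freely chosen jet of length n u at u. *)
Let piece (e : nat) (c : option B -> {poly B}) u : poly :=
  (\prod_(v <- S | v != u) dir v ^+ n v) *
  (\sum_(i < n u) (c u)`_i *: (dir u ^+ i * exc u ^+ (m + e - rest u - i))).
Let piece_tr (e : nat) (c : option B -> {poly B}) s u : poly :=
  (\prod_(v <- S | v != u) dir_tr s v ^+ n v) *
  (\sum_(i < n u) (c u)`_i *: (dir_tr s u ^+ i * exc_tr s u ^+ (m + e - rest u - i))).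

Let sub1_piece e c s u : u \in S -> sub1 (dstep s) (piece e c u) = exc s ^+ (m + e) * piece_tr e c s u.
Proof.
move=> hu; have hr := rest_le hu; rewrite rmorphM /= rmorph_prod rmorph_sum /=.
have -> : exc s ^+ (m + e) = exc s ^+ rest u * exc s ^+ (m + e - rest u).
  by rewrite -exprD; congr (_ ^+ _); lia.
rewrite /piece_tr mulrACA; congr (_ * _).
  rewrite (expr_sum _ _ _ n) -big_split; apply: eq_bigr => v _ /=.
  by rewrite rmorphXn /= sub1_dir exprMn.
rewrite mulr_sumr; apply: eq_bigr => i _; rewrite sub1Z rmorphM !rmorphXn /= sub1_dir sub1_exc.
rewrite -scalerAr; congr (_ *: _); rewrite !exprMn mulrACA -exprD; congr (_ ^+ _ * _).
have := ltn_ord i; lia.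
Qed.

Let mord_piece e c u : u \in S -> mord (m + e) (piece e c u).
Proof.
move=> hu; have hr := rest_le hu.
have em : (m + e = rest u + (m + e - rest u))%N by lia.
rewrite [X in mord X _]em; apply: mordM.
  apply: mord_prod => v _; rewrite -[X in mord X _]muln1; apply: mordXn; exact: mord_dir.
apply: mord_sum => i _; rewrite -mul_mpolyC; apply: mordMl.
have ei : (m + e - rest u = i + (m + e - rest u - i))%N by have := ltn_ord i; lia.
rewrite [X in mord X _]ei; apply: mordM; rewrite -[X in mord X _]muln1; apply: mordXn; [exact: mord_dir|exact: mord_X].
Qed.

Let piece_tr_off e c s u : s \in S -> s != u -> nbd (dstep s).1 L (g s) (piece_tr e c s u).
Proof.
move=> hs hsu; rewrite /piece_tr (big_rem s hs) /= hsu dir_tr_diag mulrC; apply: nbdM.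
rewrite mulrC; apply: nbdM; exact: hg.
Qed.

(** The n s sum to at most m, so forms of degree m + e can realize jets of lengths n s at all s in
    S. The rest is absorbed by g s, since with the exceptional coordinate and terms of order L it
    generates the n s-th power of the coordinate along the line. *)
Let glue_step e (t : option B -> poly) : exists H, mord (m + e) H /\ forall s, s \in S ->
  exists z, sub1 (dstep s) H = exc s ^+ (m + e) * z /\ nbd (dstep s).1 L (g s) (z + t s).
Proof.
pose Pi s : poly := \prod_(v <- S | v != s) dir_tr s v ^+ n v.
(* By transversality the product of the other directions is a unit at s. *)
have hinv s : exists V, s \in S -> mord L (Pi s * V - 1).
  case: (boolP (s \in S)) => hs; last by exists 0.
  have [c hc] : exists c, c * (Pi s)@_0 = 1.
    rewrite /Pi big_seq_cond; apply: (big_ind (fun f : poly => exists c, c * f@_0 = 1)).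
    - by exists 1; rewrite mcoeff1 eqxx mul1r.
    - move=> f f' [c hc] [c' hc']; exists (c * c').
      by rewrite (rmorphM (mcoeff 0%MM)) mulrACA hc hc' mulr1.
    - move=> v /andP[hv /eqP ne].
      have [c hc] := transverse_coef (nesym ne) (hT hs hv (nesym ne)).
      by exists (c ^+ n v); rewrite (rmorphXn (mcoeff 0%MM)) -exprMn hc expr1n.
  by have [V hV] := mord_inv L hc; exists V.
have /choice[V hV] := hinv.
pose c s : {poly B} := take_poly (n s) (res (other (dstep s).1) (- (V s * t s))).
exists (\sum_(u <- S) piece e c u); split.
  by rewrite big_seq; apply: mord_sum => u; exact: mord_piece.
move=> s hs; exists (\sum_(u <- S) piece_tr e c s u); split.
  rewrite rmorph_sum mulr_sumr /= big_seq [in RHS]big_seq; apply: eq_bigr => u; exact: sub1_piece.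
rewrite (bigD1_seq s) //= addrAC; apply: nbdD; last first.
  rewrite big_seq_cond; apply: (big_ind (nbd (dstep s).1 L (g s))).
  - exact/nbd_mord/mord_zero.
  - exact: nbdD.
  - by move=> u /andP[_ hu]; apply: piece_tr_off => //; rewrite eq_sym.
have [a [b [hab _]]] := axis_divide (other (dstep s).1) (n s) (- (V s * t s)).
have -> : piece_tr e c s s = Pi s * inc (other (dstep s).1) (c s).
  rewrite /piece_tr -/(Pi s); congr (_ * _).
  rewrite (incE _ (size_take_poly _ _)); apply: eq_bigr => i _.
  by rewrite dir_tr_diag exc_tr_diag expr1n mulr1.
rewrite otherK in hab.
have -> : Pi s * inc (other (dstep s).1) (c s) + t s =
    - (t s * (Pi s * V s - 1)) + ((- (Pi s * a)) * 'X_(other (dstep s).1) ^+ n s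
    + 'X_((dstep s).1) * (- (Pi s * b))).
  rewrite -/(c s) in hab.
  have -> : inc (other (dstep s).1) (c s) = - (V s * t s) -
     'X_(other (dstep s).1) ^+ n s * a - 'X_((dstep s).1) * b by rewrite hab; ring.
  ring.
apply: nbdD; first by apply/nbd_mord/mordN/mordMl/hV.
by apply: nbdD; [apply: nbdM; exact: hg|exact: nbd_X].
Qed.

(* The Chinese remainder theorem on the exceptional line, applied successively to
   the homogeneous components of degrees m, m+1, ..., m+L-1. *)
Lemma glue (t : option B -> poly) : exists G, mord m G /\ forall s, s \in S ->
  exists q h, mord L h /\ sub1 (dstep s) G = exc s ^+ m * (t s + q * g s + h).
Proof.
have : exists G, mord m G /\ forall s, s \in S -> exists q z h,
    mord L h /\ sub1 (dstep s) G = exc s ^+ m * (t s + q * g s + exc s ^+ L * z + h).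
  (* The induction raises the power of the exceptional coordinate in front of the error z; once it
     is L, the error has order L and joins h. *)
  elim: {2}L => [|e [G [hG IH]]].
    exists 0; split; first exact: mord_zero.
    move=> s hs; exists 0, (- t s), 0; split; first exact: mord_zero.
    by rewrite rmorph0; ring.
  have hz s : exists z, s \in S -> exists q h,
      mord L h /\ sub1 (dstep s) G = exc s ^+ m * (t s + q * g s + exc s ^+ e * z + h).
    case: (boolP (s \in S)) => [/IH[q [z hz]]|_]; last by exists 0.
    by exists z => _; exists q.
  have /choice[z hz'] := hz; have [H [hH hH']] := glue_step e z.
  exists (G + H); split; first by apply: mordD => //; apply: mord_le hH; exact: leq_addr.
  move=> s hs; have [q [h [hh eG]]] := hz' s hs.
  have [z' [eH [q' [t' [h' [hh' ez]]]]]] := hH' s hs.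
  exists (q + exc s ^+ e * q'), t', (h + exc s ^+ e * h'); split; first by apply: mordD => //; apply: mordMl.
  have ez' : z' = q' * g s + exc s * t' + h' - z s by rewrite -[exc s * t']/('X_((dstep s).1) * t') -ez addrK.
  by rewrite rmorphD /= eG eH ez' exprD exprS; ring.
case=> G [hG IH]; exists G; split=> // s /IH[q [z [h [hh e]]]]; exists q, (exc s ^+ L * z + h).
split; last by rewrite e !addrA.
by apply: mordD => //; apply: mordMr; rewrite -[X in mord X _]muln1; apply/mordXn/mord_X.
Qed.

End Gluing.

(** * Tangent cones *)

Lemma size_prod_XsubC_exp (k : fieldType) (A : seq k) (n : k -> nat) :
  let q := \prod_(a <- A) ('X - a%:P) ^+ n a in q \is monic /\ size q = (\sum_(a <- A) n a).+1.
Proof.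
elim: A => [|a A [h1 h2]] /=; first by rewrite !big_nil monic1 size_poly1.
rewrite !big_cons; have hm : ('X - a%:P) ^+ n a \is monic by rewrite monic_exp ?monicXsubC.
by split; rewrite ?monicMl // size_Mmonic ?monic_neq0 // h2 size_exp_XsubC addSn addnS.
Qed.

Lemma sum_root_orders (k : fieldType) (A : seq k) (n : k -> nat) (phi : {poly k}) :
  phi != 0 -> uniq A -> (forall a, ('X - a%:P) ^+ n a %| phi)%R ->
  (\sum_(a <- A) n a < size phi)%N.
Proof.
move=> phi0 hA hd; have [_ <-] := size_prod_XsubC_exp A n; apply: dvdp_leq => //.
elim: A hA => [|a A IH] /=; first by rewrite big_nil dvd1p.
case/andP=> haA hA; rewrite big_cons Gauss_dvdp ?hd ?IH // coprimep_expl //.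
rewrite coprimep_sym big_seq; apply: (big_ind (fun q => coprimep q ('X - a%:P))) => [||b hb].
- exact: coprime1p.
- by move=> q q' hq hq'; rewrite coprimepMl hq.
- rewrite coprimep_expl // coprimep_XsubC root_XsubC; apply: contraNneq haA => ->; exact: hb.
Qed.

Lemma coef_find (R : nzRingType) (p : {poly R}) (n := find (fun c => c != 0) p) :
  p != 0 -> p`_n != 0 /\ forall i, (i < n)%N -> p`_i = 0.
Proof.
move=> p0; split; last first.
  by move=> i /(before_find 0)/negbT; rewrite negbK => /eqP.
apply: (nth_find 0 (a := fun c => c != 0)); apply/hasP; exists (lead_coef p); last by rewrite lead_coef_eq0.
by rewrite lead_coefE mem_nth // prednK ?lt0n ?size_poly_eq0.
Qed.

Section TangentCone.
Variable k : fieldType.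
Local Notation poly := {mpoly k[2]}.
Local Notation i0 := (0%R : 'I_2).
Local Notation i1 := (1%R : 'I_2).

Lemma sub1_mord_div (N : nat) (B : idomainType) (s : step N B) d f :
  mord d f -> exists f', sub1 s f = 'X_(s.1) ^+ d * f'.
Proof.
elim: d f => [|d IH] f hf; first by exists (sub1 s f); rewrite mul1r.
have [F [-> hF]] := mord_decomp hf.
have /choice[F' hF'] : forall l, exists F', sub1 s (F l) = 'X_(s.1) ^+ d * F' by move=> l; apply: IH.
exists (\sum_l (if l == s.1 then 1 else 'X_l + (s.2 l)%:MP) * F' l).
rewrite rmorph_sum mulr_sumr; apply: eq_bigr => l _; rewrite rmorphM /= sub1X hF' /stepX exprS.
by case: eqP => [->|_]; ring.
Qed.

Variables (f : poly) (m : nat).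
Hypotheses (hf : mord m f) (hf' : ~ mord m.+1 f).

(* The dehomogenised initial form. *)
Let phi : {poly k} := \poly_(i < m.+1) f@_(U_(i0) *+ (m - i) + U_(i1) *+ i).

Let initial_form : exists f1, mord m.+1 f1 /\
  f = \sum_(i < m.+1) phi`_i *: ('X_0 ^+ (m - i) * 'X_1 ^+ i) + f1.
Proof.
pose f0 : poly := \sum_(i < m.+1) phi`_i *: ('X_0 ^+ (m - i) * 'X_1 ^+ i).
exists (f - f0); split; last by rewrite addrC subrK.
have hm (u : 'X_{1..2}) : u = (U_(i0) *+ u i0 + U_(i1) *+ u i1)%MM.
  by apply: (@mnm2P _ _ 0); rewrite mnmDE !mnm_axis /= ?eqxx ?mul1n ?mul0n ?addn0 ?add0n.
have hd (u : 'X_{1..2}) : mdeg u = (u i0 + u i1)%N.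
  by rewrite {1}(hm u) mdegD !mdegMn !mdeg1 !mul1n.
have hX (i : nat) : 'X_0 ^+ (m - i) * 'X_1 ^+ i = 'X_[U_(i0) *+ (m - i) + U_(i1) *+ i] :> poly.
  by rewrite mpolyXD !mpolyXn.
have hE (i : nat) : (U_(i0) *+ (m - i) + U_(i1) *+ i)%MM i1 = i :> nat.
  by rewrite mnmDE !mnm_axis /= mul0n mul1n add0n.
move=> u hu; rewrite mcoeffB /f0 raddf_sum /=.
have [e|ne] := eqVneq (mdeg u) m; last first.
  rewrite (hf (m := u)); last by move: hu ne; rewrite ltnS leq_eqVlt => /orP[->|].
  rewrite big1 ?subr0 // => i _; rewrite mcoeffZ hX mcoeffX; case: eqP => [h|_]; last by rewrite mulr0.
  by move: ne; rewrite -h mdegD !mdegMn !mdeg1 !mul1n subnK ?eqxx // -ltnS ltn_ord.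
have hu1 : (u i1 < m.+1)%N by rewrite ltnS -e hd leq_addl.
rewrite (bigD1 (Ordinal hu1)) //= mcoeffZ hX mcoeffX.
have eu : (U_(i0) *+ (m - u i1) + U_(i1) *+ u i1)%MM = u.
  by rewrite [RHS]hm; congr (_ *+ _ + _)%MM; rewrite -e hd addnK.
rewrite /= eu eqxx mulr1 coef_poly hu1 eu big1 ?addr0 ?subrr // => i hi.
rewrite mcoeffZ hX mcoeffX; case: eqP => [h|_]; last by rewrite mulr0.
by move: hi; rewrite -val_eqE /= -h hE eqxx.
Qed.

(** The initial form restricted to the exceptional line, in a coordinate that vanishes at s; at the
    vertical direction this reverses the coefficients. *)
Let psi (s : option k) : {poly k} :=
  if s is Some a then phi \Po ('X + a%:P) else \poly_(j < m.+1) phi`_(m - j).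

Let transform s f' : sub1 (dstep s) f = exc s ^+ m * f' ->
  exists b, f' = inc (other (dstep s).1) (psi s) + 'X_((dstep s).1) * b.
Proof.
have [f1 [hf1 ef]] := initial_form; have [b hb] := sub1_mord_div (dstep s) hf1.
move=> e; exists b.
apply: (mulfI (x := exc s ^+ m)); first by rewrite expf_neq0 // /exc mpolyX_neq0.
rewrite -e ef rmorphD /= hb rmorph_sum /= mulrDr; congr (_ + _); last by rewrite exprSr mulrA.
rewrite (eq_bigr (fun i : 'I_m.+1 => phi`_i *: sub1 (dstep s) ('X_0 ^+ (m - i) * 'X_1 ^+ i))); last first.
  by move=> i _; rewrite sub1Z.
case: s {e hb} => [a|]; rewrite /exc /=.
  have -> : inc (other 0) (phi \Po ('X + a%:P)) = \sum_(i < m.+1) phi`_i *: ('X_1 + a%:MP) ^+ i.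
    rewrite {1}/phi poly_def raddf_sum /inc raddf_sum horner_sum; apply: eq_bigr => i _ /=.
    rewrite coef_poly ltn_ord comp_polyZ comp_Xn_poly map_polyZ hornerZ mul_mpolyC rmorphXn /=.
    by rewrite horner_exp rmorphD /= map_polyX map_polyC hornerD hornerX hornerC.
  rewrite mulr_sumr; apply: eq_bigr => i _; rewrite -scalerAr; congr (_ *: _).
  rewrite rmorphM !rmorphXn /= !sub1X /stepX /= exprMn mulrA -exprD subnK // -ltnS ltn_ord //.
rewrite (incE _ (size_poly _ _)) mulr_sumr (reindex_inj rev_ord_inj) /=; apply: eq_bigr => i _.
have hi : (i <= m)%N by rewrite -ltnS ltn_ord.
rewrite subSS [in RHS]coef_poly ltn_ord -scalerAr; congr (_ *: _).
rewrite rmorphM !rmorphXn /= !sub1X /stepX /= mpolyC0 addr0 subKn // exprMn mulrAC -exprD.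
by rewrite subnKC.
Qed.

Let phi_neq0 : phi != 0.
Proof.
apply/eqP => h; apply: hf'; have [f1 [hf1 ->]] := initial_form.
by rewrite h big1 ?add0r // => i _; rewrite coef0 scale0r.
Qed.

Let psi_neq0 s : psi s != 0.
Proof.
case: s => [a|] /=.
  by rewrite comp_poly2_eq0 // size_XaddC.
apply: contra phi_neq0 => /eqP h; apply/eqP/polyP => i; rewrite coef0.
have [hi|hi] := ltnP i m.+1; last by rewrite coef_poly ltnNge hi.
have := congr1 (fun p : {poly k} => p`_(m - i)) h; rewrite /= coef_poly coef0 ltnS leq_subr subKn //.
Qed.

(* Intersection multiplicities of the tangent cone with the exceptional line. *)
Lemma tangent_orders : exists n : option k -> nat,
  (forall s f', sub1 (dstep s) f = exc s ^+ m * f' ->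
     axis (other (dstep s).1) (n s) f' /\ f'@_(U_(other (dstep s).1) *+ n s) != 0) /\
  forall S, uniq S -> (\sum_(s <- S) n s <= m)%N.
Proof.
pose n s := find (fun c => c != 0) (psi s); exists n; split.
  move=> s f' /transform[b ->].
  have hc e : (inc (other (dstep s).1) (psi s) + 'X_((dstep s).1) * b)@_(U_(other (dstep s).1) *+ e) = (psi s)`_e.
    by rewrite mcoeffD mcoeff_inc -{2}[(dstep s).1]otherK mcoeff_X_other addr0.
  have [h1 h2] := coef_find (psi_neq0 s).
  by split=> [e /h2|]; rewrite hc.
move=> S hS.
(* The order at the vertical direction is at most m minus the degree of phi, and that degree bounds
   the sum of the orders at the finite slopes. *)
have hNone : (n None + (size phi).-1 <= m)%N.
  have hs : ((size phi).-1 <= m)%N by rewrite -ltnS prednK ?size_poly // lt0n size_poly_eq0.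
  rewrite addnC -leq_subRL // leqNgt; apply/negP => h.
  have [_ /(_ _ h)] := coef_find (psi_neq0 None).
  rewrite /psi coef_poly ltnS leq_subr subKn //; apply/eqP.
  by rewrite -lead_coefE lead_coef_eq0.
have hSome (A : seq k) : uniq A -> (\sum_(a <- A) n (Some a) < size phi)%N.
  move=> hA; apply: sum_root_orders => // a.
  have [_ h] := coef_find (psi_neq0 (Some a)).
  have e : psi (Some a) = drop_poly (n (Some a)) (psi (Some a)) * 'X^(n (Some a)).
    rewrite -{1}(poly_take_drop (n (Some a)) (psi (Some a))) -[RHS]add0r; congr (_ + _).
    by apply/polyP => i; rewrite coef_take_poly coef0; case: ltnP => // /h.
  have -> : phi = psi (Some a) \Po ('X - a%:P).
    by rewrite /psi -comp_polyA comp_polyD comp_polyX comp_polyC subrK comp_polyXr.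
  by rewrite e comp_polyM comp_Xn_poly dvdp_mull.
have hsplit : (\sum_(s <- S) n s <= n None + \sum_(a <- pmap id S) n (Some a))%N.
  elim: S hS => [|[a|] S IH] /=; first by rewrite !big_nil.
    by case/andP=> _ /IH; rewrite !big_cons => h; rewrite addnCA leq_add2l.
  case/andP=> hN _; rewrite big_cons leq_add2l.
  elim: S hN {IH} => [|[a|] S IH] //=; first by rewrite !big_nil.
  by rewrite inE /= => /IH; rewrite !big_cons leq_add2l.
apply: leq_trans hsplit _; apply: leq_trans hNone; rewrite leq_add2l.
have /hSome : uniq (pmap id S).
  by apply: (@pmap_uniq _ _ id Some) => // -[].
by case: (size phi).
Qed.

End TangentCone.

(** * Lifts with prescribed orders *)

Lemma combine_id (E : comNzRingType) (x g p t q h : E) :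
  x * (g + p * t) - p * (x * (t + q * g + h)) = x * ((1 - p * q) * g - p * h).
Proof. ring. Qed.

Section LiftOrders.
Variables (B : idomainType) (k : fieldType) (r : {rmorphism B -> k}) (pi : B).
Hypotheses (hpi : r pi = 0) (hker : forall b, r b = 0 -> exists b', b = pi * b').
Hypothesis hunit : forall b, r b <> 0 -> b \is a GRing.unit.
(** The lifts of the slopes that occur. They are determined by their reductions, so distinct ones
    differ by units. *)
Variable T : seq B.
Hypotheses (hT0 : 0 \in T) (hT : {in T &, injective r}).
Local Notation poly := {mpoly B[2]}.
Local Notation red := (map_mpoly r).
Local Notation words := (map (@dstep B)).

Lemma unit_inv b : r b <> 0 -> exists c, c * b = 1.
Proof. by move=> /hunit hb; exists b^-1; rewrite mulVr. Qed.

(** The coefficients with zero reduction are moved into the multiple of pi, so that F0 has no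
    monomials beyond those of the reduction. Its order at the origin and its contact with the axes
    are then right at once. *)
Lemma support_lift (n : nat) (F : {mpoly B[n]}) : exists F0 F1,
  F = F0 + pi%:MP * F1 /\ forall m, (red F)@_m = 0 -> F0@_m = 0.
Proof.
have hb m : exists b, r F@_m = 0 -> F@_m = pi * b.
  by have [/hker[b hb]|] := pselect (r F@_m = 0); [exists b|exists 0].
have /choice[b hb'] := hb.
pose S0 := [seq m <- msupp F | r F@_m != 0]; pose S1 := [seq m <- msupp F | r F@_m == 0].
exists (\sum_(m <- S0) F@_m *: 'X_[m]), (\sum_(m <- S1) b m *: 'X_[m]); split.
  rewrite {1}[F]mpolyE (bigID (fun m => r F@_m != 0)) /= !big_filter; congr (_ + _).
  rewrite mulr_sumr (eq_bigl (fun m => r F@_m == 0)) => [|m]; last by rewrite negbK.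
  by apply: eq_bigr => m /eqP/hb' {1}->; rewrite mul_mpolyC scalerA.
move=> m; rewrite mcoeff_map_mpoly => h.
by rewrite mcoeff_sumX ?filter_uniq ?msupp_uniq // mem_filter h eqxx.
Qed.

Definition allowed (s : option B) := if s is Some a then a \in T else true.

Lemma allowed_transverse s u : allowed s -> allowed u -> s <> u -> transverse s u.
Proof.
case: s u => [a|] [b|] //= ha hb h; apply: unit_inv; rewrite rmorphB => /eqP.
by rewrite subr_eq0 => /eqP/(hT ha hb) e; apply: h; rewrite e.
Qed.

Lemma allowed_good s : allowed s -> good_step (dstep s).
Proof.
move=> hs; apply/forallP => l; case: s hs => [a|] /= ha; last by rewrite eqxx.
case: ifP => _; first by rewrite eqxx.
apply/orP; have [a0|a0] := eqVneq a 0; [by left|right].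
apply: hunit => e; move/eqP: a0; apply; apply: hT => //; by rewrite e rmorph0.

Qed.

Lemma step_map_dstep s : step_map r (dstep s) = dstep (omap r s).
Proof.
rewrite /step_map; case: s => [a|] //=; congr (_, _); apply/funext => l /=.
  by case: eqP; rewrite ?rmorph0.
exact: rmorph0.
Qed.

Lemma red_sub1 s (F : poly) : red (sub1 (dstep s) F) = sub1 (dstep (omap r s)) (red F).
Proof. by rewrite sub1_map step_map_dstep. Qed.

Lemma red_exc s m : red (exc s ^+ m) = exc (omap r s) ^+ m.
Proof. by rewrite rmorphXn /= map_mpolyX; case: s. Qed.

(** The transform of a variable is a monomial times a unit, so its order does not change under
    reduction. *)
Lemma mord_subw_X (w : seq (option B)) l d : all allowed w ->
  mord d (red (subw (words w) ('X_l))) -> mord d (subw (words w) 'X_l : poly).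
Proof.
move=> hw; have hm : mono_unit (subw (words w) 'X_l : poly).
  elim/last_ind: w hw => [|w s IH]; first by move=> _; exact: mono_unitX.
  rewrite all_rcons map_rcons subw_rcons => /andP[hs /IH hw].
  by apply: mono_unit_sub1 => //; exact: allowed_good.
have h0 : subw (words w) 'X_l != 0 :> poly by apply: subw_neq0; exact: mpolyX_neq0.
have h0' : red (subw (words w) 'X_l) != 0.
  by rewrite subw_map; apply: subw_neq0; rewrite map_mpolyX mpolyX_neq0.
by move/(mord_ordp _ h0'); rewrite ordp_mono // => h; apply/(mord_ordp _ h0).
Qed.

Lemma ordpXn (n : nat) (R : idomainType) (f : {mpoly R[n]}) e :
  f != 0 -> ordp (f ^+ e) = (e * ordp f)%N.
Proof.
move=> f0; elim: e => [|e IH]; first by rewrite ordp_unit // mcoeff1 eqxx oner_neq0.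
by rewrite exprS ordpM ?expf_neq0 // IH mulSn.
Qed.

(** The point of the exceptional line on the strict transform of the l-th axis. *)
Definition axis_slope (R : nzRingType) (l : 'I_2) : option R := if l == 0 then Some 0 else None.

Lemma axis_slope_dir (R : idomainType) l : (dstep (axis_slope R l)).1 = l.
Proof. by case: l => -[|[|//]] h; apply/val_inj. Qed.

Lemma axis_sub1 (R : idomainType) l M (f : {mpoly R[2]}) :
  axis l M (sub1 (dstep (axis_slope R l)) f) <-> axis l M f.
Proof.
suff e : res l (sub1 (dstep (axis_slope R l)) f) = res l f.
  by split=> h i /h; rewrite -!coef_res e.
pose Q : set {mpoly R[2]} := [set f | res l (sub1 (dstep (axis_slope R l)) f) = res l f].
apply: (@mpoly_subring_ind _ _ Q) => [|c|i]; rewrite /Q /mkset.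
- split=> [|u v hu hv|u v hu hv]; rewrite /mkset ?rmorph1 //.
    by rewrite rmorphB !resB hu hv.
  by rewrite rmorphM !resM hu hv.
- by rewrite sub1C.
have hl := axis_slope_dir R l; rewrite sub1X /stepX.
case: eqP => // /eqP; rewrite hl => /eq_other ->.
have -> : (dstep (axis_slope R l)).2 (other l) = 0.
  by rewrite /axis_slope /dstep; case: (l == 0) => //=; case: ifP.
by rewrite mpolyC0 addr0 resM res_other mulr0.
Qed.

Lemma exc_axis (R : idomainType) l m : exc (axis_slope R l) ^+ m = 'X_l ^+ m.
Proof. by rewrite /exc axis_slope_dir. Qed.

(* The words record the centres whose orders are controlled; controlling the two
   axes as well makes the lifts on the exceptional line have the right orders of
   contact with it, so that [glue] applies. *)
Lemma lift_orders L D : forall (F : poly) (W : seq (seq (option B))),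
  (forall w, w \in W -> (size w <= D)%N /\ all allowed w) ->
  (red F != 0 -> (ordp (red F) < L)%N) ->
  exists ft G, [/\ F = ft + pi%:MP * G,
    (forall w, w \in W -> forall d, (d <= L)%N ->
       mord d (red (subw (words w) F)) -> mord d (subw (words w) ft))
    & forall l M, (M <= L)%N -> axis l M (red F) -> axis l M ft].
Proof.
elim: D => [|D IH] F W hW hL.
  have [F0 [F1 [eF hF0]]] := support_lift F; exists F0, F1; split=> //.
    move=> w /hW[hw _] d _; have -> : w = [::] by case: w hw.
    by move=> h m hm; apply/hF0/h.
  by move=> l M _ h e he; apply/hF0/h.
have [F0|rF] := eqVneq (red F) 0.
  have [F0' [F1 [eF hF0]]] := support_lift F; exists 0, F1; split.
  - rewrite {1}eF; congr (_ + _); apply/mpolyP => m; rewrite mcoeff0; apply: hF0.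
    by rewrite F0 mcoeff0.
  - by move=> w _ d _ _; rewrite raddf0; exact: mord_zero.
  - by move=> l M _ _ e _; rewrite mcoeff0.
have {}hL := hL rF; set m := ordp (red F) in hL.
have [F0 [F1 [eF hF0]]] := support_lift F.
have [hm hm'] := ordpP rF.
have hmF0 : mord m F0 by move=> u hu; apply/hF0/hm.
have rF0 : red F0 = red F by rewrite [in RHS]eF rmorphD rmorphM /= map_mpolyC /= hpi mpolyC0 mul0r addr0.
have /choice[F' hF'] : forall s, exists F', sub1 (dstep s) F0 = exc s ^+ m * F'.
  by move=> s; exact: sub1_mord_div.
have rF' s : sub1 (dstep (omap r s)) (red F) = exc (omap r s) ^+ m * red (F' s).
  by rewrite -rF0 -red_sub1 hF' rmorphM /= red_exc.
have [n [hn hnS]] := tangent_orders hm hm'.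
(* The directions of both axes are included so that the lift keeps its contact with them. *)
pose S := undup [:: None, Some 0 & [seq head None w | w <- W & w != [::]]].
have hSW w s : s :: w \in W -> s \in S.
  move=> h; rewrite mem_undup !inE; apply/orP; right; apply/orP; right.
  by apply/mapP; exists (s :: w); rewrite ?mem_filter.
have hSaxis l : axis_slope B l \in S by rewrite /axis_slope mem_undup !inE; case: ifP => _; rewrite ?eqxx ?orbT.
have hSall s : s \in S -> allowed s.
  rewrite mem_undup !inE => /or3P[/eqP ->|/eqP ->|/mapP[w]] //.
  by rewrite mem_filter => /andP[w0 /hW[_ hw]] ->; case: w w0 hw => //= s' w _ /andP[].
have hn1 s : (n s <= m)%N by have := hnS [:: s] isT; rewrite big_cons big_nil addn0.
pose W' s := [seq behead w | w <- W & (w != [::]) && (head None w == s)].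
have hgR s : exists gR : poly * poly, [/\ F' s = gR.1 + pi%:MP * gR.2,
    (forall w, w \in W' s -> forall d, (d <= L)%N ->
       mord d (red (subw (words w) (F' s))) -> mord d (subw (words w) gR.1))
    & forall l M, (M <= L)%N -> axis l M (red (F' s)) -> axis l M gR.1].
  have [|F's0|g [R [h1 h2 h3]]] := IH (F' s) (W' s); last by exists (g, R).
    move=> w /mapP[w']; rewrite mem_filter => /andP[/andP[h1 _] /hW[h2 h3]] ->.
    by case: w' h1 h2 h3 => //= u w' _ h2 /andP[].
  (* The order of the transform is at most its contact with the exceptional line, hence at most m
     and below L. *)
  apply: leq_ltn_trans hL; apply: leq_trans (hn1 (omap r s)).
  have [h1 h2] := hn _ _ (rF' s); rewrite leqNgt; apply/negP => hlt.
  have [h3 _] := ordpP F's0.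
  by move: h2; rewrite (axis_mord _ h3 hlt) eqxx.
have /choice[gR hgR'] := hgR; pose g s := (gR s).1; pose R s := (gR s).2.
have hg s : F' s = g s + pi%:MP * R s by have [] := hgR' s.
have hTr s u : s \in S -> u \in S -> s <> u -> transverse s u.
  by move=> /hSall hs /hSall hu; apply: allowed_transverse.
have hSum : (\sum_(s <- S) n (omap r s) <= m)%N.
  rewrite -(big_map (omap r) xpredT n); apply: hnS; rewrite map_inj_in_uniq ?undup_uniq //.
  move=> [a|] [b|] /hSall ha /hSall hb //= [] e; congr Some; exact: hT.
have hNbd s : s \in S -> nbd (dstep s).1 L (g s) ('X_(other (dstep s).1) ^+ n (omap r s)).
  move=> _; have [h1 h2] := hn _ _ (rF' s).
  have ej : (dstep (omap r s)).1 = (dstep s).1 by case: (s).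
  rewrite ej in h1 h2.
  have [_ _ /(_ _ _ _ h1) h3] := hgR' s.
  have [c hc] : exists c, c * (g s)@_(U_(other (dstep s).1) *+ n (omap r s)) = 1.
    apply: unit_inv => e; move/eqP: h2; apply; rewrite mcoeff_map_mpoly hg mcoeffD mcoeffCM.
    have hz a b : r a = 0 -> r (a + pi * b) = 0.
      by move=> ha; rewrite rmorphD rmorphM ha hpi mul0r addr0.
    exact: hz.
  have := nbd_axis L (h3 (leq_trans (hn1 _) (ltnW hL))) hc; rewrite otherK; exact.
(* The transform of F0 at s is g s + pi R s, where g s has the right orders. Subtracting pi G from
   F0 removes R s up to multiples of g s and terms of order L. *)
have [G [hG hGS]] := glue (undup_uniq _) hTr hSum hNbd R.
have hft s : s \in S -> exists q h, mord L h /\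
    sub1 (dstep s) (F0 - pi%:MP * G) = exc s ^+ m * (q * g s + h).
  move=> /hGS[q [h [hh e]]]; exists (1 - pi%:MP * q), (- (pi%:MP * h)); split.
    by apply/mordN/mordMl.
  have -> : sub1 (dstep s) (F0 - pi%:MP * G) = sub1 (dstep s) F0 - pi%:MP * sub1 (dstep s) G.
    by rewrite -[in RHS](sub1C (dstep s) pi) -(rmorphM (sub1 (dstep s))) -(rmorphB (sub1 (dstep s))).
  rewrite e (hF' s) (hg s); exact: combine_id.
have hmft : mord m (F0 - pi%:MP * G) by apply: mordB => //; apply: mordMl.
exists (F0 - pi%:MP * G), (F1 + G); split; first by rewrite {1}eF; ring.
  move=> [|s w] hw d hd.
    by move=> /(mord_ordp _ rF) hdm; apply: mord_le hmft.
  have [q [h [hh e]]] := hft s (hSW _ _ hw).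
  have [_ hwall] := hW _ hw; move: hwall => /= /andP[hs hwall].
  have -> : red (subw (words (s :: w)) F) = red (subw (words w) (sub1 (dstep s) F0)).
    by rewrite -[X in _ = red X]/(subw (words (s :: w)) F0) !subw_map rF0.
  rewrite hF' e (rmorphM (subw (words w))) (rmorphXn (subw (words w))).
  rewrite (rmorphM (map_mpoly r)) (rmorphXn (map_mpoly r)).
  rewrite (rmorphM (subw (words w))) (rmorphXn (subw (words w))) (rmorphD (subw (words w))) (rmorphM (subw (words w))).
  pose X := subw (words w) (exc s); pose Y := subw (words w) (F' s).
  change (mord d (red X ^+ m * red Y) -> mord d (X ^+ m *
    (subw (words w) q * subw (words w) (g s) + subw (words w) h))).
  move=> hXY; have X0 : red X != 0.
    by rewrite subw_map; apply: subw_neq0; rewrite map_mpolyX mpolyX_neq0.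
  have Y0 : red Y != 0.
    rewrite subw_map; apply: subw_neq0; apply: contra_neq rF => e0.
    have := rF' s; rewrite e0 mulr0 => h0.
    by apply: (@sub1_inj _ _ (dstep (omap r s))); rewrite h0 rmorph0.
  have hX : mord (ordp (red X)) X by have [h0 _] := ordpP X0; exact: (mord_subw_X hwall h0).
  have XY0 : red X ^+ m * red Y != 0 by rewrite mulf_neq0 ?expf_neq0.
  move/(mord_ordp _ XY0): hXY; rewrite ordpM ?expf_neq0 // ordpXn // => hdo.
  have hXm : mord (m * ordp (red X)) (X ^+ m) by exact: mordXn hX.
  (* Either the exceptional factor alone has order d, or the missing order comes from g s by
     induction, and from h because its order L is at least d. *)
  have [hle|hlt] := leqP d (m * ordp (red X)).
    by apply: mordMr; apply: mord_le hXm.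
  rewrite -(subnKC (ltnW hlt)); apply: mordM => //; apply: mordD.
    apply: mordMl; have [_ h2 _] := hgR' s; apply: h2.
    - by apply/mapP; exists (s :: w) => //; rewrite mem_filter /= eqxx.
    - by apply: leq_trans hd; exact: leq_subr.
    - by apply/(mord_ordp _ Y0); rewrite leq_subLR.
  by apply: subw_mord; apply: mord_le hh; apply: leq_trans hd; exact: leq_subr.
move=> l M hM hax.
have [hMm|hmM] := leqP M m; first exact: axis_mord (mord_le hMm hmft).
have [q [h [hh e]]] := hft _ (hSaxis l).
rewrite -(subnKC (ltnW hmM)); apply/axis_sub1; rewrite e exc_axis; apply/axis_XM.
apply: axisD; last by apply: axis_mord (mord_le _ hh); apply: leq_trans hM; exact: leq_subr.
apply: axisM; have [_ _ h3] := hgR' (axis_slope B l).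
apply: h3; first by apply: leq_trans hM; exact: leq_subr.
apply/(axis_XM l _ m); rewrite subnKC ?(ltnW hmM) //.
have er : omap r (axis_slope B l) = axis_slope k l by rewrite /axis_slope; case: eqP => //= _; rewrite rmorph0.
have := rF' (axis_slope B l); rewrite er exc_axis => <-.
exact/axis_sub1.
Qed.

End LiftOrders.

(** * Lifting the sequence of blow-ups *)

Section Words.
Variables (N : nat) (k : closedFieldType).

Lemma reach_normalised (ws : nat -> seq (step N k)) n : (forall i, (i < n)%N -> reach ws i (ws i)) ->
  forall i, (i < n)%N -> all (fun s => `[< normalised s >]) (ws i).
Proof.
move=> hws; suff h : forall i, (i < n)%N -> forall j, (j <= i)%N -> forall w, reach ws j w ->
    all (fun s => `[< normalised s >]) w.
  by move=> i hi; apply: (h i hi i (leqnn i)); exact: hws.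
elim=> [|i IH] hi j.
  by rewrite leqn0 => /eqP -> w /= ->.
elim: j => [|j IHj] hj w /=; first by move=> ->.
case=> [[hw _]|[s hs ->]]; first exact: IHj (ltnW hj) w hw.
rewrite all_rcons; apply/andP; split; first exact/asboolP.
apply: (IH (ltnW hi) j); [by rewrite -ltnS|apply: hws; exact: leq_ltn_trans (ltnW hj) hi].
Qed.

Definition coords (w : seq (step N k)) : seq k := flatten [seq [seq s.2 l | l <- enum 'I_N] | s <- w].

Lemma map_coords (C : Type) (w : seq (step N k)) (f g : k -> C) :
  {in coords w, f =1 g} -> map (step_map f) w = map (step_map g) w.
Proof.
elim: w => [|s w IH] //= h; rewrite IH; last by move=> a ha; apply: h; rewrite mem_cat ha orbT.
congr (_ :: _); rewrite /step_map; congr (_, _); apply/funext => l /=; apply: h.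
by rewrite mem_cat; apply/orP; left; apply/mapP; exists l; rewrite ?mem_enum.
Qed.

Lemma step_map_id (w : seq (step N k)) : map (step_map id) w = w.
Proof. by elim: w => [|[j a] w IH] //=; rewrite IH. Qed.

Lemma all_good (B : idomainType) (tau : k -> B) (cs : seq k) (w : seq (step N k)) :
  (forall a, a \in cs -> tau a = 0 \/ tau a \is a GRing.unit) -> {subset coords w <= cs} ->
  all (@good_step N B) (map (step_map tau) w).
Proof.
move=> h; elim: w => [|s w IH] //= hw; apply/andP; split; last first.
  by apply: IH => a ha; apply: hw; rewrite mem_cat ha orbT.
apply/forallP => l; apply/orP; case: (h (s.2 l)) => [|/= ->|/= ->]; [|by left|by right].
by apply: hw; rewrite mem_cat; apply/orP; left; apply/mapP; exists l; rewrite ?mem_enum.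
Qed.

End Words.

Lemma step_map_comp (N : nat) (A B C : Type) (f : B -> C) (g : A -> B) (w : seq (step N A)) :
  map (step_map f) (map (step_map g) w) = map (step_map (f \o g)) w.
Proof. by rewrite -map_comp. Qed.

Lemma chain_ext (N : nat) (B : idomainType) (ws ws' : nat -> seq (step N B)) Gs hs Js n :
  (forall i, (i < n)%N -> ws i = ws' i) -> chain ws Gs hs Js n -> chain ws' Gs hs Js n.
Proof. by move=> e [h1 h2]; split=> // i hi; rewrite -e //; exact: h2. Qed.

Lemma chain_sequence (N : nat) (F : closedFieldType) ws Gs hs Js n : @chain N F ws Gs hs Js n ->
  blowup_sequence n (fun i => Bl (@SP N F) (GF (seqset (Gs i)))) (fun i => pt (ws i.-1)).
Proof.
by move=> /(@chain_models N F) [h0 hS]; split=> // i hi; have [h1 h2 h3] := hS i hi; rewrite origin_pt.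
Qed.

Lemma blowup_sequence_eq (F : fieldType) (N n : nat) (A A' : nat -> set (set (funfield F N))) P P' :
  blowup_sequence n A P -> blowup_sequence n A' P' -> (forall i, (i < n)%N -> P i.+1 = P' i.+1) ->
  forall i, (i <= n)%N -> A i = A' i.
Proof.
move=> [h0 hS] [h0' hS'] hP; elim=> [_|i IH hi]; first by rewrite h0 h0'.
have [_ _ ->] := hS i hi; have [_ _ ->] := hS' i hi.
by rewrite IH ?hP //; apply: ltnW.
Qed.

(** * Change of base and assembly of the lifted sequence *)

Section Base.
Variables (L k : closedFieldType) (p : nat).
Hypothesis hp : p \in [pchar k].
Local Notation "<< sg >>" := (subring_gen (seqset sg)) : classical_set_scope.

Lemma skeleton_idfun (F : fieldType) (S : set F) : fg_subring S -> is_skeleton idfun [set: F] S.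
Proof.
move=> h; split=> //; apply/seteqP; split=> // x _.
by apply: sub_subring_gen; left; exists x.
Qed.

Lemma hom_on_gen (sg : seq L) (phi : L -> k) : hom_on <<sg>> phi -> phi @` <<sg>> = <<map phi sg>>.
Proof.
have hS := subring_genP (seqset sg); have hS' := subring_genP (seqset (map phi sg)).
case: (hS) (hS') => S1 SB SM [T1 TB TM] [h1 hB hM]; apply/seteqP; split.
  move=> _ [a ha <-].
  suff : <<sg>> `<=` [set a | <<sg>> a /\ <<map phi sg>> (phi a)] by move=> /(_ a ha)[].
  apply: subring_gen_min.
    split; first by split; rewrite ?h1.
      by move=> u v [u1 u2] [v1 v2]; split; [exact: SB|rewrite hB //; exact: TB].
    by move=> u v [u1 u2] [v1 v2]; split; [exact: SM|rewrite hM //; exact: TM].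
  move=> x hx; split; apply: sub_subring_gen => //; exact: map_f.
apply: subring_gen_min.
  split; first by exists 1.
    by move=> _ _ [u hu <-] [v hv <-]; exists (u - v); [exact: SB|rewrite hB].
  by move=> _ _ [u hu <-] [v hv <-]; exists (u * v); [exact: SM|rewrite hM].
by move=> _ /mapP[x hx ->]; exists x => //; apply: sub_subring_gen.
Qed.

Lemma base_compatible (sg : seq L) (phi : L -> k) : base p sg phi -> compatible_base p phi <<sg>> (phi @` <<sg>>).
Proof.
move=> [hphi hk _]; split; [by apply: skeleton_idfun; exists sg| |].
  by apply: skeleton_idfun; exists (map phi sg); rewrite hom_on_gen.
case: (hphi) => h1 hB hM; split=> // a ha; split=> [/(hk _ ha)[b hb ->]|[b hb eb]].
  by exists b => //; rewrite mulr_natl.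
have := rmorphMn (subring_hom hphi) p (mksub (subring_genP (seqset sg)) hb).
have -> : mksub (subring_genP (seqset sg)) hb *+ p = mksub (subring_genP (seqset sg)) ha.
  apply: (@subring_val_inj _ _ (subring_genP (seqset sg))).
  by rewrite (rmorphMn (@subring_val _ _ (subring_genP (seqset sg)))) /= -eb.
by move=> e; have -> : phi a = phi b *+ p by []; rewrite -mulr_natl (pcharf0 hp) mul0r.
Qed.

End Base.

Section Factor.
Variables (L : fieldType) (B B' : idomainType) (iota : {rmorphism B -> L}) (iota' : {rmorphism B' -> L}).
Hypotheses (inj : injective iota') (h : forall b, exists b', iota' b' = iota b).

Definition factor of injective iota' := fun b : B => proj1_sig (cid (h b)) : B'.

Lemma factorE b : iota' (factor inj b) = iota b. Proof. exact: proj2_sig (cid (h b)). Qed.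

Lemma factor_zmod : zmod_morphism (factor inj).
Proof. by move=> a b; apply: inj; rewrite rmorphB !factorE rmorphB. Qed.

Lemma factor_monoid : monoid_morphism (factor inj).
Proof. by split=> [|a b]; apply: inj; rewrite ?rmorph1 ?rmorphM !factorE ?rmorph1 ?rmorphM. Qed.

HB.instance Definition _ := GRing.isZmodMorphism.Build B B' (factor inj) factor_zmod.
HB.instance Definition _ := GRing.isMonoidMorphism.Build B B' (factor inj) factor_monoid.

End Factor.

Section LocalBaseMorphism.
Variables (L k : closedFieldType) (p : nat).
Local Notation "<< sg >>" := (subring_gen (seqset sg)) : classical_set_scope.

(** An element b is u / v over the old base with v not killed by phi. As phi' extends phi, v is
    invertible in B' too, which gives the image of b; compatibility with reduction is checked after
    multiplying by v. *)
Lemma local_base_morphism sg phi sg' phi' (B B' : idomainType) (iota : {rmorphism B -> L})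
    (r : {rmorphism B -> k}) sgB (iota' : {rmorphism B' -> L}) (r' : {rmorphism B' -> k}) sgB' :
  extends sg phi sg' phi' -> local_base p sg phi iota r sgB -> local_base p sg' phi' iota' r' sgB' ->
  exists j : {rmorphism B -> B'}, iota' \o j =1 iota /\ r' \o j =1 r.
Proof.
move=> [hsub he] [inj [hu _ hfr] [eSg er] _] [inj' [hu' _ _] [eSg' er'] _].
have hq b : exists b' u v, [/\ iota' b' = iota b, b' * v = u, <<sgB'>> u, <<sgB'>> v &
    exists u0 v0, [/\ <<sgB>> u0, <<sgB>> v0, b * v0 = u0, iota' u = iota u0 &
      iota' v = iota v0 /\ r v0 != 0]].
  have [u [v [hu1 hv1 pv e]]] := hfr b.
  have [u0 hu0 eu0] : (iota @` <<sgB>>) u by rewrite eSg.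
  have [v0 hv0 ev0] : (iota @` <<sgB>>) v by rewrite eSg.
  have [u' hu2 eu'] : (iota' @` <<sgB'>>) u by rewrite eSg'; exact: hsub.
  have [v' hv2 ev'] : (iota' @` <<sgB'>>) v by rewrite eSg'; exact: hsub.
  have rv0 : r v0 != 0 by rewrite er // ev0.
  have rv' : r' v' != 0 by rewrite er' // ev' he.
  have v'u := hu' _ rv'; have v0u := hu _ rv0.
  have vn0 : v != 0 by rewrite -ev0 -unitfE rmorph_unit.
  exists (v'^-1 * u'), u', v'; split=> //.
  - by rewrite rmorphM rmorphV //= ev' eu' e mulrC.
  - by rewrite mulrAC mulVr ?mul1r.
  - exists u0, v0; split=> //; last by rewrite ev'.
    + by apply: inj; rewrite rmorphM e ev0 eu0 divfK.
    + by rewrite eu' eu0.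
have h b : exists b', iota' b' = iota b by have [b' [_ [_ [e _ _ _ _]]]] := hq b; exists b'.
exists (factor h inj'); split=> b; first exact: factorE.
have [b' [u [v [e1 e2 hu2 hv2 [u0 [v0 [hu0 hv0 e3 eu [ev rv0]]]]]]]] := hq b.
have -> : (r' \o factor h inj') b = r' b'.
  by congr (r' _); apply: (inj' : forall x y, iota' x = iota' y -> x = y); rewrite e1; exact: factorE.
apply: (mulIf rv0).
have rE c c0 : <<sgB'>> c -> <<sgB>> c0 -> iota' c = iota c0 -> r' c = r c0.
  by move=> hc hc0 ec; rewrite er' // er // ec he // -eSg; exists c0.
by rewrite -[RHS]rmorphM e3 -(rE _ _ hv2 hv0 ev) -rmorphM e2; exact: rE.
Qed.

End LocalBaseMorphism.

Section Lifting.
Variables (L k : closedFieldType) (p N : nat).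
Hypotheses (hp : p \in [pchar k]) (char0 : forall n, n.+1%:R != 0 :> L).
Hypothesis htr : forall sg : seq L, exists t, forall f : {poly L},
  (forall i, subring_gen (seqset sg) f`_i) -> root f t -> f = 0.
Local Notation "<< sg >>" := (subring_gen (seqset sg)) : classical_set_scope.

Lemma exists_lbase sg (phi : L -> k) : base p sg phi ->
  exists B iota r sgB, @lbase L k p B iota r sg phi sgB.
Proof.
move=> hb; have [hphi hk _] := hb; have [B [iota [r [sgB hl]]]] := exists_local_base hphi hk.
by exists B, iota, r, sgB.
Qed.

Section Fixed.
Variables (B : idomainType) (iota : {rmorphism B -> L}) (r : {rmorphism B -> k}).
Variables (sg : seq L) (phi : L -> k) (sgB : seq B).
Hypothesis hl : lbase p iota r sg phi sgB.

Lemma lbase_inj : injective iota. Proof. by case: hl => _ []. Qed.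

Lemma lbase_unit b : r b != 0 -> b \is a GRing.unit.
Proof. by case: hl => _ [_ [h _ _] _ _]; exact: h. Qed.

Lemma lbase_ker b : r b = 0 -> exists b', b = p%:R * b'.
Proof. by case: hl => _ [_ [_ h _] _ _]; exact: h. Qed.

Lemma lbase_red b : <<sgB>> b -> <<sg>> (iota b) /\ phi (iota b) = r b.
Proof. by case: hl => _ [_ _ [<- h] _] hb; rewrite h //; split=> //; exists b. Qed.

Lemma lbase_onto a : (exists2 c, <<sg>> c & phi c = a) -> exists b, r b = a.
Proof.
case: hl => _ [_ _ [<- h] _] [_ [b hb <-] <-]; exists b; exact: h.
Qed.

Lemma lbase_p0 : p%:R != 0 :> B.
Proof.
by apply: contraNneq (charp_neq0 hp char0) => e; rewrite -(rmorph_nat iota) e rmorph0.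
Qed.

Lemma lbase_local_dom : local_dom B.
Proof.
move=> a b e; have [ra|ra] := eqVneq (r a) 0; [right|left]; apply: lbase_unit => //.
by apply: contra_eq_neq e => rb; apply: contra_neq (oner_neq0 k) => e; rewrite -(rmorph1 r) -e rmorphD ra rb addr0.
Qed.

End Fixed.

Lemma map_mpoly_comp (B B' B'' : idomainType) (f : {rmorphism B -> B'}) (g : {rmorphism B' -> B''})
    (h : {rmorphism B -> B''}) (u : {mpoly B[N]}) : g \o f =1 h ->
  map_mpoly g (map_mpoly f u) = map_mpoly h u.
Proof. by move=> e; apply/mpolyP => m; rewrite !mcoeff_map_mpoly; exact: e. Qed.

Lemma map_mpoly_neq0 (B : idomainType) (F : fieldType) (f : {rmorphism B -> F}) (u : {mpoly B[N]}) :
  injective f -> u != 0 -> map_mpoly f u != 0.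
Proof.
move=> inj; apply: contra_neq => /mpolyP h; apply/mpolyP => m; apply: inj.
by have := h m; rewrite mcoeff_map_mpoly !mcoeff0 rmorph0.
Qed.

Lemma mord_map_inj (B B' : idomainType) (f : {rmorphism B -> B'}) d (u : {mpoly B[N]}) :
  injective f -> mord d (map_mpoly f u) -> mord d u.
Proof.
by move=> inj h m /h; rewrite mcoeff_map_mpoly => e; apply: inj; rewrite e rmorph0.
Qed.

(** An order can only grow under a morphism and is unchanged under an injective one, so the bound on
    u forces equality. *)
Lemma ordp_lift (B : idomainType) (F F' : fieldType) (f : {rmorphism B -> F}) (g : {rmorphism B -> F'})
    (u : {mpoly B[N]}) : injective g -> map_mpoly f u != 0 ->
  mord (ordp (map_mpoly f u)) u -> ordp (map_mpoly g u) = ordp (map_mpoly f u).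
Proof.
move=> inj u0 hu; have u0' : u != 0 by apply: contra_neq u0 => ->; rewrite raddf0.
apply: ordp_spec; [exact: map_mpoly_neq0|exact: mord_map|].
by move=> /(mord_map_inj inj)/(mord_map f); have [_] := ordpP u0.
Qed.

(* Data realizing a sequence of point blow-ups of affine space over [k] over the
   localized base [B]. *)
Record model (ws : nat -> seq (step N k)) (cs : seq k) n (B : idomainType) (r : {rmorphism B -> k}) := Model {
  sec : k -> B;
  sec0 : sec 0 = 0;
  secK : forall a, a \in cs -> r (sec a) = a;
  mGs : nat -> seq {mpoly B[N]};
  mhs : nat -> {mpoly B[N]};
  mJs : nat -> seq {mpoly B[N]};
  mchain : chain (fun i => map (step_map sec) (ws i)) mGs mhs mJs n;
  mhs0 : forall i, (i < n)%N -> map_mpoly r (mhs i) != 0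
}.

Definition mwords ws cs n B r (M : @model ws cs n B r) i := map (step_map (sec M)) (ws i).

Lemma exists_model ws cs n : (forall i, (i < n)%N -> reach ws i (ws i)) ->
  (forall i, (i < n)%N -> {subset coords (ws i) <= cs}) ->
  exists B iota r sg phi sgB, @lbase L k p B iota r sg phi sgB /\ inhabited (model ws cs n r).
Proof.
move=> hws hcs; have [phi0 hb0] := base_start hp char0.
have [sg [phi [hb _ hcs']]] := base_extend hp char0 htr cs hb0.
have [B [iota [r [sgB hl]]]] := exists_lbase hb.
exists B, iota, r, sg, phi, sgB; split=> //.
(* Zero must lift to zero: the lifted steps then keep their vanishing coordinates, and every other
   coordinate becomes a unit. *)
have hsec a : exists b : B, (a = 0 -> b = 0) /\ (a \in cs -> r b = a).
  have [->|a0] := eqVneq a 0; first by exists 0; rewrite rmorph0.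
  have [/hcs'/(lbase_onto hl)[b hb1]|_] := boolP (a \in cs); last by exists 0; split=> // e; rewrite e eqxx in a0.
  by exists b; split=> // e; rewrite e eqxx in a0.
have /choice[tau htau] := hsec.
have hid i : (i < n)%N -> map (step_map r) (map (step_map tau) (ws i)) = ws i.
  move=> hi; rewrite step_map_comp -[RHS]step_map_id; apply: map_coords => a /(hcs i hi) ha /=.
  by have [_ ->] := htau a.
have [Gs [hs [Js [h1 h2]]]] := exists_chain (lbase_unit hl) hws hid.
constructor; apply: (@Model ws cs n B r tau _ _ Gs hs Js h1 h2).
  by have [->] := htau 0.
by move=> a ha; have [_ ->] := htau a.
Qed.

Section Model.
Variables (ws : nat -> seq (step N k)) (cs : seq k) (n : nat).
Hypothesis hcs : forall i, (i < n)%N -> {subset coords (ws i) <= cs}.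
Variables (B : idomainType) (iota : {rmorphism B -> L}) (r : {rmorphism B -> k}).
Variables (sg : seq L) (phi : L -> k) (sgB : seq B).
Hypothesis hl : lbase p iota r sg phi sgB.
Variable M : model ws cs n r.

Lemma mwords_red i : (i < n)%N -> map (step_map r) (mwords M i) = ws i.
Proof.
move=> hi; rewrite step_map_comp -[RHS]step_map_id; apply: map_coords => a /(hcs hi) ha /=.
exact: secK.
Qed.

Lemma mwords_good i : (i < n)%N -> all (@good_step N B) (mwords M i).
Proof.
move=> hi; apply: (all_good _ (hcs hi)) => a ha; have [->|a0] := eqVneq a 0; first by left; exact: sec0.
by right; apply: (lbase_unit hl); rewrite secK.
Qed.

Lemma model_red : blowup_sequence n
  (fun i => Bl (@SP N k) (GF (seqset (map (map_mpoly r) (mGs M i))))) (fun i => pt (ws i.-1)).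
Proof.
have h := chain_map (@mhs0 _ _ _ _ _ M) (mchain M).
have := chain_sequence (chain_ext (fun i hi => mwords_red hi) h); exact.
Qed.

Lemma model_gen : blowup_sequence n
  (fun i => Bl (@SP N L) (GF (seqset (map (map_mpoly iota) (mGs M i)))))
  (fun i => pt (map (step_map iota) (mwords M i.-1))).
Proof.
apply: (chain_sequence (chain_map _ (mchain M))) => i hi.
apply: map_mpoly_neq0 (lbase_inj hl) _; apply: contraNneq (mhs0 M hi) => ->; by rewrite raddf0.
Qed.

Lemma model_torsion i : (i <= n)%N -> torsion_free_eventually p%:R (seqset (mGs M i)).
Proof.
move=> hi; have := @chain_torsion N B p%:R _ _ _ _ _ (lbase_p0 iota) (lbase_local_dom hl) (mchain M) i hi.
exact.
Qed.

Lemma model_discrepancy (hN : (0 < N)%N) i : (i < n)%N -> exists kappa,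
  rel_canonical_coef (excR (ws i)) (excv (ws i)) kappa /\
  rel_canonical_coef (excR (map (step_map iota) (mwords M i)))
    (excv (map (step_map iota) (mwords M i))) kappa.
Proof.
move=> hi; exists (N.-1%:Z + (ordp (jacw (ws i)))%:Z); split; first exact: discrepancy.
suff -> : ordp (jacw (ws i)) = ordp (jacw (map (step_map iota) (mwords M i))) by exact: discrepancy.
have hm := jacw_mono (mwords_good hi).
rewrite -{1}(mwords_red hi) -!jacw_map !ordp_mono // jacw_map; exact: jacw_neq0.
Qed.

End Model.
End Lifting.

Section BaseChange.
Variables (k : closedFieldType) (N : nat) (ws : nat -> seq (step N k)) (cs : seq k) (n : nat).
Variables (B B' : idomainType) (r : {rmorphism B -> k}) (r' : {rmorphism B' -> k}).
Variables (j : {rmorphism B -> B'}) (M : model ws cs n r).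
Hypothesis hr : r' \o j =1 r.

Lemma exists_model_map : exists M' : model ws cs n r',
  (forall i, mGs M' i = map (map_mpoly j) (mGs M i)) /\
  forall i, mwords M' i = map (step_map j) (mwords M i).
Proof.
have h0 i : (i < n)%N -> map_mpoly r' (map_mpoly j (mhs M i)) != 0.
  by move=> hi; rewrite (map_mpoly_comp _ hr); exact: mhs0.
have h0' i : (i < n)%N -> map_mpoly j (mhs M i) != 0.
  by move=> /h0; apply: contra_neq => ->; rewrite raddf0.
have hc := chain_map h0' (mchain M).
have s0 : j (sec M 0) = 0 by rewrite sec0 rmorph0.
have sK a : a \in cs -> r' (j (sec M a)) = a by move=> ha; rewrite -[LHS]/((r' \o j) _) hr secK.
have hc' : chain (fun i => map (step_map (j \o sec M)) (ws i))
    (fun i => map (map_mpoly j) (mGs M i)) (fun i => map_mpoly j (mhs M i))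
    (fun i => map (map_mpoly j) (mJs M i)) n.
  by apply: chain_ext hc => i _; exact: step_map_comp.
exists (@Model _ _ ws cs n B' r' (j \o sec M) s0 sK _ _ _ hc' h0); split=> i //.
by rewrite /mwords /= step_map_comp.
Qed.

End BaseChange.

Section PlaneLift.
Variables (L k : closedFieldType) (p : nat).
Hypothesis hp : p \in [pchar k].
Variables (ws : nat -> seq (step 2 k)) (cs : seq k) (n : nat).
Hypothesis hcs : forall i, (i < n)%N -> {subset coords (ws i) <= cs}.
Hypothesis hws : forall i, (i < n)%N -> all (fun s => `[< normalised s >]) (ws i).
Variables (B : idomainType) (iota : {rmorphism B -> L}) (r : {rmorphism B -> k}).
Variables (sg : seq L) (phi : L -> k) (sgB : seq B).
Hypothesis hl : lbase p iota r sg phi sgB.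
Variable M : model ws cs n r.

Let T : seq B := [seq sec M a | a <- 0 :: cs].

Let secK0 a : a \in 0 :: cs -> r (sec M a) = a.
Proof. by rewrite inE => /orP[/eqP ->|/secK//]; rewrite sec0 rmorph0. Qed.

Let words_dstep (w : seq (step 2 k)) : all (fun s => `[< normalised s >]) w -> {subset coords w <= cs} ->
  exists ow, map (@dstep B) ow = map (step_map (sec M)) w /\ all (allowed T) ow.
Proof.
elim: w => [|s w IH] /=; first by exists [::].
case/andP=> /asboolP[hs1 hs2] hw hc.
have [|ow [e1 e2]] := IH hw; first by move=> a ha; apply: hc; rewrite mem_cat ha orbT.
have hcs' l : s.2 l \in cs.
  by apply: hc; rewrite mem_cat; apply/orP; left; apply/mapP; exists l; rewrite ?mem_enum.
have [o [eo ho]] : exists o, dstep o = step_map (sec M) s /\ allowed T o.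
  case: s hs1 hs2 hcs' {hc} => -[[|[|//]] hj] a /= a1 a2 ha.
    exists (Some (sec M (a 1))); split; last by apply: map_f; rewrite inE ha orbT.
    rewrite /step_map /=; congr (_, _); first exact/val_inj.
    apply/funext => l /=; case: ifP => [/eqP ->|/eqP/eqP/eq_other -> //].
    have -> : a 0 = 0 by rewrite -[RHS]a1; congr a; exact/val_inj.
    by rewrite sec0.
  exists None; split=> //; rewrite /step_map /=; congr (_, _); first exact/val_inj.
  apply/funext => l /=; have [->|ne] := eqVneq l (Ordinal hj); first by rewrite a1 sec0.
  rewrite a2 ?sec0 //; by case: l ne => -[|[|//]] h.
by exists (o :: ow); rewrite /= eo e1 ho.
Qed.

(** Lifting the coefficients arbitrarily may lower the orders; [lift_orders] corrects such a lift by
    a multiple of p. *)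
Lemma plane_lift (f : {mpoly k[2]}) : (forall m, exists b, r b = f@_m) ->
  exists ft : {mpoly B[2]}, [/\ map_mpoly r ft = f, (f = 0 -> ft = 0) &
    f != 0 -> forall i, (i < n)%N -> mord (ordp (subw (ws i) f)) (subw (mwords M i) ft)].
Proof.
move=> /choice[b hb]; have [f0|f0] := eqVneq f 0; first by exists 0; rewrite raddf0 f0; split.
pose F : {mpoly B[2]} := \sum_(m <- msupp f) b m *: 'X_[m].
have rF : map_mpoly r F = f.
  apply/mpolyP => m; rewrite mcoeff_map_mpoly mcoeff_sumX ?msupp_uniq //.
  by case: ifPn => h; [exact: hb|rewrite (memN_msupp_eq0 h); exact: rmorph0].
have hT0 : 0 \in T by apply/mapP; exists 0; rewrite ?mem_head ?sec0.
have hT : {in T &, injective r}.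
  by move=> _ _ /mapP[a ha ->] /mapP[a' ha' ->]; rewrite !secK0 // => ->.
have how i : exists ow, (i < n)%N -> map (@dstep B) ow = mwords M i /\ all (allowed T) ow.
  have [hi|] := boolP (i < n)%N; last by exists [::].
  by have [ow [h1 h2]] := words_dstep (hws hi) (hcs hi); exists ow.
have /choice[ow how'] := how.
pose W := [seq ow i | i <- seq.iota 0 n].
pose D := (\sum_(i <- seq.iota 0 n) size (ow i))%N.
(* The precision must exceed the order of f and reach the orders of all its transforms at the
   centres. *)
pose L0 := (ordp f + \sum_(i <- seq.iota 0 n) ordp (subw (ws i) f)).+1%N.
have hiota i : (i \in seq.iota 0 n) = (i < n)%N by rewrite mem_iota.
have hsum (c : nat -> nat) i : (i < n)%N -> (c i <= \sum_(i <- seq.iota 0 n) c i)%N.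
  by move=> hi; rewrite (big_rem i) ?hiota //= leq_addr.
have rp : r p%:R = 0 by rewrite rmorph_nat (pcharf0 hp).
have hunit b' : r b' <> 0 -> b' \is a GRing.unit by move/eqP; exact: (lbase_unit hl).
have [||ft [G [eF h1 _]]] := @lift_orders B k r p%:R rp (lbase_ker hl) hunit T hT0 hT L0 D F W.
- move=> w hw; have [i + ->] := @mapP _ _ ow (seq.iota 0 n) w hw; rewrite hiota => hi; split; last by have [] := how' i hi.
  exact: (hsum (fun i => size (ow i))).
- by rewrite rF => _; rewrite ltnS leq_addr.
exists ft; split=> [|/eqP|_ i hi]; [|by rewrite (negbTE f0)|].
  by rewrite -rF eF rmorphD rmorphM /= map_mpolyC /= rp mpolyC0 mul0r addr0.
have [e1 _] := how' i hi; rewrite -e1; apply: h1.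
- by apply/mapP; exists i; rewrite ?hiota.
- by apply: leqW; rewrite -[X in (X <= _)%N]add0n leq_add // (hsum (fun i => ordp (subw (ws i) f))).
have f0' : subw (ws i) f != 0 by apply: subw_neq0.
rewrite e1 subw_map (mwords_red hcs) // rF; by have [] := ordpP f0'.
Qed.

End PlaneLift.

Lemma same_value_lift (N : nat) (L k : closedFieldType) (B : idomainType) (iota : {rmorphism B -> L})
    (r : {rmorphism B -> k}) (w : seq (step N B)) (f : {mpoly k[N]}) (ft : {mpoly B[N]}) :
  injective iota -> map_mpoly r ft = f -> (f = 0 -> ft = 0) ->
  (f != 0 -> mord (ordp (subw (map (step_map r) w) f)) (subw w ft)) ->
  same_value (excv (map (step_map r) w)) (polyF f)
    (excv (map (step_map iota) w)) (polyF (map_mpoly iota ft)).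
Proof.
move=> inj ef h0 hord; rewrite /polyF; split.
  split=> /eqP; rewrite tofrac_eq0 => /eqP e; apply/eqP; rewrite tofrac_eq0.
    by rewrite h0 // raddf0.
  have : map_mpoly iota ft == 0 by rewrite e.
  by apply: contraTT => f0; apply: map_mpoly_neq0 => //; apply: contra_neq f0 => e0; rewrite -ef e0 raddf0.
rewrite tofrac_eq0 => f0; rewrite /excv !thetaF !ordF.
- rewrite -subw_map -ef -subw_map; congr (_%:Z); apply/esym/ordp_lift => //.
    by rewrite subw_map ef; apply: subw_neq0.
  by rewrite subw_map ef; exact: hord.
- by apply: subw_neq0; apply: map_mpoly_neq0 => //; apply: contra_neq f0 => e0; rewrite -ef e0 raddf0.
- exact: subw_neq0.
Qed.

Lemma map_map_mpoly (N : nat) (B B' B'' : idomainType) (f : {rmorphism B -> B'})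
    (g : {rmorphism B' -> B''}) (h : {rmorphism B -> B''}) (s : seq {mpoly B[N]}) : g \o f =1 h ->
  map (map_mpoly g) (map (map_mpoly f) s) = map (map_mpoly h) s.
Proof. by move=> e; rewrite -map_comp; apply: eq_map => u /=; exact: map_mpoly_comp. Qed.

(** The complex numbers enter only through characteristic 0, algebraic closedness and the existence
    of elements transcendental over each finitely generated subring. The models and centres over L
    are fixed before f is given; only the skeletons are chosen anew for each f. *)
Lemma lift_blowup_sequence (L k : closedFieldType) (p : nat)
    (char0 : forall m, m.+1%:R != 0 :> L)
    (htr : forall sg : seq L, exists t, forall f : {poly L},
      (forall i, subring_gen (seqset sg) f`_i) -> root f t -> f = 0)
    (hp : p \in [pchar k]) (N : nat) (hN : (0 < N)%N) (n : nat)
    (A : nat -> set (set (funfield k N))) (P : nat -> set (funfield k N))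
    (hA : blowup_sequence n A P) :
  exists (At : nat -> set (set (funfield L N)))
         (Pt : nat -> set (funfield L N))
         (Sigmat : set L) (Sigma : set k) (phi : L -> k),
    [/\ compatible_base p phi Sigmat Sigma,
        (forall i, (i <= n)%N -> reduces_to p phi Sigmat (At i) (A i)),
        blowup_sequence n At Pt,
        (forall i, (1 <= i <= n)%N ->
           exists O v Ot vt kappa,
             [/\ exc_valuation (P i) O v, exc_valuation (Pt i) Ot vt,
                 rel_canonical_coef O v kappa
               & rel_canonical_coef Ot vt kappa])
      & N = 2%N -> forall f : {mpoly k[N]},
          exists (Sigmat' : set L) (Sigma' : set k) (phi' : L -> k)
                 (ft : {mpoly L[N]}),
            [/\ compatible_base p phi' Sigmat' Sigma',
                Sigmat `<=` Sigmat' /\ (forall c, Sigmat c -> phi' c = phi c),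
                (forall i, (i <= n)%N ->
                   reduces_to p phi' Sigmat' (At i) (A i)),
                is_lifting phi' Sigmat' ft f
              & forall i, (1 <= i <= n)%N ->
                  exists O v Ot vt,
                    [/\ exc_valuation (P i) O v, exc_valuation (Pt i) Ot vt
                      & same_value v (polyF f) vt (polyF ft)]]].
Proof.
have [ws hws] := exists_centres hA.
have hreach i (hi : (i < n)%N) := (hws i hi).1.
have hP i (hi : (i < n)%N) := (hws i hi).2.
pose cs := flatten [seq coords (ws i) | i <- seq.iota 0 n].
have hcs i : (i < n)%N -> {subset coords (ws i) <= cs}.
  move=> hi a ha; apply/flattenP; exists (coords (ws i)) => //.
  by apply: map_f; rewrite mem_iota.
have [B [iota [r [sg [phi [sgB [hl [M]]]]]]]] := exists_model hp char0 htr hreach hcs.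
have hAk : forall i, (i <= n)%N -> A i = Bl (@SP N k) (GF (seqset (map (map_mpoly r) (mGs M i)))).
  exact: blowup_sequence_eq hA (model_red hcs M) hP.
have [sg1 [phi1 [sgB1 [hl1 _ hred1]]]] :=
  lbase_reduces hp char0 hl (lbase_p0 hp char0 iota) (model_torsion hp char0 hl (M := M)).
exists (fun i => Bl (@SP N L) (GF (seqset (map (map_mpoly iota) (mGs M i))))).
exists (fun i => pt (map (step_map iota) (mwords M i.-1))).
exists (subring_gen (seqset sg1)), (phi1 @` subring_gen (seqset sg1)), phi1; split.
- have hb1 : base p sg1 phi1 by case: hl1.
  have hcb := base_compatible hp hb1.
  exact: hcb.
- by move=> i hi; rewrite hAk //; exact: hred1.
- exact: model_gen hl M.
- case=> // i hi; have [kappa [h1 h2]] := model_discrepancy hcs hl M hN hi.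
  exists (excR (ws i)), (excv (ws i)).
  exists (excR (map (step_map iota) (mwords M i))), (excv (map (step_map iota) (mwords M i))), kappa.
  split; [rewrite (hP i hi)|..|exact: h1|exact: h2]; exact: exc_valuationP.
move=> eN; subst N => f.
(* The base is enlarged to lift the coefficients of f. The new localization B2 receives a morphism j
   from B, along which words and ideals are transported, so the models over L do not change. *)
have [sg2 [phi2 [hb2 he2 hc2]]] := base_extend hp char0 htr [seq f@_m | m <- msupp f] hl1.1.
have [B2 [iota2 [r2 [sgB2 hl2]]]] := exists_lbase hb2.
have [j [hj1 hj2]] := local_base_morphism he2 hl1.2 hl2.2.
have [M2 [hG2 hw2]] := exists_model_map M hj2.
have hf m : exists b, r2 b = f@_m.
  have [hm|hm] := boolP (m \in msupp f); last by exists 0; rewrite rmorph0 (memN_msupp_eq0 hm).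
  by apply: (lbase_onto hl2); apply: hc2; apply: map_f.
have hnorm := reach_normalised hreach.
have [ft [eft ft0 hft]] := plane_lift hp hcs hnorm hl2 M2 hf.
(* The coefficients of ft lie in the localization B2; inverting their denominators brings them into
   the base itself, over which the Rees algebras are then saturated again. *)
have [sg3 [phi3 [sgB3 [hl3 [hx3 _ _] hcl]]]] := lbase_clear 2 hp char0 [seq ft@_m | m <- msupp ft] hl2.
have [sg4 [phi4 [sgB4 [hl4 [hx4 hs4 _] hred4]]]] :=
  lbase_reduces hp char0 hl3 (lbase_p0 hp char0 iota2) (model_torsion hp char0 hl3 (M := M2)).
exists (subring_gen (seqset sg4)), (phi4 @` subring_gen (seqset sg4)), phi4, (map_mpoly iota2 ft); split.
- have hb4 : base p sg4 phi4 by case: hl4.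
  have hcb := base_compatible hp hb4.
  exact: hcb.
- exact: extends_trans he2 (extends_trans hx3 hx4).
- move=> i hi; rewrite hAk //; have := hred4 i hi.
  rewrite !hG2 (map_map_mpoly _ hj1) (map_map_mpoly _ hj2); exact.
- move=> m; rewrite mcoeff_map_mpoly -eft mcoeff_map_mpoly; apply: (lbase_red hl4).
  apply: hs4; have [hm|hm] := boolP (m \in msupp ft); first by apply: hcl; apply: map_f.
  rewrite (memN_msupp_eq0 hm); exact: (subring0 (subring_genP _)).
case=> // i hi.
exists (excR (ws i)), (excv (ws i)).
exists (excR (map (step_map iota) (mwords M i))), (excv (map (step_map iota) (mwords M i))).
split; [rewrite (hP i hi); exact: exc_valuationP|exact: exc_valuationP|].
have eL : map (step_map iota) (mwords M i) = map (step_map iota2) (mwords M2 i).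
  rewrite hw2 step_map_comp; apply: eq_map => s; rewrite /step_map; congr (_, _).
  by apply/funext => l /=; rewrite -hj1.
rewrite eL -(mwords_red hcs M2 hi).
apply: same_value_lift => //; first exact: (lbase_inj hl2).
by move=> f0; rewrite (mwords_red hcs M2 hi); apply: hft.
Qed.

Theorem theorem1p1 (Rr : realType) (k : closedFieldType) (p : nat)
    (hp : p \in [pchar k]) (N : nat) (hN : (0 < N)%N) (n : nat)
    (A : nat -> set (set (funfield k N))) (P : nat -> set (funfield k N))
    (hA : blowup_sequence n A P) :
  exists (At : nat -> set (set (funfield Rr[i] N)))
         (Pt : nat -> set (funfield Rr[i] N))
         (Sigmat : set Rr[i]) (Sigma : set k) (phi : Rr[i] -> k),
    [/\ compatible_base p phi Sigmat Sigma,
        (forall i, (i <= n)%N -> reduces_to p phi Sigmat (At i) (A i)),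
        blowup_sequence n At Pt,
        (forall i, (1 <= i <= n)%N ->
           exists O v Ot vt kappa,
             [/\ exc_valuation (P i) O v, exc_valuation (Pt i) Ot vt,
                 rel_canonical_coef O v kappa
               & rel_canonical_coef Ot vt kappa])
      & N = 2%N -> forall f : {mpoly k[N]},
          exists (Sigmat' : set Rr[i]) (Sigma' : set k) (phi' : Rr[i] -> k)
                 (ft : {mpoly Rr[i][N]}),
            [/\ compatible_base p phi' Sigmat' Sigma',
                Sigmat `<=` Sigmat' /\ (forall c, Sigmat c -> phi' c = phi c),
                (forall i, (i <= n)%N ->
                   reduces_to p phi' Sigmat' (At i) (A i)),
                is_lifting phi' Sigmat' ft f
              & forall i, (1 <= i <= n)%N ->
                  exists O v Ot vt,
                    [/\ exc_valuation (P i) O v, exc_valuation (Pt i) Ot vt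
                      & same_value v (polyF f) vt (polyF ft)]]].
Proof.
have char0 m : m.+1%:R != 0 :> Rr[i] by rewrite pnatr_eq0.
exact: (lift_blowup_sequence char0 (@exists_transcendental Rr) hp hN hA).
Qed.
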